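(* Let $K$ and $K'$ be number fields, and let $l$ be any prime number. There exists a bijection \[ \Theta: \textup{Iso}_{L\textup{-series}}(\check{G}_{K}[l], \check{G}_{K'}[l]) \longrightarrow \textup{Iso}(K, K'). \]
   Context: For a number field $K$ with absolute Galois group $G_K$, $\check{G}_{K}$ denotes the group of Dirichlet characters, i.e. continuous homomorphisms $G_K \to \mathbb{C}^\times$, and $\check{G}_{K}[l]$ denotes the subgroup generated by the characters of order $l$. For a character $\chi$ with associated cyclic extension $K_\chi/K$ and a prime $\mathfrak p$ of $K$, $\chi(\mathfrak p)$ is $\chi$ evaluated at the Frobenius of $\mathfrak p$ in $\mathrm{Gal}(K_\chi/K)$ if $\mathfrak p$ is unramified in $K_\chi$, and $0$ otherwise; the $L$-series is $L(\chi,s)=\prod_{\mathfrak p}(1-\chi(\mathfrak p)N\mathfrak p^{-s})^{-1}$. $\textup{Iso}_{L\textup{-series}}(\check{G}_{K}[l], \check{G}_{K'}[l])$ is the set of group isomorphisms $\psi: \check{G}_{K}[l] \xrightarrow{\sim} \check{G}_{K'}[l]$ such that $L(\chi,s)=L(\psi(\chi),s)$ for all $\chi \in \check{G}_{K}[l]$, and $\textup{Iso}(K,K')$ is the set of field isomorphisms $K \xrightarrow{\sim} K'$. *)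

(* Defs.v *)
From HB Require Import structures.
From mathcomp Require Import all_boot all_order all_algebra all_field.
From mathcomp Require Import finmap all_classical all_reals all_analysis.
From mathcomp Require Import complex.
From mathcomp Require Import summability.

Set Implicit Arguments.
Unset Strict Implicit.
Unset Printing Implicit Defensive.

Import Order.TTheory GRing.Theory Num.Theory.
Import numFieldNormedType.Exports.

Local Open Scope classical_set_scope.
Local Open Scope ring_scope.
Local Open Scope complex_scope.

(* R[i] carries its topology only when seen as the carrier of a numFieldType. *)
Definition complexNumField (R : realType) : numFieldType :=
  Num.NumField.clone R[i] _.

(* A number field is a fieldExtType rat. *)

Record algClosure (K : fieldType) := AlgClosure {
  acl_field :> closedFieldType;
  acl_emb : {rmorphism K -> acl_field};
  acl_alg : forall x : acl_field, algebraicOver acl_emb x }.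

Arguments acl_emb {K} a.

Section AbsoluteGaloisGroup.
Variables (K : fieldType) (Kb : algClosure K).

Record absGal := AbsGal {
  gal_fun :> Kb -> Kb;
  gal_zmod_morphism : zmod_morphism gal_fun;
  gal_monoid_morphism : GRing.monoid_morphism gal_fun;
  gal_bij : bijective gal_fun;
  gal_fix : forall a : K, gal_fun (acl_emb Kb a) = acl_emb Kb a }.

HB.instance Definition _ := gen_eqMixin absGal.
HB.instance Definition _ := gen_choiceMixin absGal.

Lemma absGal_ext (s t : absGal) : s =1 t -> s = t.
Proof.
case: s t => [f f1 f2 f3 f4] [g g1 g2 g3 g4] /= /funext fg.
by subst g; congr AbsGal; exact: Prop_irrelevance.
Qed.

Definition gal_one : absGal.
Proof. by exists idfun => //; exists idfun. Defined.

Definition gal_mul (s t : absGal) : absGal.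
Proof.
exists (s \o t).
- by move=> x y /=; rewrite !gal_zmod_morphism.
- split=> [|x y] /=; first by rewrite !(gal_monoid_morphism _).1.
  by rewrite !(gal_monoid_morphism _).2.
- by apply: bij_comp; exact: gal_bij.
- by move=> a /=; rewrite !gal_fix.
Defined.

Definition gal_inv_fun (s : absGal) (y : Kb) : Kb := xget 0 [set x | s x = y].

Lemma gal_invK (s : absGal) : cancel (gal_inv_fun s) s.
Proof.
move=> y; rewrite /gal_inv_fun; case: xgetP => [x _ //|no].
by have [g _ gK] := gal_bij s; case: (no (g y)); exact: gK.
Qed.

Lemma gal_Kinv (s : absGal) : cancel s (gal_inv_fun s).
Proof. by move=> x; apply: (bij_inj (gal_bij s)); rewrite gal_invK. Qed.

Definition gal_inv (s : absGal) : absGal.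
Proof.
exists (gal_inv_fun s).
- move=> x y; apply: (bij_inj (gal_bij s)).
  by rewrite gal_zmod_morphism !gal_invK.
- split=> [|x y]; apply: (bij_inj (gal_bij s)).
    by rewrite gal_invK (gal_monoid_morphism s).1.
  by rewrite (gal_monoid_morphism s).2 !gal_invK.
- by exists s; [exact: gal_invK|exact: gal_Kinv].
- by move=> a; apply: (bij_inj (gal_bij s)); rewrite gal_invK gal_fix.
Defined.

Lemma gal_mulA : associative gal_mul.
Proof. by move=> s t u; apply: absGal_ext. Qed.
Lemma gal_mul1 : left_id gal_one gal_mul.
Proof. by move=> s; apply: absGal_ext. Qed.
Lemma gal_1mul : right_id gal_one gal_mul.
Proof. by move=> s; apply: absGal_ext. Qed.
Lemma gal_mulV : left_inverse gal_one gal_inv gal_mul.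
Proof. by move=> s; apply: absGal_ext => x; exact: gal_Kinv. Qed.
Lemma gal_Vmul : right_inverse gal_one gal_inv gal_mul.
Proof. by move=> s; apply: absGal_ext => x; exact: gal_invK. Qed.

HB.instance Definition _ :=
  isGroup.Build absGal gal_mulA gal_mul1 gal_1mul gal_mulV gal_Vmul.
HB.instance Definition _ := isPointed.Build absGal (1%g : absGal).

(* The Krull topology: for finite S, the automorphisms agreeing with s on S   *)
(* form the coset s Gal(Kb / K(S)).                                           *)
Definition krull_index : Type := (absGal * seq Kb)%type.
HB.instance Definition _ := Choice.on krull_index.
HB.instance Definition _ := isPointed.Build krull_index (1%g, [::]).

Definition krull_base (i : krull_index) : set absGal :=
  [set t : absGal | {in i.2, t =1 i.1}].

Lemma krull_cover : \bigcup_(i in setT) krull_base i = setT.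
Proof. by apply/seteqP; split=> // s _; exists ((s, [::]) : krull_index). Qed.

Lemma krull_join (i j : krull_index) s : setT i -> setT j -> krull_base i s ->
  krull_base j s ->
  exists k, [/\ setT k, krull_base k s
               & krull_base k `<=` krull_base i `&` krull_base j].
Proof.
move=> _ _ si sj; exists ((s, i.2 ++ j.2) : krull_index); split=> // t tk; split=> x xS.
  by rewrite tk ?mem_cat ?xS //= si.
by rewrite tk ?mem_cat ?xS ?orbT //= sj.
Qed.

HB.instance Definition _ :=
  isBaseTopological.Build absGal krull_cover krull_join.

End AbsoluteGaloisGroup.

Section DirichletCharacters.
Variables (R : realType) (K : fieldType) (Kb : algClosure K).
Local Notation C := (complexNumField R).

(* Continuous homomorphisms to the multiplicative group of R[i].              *)
Record dirichletChar := DirichletChar {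
  dchar_fun :> absGal Kb -> C;
  dchar_neq0 : forall s, dchar_fun s != 0;
  dcharM : forall s t, dchar_fun (s * t)%g = dchar_fun s * dchar_fun t;
  dchar_continuous : continuous dchar_fun }.

HB.instance Definition _ := gen_eqMixin dirichletChar.
HB.instance Definition _ := gen_choiceMixin dirichletChar.

Lemma dchar_ext (x y : dirichletChar) : x =1 y -> x = y.
Proof.
case: x y => [f f1 f2 f3] [g g1 g2 g3] /= /funext fg.
by subst g; congr DirichletChar; exact: Prop_irrelevance.
Qed.

Definition dchar_one : dirichletChar.
Proof.
exists (fun=> 1) => [s|s t|].
- exact: oner_neq0.
- by rewrite mulr1.
- by move=> s; exact: (@cvg_cst C 1 _ (nbhs s) _).
Defined.

Definition dchar_mul (x y : dirichletChar) : dirichletChar.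
Proof.
exists (fun s => x s * y s) => [s|s t|s].
- by rewrite mulf_neq0 ?dchar_neq0.
- by rewrite !dcharM mulrACA.
- by apply: (@cvgM C _ (nbhs s)); exact: dchar_continuous.
Defined.

Definition dchar_inv (x : dirichletChar) : dirichletChar.
Proof.
exists (fun s => (x s)^-1) => [s|s t|s].
- by rewrite invr_neq0 ?dchar_neq0.
- by rewrite dcharM invfM.
- apply: (@cvgV C _ (nbhs s) _ x (x s)); first exact: dchar_neq0.
  exact: dchar_continuous.
Defined.

Lemma dchar_mulA : associative dchar_mul.
Proof. by move=> x y z; apply: dchar_ext => s /=; rewrite mulrA. Qed.
Lemma dchar_mul1 : left_id dchar_one dchar_mul.
Proof. by move=> x; apply: dchar_ext => s /=; rewrite mul1r. Qed.
Lemma dchar_1mul : right_id dchar_one dchar_mul.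
Proof. by move=> x; apply: dchar_ext => s /=; rewrite mulr1. Qed.
Lemma dchar_mulV : left_inverse dchar_one dchar_inv dchar_mul.
Proof. by move=> x; apply: dchar_ext => s /=; rewrite mulVf ?dchar_neq0. Qed.
Lemma dchar_Vmul : right_inverse dchar_one dchar_inv dchar_mul.
Proof. by move=> x; apply: dchar_ext => s /=; rewrite mulfV ?dchar_neq0. Qed.

HB.instance Definition _ := isGroup.Build dirichletChar
  dchar_mulA dchar_mul1 dchar_1mul dchar_mulV dchar_Vmul.

End DirichletCharacters.

Section GeneratedSubgroup.
Variable G : groupType.

Definition has_order (x : G) (n : nat) : Prop :=
  [/\ (0 < n)%N, (x ^+ n)%g = 1%g
    & forall m, (0 < m < n)%N -> (x ^+ m)%g <> 1%g].

Definition generated (S : set G) : set G :=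
  smallest (fun H : set G => group_closed [pred x in H]) S.

Lemma generated_group_closed (S : set G) : group_closed [pred x in generated S].
Proof.
split=> [|x y].
  by rewrite inE => H [[H1 _] _]; move: H1; rewrite inE.
rewrite !inE => xS yS H HS; have := HS.1.2 x y; rewrite !inE; apply.
  exact: xS.
exact: yS.
Qed.

End GeneratedSubgroup.

Section OrderLCharacters.
Variables (R : realType) (K : fieldType) (Kb : algClosure K) (l : nat).

Definition charGen : set (dirichletChar R Kb) :=
  generated [set chi | has_order chi l].

Definition charGroup : Type :=
  {chi : dirichletChar R Kb | chi \in charGen}.

HB.instance Definition _ := SubChoice.on charGroup.
HB.instance Definition _ := SubChoice_isSubGroup.Build _ _ charGroup
  (generated_group_closed _).

End OrderLCharacters.

Section Ideals.
Variable F : fieldType.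
Implicit Types (A I J L P : set F).

(* The ring of integers of a subfield L of F; it and its ideals are sets of   *)
(* elements of F.                                                             *)
Definition ringOfIntegers L : set F :=
  [set x | L x /\ integralOver (intr : int -> F) x].

Definition is_ideal A I : Prop :=
  [/\ I `<=` A, I 0, (forall x y, I x -> I y -> I (x + y))
    & forall a x, A a -> I x -> I (a * x)].

Definition is_nonzero_prime A P : Prop :=
  [/\ is_ideal A P, ~ P 1,
      forall x y, A x -> A y -> P (x * y) -> P x \/ P y
    & exists2 x, P x & x != 0].

Definition ideal_mul I J : set F :=
  [set x | exists (n : nat) (a b : 'I_n -> F),
     [/\ forall i, I (a i), forall i, J (b i) & x = \sum_(i < n) a i * b i]].

Fixpoint ideal_exp A I (n : nat) : set F :=
  if n is n'.+1 then ideal_mul I (ideal_exp A I n') else A.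

Definition cosets A I : set (set F) :=
  [set [set y | A y /\ I (y - x)] | x in A].

(* fset_set sends an infinite set to the empty one, but A / I is finite for   *)
(* nonzero ideals I of rings of integers of number fields.                    *)
Definition ideal_norm A I : nat := #|` fset_set (cosets A I)|.

End Ideals.

Section LSeries.
Variables (R : realType) (K : fieldType) (Kb : algClosure K).
Local Notation C := (complexNumField R).
Implicit Types (chi : dirichletChar R Kb) (s : R[i]).

Definition primeSet : set (set K) :=
  [set p | is_nonzero_prime (ringOfIntegers [set: K]) p].

Definition primeOf : Type := {p : set K | p \in primeSet}.
HB.instance Definition _ := SubChoice.on primeOf.
Implicit Types p : primeOf.

Definition primeNorm p : nat := ideal_norm (ringOfIntegers [set: K]) (val p).

(* The cyclic extension attached to chi: the fixed field of its kernel.       *)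
Definition charField chi : set Kb :=
  [set x | forall g : absGal Kb, chi g = 1 -> g x = x].

Definition charInt chi : set Kb := ringOfIntegers (charField chi).

Definition prime_above chi p (P : set Kb) : Prop :=
  is_nonzero_prime (charInt chi) P /\ acl_emb Kb @^-1` P = val p.

(* e is the largest exponent with p O contained in P ^ e, for O the ring of   *)
(* integers of charField chi.                                                 *)
Definition is_ramification_index chi p (P : set Kb) (e : nat) : Prop :=
  acl_emb Kb @` (val p) `<=` ideal_exp (charInt chi) P e /\
  ~ (acl_emb Kb @` (val p) `<=` ideal_exp (charInt chi) P e.+1).

(* Residue fields are finite, so no separability condition is needed.         *)
Definition unramified chi p : Prop :=
  forall P, prime_above chi p P -> is_ramification_index chi p P 1.

(* g restricts to the Frobenius of p in Gal(K_chi / K). As this group is      *)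
(* abelian, the Frobenius does not depend on the prime above p.               *)
Definition is_frobenius chi p (g : absGal Kb) : Prop :=
  forall P, prime_above chi p P ->
  forall x, charInt chi x -> P (g x - x ^+ primeNorm p).

Definition char_at chi p : C :=
  if `[< unramified chi p >] then chi (get [set g | is_frobenius chi p g])
  else 0.

Definition expC (z : R[i]) : R[i] :=
  (expR (complex.Re z))%:C * (cos (complex.Im z) +i* sin (complex.Im z)).

Definition natpowC (n : nat) (z : R[i]) : R[i] := expC (z * (ln n%:R)%:C).

(* The limit over the finite sets of primes ordered by inclusion; the product *)
(* converges absolutely for Re s > 1.                                         *)
Definition Lseries chi s : C :=
  lim ((fun A : {fset primeOf} =>
          \prod_(p <- A) (1 - char_at chi p * natpowC (primeNorm p) (- s))^-1 : C)
       @ totally).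

End LSeries.

Definition isoLseries (R : realType) (K K' : fieldType)
    (Kb : algClosure K) (Kb' : algClosure K') (l : nat) : Type :=
  {psi : charGroup R Kb l -> charGroup R Kb' l |
    [/\ bijective psi, {morph psi : x y / (x * y)%g}
      & forall chi (s : R[i]), 1 < complex.Re s ->
          Lseries (val chi) s = Lseries (val (psi chi)) s]}.

Definition isoField (K K' : fieldType) : Type :=
  {f : K -> K' | [/\ bijective f, zmod_morphism f & GRing.monoid_morphism f]}.

(* Main.v *)
(** The fields K and K' are moved into the algebraic numbers and everything is read off on
    a large Galois number field F with group G. Equality of L-series gives, by uniqueness of
    Dirichlet coefficients, equality of the sums of chi over the primes of norm q. For large
    q these are sums over the cosets of the stabiliser H of K fixed by the Frobenius phi_q,
    so orthogonality of the characters shows that an element of H conjugate to phi_q lies in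
    one of finitely many subgroups H_tau, made of the g such that chi and psi(chi) agree at g
    and tau g tau^-1; here tau runs over the isomorphisms Kb -> Kb' up to Gal(Kb'/K'). An
    elementary form of Frobenius' density theorem (counting algebraic integers in boxes by
    their factorisation) turns this covering into |H| <= sum |H_tau|. Kummer characters
    composed with the transfer are rich enough for H_tau to have large index for all tau but
    one, and for that one H_tau = H: this tau carries K to K' and induces psi. Conversely an
    isomorphism K -> K' extends to Kb -> Kb' and transports the characters and their
    L-series, the Frobenius at an unramified prime being unique modulo the kernel of the
    character. *)
Require Import Defs.
From HB Require Import structures.
From mathcomp Require Import all_boot all_order all_fingroup all_algebra all_field.
From mathcomp Require Import finmap all_classical all_reals all_analysis.
From mathcomp Require Import complex.
From mathcomp Require Import summability.
From mathcomp Require Import zify ring lra.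
Import Defs.

Set Implicit Arguments.
Unset Strict Implicit.
Unset Printing Implicit Defensive.

Import Order.TTheory GRing.Theory Num.Theory.
Import numFieldNormedType.Exports.

Local Open Scope classical_set_scope.
Local Open Scope ring_scope.

(** * Algebraic integers and prime ideals *)

(** Only the sizes of groups enter, so no density of a single Frobenius class is required. For a
    subgroup [J] of [G] the cosets [J x] with [x phi_q x^-1] in [J] count the primes of norm [q] of
    the fixed field of [J], and the sum of [1 / q] over these primes grows at the same rate for
    every field. This is the pole of a Dedekind zeta function at 1; no L-function has to be shown
    non-zero there. The obstacle is that [F] grows with the characters taken into account, whereas
    tau must serve all of them. The number [n] of isomorphisms up to Gal(Kb'/K') depends on the
    fields alone, so finitely many characters give every unsuitable [H_tau] an index above [2 n];
    together these fill less than half of [H]. Hence some tau is suitable on an open subgroup, all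
    such tau agree up to Gal(Kb'/K'), and a further character at which this tau failed would cut its
    [H_tau] to at most half of [H], leaving part of [H] uncovered. Products compose from left to
    right in [gal_of] and from right to left in [absGal]; restriction to [F] therefore reverses
    them. *)

Definition alint (F : fieldType) : set F := [set a | integralOver (intr : int -> F) a].

Section AlgebraicIntegers.
Variables (F E : fieldType).
Implicit Types a b : F.

Lemma alint_int (z : int) : alint (z%:~R : F).
Proof. exact: (integral_id (intr : {rmorphism int -> F}) z). Qed.

Lemma alint_nat (n : nat) : alint (n%:R : F).
Proof. exact: (alint_int n). Qed.

Lemma alint0 : alint (0 : F). Proof. exact: (alint_nat 0). Qed.
Lemma alint1 : alint (1 : F). Proof. exact: (alint_nat 1). Qed.

Lemma alintD a b : alint a -> alint b -> alint (a + b).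
Proof. exact: (@integral_add _ _ (intr : {rmorphism int -> F})). Qed.
Lemma alintB a b : alint a -> alint b -> alint (a - b).
Proof. exact: (@integral_sub _ _ (intr : {rmorphism int -> F})). Qed.
Lemma alintN a : alint a -> alint (- a).
Proof. exact: (@integral_opp _ _ (intr : {rmorphism int -> F})). Qed.
Lemma alintM a b : alint a -> alint b -> alint (a * b).
Proof. exact: (@integral_mul _ _ (intr : {rmorphism int -> F})). Qed.

Lemma alintX a n : alint a -> alint (a ^+ n).
Proof.
by move=> ia; elim: n => [|n IH]; [exact: alint1|rewrite exprS; exact: alintM].
Qed.

Lemma alint_sum I (r : seq I) (P : pred I) (f : I -> F) :
  (forall i, P i -> alint (f i)) -> alint (\sum_(i <- r | P i) f i).
Proof. by apply: big_ind; [exact: alint0|exact: alintD]. Qed.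

Lemma alint_prod I (r : seq I) (P : pred I) (f : I -> F) :
  (forall i, P i -> alint (f i)) -> alint (\prod_(i <- r | P i) f i).
Proof. by apply: big_ind; [exact: alint1|exact: alintM]. Qed.

Lemma alint_rmorph (f : {rmorphism F -> E}) a : alint (f a) <-> alint a.
Proof.
have ef (p : {poly int}) : map_poly intr p = map_poly f (map_poly intr p).
  by rewrite -map_poly_comp; apply: eq_map_poly => z /=; rewrite rmorph_int.
split=> -[p pm pr]; exists p => //; move: pr; first by rewrite ef fmorph_root.
by rewrite ef fmorph_root.
Qed.

End AlgebraicIntegers.

Section SubringsAndIdeals.
Variable E : fieldType.
Implicit Types (A I P : set E).

Definition is_subring A : Prop :=
  [/\ A 1, forall x y, A x -> A y -> A (x - y) & forall x y, A x -> A y -> A (x * y)].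

Definition is_prime_ideal A P : Prop :=
  [/\ is_ideal A P, ~ P 1
    & forall x y, A x -> A y -> P (x * y) -> P x \/ P y].

Lemma alint_subring : is_subring (@alint E).
Proof. by split; [exact: alint1|exact: alintB|exact: alintM]. Qed.

Lemma is_nonzero_prime_ideal A P : is_nonzero_prime A P -> is_prime_ideal A P.
Proof. by case. Qed.

Section Subring.
Variable A : set E.
Hypothesis subA : is_subring A.

Lemma subring1 : A 1. Proof. by case: subA. Qed.
Lemma subringB x y : A x -> A y -> A (x - y). Proof. by case: subA => _ + _; exact. Qed.
Lemma subringM x y : A x -> A y -> A (x * y). Proof. by case: subA => _ _; exact. Qed.
Lemma subring0 : A 0. Proof. by rewrite -(subrr 1); apply: subringB; exact: subring1. Qed.
Lemma subringN x : A x -> A (- x).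
Proof. by move=> Ax; rewrite -sub0r; apply: subringB => //; exact: subring0. Qed.
Lemma subringD x y : A x -> A y -> A (x + y).
Proof. by move=> Ax Ay; rewrite -[y]opprK; apply: subringB => //; exact: subringN. Qed.
Lemma subringX x n : A x -> A (x ^+ n).
Proof.
by move=> Ax; elim: n => [|n IH]; [exact: subring1|rewrite exprS; exact: subringM].
Qed.
Lemma subring_nat n : A n%:R.
Proof. by elim: n => [|n IH]; [exact: subring0|rewrite -natr1; apply: subringD => //; exact: subring1]. Qed.
Lemma subring_int (z : int) : A z%:~R.
Proof. by case: z => n; [|rewrite NegzE mulrNz; apply: subringN]; exact: subring_nat. Qed.
Lemma subring_sum T (r : seq T) (Q : pred T) (f : T -> E) :
  (forall i, Q i -> A (f i)) -> A (\sum_(i <- r | Q i) f i).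
Proof. by apply: big_ind; [exact: subring0|exact: subringD]. Qed.
Lemma subring_prod T (r : seq T) (Q : pred T) (f : T -> E) :
  (forall i, Q i -> A (f i)) -> A (\prod_(i <- r | Q i) f i).
Proof. by apply: big_ind; [exact: subring1|exact: subringM]. Qed.

Section Ideal.
Variable I : set E.
Hypothesis idI : is_ideal A I.

Lemma ideal_sub x : I x -> A x. Proof. by case: idI => + _ _ _; exact. Qed.
Lemma ideal0 : I 0. Proof. by case: idI. Qed.
Lemma idealD x y : I x -> I y -> I (x + y). Proof. by case: idI => _ _ + _; exact. Qed.
Lemma idealM_l a x : A a -> I x -> I (a * x). Proof. by case: idI => _ _ _; exact. Qed.
Lemma idealM_r a x : A a -> I x -> I (x * a). Proof. by rewrite mulrC; exact: idealM_l. Qed.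
Lemma idealN x : I x -> I (- x).
Proof. by rewrite -mulN1r; apply: idealM_l; apply: subringN; exact: subring1. Qed.
Lemma idealB x y : I x -> I y -> I (x - y).
Proof. by move=> Ix Iy; apply: idealD => //; exact: idealN. Qed.
Lemma ideal_sum J (r : seq J) (Q : pred J) (f : J -> E) :
  (forall i, Q i -> I (f i)) -> I (\sum_(i <- r | Q i) f i).
Proof. by apply: big_ind; [exact: ideal0|exact: idealD]. Qed.
Lemma ideal_subl x y : I (x - y) -> I y -> I x.
Proof. by move=> xy Iy; rewrite -(subrK y x); exact: idealD. Qed.
Lemma ideal_subr x y : I (x - y) -> I x -> I y.
Proof. by move=> xy Ix; rewrite -[y](subKr x); exact: idealB. Qed.
Lemma ideal_symB x y : I (x - y) -> I (y - x).
Proof. by rewrite -(opprB x y); exact: idealN. Qed.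
Lemma ideal_transB y x z : I (x - y) -> I (y - z) -> I (x - z).
Proof. by move=> xy yz; rewrite -(subrKA y); exact: idealD. Qed.
Lemma idealBX x y n : A x -> A y -> I (x - y) -> I (x ^+ n - y ^+ n).
Proof.
move=> Ax Ay xy; rewrite subrXX; apply: idealM_r => //.
by apply: subring_sum => i _; apply: subringM; exact: subringX.
Qed.
Lemma idealBM x y x' y' : A x -> A y' -> I (x - x') -> I (y - y') ->
  I (x * y - x' * y').
Proof.
move=> Ax Ay' xx yy; rewrite -(subrKA (x * y')) -mulrBr -mulrBl.
by apply: idealD; [exact: idealM_l|exact: idealM_r].
Qed.
Lemma idealBD x y x' y' : I (x - x') -> I (y - y') -> I (x + y - (x' + y')).
Proof. by move=> xx yy; rewrite opprD addrACA; exact: idealD. Qed.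
End Ideal.

Section Prime.
Variable P : set E.
Hypothesis prP : is_prime_ideal A P.

Lemma prime_isideal : is_ideal A P. Proof. by case: prP. Qed.
Let idP := prime_isideal.
Lemma primeN1 : ~ P 1. Proof. by case: prP. Qed.
Lemma primeM x y : A x -> A y -> P (x * y) -> P x \/ P y.
Proof. by case: prP => _ _; exact. Qed.
Lemma primeNM x y : A x -> A y -> ~ P x -> ~ P y -> ~ P (x * y).
Proof. by move=> Ax Ay nx ny /(primeM Ax Ay)[]. Qed.
Lemma primeX x n : A x -> P (x ^+ n) -> P x.
Proof.
move=> Ax; elim: n => [/primeN1//|n IH].
by rewrite exprS => /primeM[]//; exact: subringX.
Qed.
Lemma prime_prod (J : eqType) (r : seq J) (f : J -> E) :
  (forall i, i \in r -> A (f i)) -> P (\prod_(i <- r) f i) ->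
  exists2 i, i \in r & P (f i).
Proof.
elim: r => [|i r IH] Ar; first by rewrite big_nil => /primeN1.
rewrite big_cons => /primeM[].
- by apply: Ar; rewrite mem_head.
- rewrite big_seq; apply: subring_prod => j jr; apply: Ar; by rewrite in_cons jr orbT.
- by move=> Pi; exists i => //; rewrite mem_head.
- case/IH => [j jr|j jr Pj]; first by apply: Ar; rewrite in_cons jr orbT.
  by exists j => //; rewrite in_cons jr orbT.
Qed.

Variable q : nat.
Hypotheses (q_pr : prime q) (Pq : P q%:R).

Lemma prime_over_int (z : int) : P z%:~R <-> (q %| z)%Z.
Proof.
split=> [Pz|/dvdzP[w ->]]; last first.
  by rewrite rmorphM /=; apply: (idealM_l idP) => //; exact: subring_int.
apply/negP => /negP nd; apply: primeN1.
have cop : coprimez q z.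
  by rewrite /coprimez /gcdz /= eqz_nat -[_ == _]/(coprime q `|z|) prime_coprime.
have [u [v]] := Bezoutz q z; rewrite (eqP cop) => e.
rewrite -[1]/(1%:~R) -e rmorphD !rmorphM /=.
by apply: (idealD idP); apply: (idealM_l idP) => //; exact: subring_int.
Qed.

Lemma prime_over_nat (n : nat) : P n%:R <-> (q %| n)%N.
Proof. exact: (prime_over_int n). Qed.

Lemma prime_frobD a b : A a -> A b -> P ((a + b) ^+ q - (a ^+ q + b ^+ q)).
Proof.
move=> Aa Ab; have q_gt0 := prime_gt0 q_pr.
rewrite exprDn -(prednK q_gt0) big_ord_recl big_ord_recr /= !prednK //.
rewrite /bump /= !add1n prednK // subn0 subnn !expr0 mulr1 mul1r bin0 binn !mulr1n.
have -> u v w : u + (v + w) - (u + w) = v :> E by ring.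
apply: (ideal_sum idP) => i _; rewrite -mulr_natr; apply: (idealM_l idP).
  by apply: subringM; exact: subringX.
apply/prime_over_nat; apply: prime_dvd_bin => //.
by rewrite /bump /= add1n /= -ltn_predRL ltn_ord.
Qed.

End Prime.

Lemma prime_ideal_exists (I : set E) : is_ideal A I -> ~ I 1 ->
  exists P, is_prime_ideal A P /\ I `<=` P.
Proof.
move=> idI nI1.
(* The empty chain has the empty union, so the family must contain the empty set; joining [I] to
   every member achieves this. *)
pose ok (J : set E) := is_ideal A (I `|` J) /\ ~ (I `|` J) 1.
have [|J [[idM nM1] maxM]] := @Zorn_bigcup E ok.
  move=> C Cok Ctot; pose U := I `|` \bigcup_(X in C) X.
  have U2 x y : U x -> U y -> I x /\ I y \/ exists2 X, C X & (I `|` X) x /\ (I `|` X) y.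
    move=> [Ix|[X CX Xx]] [Iy|[Y CY Yy]].
    - by left.
    - by right; exists Y => //; split; [left|right].
    - by right; exists X => //; split; [right|left].
    - right; case: (Ctot _ _ CX CY) => XY.
        by exists Y => //; split; right => //; exact: XY.
      by exists X => //; split; right => //; exact: XY.
  split; first split.
  - move=> x Ux; case: (U2 _ _ Ux Ux) => [[Ix _]|[X /Cok[idX _] [Xx _]]].
      exact: (ideal_sub idI).
    exact: (ideal_sub idX).
  - by left; exact: (ideal0 idI).
  - move=> x y Ux Uy; case: (U2 _ _ Ux Uy) => [[Ix Iy]|[X CX [Xx Xy]]].
      by left; exact: (idealD idI).
    have [idX _] := Cok _ CX; case: (idealD idX Xx Xy) => [|h]; first by left.
    by right; exists X.
  - move=> a x Aa Ux; case: (U2 _ _ Ux Ux) => [[Ix _]|[X CX [Xx _]]].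
      by left; exact: (idealM_l idI).
    have [idX _] := Cok _ CX; case: (idealM_l idX Aa Xx) => [|h]; first by left.
    by right; exists X.
  - move=> U1; case: (U2 _ _ U1 U1) => [[]//|[X /Cok[_ +] [+ _]]]; exact.
set M := I `|` J in idM nM1.
have maxM' a : A a -> ~ M a -> exists m b, [/\ M m, A b & 1 = m + b * a].
  move=> Aa nMa.
  pose N : set E := [set n | exists m b, [/\ M m, A b & n = m + b * a]].
  have MN : M `<=` N by move=> m Mm; exists m, 0; split=> //; [exact: subring0|rewrite mul0r addr0].
  have Na : N a.
    exists 0, 1; split; [exact: (ideal0 idM)|exact: subring1|by rewrite mul1r add0r].
  have IN : I `|` N = N.
    by apply/seteqP; split=> [x [Ix|//]|x]; [apply: MN; left|right].
  have idN : is_ideal A N.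
    split.
    - move=> _ [m [b [Mm Ab ->]]]; apply: subringD; first exact: (ideal_sub idM).
      exact: subringM.
    - by apply: MN; exact: (ideal0 idM).
    - move=> _ _ [m [b [Mm Ab ->]]] [m' [b' [Mm' Ab' ->]]].
      exists (m + m'), (b + b'); split; [exact: (idealD idM)|exact: subringD|].
      by rewrite mulrDl addrACA.
    - move=> c _ Ac [m [b [Mm Ab ->]]]; exists (c * m), (c * b).
      by split; [exact: (idealM_l idM)|exact: subringM|rewrite mulrDr mulrA].
  have : ~ ok N.
    apply: maxM; split=> [|NJ]; first by move=> x Jx; apply: MN; right.
    by apply: nMa; right; exact: NJ.
  rewrite /ok IN => nok; have [N1|nN1] := pselect (N 1); last by case: nok.
  by case: N1 => m [b ?]; exists m, b.
exists M; split; last by move=> x Ix; left.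
split=> // x y Ax Ay Mxy; have [Mx|nMx] := pselect (M x); first by left.
right; have [m [b [Mm Ab e]]] := maxM' _ Ax nMx.
rewrite -[y]mul1r e mulrDl -mulrA; apply: (idealD idM); first exact: (idealM_r idM).
exact: (idealM_l idM).
Qed.

Lemma prime_avoidance (J : eqType) (r : seq J) (I : set E) (P_ : J -> set E) :
  is_ideal A I -> (forall j, j \in r -> is_prime_ideal A (P_ j)) ->
  (forall j, j \in r -> exists2 a, I a & ~ P_ j a) ->
  exists2 a, I a & forall j, j \in r -> ~ P_ j a.
Proof.
move=> idI; elim: {r}(size r) {-2}r (leqnn (size r)) => [|n IH] [|j r] //= sz prP nsub.
- by exists 0 => //; exact: (ideal0 idI).
- by exists 0 => //; exact: (ideal0 idI).
have sr k : k \in r -> k \in j :: r by move=> kr; rewrite in_cons kr orbT.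
have [[k kr kj]|nk] := pselect (exists2 k, k \in r & P_ k `<=` P_ j).
  have sf x : x \in j :: [seq y <- r | y != k] -> x \in j :: r.
    by rewrite !in_cons mem_filter; case: eqP => //= _ /andP[].
  have [|||a Ia na] := IH (j :: [seq y <- r | y != k]).
  - rewrite /= size_filter -(count_predC (pred1 k)) in sz *.
    rewrite -ltnS; apply: leq_trans sz; rewrite ltnS -add1n leq_add2r.
    by rewrite -has_count has_pred1.
  - by move=> x /sf /prP.
  - by move=> x /sf /nsub.
  - exists a => // x; have [-> _ Pka|xk] := eqVneq x k.
      by apply: (na j); [rewrite mem_head|exact: kj].
    rewrite in_cons => /orP[/eqP->|xr]; first by apply: na; rewrite mem_head.
    by apply: na; rewrite in_cons mem_filter /= xk xr orbT.
have [|x /sr /prP //|x /sr /nsub //|a Ia na] := IH r; first by rewrite -ltnS.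
have [Pja|nPja] := pselect (P_ j a); last first.
  by exists a => // x; rewrite in_cons => /orP[/eqP->|/na].
have /choice[b bP] : forall k, exists b, k \in r -> P_ k b /\ ~ P_ j b.
  move=> k; have [kr|_] := boolP (k \in r); last by exists 0.
  have [//|none] := pselect (exists b, P_ k b /\ ~ P_ j b); first by case=> b ?; exists b.
  case: nk; exists k => // x Pkx; have [//|nPjx] := pselect (P_ j x).
  by case: none; exists x.
have jr : j \in j :: r by rewrite mem_head.
have [i0 Ii0 nPi0] := nsub j jr.
have Ab k : k \in r -> A (b k).
  by move=> kr; have [Pk _] := bP k kr; exact: (ideal_sub (prime_isideal (prP k (sr _ kr)))).
have Apb : A (\prod_(k <- r) b k) by rewrite big_seq; apply: subring_prod.
(* Here [a] lies in [P_ j] and in none of the other primes, while the added term lies in all the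
   others and not in [P_ j]. *)
exists (a + i0 * \prod_(k <- r) b k).
  by apply: (idealD idI) => //; exact: (idealM_r idI).
have idj := prime_isideal (prP j jr).
move=> x; rewrite in_cons => /orP[/eqP->|xr] Px.
  have : P_ j (i0 * \prod_(k <- r) b k).
    by rewrite -[X in P_ j X](addKr a); apply: (idealD idj) => //; exact: (idealN idj).
  case/(primeM (prP j jr)) => //; first exact: (ideal_sub idI).
  by case/(prime_prod (prP j jr)) => // k kr; case: (bP k kr).
apply: (na x xr); have idx := prime_isideal (prP x (sr _ xr)).
rewrite -[a](addrK (i0 * \prod_(k <- r) b k)); apply: (idealB idx) => //.
rewrite (big_rem x xr) /= mulrCA; apply: (idealM_r idx); last by case: (bP x xr).
apply: subringM; first exact: (ideal_sub idI).
by rewrite big_seq; apply: subring_prod => k /mem_rem /Ab.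
Qed.

End Subring.

(** Horner's scheme for a monic integer polynomial vanishing at [a]: modulo [P'] its constant term
    is 0, so [q] divides that term, which then lies in [P] and can be removed. Either [a] is in [P]
    or the quotient polynomial, again monic, has its value in [P]; the descent cannot reach the
    constant 1. *)
Lemma prime_over_max (A B P P' : set E) (q : nat) :
  is_subring A -> is_subring B -> A `<=` @alint E -> A `<=` B -> prime q ->
  is_prime_ideal A P -> is_prime_ideal B P' -> P q%:R -> P `<=` P' ->
  forall a, A a -> P' a -> P a.
Proof.
move=> sA sB iA AB q_pr prP prP' Pq PP' a Aa P'a.
have P'q := PP' _ Pq.
have [f fm fr] := iA _ Aa.
have : P (map_poly intr f).[a] by rewrite (eqP fr); exact: (ideal0 (prime_isideal prP)).
elim/poly_ind: f {fr} fm => [|f c IH]; first by rewrite monicE lead_coef0 eq_sym oner_eq0.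
have Af g : A (map_poly intr g).[a].
  rewrite horner_coef; apply: (subring_sum sA) => i _; apply: (subringM sA).
    by rewrite coef_map; exact: (subring_int sA).
  exact: (subringX sA).
rewrite rmorphD rmorphM /= map_polyX map_polyC /= !hornerE => fm Pfc.
have [f0|fn0] := eqVneq f 0.
  move: fm Pfc; rewrite f0 !rmorph0 !mul0r !add0r monicE lead_coefC => /eqP->.
  by rewrite horner0 mul0r add0r => /(primeN1 prP).
have fm' : f \is monic.
  move: fm; rewrite !monicE lead_coefDl ?lead_coefMX //.
  by rewrite size_mulX // size_polyC; case: (c != 0); rewrite ltnS // size_poly_gt0.
have idP := prime_isideal prP; have idP' := prime_isideal prP'.
have P'c : P' c%:~R.
  rewrite -[c%:~R](addKr ((map_poly intr f).[a] * a)); apply: (idealD idP').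
    by apply: (idealN sB idP'); apply: (idealM_l idP') => //; exact: AB.
  exact: PP'.
have Pc : P c%:~R.
  by apply/(prime_over_int sA prP q_pr Pq)/(prime_over_int sB prP' q_pr P'q).
have : P ((map_poly intr f).[a] * a).
  by rewrite -[X in P X](addrK c%:~R); apply: (idealB sA idP).
by case/(primeM prP) => //; exact: IH.
Qed.
End SubringsAndIdeals.

(** * Galois number fields *)

Lemma int_pfactor (q : nat) (z : int) : prime q -> z != 0 ->
  exists (j : nat) (m : int), z = q%:R ^+ j * m /\ ~ (q %| m)%Z.
Proof.
move=> q_pr z0; have za : (0 < `|z|)%N by rewrite absz_gt0.
have [m cqm zm] := pfactor_coprime q_pr za.
exists (logn q `|z|), (sgz z * m%:Z); split.
  have e : (m%:Z * q%:R ^+ logn q `|z|) = `|z|%N%:Z by rewrite [in RHS]zm PoszM -natrX natz.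
  by rewrite mulrC -mulrA e -intEsg.
have sz : `|sgz z|%N = 1%N by move: z0; case: (z) => [[|n]|n].
rewrite dvdzE abszM sz mul1n /= => qm.
by move: cqm; rewrite prime_coprime // qm.
Qed.

Section GaloisIntegers.
Variables (F : splittingFieldType rat) (FC : {rmorphism F -> algC}).
Local Notation G := (gal_of {:F}).
Implicit Types (a b : F) (x y z : G) (Q : set F).

Lemma galMf x y a : (x * y)%g a = y (x a).
Proof. by rewrite galM ?memvf. Qed.

Lemma gal_Vf x a : (x^-1)%g (x a) = a.
Proof. by rewrite -galMf mulgV gal_id. Qed.

Lemma galVf x a : x ((x^-1)%g a) = a.
Proof. by rewrite -galMf mulVg gal_id. Qed.

Lemma gal_extf x y : (forall a, x a = y a) -> x = y.
Proof. by move=> xy; apply/eqP/gal_eqP => a _. Qed.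

Lemma alint_gal x a : alint (x a) <-> alint a.
Proof. exact: (alint_rmorph (x : {rmorphism F -> F})). Qed.

Lemma galois_full (K : {subfield F}) : galois K {:F}.
Proof.
apply/and3P; split; [exact: subvf| |exact: normalFieldf].
by apply/separableP => a _; apply: pcharf0_separable; move=> p; rewrite pchar_lalg; exact: pchar_num.
Qed.

Lemma galois_rat a : (forall x, x a = a) -> exists r : rat, a = ratr r.
Proof.
move=> fa; have /galois_fixedField e := galois_full 1%AS.
have : a \in fixedField 'Gal({:F} / 1)%g.
  by apply/fixedFieldP; [exact: memvf|move=> x _; exact: fa].
by rewrite e => /vlineP[r ->]; exists r; rewrite alg_num_field.
Qed.

Lemma alint_ratP (r : rat) : alint (ratr r : F) -> exists z : int, r = z%:~R.
Proof.
move=> /(alint_rmorph FC); rewrite fmorph_rat => -[p pm pr].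
have : (ratr r : algC) \in Num.int.
  apply: Cint_rat_Aint; first exact: Crat_rat.
  apply: (root_monic_Aint pr); first exact: monic_map.
  by apply/polyOverP => i; rewrite coef_map /= intr_int.
by rewrite Cint_rat => /intrP.
Qed.

Lemma intrF_inj : injective (intr : int -> F).
Proof. by move=> u v /(congr1 FC); rewrite !rmorph_int; exact: intr_inj. Qed.

Lemma natF_neq0 n : (0 < n)%N -> (n%:R : F) != 0.
Proof. by move=> n0; rewrite -(inj_eq (fmorph_inj FC)) rmorph_nat rmorph0 pnatr_eq0 -lt0n. Qed.

Lemma gal_fix_int a : alint a -> (forall x, x a = a) -> exists z : int, a = z%:~R.
Proof.
move=> ia /galois_rat[r er]; rewrite er in ia *.
by have [z ->] := alint_ratP ia; exists z; rewrite ratr_int.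
Qed.

Lemma gal_norm_int a : alint a -> exists z : int, \prod_(x : G) x a = z%:~R.
Proof.
move=> ia; apply: gal_fix_int => [|y].
  by apply: alint_prod => x _; apply/alint_gal.
rewrite rmorph_prod /= [RHS](reindex_inj (mulIg y)) /=.
by apply: eq_bigr => x _; rewrite galMf.
Qed.

Lemma gal_norm_neq0 a : a != 0 -> \prod_(x : G) x a != 0.
Proof. by move=> a0; apply/prodf_neq0 => x _; rewrite fmorph_eq0. Qed.

Definition alint_poly (p : {poly F}) := forall i, alint p`_i.

Lemma alint_polyM p q : alint_poly p -> alint_poly q -> alint_poly (p * q).
Proof. by move=> ip iq i; rewrite coefM; apply: alint_sum => j _; apply: alintM. Qed.

Lemma alint_polyXsubC a : alint a -> alint_poly ('X - a%:P).
Proof.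
move=> ia i; rewrite coefB coefX coefC; apply: alintB; first exact: alint_nat.
by case: ifP => _ //; exact: alint0.
Qed.

Lemma alint_poly_prod (P : pred G) (f : G -> {poly F}) :
  (forall x, P x -> alint_poly (f x)) -> alint_poly (\prod_(x | P x) f x).
Proof.
move=> h; apply: (big_ind alint_poly) => //; last exact: alint_polyM.
by move=> i; rewrite coefC; case: ifP => _; [exact: alint1|exact: alint0].
Qed.

Lemma gal_poly_int (p : {poly F}) : alint_poly p ->
  (forall x, map_poly x p = p) -> exists p0 : {poly int}, p = map_poly intr p0.
Proof.
move=> ip fp; have /choice[c cP] : forall i, exists z : int, p`_i = z%:~R.
  by move=> i; apply: gal_fix_int => // x; rewrite -{2}(fp x) coef_map.
exists (\poly_(i < size p) c i); apply/polyP => i; rewrite coef_map coef_poly.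
by case: ltnP => [_|h]; [rewrite cP|rewrite nth_default].
Qed.

Lemma charpoly_int a : alint a -> exists2 p : {poly int},
  \prod_(x : G) ('X - (x a)%:P) = map_poly intr p & p \is monic.
Proof.
move=> ia; have [||p ep] := gal_poly_int (p := \prod_(x : G) ('X - (x a)%:P)).
- by apply: alint_poly_prod => x _; apply: alint_polyXsubC; apply/alint_gal.
- move=> y; rewrite rmorph_prod /= [RHS](reindex_inj (mulIg y)) /=.
  by apply: eq_bigr => x _; rewrite map_polyXsubC galMf.
exists p => //; have := monic_prod_XsubC (index_enum G) predT (fun x => x a).
by rewrite ep !monicE lead_coef_map_inj ?(inj_eq intrF_inj _ 1) //; exact: intrF_inj.
Qed.

Section Primitive.
Variable theta : F.
Hypotheses (itheta : alint theta) (sep : forall x y, x theta = y theta -> x = y).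

(** The interpolation polynomial taking the value [x (different * a)] at each conjugate [x theta].
    For integral [a] its coefficients are integers, so [different] times any algebraic integer lies
    in Z[theta]. *)
Definition lagrange a : {poly F} :=
  \sum_(x : G) (x a)%:P * \prod_(y | y != x) ('X - (y theta)%:P).

(** The derivative at [theta] of the characteristic polynomial of [theta], which generates the
    different of Z[theta]. Primes not containing it are unramified. *)
Definition different : F := \prod_(y : G | y != 1%g) (theta - y theta).

Lemma lagrange_fix a y : map_poly y (lagrange a) = lagrange a.
Proof.
rewrite /lagrange rmorph_sum /= [RHS](reindex_inj (mulIg y)) /=.
apply: eq_bigr => x _; rewrite rmorphM /= map_polyC /= galMf; congr (_ * _).
rewrite rmorph_prod /= [RHS](reindex_inj (mulIg y)) /=.
apply: eq_big => z; first by rewrite (inj_eq (mulIg y)).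
by rewrite map_polyXsubC galMf.
Qed.

Lemma lagrange_coef_alint x i :
  alint (\prod_(y : G | y != x) ('X - (y theta)%:P))`_i.
Proof.
apply: alint_poly_prod => y _; apply: alint_polyXsubC; exact/alint_gal.
Qed.

Lemma lagrange_horner a : (lagrange a).[theta] = different * a.
Proof.
rewrite /lagrange horner_sum (bigD1 1%g) //= [X in _ + X]big1 => [|x x1].
  rewrite addr0 hornerM hornerC gal_id mulrC horner_prod; congr (_ * _).
  by apply: eq_bigr => y _; rewrite hornerXsubC.
rewrite hornerM horner_prod (bigD1 1%g) /= ?hornerXsubC ?gal_id ?subrr ?mul0r ?mulr0 //.
by rewrite eq_sym.
Qed.

Lemma lagrange_int a : alint a -> exists p : {poly int}, lagrange a = map_poly intr p.
Proof.
move=> ia; apply: gal_poly_int => [i|x]; last exact: lagrange_fix.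
rewrite /lagrange coef_sum; apply: alint_sum => x _; rewrite coefCM.
by apply: alintM; [exact/alint_gal|exact: lagrange_coef_alint].
Qed.

Lemma different_alint : alint different.
Proof. by apply: alint_prod => y _; apply: alintB => //; exact/alint_gal. Qed.

Lemma different_neq0 : different != 0.
Proof.
apply/prodf_neq0 => y y1; rewrite subr_eq0; apply: contra y1 => /eqP e.
by apply/eqP/sep; rewrite gal_id.
Qed.

Section Local.
Variables (q : nat) (Q : set F).
Hypotheses (q_pr : prime q) (prQ : is_prime_ideal (@alint F) Q) (Qq : Q q%:R).
Let sO := alint_subring F.
Let idQ := prime_isideal prQ.
Let frobD := @prime_frobD _ _ sO _ prQ _ q_pr Qq.

(** The coefficients of [lagrange a] are rational integers lying in [Q], hence multiples of [q];
    evaluation at [theta] gives the quotient. *)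
Lemma different_kill a : alint a -> (forall x, Q (x a)) ->
  exists2 b, alint b & different * a = q%:R * b.
Proof.
move=> ia Qa; have [p ep] := lagrange_int ia.
have dvd i : (q %| p`_i)%Z.
  apply/(prime_over_int sO prQ q_pr Qq).
  rewrite -[_%:~R](coef_map (intr : {rmorphism int -> F})) /= -ep /lagrange coef_sum.
  apply: (ideal_sum idQ) => x _; rewrite coefCM mulrC; apply: (idealM_l idQ) => //.
  exact: lagrange_coef_alint.
have /choice[c cP] : forall i, exists c, p`_i = c * q%:Z.
  by move=> i; have /dvdzP[c ->] := dvd i; exists c.
pose p' := \poly_(i < size p) c i; exists (map_poly intr p').[theta].
  rewrite horner_coef; apply: alint_sum => i _; rewrite coef_map.
  by apply: alintM; [exact: alint_int|exact: alintX].
rewrite -lagrange_horner ep; have -> : p = q%:Z *: p'.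
  apply/polyP => i; rewrite coefZ coef_poly; case: ltnP => h; first by rewrite cP mulrC.
  by rewrite nth_default // mulr0.
by rewrite map_polyZ hornerZ.
Qed.

Lemma frob_int (c : int) : Q (c%:~R ^+ q - c%:~R).
Proof.
have q0 := prime_gt0 q_pr.
have add (u v : int) : Q (u%:~R ^+ q - u%:~R) -> Q (v%:~R ^+ q - v%:~R) ->
    Q ((u + v)%:~R ^+ q - (u + v)%:~R).
  move=> hu hv; rewrite rmorphD /=.
  apply: (ideal_transB idQ (frobD (alint_int _ u) (alint_int _ v))).
  exact: (idealBD idQ).
have opp (u : int) : Q (u%:~R ^+ q - u%:~R) -> Q ((- u)%:~R ^+ q - (- u)%:~R).
  move=> hu; have := frobD (alint_int _ u) (alint_int _ (- u)).
  rewrite rmorphN /= subrr expr0n gtn_eqF //= sub0r => h.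
  have := idealB sO idQ (idealN sO idQ h) hu; congr Q; ring.
elim/int_rect: c => [|n IH|n IH].
- by rewrite expr0n gtn_eqF //= subrr; exact: (ideal0 idQ).
- rewrite intS; apply: add => //; rewrite expr1n subrr; exact: (ideal0 idQ).
- rewrite intS opprD; apply: add => //; apply: opp; rewrite expr1n subrr; exact: (ideal0 idQ).
Qed.

Lemma frob_poly (p : {poly int}) b : alint b ->
  Q ((map_poly intr p).[b ^+ q] - (map_poly intr p).[b] ^+ q).
Proof.
move=> ib; have q0 := prime_gt0 q_pr.
have ip (c : F) (r : {poly int}) : alint c -> alint (map_poly intr r).[c].
  move=> ic; rewrite horner_coef; apply: alint_sum => i _; rewrite coef_map.
  by apply: alintM; [exact: alint_int|exact: alintX].
elim/poly_ind: p => [|p c IH].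
  by rewrite rmorph0 !horner0 expr0n gtn_eqF //= subrr; exact: (ideal0 idQ).
rewrite rmorphD rmorphM /= map_polyX map_polyC /= !hornerE.
apply: (ideal_transB idQ _ (ideal_symB sO idQ (frobD (alintM (ip _ _ ib) ib) (alint_int _ c)))).
apply: (idealBD idQ); last exact: (ideal_symB sO idQ (frob_int c)).
rewrite exprMn -mulrBl mulrC; apply: (idealM_l idQ) => //; exact: alintX.
Qed.

(** The characteristic polynomial of [theta] has integer coefficients, so modulo [Q] it vanishes at
    [theta ^+ q] as well, and this power is congruent to some conjugate [phi theta]. The congruence
    passes to Z[theta], and from there to all integers because [different] is invertible modulo
    [Q]. *)
Lemma frobenius_exists : ~ Q different ->
  exists phi : G, forall a, alint a -> Q (phi a - a ^+ q).
Proof.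
move=> nQd; have [f ef _] := charpoly_int itheta.
have itq : alint (theta ^+ q) by exact: alintX.
have : Q (\prod_(x : G) ('X - (x theta)%:P)).[theta ^+ q].
  rewrite ef; apply: (ideal_subl idQ (frob_poly f itheta)).
  rewrite -ef horner_prod (bigD1 1%g) //= hornerXsubC gal_id subrr mul0r.
  by rewrite expr0n gtn_eqF ?prime_gt0 //; exact: (ideal0 idQ).
rewrite horner_prod => /(prime_prod sO prQ)[x _|phi _].
  by rewrite hornerXsubC; apply: alintB => //; exact/alint_gal.
rewrite hornerXsubC => Qphi; exists phi.
have pint (p : {poly int}) : Q (phi (map_poly intr p).[theta] - (map_poly intr p).[theta] ^+ q).
  apply: (ideal_transB idQ _ (frob_poly p itheta)).
  have -> : phi (map_poly intr p).[theta] = (map_poly intr p).[phi theta].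
    rewrite -horner_map -map_poly_comp; congr _.[_].
    by apply: eq_map_poly => z /=; rewrite rmorph_int.
  rewrite !horner_coef -sumrB; apply: (ideal_sum idQ) => i _; rewrite coef_map -mulrBr.
  apply: (idealM_l idQ); first exact: alint_int.
  by apply: (idealBX sO idQ) => //; [exact/alint_gal|exact: (ideal_symB sO idQ)].
have pall a : alint a -> Q (phi (different * a) - (different * a) ^+ q).
  by move=> /lagrange_int[p ep]; rewrite -lagrange_horner ep; exact: pint.
move=> a ia; have id := different_alint.
have iphi b : alint b -> alint (phi b) by move=> ib; exact/alint_gal.
have h1 : Q (phi different - different ^+ q).
  by have := pall 1 (alint1 _); rewrite mulr1.
have h2 : Q (different ^+ q * (phi a - a ^+ q)).
  rewrite mulrBr -exprMn; apply: (ideal_transB idQ _ (pall a ia)).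
  rewrite rmorphM /= -mulrBl mulrC; apply: (idealM_l idQ); first exact: iphi.
  exact: (ideal_symB sO idQ).
case: (primeM prQ _ _ h2) => //; first exact: alintX.
  by apply: alintB; [exact: iphi|exact: alintX].
by move/(primeX sO prQ) => /(_ id).
Qed.

Hypothesis nQd : ~ Q different.

(** The valuation of [a] at [Q], with [q] as uniformizer and [t], [u] units at [Q]. Its existence
    for all non-zero [a] expresses that [Q] is unramified over [q]. *)
Definition hasval a k := exists t u,
  [/\ alint t, alint u, ~ Q t, ~ Q u & t * a = q%:R ^+ k * u].

Lemma alintq : alint (q%:R : F). Proof. exact: alint_nat. Qed.

Lemma hasval_uniq a k k' : hasval a k -> hasval a k' -> k = k'.
Proof.
have q0 := natF_neq0 (prime_gt0 q_pr).
wlog le : k k' / (k <= k')%N => [hw|].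
  by move=> h h'; case: (leqP k k') => [/hw|/ltnW /hw e]; [exact|exact/esym/e].
move=> [t [u [it iu nt nu e]]] [t' [u' [it' iu' nt' nu' e']]].
apply/eqP; rewrite eqn_leq le /= leqNgt; apply/negP => lt.
have : Q (t' * u).
  have -> : t' * u = q%:R * (q%:R ^+ (k' - k).-1 * (t * u')).
    apply: (mulfI (expf_neq0 k q0)); rewrite mulrCA -e mulrCA e' mulrCA.
    have ek : k' = (k + (k' - k).-1.+1)%N by rewrite prednK ?subn_gt0 // subnKC.
    by rewrite {1}ek exprD exprS; ring.
  apply: (idealM_r idQ) => //; apply: alintM; first exact: alintX alintq.
  exact: alintM.
by case/(primeM prQ).
Qed.

Lemma hasvalM a a' k k' : hasval a k -> hasval a' k' -> hasval (a * a') (k + k').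
Proof.
move=> [t [u [it iu nt nu e]]] [t' [u' [it' iu' nt' nu' e']]].
exists (t * t'), (u * u'); split; [exact: alintM|exact: alintM| | |].
- exact: (primeNM prQ).
- exact: (primeNM prQ).
- by rewrite mulrACA e e' mulrACA -exprD.
Qed.

Lemma hasval_gt0 a k : alint a -> hasval a k -> (Q a <-> (0 < k)%N).
Proof.
move=> ia [t [u [it iu nt nu e]]]; split=> [Qa|k0].
  case: k e => // e; rewrite expr0 mul1r in e.
  by case: nu; rewrite -e; exact: (idealM_l idQ).
have : Q (t * a).
  rewrite e -(prednK k0) exprS -mulrA; apply: (idealM_r idQ) => //.
  by apply: alintM => //; exact: alintX alintq.
by case/(primeM prQ).
Qed.

Lemma hasval_int j (m : int) : ~ (q %| m)%Z -> hasval (q%:R ^+ j * m%:~R) j.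
Proof.
move=> nqm; exists 1, m%:~R; rewrite mul1r; split=> //.
- exact: alint1.
- exact: alint_int.
- exact: (primeN1 prQ).
- by move/(prime_over_int sO prQ q_pr Qq).
Qed.

(* s avoids Q but lies in all the other conjugates of Q, so s a lies in every
   prime over q as soon as a lies in Q. *)
Lemma unramified_uniformizer : exists t, [/\ alint t, ~ Q t
  & forall a, Q a -> exists2 b, alint b & t * a = q%:R * b].
Proof.
have /choice[s sP] : forall x : G, exists s, [/\ alint s, ~ Q s
    & Q (x s) \/ forall a, alint a -> Q a -> Q (x a)].
  move=> x; have [[s [is_ Qxs nQs]]|none] :=
    pselect (exists s, [/\ alint s, Q (x s) & ~ Q s]).
    by exists s; split=> //; left.
  exists 1; split; [exact: alint1|exact: (primeN1 prQ)|right=> a ia Qa].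
  have prx : is_prime_ideal (@alint F) [set b | alint b /\ Q (x b)].
    split; first split.
    - by move=> b [].
    - by split; [exact: alint0|rewrite /= rmorph0; exact: (ideal0 idQ)].
    - move=> b c [ib Qb] [ic Qc]; split; first exact: alintD.
      by rewrite /= rmorphD; exact: (idealD idQ).
    - move=> b c ib [ic Qc]; split; first exact: alintM.
      by rewrite /= rmorphM; apply: (idealM_l idQ) => //; exact/alint_gal.
    - by move=> [_]; rewrite /= rmorph1; exact: (primeN1 prQ).
    - move=> b c ib ic [_]; rewrite /= rmorphM => /(primeM prQ)[]; try exact/alint_gal.
        by left.
      by right.
  have sub : [set b | alint b /\ Q (x b)] `<=` Q.
    move=> b [ib Qxb]; have [//|nQb] := pselect (Q b).
    by case: none; exists b.
  have [] := prime_over_max sO sO (fun _ => id) (fun _ => id) q_pr prx prQ _ sub ia Qa => //.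
  by split; [exact: alintq|rewrite /= rmorph_nat].
have is_ x : alint (s x) by case: (sP x).
have ips : alint (\prod_x s x) by apply: alint_prod.
exists (different * \prod_x s x); split.
- by apply: alintM => //; exact: different_alint.
- apply: (primeNM prQ) => //; first exact: different_alint.
  case/(prime_prod sO prQ) => // x _; by case: (sP x).
move=> a Qa; have ia := ideal_sub idQ Qa.
have [|x|b ib e] := @different_kill ((\prod_x s x) * a).
- exact: alintM.
- rewrite rmorphM /=; case: (sP x) => _ _ [Qxs|pres]; last first.
    by apply: (idealM_l idQ); [exact/alint_gal|exact: pres].
  apply: (idealM_r idQ); first exact/alint_gal.
  rewrite (bigD1 x) //= rmorphM /=; apply: (idealM_r idQ) => //.
  by apply/alint_gal; apply: alint_prod.
by exists b => //; rewrite -mulrA.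
Qed.

(** As long as the numerator lies in [Q], [unramified_uniformizer] extracts another factor [q]. The
    exponent of [q] in the norm of [a] bounds the number of extractions. *)
Lemma hasval_exists a : alint a -> a != 0 -> exists k, hasval a k.
Proof.
move=> ia a0; have [t0 [it0 nt0 t0P]] := unramified_uniformizer.
have [//|none] := pselect (exists k, hasval a k).
have pow k : exists t u, [/\ alint t, alint u, ~ Q t & t * a = q%:R ^+ k * u].
  elim: k => [|k [t [u [it iu nt e]]]].
    by exists 1, a; rewrite expr0; split=> //; [exact: alint1|exact: (primeN1 prQ)].
  have [Qu|nQu] := pselect (Q u); last by case: none; exists k, t, u.
  have [b ib eb] := t0P u Qu; exists (t0 * t), b; split=> //; first exact: alintM.
    exact: (primeNM prQ).
  by rewrite -mulrA e mulrCA eb exprS; ring.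
have [z ez] := gal_norm_int ia.
have z0 : z != 0.
  by have := gal_norm_neq0 a0; rewrite ez -(inj_eq intrF_inj).
have [j [m [zjm nqm]]] := int_pfactor q_pr z0.
have [t [u [it iu nt e]]] := pow j.+1.
have q0 := natF_neq0 (prime_gt0 q_pr).
pose a' := \prod_(x : G | x != 1%g) x a.
have ia' : alint a' by apply: alint_prod => x _; exact/alint_gal.
have ea : a * a' = q%:R ^+ j * m%:~R.
  by move: ez; rewrite (bigD1 1%g) //= gal_id zjm rmorphM rmorphXn /= natz.
have : Q (t * m%:~R).
  have -> : t * m%:~R = q%:R * (u * a').
    apply: (mulfI (expf_neq0 j q0)); rewrite mulrCA -ea [t * _]mulrA e exprSr; ring.
  by apply: (idealM_r idQ) => //; exact: alintM.
by case/(primeM prQ) => //; [exact: alint_int|move/(prime_over_int sO prQ q_pr Qq)].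
Qed.

End Local.
End Primitive.
End GaloisIntegers.

(** * Conjugacy of primes, good primes and their valuations *)

Section GoodPrimes.
Variables (F : splittingFieldType rat) (FC : {rmorphism F -> algC}).
Local Notation G := (gal_of {:F}).
Local Notation O := (@alint F).
Implicit Types (a b : F) (x y z : G) (Q : set F).
Let sO := alint_subring F.

Lemma alint_scale a : exists2 m : int, m != 0 & alint (m%:~R * a).
Proof.
have [r [er rm] _] := minCpolyP (FC a).
have [q [c c0 rq]] := rat_poly_scale r.
exists c => //; apply/(alint_rmorph FC); rewrite rmorphM rmorph_int /=.
have r0 : root (map_poly ratr r) (FC a) by rewrite -er root_minCpoly.
pose n := (size r).-1.
have sr : size r = n.+1 by rewrite prednK // size_poly_gt0 monic_neq0.
have c0' : (c%:~R : rat) != 0 by rewrite intr_eq0.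
pose P : {poly algC} := \poly_(i < n.+1) (c%:~R ^+ (n - i) * ratr r`_i).
have rn : r`_n = 1 by move: rm; rewrite monicE lead_coefE => /eqP.
apply: (@integral_root_monic _ _ (intr : {rmorphism int -> algC}) _ P).
- by rewrite monicE lead_coef_poly //= subnn expr0 mul1r rn rmorph1 ?oner_eq0.
- rewrite /root horner_poly.
  rewrite (eq_bigr (fun i : 'I_n.+1 => c%:~R ^+ n * (ratr r`_i * FC a ^+ i))).
    rewrite -mulr_sumr mulf_eq0; apply/orP; right.
    move: r0; rewrite /root horner_coef size_map_poly sr => r0.
    by rewrite -(eqP r0); apply/eqP; rewrite (eqP r0) -[RHS](eqP r0); apply: eq_bigr => i _; rewrite coef_map.
  move=> i _; have le : (i <= n)%N by rewrite -ltnS ltn_ord.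
  have -> : (c%:~R : algC) ^+ n = c%:~R ^+ (n - i) * c%:~R ^+ i by rewrite -exprD subnK.
  by rewrite exprMn; ring.
- apply/integral_poly => i; rewrite coef_poly; case: ltnP => [lt|_]; last first.
    exact: (alint0 algC).
  have [->|ni] := eqVneq i n.
    by rewrite subnn expr0 mul1r rn rmorph1; exact: (alint1 algC).
  have lt' : (i < n)%N by rewrite ltn_neqAle ni.
  have -> : (c%:~R ^+ (n - i) * ratr r`_i : algC) = (c ^+ (n - i).-1 * q`_i)%:~R.
    rewrite rq coefZ coef_map /= rmorphM /= fmorphV /= !ratr_int [in RHS]rmorphM rmorphXn /=.
    rewrite -{1}(prednK (n := n - i)) ?subn_gt0 // exprSr.
    have : (c%:~R : algC) != 0 by rewrite intr_eq0.
    by move=> ?; field.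
  exact: (alint_int algC).
Qed.

Lemma primitive_exists : exists theta : F,
  alint theta /\ forall x y : G, x theta = y theta -> x = y.
Proof.
have sepF : separable 1%AS {:F} by have := galois_full (F := F) 1%AS => /and3P[].
have eF := eq_adjoin_separable_generator sepF (subvf _).
set g := separable_generator _ _ in eF.
have [m m0 im] := alint_scale g; exists (m%:~R * g); split=> // x y.
rewrite !rmorphM /= !rmorph_int => /mulfI e.
have {}e : x g = y g by apply: e; rewrite -(rmorph0 intr) (inj_eq (intrF_inj FC)).
apply: gal_extf => a; have : a \in <<1; g>>%VS by rewrite -eF memvf.
move/Fadjoin_polyP => [p /polyOverP Qp ->].
have fp z : map_poly z p = p.
  apply/polyP => i; rewrite coef_map /=; have /vlineP[k ->] := Qp i.
  by rewrite alg_num_field fmorph_rat.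
by rewrite -!horner_map !fp /= e.
Qed.

Lemma prime_over_exists q : prime q -> exists Q, is_prime_ideal O Q /\ Q q%:R.
Proof.
move=> q_pr; have q0 := natF_neq0 FC (prime_gt0 q_pr).
have [|[b ib e]|Q [prQ sub]] := prime_ideal_exists sO (I := [set a | exists2 b, alint b & a = q%:R * b]).
- split.
  + by move=> _ [b ib ->]; apply: alintM => //; exact: alint_nat.
  + by exists 0; [exact: alint0|rewrite mulr0].
  + move=> _ _ [b ib ->] [c ic ->]; exists (b + c); [exact: alintD|by rewrite mulrDr].
  + move=> a _ ia [b ib ->]; exists (a * b); [exact: alintM|by rewrite mulrCA].
- have eb : b = ratr (q%:R^-1).
    by apply: (mulfI q0); rewrite -e -alg_num_field -in_algE fmorphV rmorph_nat divff.
  rewrite eb in ib; have [w ew] := alint_ratP FC ib.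
  have qz : (q%:R : rat) != 0 by rewrite pnatr_eq0 -lt0n prime_gt0.
  have : (q%:Z * w)%:~R = 1 :> rat by rewrite rmorphM /= -ew divff.
  rewrite -[1]/(1%:~R) => /intr_inj /(congr1 absz); rewrite abszM /= => /eqP.
  by rewrite muln_eq1 => /andP[/eqP q1 _]; rewrite q1 in q_pr.
- by exists Q; split=> //; apply: sub; exists 1; [exact: alint1|rewrite mulr1].
Qed.

Lemma gal_prime Q x : is_prime_ideal O Q -> is_prime_ideal O [set b | alint b /\ Q (x b)].
Proof.
move=> prQ; have idQ := prime_isideal prQ; split; first split.
- by move=> b [].
- by split; [exact: alint0|rewrite /= rmorph0; exact: (ideal0 idQ)].
- move=> b c [ib Qb] [ic Qc]; split; first exact: alintD.
  by rewrite /= rmorphD; exact: (idealD idQ).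
- move=> b c ib [ic Qc]; split; first exact: alintM.
  by rewrite /= rmorphM; apply: (idealM_l idQ) => //; exact/alint_gal.
- by move=> [_]; rewrite /= rmorph1; exact: (primeN1 prQ).
- move=> b c ib ic [_]; rewrite /= rmorphM => /(primeM prQ)[]; try exact/alint_gal.
    by left.
  by right.
Qed.

Lemma prime_subring (A : set F) P : is_subring A -> A `<=` O -> is_prime_ideal O P ->
  is_prime_ideal A [set a | A a /\ P a].
Proof.
move=> sA AO prP; have idP := prime_isideal prP; split; first split.
- by move=> a [].
- by split; [exact: (subring0 sA)|exact: (ideal0 idP)].
- by move=> a b [Aa Pa] [Ab Pb]; split; [exact: (subringD sA)|exact: (idealD idP)].
- move=> a b Aa [Ab Pb]; split; [exact: (subringM sA)|].
  by apply: (idealM_l idP) => //; exact: AO.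
- by move=> [_ /(primeN1 prP)].
- by move=> a b Aa Ab [_ /(primeM prP (AO _ Aa) (AO _ Ab))[]]; [left|right].
Qed.

(** Were [P] contained in no pullback of [Q] by an element of [G], prime avoidance would give [a] in
    [P] none of whose conjugates is in [Q]. But the constant term of its characteristic polynomial
    is an integer in [P], thus divisible by [q], thus in [Q], and it is a product of conjugates up
    to sign. Containment becomes equality by [prime_over_max]. *)
Lemma primes_conjugate (A : set F) P Q q : prime q -> is_subring A -> A `<=` O ->
  is_prime_ideal A P -> P q%:R -> is_prime_ideal O Q -> Q q%:R ->
  exists x : G, forall a, A a -> (P a <-> Q (x a)).
Proof.
move=> q_pr sA AO prP Pq prQ Qq; have idP := prime_isideal prP.
pose Q_ (x : G) : set F := [set a | A a /\ Q (x a)].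
have prQ_ x : is_prime_ideal A (Q_ x).
  have := prime_subring sA AO (gal_prime x prQ).
  congr is_prime_ideal; apply/seteqP; split=> a /=; first by case=> Aa [].
  by case=> Aa ?; split=> //; split=> //; exact: AO.
have [[x sub]|none] := pselect (exists x, P `<=` Q_ x).
  exists x => a Aa; split=> [/sub[]//|Qxa].
  by apply: (prime_over_max sA sA AO (fun _ => id) q_pr prP (prQ_ x) Pq sub Aa).
have [x _|a Pa na] := prime_avoidance sA (r := index_enum G) idP (fun x _ => prQ_ x).
  have [//|nex] := pselect (exists2 a, P a & ~ Q_ x a).
  by case: none; exists x => a Pa; have [//|n] := pselect (Q_ x a); case: nex; exists a.
have Aa := ideal_sub idP Pa; have ia := AO _ Aa.
have [p ep pm] := charpoly_int FC ia.
have Pp0 : P (p`_0)%:~R.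
  have Ap (r : {poly int}) : A (map_poly intr r).[a].
    rewrite horner_coef; apply: (subring_sum sA) => i _; apply: (subringM sA).
      by rewrite coef_map; exact: (subring_int sA).
    exact: (subringX sA).
  have e : (map_poly intr p).[a] = 0.
    by rewrite -ep horner_prod (bigD1 1%g) //= hornerXsubC gal_id subrr mul0r.
  have : (map_poly intr p).[a] = (map_poly intr (p - (p`_0)%:P)).[a] + (p`_0)%:~R.
    by rewrite rmorphB /= map_polyC hornerD hornerN hornerC subrK.
  have /factor_theorem[r er] : root (p - (p`_0)%:P) 0.
    by rewrite /root !hornerE horner_coef0 subrr.
  rewrite er rmorphM rmorphB /= map_polyX map_polyC /= subr0 hornerM hornerX e.
  move=> /esym /eqP; rewrite addrC addr_eq0 => /eqP ->; apply: (idealN sA idP).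
  by apply: (idealM_l idP).
have : Q (\prod_(x : G) - x a).
  have -> : \prod_(x : G) - x a = (p`_0)%:~R.
    rewrite -[(p`_0)%:~R](coef_map (intr : {rmorphism int -> F})) /= -ep -horner_coef0 horner_prod.
    by apply: eq_bigr => x _; rewrite hornerXsubC sub0r.
  by apply/(prime_over_int sO prQ q_pr Qq)/(prime_over_int sA prP q_pr Pq).
case/(prime_prod sO prQ) => [x _|x _]; first by apply: alintN; exact/alint_gal.
move/(idealN sO (prime_isideal prQ)); rewrite opprK => Qxa.
by case: (na x (mem_index_enum x)).
Qed.

Lemma prime_not_dividing b : alint b -> b != 0 -> exists D : nat,
  forall q Q, prime q -> (D < q)%N -> is_prime_ideal O Q -> Q q%:R -> ~ Q b.
Proof.
move=> ib b0; have [z ez] := gal_norm_int FC ib; exists `|z|%N => q Q q_pr lt prQ Qq Qb.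
have z0 : z != 0 by have := gal_norm_neq0 b0; rewrite ez -(inj_eq (intrF_inj FC)).
have : Q z%:~R.
  rewrite -ez (bigD1 1%g) //= gal_id; apply: (idealM_r (prime_isideal prQ)) => //.
  by apply: alint_prod => x _; exact/alint_gal.
move/(prime_over_int sO prQ q_pr Qq); rewrite dvdzE /= => /dvdn_leq; rewrite absz_gt0 => /(_ z0).
by rewrite leqNgt lt.
Qed.

(** [phi] is a Frobenius element at [Q], and the last clause says that [Q] is unramified. *)
Definition good_prime q Q (phi : G) : Prop :=
  [/\ is_prime_ideal O Q, Q q%:R, forall a, alint a -> Q (phi a - a ^+ q)
    & forall a, alint a -> a != 0 -> exists k, hasval q Q a k].

Lemma good_primes_exist : exists (D : nat) (Q_ : nat -> set F) (phi_ : nat -> G),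
  forall q, prime q -> (D < q)%N -> good_prime q (Q_ q) (phi_ q).
Proof.
have [theta [it sep]] := primitive_exists.
have [D DP] := prime_not_dividing (different_alint it) (different_neq0 sep).
have /choice[Qphi QP] : forall q, exists Qphi : set F * G,
    prime q -> (D < q)%N -> good_prime q Qphi.1 Qphi.2.
  move=> q; have [q_pr|_] := boolP (prime q); last by exists (set0, 1%g).
  have [Q [prQ Qq]] := prime_over_exists q_pr.
  have [lt|_] := boolP (D < q)%N; last by exists (set0, 1%g).
  have nQd := DP q Q q_pr lt prQ Qq.
  have [phi phiP] := frobenius_exists FC it q_pr prQ Qq nQd.
  exists (Q, phi) => _ _; split=> // a ia a0.
  exact: (hasval_exists FC it q_pr prQ Qq nQd ia a0).
by exists D, (fun q => (Qphi q).1), (fun q => (Qphi q).2).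
Qed.

Definition qval q Q a : nat := xget 0%N [set k | hasval q Q a k].

Section Good.
Variables (q : nat) (Q : set F) (phi : G).
Hypotheses (q_pr : prime q) (gQ : good_prime q Q phi).
Let prQ : is_prime_ideal O Q. Proof. by case: gQ. Qed.
Let idQ := prime_isideal prQ.
Let Qq : Q q%:R. Proof. by case: gQ. Qed.
Let nz a b : a != 0 -> b != 0 -> a * b != 0.
Proof. by move=> *; rewrite mulf_neq0. Qed.

Lemma qvalP a : alint a -> a != 0 -> hasval q Q a (qval q Q a).
Proof.
move=> ia a0; rewrite /qval; case: xgetP => [k _ //|no].
by case: gQ => _ _ _ /(_ a ia a0)[k hk]; case: (no k).
Qed.

Lemma qval_eq a k : alint a -> a != 0 -> hasval q Q a k -> qval q Q a = k.
Proof. by move=> ia a0; apply: (hasval_uniq FC q_pr prQ Qq); exact: qvalP. Qed.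

Lemma qvalM a b : alint a -> alint b -> a != 0 -> b != 0 ->
  qval q Q (a * b) = (qval q Q a + qval q Q b)%N.
Proof.
move=> ia ib a0 b0; apply: qval_eq; [exact: alintM|exact: nz|].
by apply: (hasvalM prQ); exact: qvalP.
Qed.

Lemma qval_gt0 a : alint a -> a != 0 -> (Q a <-> (0 < qval q Q a)%N).
Proof. by move=> ia a0; apply: (hasval_gt0 prQ Qq ia); exact: qvalP. Qed.

Lemma qval_int j (m : int) : ~ (q %| m)%Z -> qval q Q (q%:R ^+ j * m%:~R) = j.
Proof.
move=> nqm; have q0 := natF_neq0 FC (prime_gt0 q_pr).
apply: qval_eq; last exact: (hasval_int q_pr prQ Qq).
- by apply: alintM; [apply: alintX; exact: alint_nat|exact: alint_int].
- apply: nz; first exact: expf_neq0.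
  rewrite -(rmorph0 intr) (inj_eq (intrF_inj FC)); apply/eqP => m0.
  by apply: nqm; rewrite m0 dvdz0.
Qed.

Lemma qval_logn (z : int) : z != 0 -> qval q Q z%:~R = logn q `|z|.
Proof.
move=> z0; have [j [m [e nqm]]] := int_pfactor q_pr z0.
have e2 : (z%:~R : F) = q%:R ^+ j * m%:~R by rewrite e rmorphM rmorphXn /= natz.
rewrite e2 qval_int // e abszM abszX natz /= lognM; last 2 first.
- by rewrite expn_gt0 prime_gt0.
- by rewrite absz_gt0; apply/eqP => m0; apply: nqm; rewrite m0 dvdz0.
rewrite pfactorK // (_ : logn q `|m| = 0%N) ?addn0 //.
by apply/eqP; rewrite lognE q_pr /=; case: ifP => // /andP[_ h]; case: nqm; rewrite dvdzE.
Qed.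

Lemma qval_frob a : alint a -> a != 0 -> qval q Q (phi a) = qval q Q a.
Proof.
move=> ia a0; apply: qval_eq; [exact/alint_gal|by rewrite fmorph_eq0|].
have [t [u [it iu nt nu e]]] := qvalP ia a0.
have nphi b : alint b -> ~ Q b -> ~ Q (phi b).
  move=> ib nb Qpb; apply: nb; apply: (primeX sO prQ (n := q)) => //.
  by apply: (ideal_subr sO idQ) Qpb; case: gQ => _ _ + _; exact.
exists (phi t), (phi u); split; try exact/alint_gal; try exact: nphi.
by rewrite -rmorphM e rmorphM rmorphXn /= rmorph_nat.
Qed.

Lemma qval_prod (I : finType) (r : pred I) (f : I -> F) :
  (forall i, r i -> alint (f i) /\ f i != 0) ->
  qval q Q (\prod_(i | r i) f i) = (\sum_(i | r i) qval q Q (f i))%N.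
Proof.
move=> h; suff : [/\ alint (\prod_(i | r i) f i), \prod_(i | r i) f i != 0 &
  qval q Q (\prod_(i | r i) f i) = (\sum_(i | r i) qval q Q (f i))%N] by case.
apply: (big_rec2 (fun a k => [/\ alint a, a != 0 & qval q Q a = k])).
  split; [exact: alint1|exact: oner_neq0|].
  have := @qval_int 0 1; rewrite expr0 mul1r; apply.
  by rewrite dvdzE /= dvdn1 => /eqP q1; have := q_pr; rewrite q1.
move=> i k a /h[ifi fi0] [ia a0 <-].
by split; [exact: alintM|exact: nz|exact: qvalM].
Qed.

End Good.

Variables (D : nat) (Q_ : nat -> set F) (phi_ : nat -> G).
Hypothesis goodP : forall q, prime q -> (D < q)%N -> good_prime q (Q_ q) (phi_ q).

(** The valuations of all conjugates at the single prime [Q_ q] stand for the valuations at every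
    prime over [q]. If [b / a] were not integral, its ideal of denominators would lie in a prime
    [P]; this prime contains the norm of [a], so it lies over some [q > D] and is conjugate to
    [Q_ q], where the local expressions of [a] and [b] provide a denominator outside [P]. *)
Lemma qval_dvd a b : alint a -> alint b -> a != 0 -> b != 0 ->
  (forall (z : int) q, \prod_(x : G) x a = z%:~R -> prime q -> (q %| z)%Z -> (D < q)%N) ->
  (forall q x, prime q -> (D < q)%N -> (qval q (Q_ q) (x a) <= qval q (Q_ q) (x b))%N) ->
  alint (b / a).
Proof.
move=> ia ib a0 b0 big le; have [//|nint] := pselect (alint (b / a)).
have [||P [prP sub]] := prime_ideal_exists sO (I := [set t | alint t /\ alint (t * b / a)]).
- split.
  + by move=> t [].
  + by split; [exact: alint0|rewrite !mul0r; exact: alint0].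
  + by move=> s t [? ?] [? ?]; split; [exact: alintD|rewrite !mulrDl; exact: alintD].
  + by move=> s t ? [? ?]; split; [exact: alintM|rewrite -!mulrA; apply: alintM; rewrite // mulrA].
- by move=> [_]; rewrite mul1r.
have [z ez] := gal_norm_int FC ia.
have z0 : z != 0 by have := gal_norm_neq0 a0; rewrite ez -(inj_eq (intrF_inj FC)).
have Pz : P z%:~R.
  apply: sub; split; first exact: alint_int.
  rewrite -ez (bigD1 1%g) //= gal_id mulrAC [a * _]mulrC mulfK // mulrC; apply: alintM => //.
  by apply: alint_prod => x _; exact/alint_gal.
have [q [q_pr qz Pq]] : exists q, [/\ prime q, (q %| z)%Z & P q%:R].
  have : P (`|z|%N)%:R.
    by move: Pz; rewrite {1}[z]intEsg rmorphM /= => Pz; rewrite -[_%:R]/((`|z|%N)%:~R) -[X in P X]mul1r;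
       case: (sgzP z) Pz z0 => [->|_|_] //; rewrite ?mul1r // mulN1r => /(idealN sO (prime_isideal prP)); rewrite opprK.
  rewrite {1}(prod_prime_decomp (n := `|z|)) ?absz_gt0 // prime_decompE big_map natr_prod.
  case/(prime_prod sO prP) => [p _|p]; first exact: alint_nat.
  rewrite mem_primes => /and3P[p_pr _ pz]; rewrite natrX => /(primeX sO prP) Pp.
  by exists p; split=> //; apply: Pp; exact: alint_nat.
have ltq := big z q ez q_pr qz.
have gQ := goodP q_pr ltq; have [prQ Qq _ _] := gQ.
have [x xP] := primes_conjugate q_pr sO (fun _ => id) prP Pq prQ Qq.
have ixa : alint (x a) by exact/alint_gal.
have ixb : alint (x b) by exact/alint_gal.
have xa0 : x a != 0 by rewrite fmorph_eq0.
have xb0 : x b != 0 by rewrite fmorph_eq0.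
have [t [u [it iu nt nu e]]] := qvalP gQ ixa xa0.
have [t' [u' [it' iu' nt' nu' e']]] := qvalP gQ ixb xb0.
have {}le := le q x q_pr ltq.
set k := qval _ _ _ in e le; set k' := qval _ _ _ in e' le.
have nut : ~ Q_ q (u * t') by exact: (primeNM prQ).
case: nut; have iut : alint ((x^-1)%g (u * t')) by apply/alint_gal; exact: alintM.
rewrite -(galVf x (u * t')); apply/xP => //; apply: sub; split=> //.
have -> : (x^-1)%g (u * t') * b / a = (x^-1)%g (q%:R ^+ (k' - k) * u' * t).
  apply: (mulIf a0); rewrite divfK //; apply: (fmorph_inj x).
  rewrite rmorphM [in RHS]rmorphM /= !galVf.
  have eqk : (q%:R : F) ^+ k' = q%:R ^+ (k' - k) * q%:R ^+ k by rewrite -exprD subnK.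
  move: e e'; rewrite eqk; move: (q%:R ^+ (k' - k)) (q%:R ^+ k) (x a) (x b) => A B ya yb e e'.
  have rid (c d f g : F) : c * (d * f * g) = d * g * (f * c) by clear; ring.
  by rewrite -[LHS]mulrA e' -[RHS]mulrA e rid.
apply/alint_gal; apply: alintM => //; apply: alintM => //.
by apply: alintX; exact: alint_nat.
Qed.

End GoodPrimes.

(** * Density of Frobenius elements *)

Section CosetNorm.
Variables (F : splittingFieldType rat) (FC : {rmorphism F -> algC}).
Local Notation G := (gal_of {:F}).
Variable J : {group G}.
Implicit Types (a b : F) (x y : G).

(** Restriction to the fixed field of [J] identifies these representatives of the right cosets with
    the embeddings of that field into [F]. *)
Definition transv : {set G} := finset (fun x => repr (J :* x)%g == x).
Local Notation T := transv.

Lemma transv_repr x : repr (J :* x)%g \in T.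
Proof. by rewrite inE rcoset_repr. Qed.

Lemma transv_inj x y : x \in T -> y \in T -> (J :* x = J :* y)%g -> x = y.
Proof. by rewrite !inE => /eqP ex /eqP ey e; rewrite -ex e ey. Qed.

Lemma repr_cosetP x : exists2 j, j \in J & repr (J :* x)%g = (j * x)%g.
Proof. exact/rcosetP/mem_repr_rcoset. Qed.

Lemma card_transv : (#|J| * #|T|)%N = #|{: G}|.
Proof.
have -> : #|T| = #|[set: G]%SET : J|%g.
  have <- : (fun A : {set G} => repr A) @: rcosets J [set: G]%SET = T.
    apply/setP => x; apply/imsetP/idP => [[_ /imsetP[y _ ->] ->]|].
      by rewrite rcosetE transv_repr.
    by rewrite inE => /eqP e; exists (J :* x)%g => //; rewrite -rcosetE; apply: imset_f; rewrite inE.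
  apply: card_in_imset => _ _ /imsetP[x _ ->] /imsetP[y _ ->]; rewrite !rcosetE => e.
  by rewrite -(rcoset_repr J x) e rcoset_repr.
by rewrite -cardsT; apply: (Lagrange (G := [set: G]%G)); exact: finset.subsetT.
Qed.

Definition Jfix a := forall j, j \in J -> j a = a.

Lemma Jfix_repr x a : Jfix a -> (repr (J :* x)%g) a = x a.
Proof. by move=> fa; have [j jJ ->] := repr_cosetP x; rewrite galMf fa. Qed.

Lemma transv_reindex (R : Type) (idx : R) (op : Monoid.com_law idx) y (f : G -> R) :
  \big[op/idx]_(x in T) f x = \big[op/idx]_(x in T) f (repr (J :* (x * y))%g).
Proof.
pose h (z x : G) := repr (J :* (x * z))%g.
have hK z x : x \in T -> h z^-1%g (h z x) = x.
  move=> xT; apply: transv_inj => //; first exact: transv_repr.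
  by rewrite /h rcoset_repr rcosetM rcoset_repr -rcosetM mulgK.
rewrite (reindex_onto (h y) (h y^-1%g)); last first.
  by move=> x xT; have := hK y^-1%g x xT; rewrite invgK.
apply: eq_bigl => x; rewrite transv_repr /=.
apply/eqP/idP => [<-|]; [exact: transv_repr|exact: hK].
Qed.

(** For [a] in the fixed field of [J], this is its norm to the rationals. *)
Definition cnorm a := \prod_(x in T) x a.

Lemma cnorm_int a : alint a -> Jfix a -> exists z : int, cnorm a = z%:~R.
Proof.
move=> ia fa; apply: (gal_fix_int FC) => [|y].
  by apply: alint_prod => x _; exact/alint_gal.
rewrite /cnorm rmorph_prod /= [RHS](transv_reindex _ y).
by apply: eq_bigr => x _; rewrite Jfix_repr // galMf.
Qed.

Lemma cnorm_neq0 a : a != 0 -> cnorm a != 0.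
Proof. by move=> a0; apply/prodf_neq0 => x _; rewrite fmorph_eq0. Qed.

Lemma Jfix_lin n (c : 'I_n -> int) (e : 'I_n -> F) :
  (forall i, Jfix (e i)) -> Jfix (\sum_i (c i)%:~R * e i).
Proof.
move=> fe j jJ; rewrite rmorph_sum /=; apply: eq_bigr => i _.
by rewrite rmorphM /= rmorph_int fe.
Qed.

(** A rational basis of the fixed field with its denominators cleared. It spans a sublattice of
    finite index in the ring of integers, which is precise enough for counting up to constants. *)
Lemma integral_basis : exists e : 'I_#|T| -> F,
  [/\ forall i, alint (e i), forall i, Jfix (e i)
    & forall c : 'I_#|T| -> int, \sum_i (c i)%:~R * e i = 0 -> forall i, c i = 0].
Proof.
pose L := fixedField J.
have dimL : \dim L = #|T|.
  have h1 : #|J| = (\dim {:F} %/ \dim L)%N := dim_fixedField J.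
  have := galois_dim (galois_full (F := F) 1%AS).
  have -> : 'Gal({:F} / 1)%g = [set: G]%SET.
    by apply/setP => x; rewrite inE gal_kHom ?sub1v // k1HomE ahomWin.
  rewrite dimv1 divn1 cardsT => h2.
  have dvd : (\dim L %| \dim {:F})%N by apply: field_dimS; exact: subvf.
  have J0 : (0 < #|J|)%N by exact: cardG_gt0.
  apply/eqP; rewrite -(eqn_pmul2l J0) card_transv -h2 h1.
  by rewrite divnK.
rewrite -dimL.
pose b := vbasis L.
have /choice[m mP] : forall i : 'I_(\dim L), exists m : int, m != 0 /\ alint (m%:~R * b`_i).
  by move=> i; have [m m0 im] := alint_scale FC b`_i; exists m.
exists (fun i => (m i)%:~R * b`_i); split=> [i|i j jJ|c c0 i].
- by case: (mP i).
- rewrite rmorphM /= rmorph_int; congr (_ * _).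
  have : b`_i \in L by apply: vbasis_mem; rewrite mem_nth ?size_tuple.
  by move/fixedFieldP => ->; rewrite ?memvf.
have /freeP fr : free b by have /andP[] := vbasisP L.
have /eqP : (c i * m i)%:~R = 0 :> rat.
  apply: (fr (fun i => (c i * m i)%:~R)); rewrite -[RHS]c0; apply: eq_bigr => k _.
  by rewrite mulrA -rmorphM /= scaler_int mulrzl.
by rewrite intr_eq0 mulf_eq0 => /orP[/eqP//|/eqP m0]; case: (mP i); rewrite m0 eqxx.
Qed.

End CosetNorm.

Lemma prime_poly_factor (q : nat) : prime q ->
  forall i, (q %| (\prod_(r < q) ('X - (r%:Z)%:P) - ('X^q - 'X : {poly int}))`_i)%Z.
Proof.
move=> q_pr i; have ch := pchar_Fp q_pr.
rewrite (dvdz_pcharf ch) -[_%:~R](coef_map (intr : {rmorphism int -> 'F_q})) /=.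
rewrite !rmorphB /= rmorphXn /= map_polyX rmorph_prod /=.
suff -> : \prod_(r < q) map_poly intr ('X - (r%:Z)%:P) = 'X^q - 'X :> {poly 'F_q}.
  by rewrite subrr coef0.
have := finField_genPoly 'F_q; rewrite card_Fp // => ->.
pose f (k : nat) : {poly 'F_q} := 'X - (k%:R)%:P.
transitivity (\prod_(r < q) f r).
  by apply: eq_bigr => r _; rewrite rmorphB /= map_polyX map_polyC.
transitivity (\prod_(r < (Zp_trunc (pdiv q)).+2) f r).
  by rewrite -!(big_mkord xpredT f) Fp_cast.
by apply: eq_bigr => r _; rewrite /f natr_Zp.
Qed.

Section Residues.
Variables (F : splittingFieldType rat).
Local Notation G := (gal_of {:F}).
Variables (q : nat) (Q : set F).
Hypotheses (q_pr : prime q) (prQ : is_prime_ideal (@alint F) Q) (Qq : Q q%:R).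
Let sO := alint_subring F.
Let idQ := prime_isideal prQ.

(** Modulo [q] the polynomial X^q - X is the product of the X - r, so a residue fixed by the q-th
    power map belongs to the prime field. This is how primes of degree one are recognised. *)
Lemma residue_exists (y : F) : alint y -> Q (y ^+ q - y) ->
  exists r : 'I_q, Q (y - (r : nat)%:R).
Proof.
move=> iy Qy; set f := (\prod_(r < q) ('X - (r%:Z)%:P) - ('X^q - 'X) : {poly int}).
have Qf : Q (map_poly intr f).[y].
  rewrite horner_coef; apply: (ideal_sum idQ) => i _; rewrite coef_map mulrC.
  apply: (idealM_l idQ); first exact: alintX.
  by apply/(prime_over_int sO prQ q_pr Qq); exact: prime_poly_factor.
have : Q (\prod_(r < q) (y - (r : nat)%:R)).
  move: Qf; rewrite /f !rmorphB /= rmorphXn /= map_polyX rmorph_prod /= !hornerE /=.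
  rewrite horner_prod => h.
  have := idealD idQ h Qy; rewrite subrK; congr Q; apply: eq_bigr => r _.
  by rewrite rmorphB /= map_polyX map_polyC /= !hornerE.
case/(prime_prod sO prQ) => [r _|r _ Qr]; last by exists r.
by apply: alintB => //; exact: alint_nat.
Qed.
End Residues.

Lemma shift_abs_inj (c c' : int) (B : nat) : (`|c| <= B)%N -> (`|c'| <= B)%N ->
  absz (c + B%:Z) = absz (c' + B%:Z) -> c = c'.
Proof. by lia. Qed.

Lemma shift_abs_lt (c : int) (B : nat) : (`|c| <= B)%N -> (absz (c + B%:Z)%R < (2 * B).+1)%N.
Proof. by lia. Qed.

(** * Counting products of primes of degree one *)

Section UpperCount.
Variables (F : splittingFieldType rat) (FC : {rmorphism F -> algC}).
Local Notation G := (gal_of {:F}).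
Variables (D : nat) (Q_ : nat -> set F) (phi_ : nat -> G).
Hypothesis goodP : forall q, prime q -> (D < q)%N -> good_prime q (Q_ q) (phi_ q).
Variable J : {group G}.
Local Notation T := (transv J).
Let sO := alint_subring F.

(** The condition says that right multiplication by the Frobenius fixes the coset [J x]. The
    elements [a] of the fixed field of [J] with [x a] in [Q_ q] then form a prime of degree one over
    [q]. *)
Definition fixq q : {set G} :=
  finset (fun x => (x \in T) && ((x * phi_ q * x^-1)%g \in J)).

Lemma fixq_frob q x a : x \in fixq q -> Jfix J a -> phi_ q (x a) = x a.
Proof.
rewrite inE => /andP[_ xJ] fa; rewrite -galMf -{1}(mulgKV x (x * phi_ q)%g) galMf.
by rewrite fa.
Qed.

Lemma fixq_residue q x a : prime q -> (D < q)%N -> x \in fixq q -> alint a -> Jfix J a ->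
  exists r : 'I_q, Q_ q (x a - (r : nat)%:R).
Proof.
move=> q_pr ltq xq ia fa; have [prQ Qq frobQ _] := goodP q_pr ltq.
have ixa : alint (x a) by exact/alint_gal.
apply: (residue_exists q_pr prQ Qq ixa).
by apply: (ideal_symB sO (prime_isideal prQ)); have := frobQ _ ixa; rewrite (fixq_frob xq).
Qed.

Lemma transv_gt0 : (0 < #|T|)%N.
Proof. by apply/card_gt0P; exists (repr (J :* 1)%g); exact: transv_repr. Qed.

Variable e : 'I_#|T| -> F.
Hypotheses (ie : forall i, alint (e i)) (fe : forall i, Jfix J (e i)).
Hypothesis free_e : forall c : 'I_#|T| -> int,
  \sum_i (c i)%:~R * e i = 0 -> forall i, c i = 0.
Local Notation n := #|T|.

Definition lin (c : 'I_n -> int) : F := \sum_i (c i)%:~R * e i.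

Lemma lin_alint c : alint (lin c).
Proof. by apply: alint_sum => i _; apply: alintM => //; exact: alint_int. Qed.

Lemma lin_fix c : Jfix J (lin c). Proof. exact: Jfix_lin. Qed.

Lemma lin_bound : exists M : nat, forall (c : 'I_n -> int) (B : nat) (x : G),
  (forall i, (`|c i| <= B)%N) -> `|FC (x (lin c))| <= (B * M)%:R.
Proof.
pose M0 x := \sum_(i < n) `|FC (x (e i))|.
exists (\sum_(x : G) Num.bound (M0 x))%N => c B x cB.
apply: (@le_trans _ _ (B%:R * M0 x)); last first.
  rewrite natrM ler_wpM2l ?ler0n //; apply: ltW; apply: lt_le_trans (archi_boundP _) _.
    by apply: sumr_ge0 => i _; exact: normr_ge0.
  by rewrite ler_nat (bigD1 x) //= leq_addr.
rewrite /lin !rmorph_sum /=; apply: le_trans (ler_norm_sum _ _ _) _.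
rewrite mulr_sumr; apply: ler_sum => i _.
rewrite !rmorphM /= !rmorph_int normrM ler_wpM2r ?normr_ge0 //.
by rewrite -intr_norm -abszE -[B%:R]/(B%:~R) ler_int lez_nat.
Qed.

Lemma cnorm_bound : exists E0 : nat, forall (c : 'I_n -> int) (B : nat) (z : int),
  (forall i, (`|c i| <= B)%N) -> cnorm J (lin c) = z%:~R -> (`|z| <= E0 * B ^ n)%N.
Proof.
have [M MP] := lin_bound; exists (M ^ n)%N => c B z cB ez.
have : `|FC (cnorm J (lin c))| <= (B * M)%:R ^+ n.
  rewrite /cnorm rmorph_prod /= normr_prod -prodr_const.
  by apply: ler_prod => x _; rewrite normr_ge0 MP.
rewrite ez rmorph_int -intr_norm -abszE -natrX -[_%:R]/((_ : nat)%:~R) ler_int lez_nat.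
by rewrite expnMn mulnC.
Qed.

Section Tau.
Variable X : nat.
Implicit Types tau : {ffun 'I_X.+1 -> unit + G}.

(** A valid [tau] encodes an ideal of the fixed field of [J]: a product of primes of degree one, at
    most one over each [q], where [inl tt] stands for no prime. Its norm is [tausize tau]. *)
Definition valid tau := [forall q : 'I_X.+1,
  if tau q is inr x then [&& prime q, (D < q)%N & x \in fixq q] else true].

Definition tausize tau : nat := (\prod_(q < X.+1) (if tau q is inr _ then (q : nat) else 1))%N.

Lemma validP tau q x : valid tau -> tau q = inr x ->
  [/\ prime q, (D < q)%N & x \in fixq q].
Proof. by move=> /forallP/(_ q) + e0; rewrite e0 => /and3P. Qed.

Lemma tausize_gt0 tau : valid tau -> (0 < tausize tau)%N.
Proof.
move=> v; apply: prodn_gt0 => q; case eq: (tau q) => [//|x].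
by have [/prime_gt0] := validP v eq.
Qed.

Lemma tausize_dvd tau (q : 'I_X.+1) : valid tau -> prime q ->
  (q %| tausize tau)%N = if tau q is inr _ then true else false.
Proof.
move=> v q_pr; rewrite /tausize (bigD1 q) //= Euclid_dvdM //.
case eq: (tau q) => [u0|x]; last by rewrite dvdnn.
rewrite dvdn1 gtn_eqF ?prime_gt1 //=; apply: negbTE; apply: contraL q_pr.
elim/big_rec: _ => [|r m rq IH]; first by rewrite dvdn1 => /eqP->.
case er: (tau r) => [u1|x]; first by rewrite mul1n.
have [r_pr _ _] := validP v er.
have [q_pr|//] := boolP (prime q); rewrite Euclid_dvdM // => /orP[|/IH]; last by rewrite q_pr.
by rewrite dvdn_prime2 // => /eqP /val_inj e'; rewrite e' eqxx in rq.
Qed.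

Lemma tausize_logn tau (q : 'I_X.+1) x : valid tau -> tau q = inr x ->
  logn q (tausize tau) = 1%N.
Proof.
move=> v eq; have [q_pr _ _] := validP v eq.
have t0 := tausize_gt0 v; move: t0; rewrite /tausize (bigD1 q) //= eq muln_gt0 => /andP[q0 m0].
rewrite lognM // logn_prime // eqxx; congr (1 + _)%N; apply/eqP.
rewrite -leqn0 leqNgt logn_gt0 mem_primes q_pr m0 /=; apply/negP.
apply/negP; elim/big_rec: _ => [|r m rq IH]; first by rewrite dvdn1 gtn_eqF ?prime_gt1.
case er: (tau r) => [u1|y]; first by rewrite mul1n.
have [r_pr _ _] := validP v er; rewrite Euclid_dvdM // negb_or IH andbT.
by rewrite dvdn_prime2 //; apply: contra rq => /eqP /val_inj ->.
Qed.

(** Thue's pigeonhole argument. There are [B.+1 ^ n] vectors with coordinates from 0 to [B], but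
    only [tausize tau] systems of residues at the primes of [tau]; the difference of two vectors
    with equal residues lies in all these primes. *)
Lemma tau_thue tau B : valid tau -> (tausize tau < B.+1 ^ n)%N ->
  exists c : 'I_n -> int, [/\ forall i, (`|c i| <= B)%N, exists i, c i != 0
    & forall q x, tau q = inr x -> Q_ q (x (lin c))].
Proof.
move=> v lt.
pose al (C : {ffun 'I_n -> 'I_B.+1}) := lin (fun i => (C i : nat)%:Z).
have /choice[r rP] : forall Cq : {ffun 'I_n -> 'I_B.+1} * 'I_X.+1, exists r : 'I_X.+1,
    if tau Cq.2 is inr x then (r < Cq.2)%N /\ Q_ Cq.2 (x (al Cq.1) - (r : nat)%:R)
    else r = ord0.
  move=> [C q] /=; case eq: (tau q) => [u0|x]; first by exists ord0.
  have [q_pr ltq xq] := validP v eq.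
  have [r Qr] := fixq_residue q_pr ltq xq (lin_alint _) (lin_fix (fun i => (C i : nat)%:Z)).
  by exists (widen_ord (ltnW (ltn_ord q)) r) => /=; split.
pose f (C : {ffun 'I_n -> 'I_B.+1}) : {ffun 'I_X.+1 -> 'I_X.+1} := [ffun q => r (C, q)].
pose fam (q : 'I_X.+1) : pred 'I_X.+1 := fun k => if tau q is inr _ then (k < q)%N else k == ord0.
have [/injectiveP inj|/injectivePn[C [C' ne eC]]] := boolP (injectiveb f).
  have sub : codom f \subset family fam.
    apply/fintype.subsetP => _ /codomP[C ->]; apply/familyP => q; rewrite ffunE unfold_in /fam.
    by have := rP (C, q); case: (tau q) => [u0 /= ->|x /= []//].
  have := subset_leq_card sub.
  rewrite (card_codom inj) card_ffun !card_ord card_family.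
  have -> : foldr muln 1%N [seq #|fam x| | x : 'I_X.+1] = tausize tau.
    rewrite /tausize /image_mem foldrE big_map big_enum /=; apply: eq_bigr => q _.
    rewrite /fam; case: (tau q) => u0.
      by rewrite -[RHS](card1 (ord0 : 'I_X.+1)); apply: eq_card => k; rewrite !inE.
    have winj : injective (widen_ord (ltnW (ltn_ord q))) by move=> ? ? /(congr1 val) /= /val_inj.
    rewrite -[RHS](card_ord q) -(fintype.card_image winj).
    apply: eq_card => k; rewrite [LHS]unfold_in; apply/idP/fintype.imageP => [kq|[k' _ ->]]; last by have := ltn_ord k'.
    by exists (Ordinal kq) => //; apply: val_inj.
  by rewrite leqNgt lt.
exists (fun i => (C i : nat)%:Z - (C' i : nat)%:Z); split.
- by move=> i; have := ltn_ord (C i); have := ltn_ord (C' i); lia.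
- have /existsP[i ni] : [exists i, C i != C' i].
    by rewrite -negb_forall; apply: contra ne => /forallP h; apply/eqP/ffunP => i; exact/eqP.
  by exists i; rewrite subr_eq0 eqz_nat.
move=> q x eq; have [q_pr ltq xq] := validP v eq; have [prQ _ _ _] := goodP q_pr ltq.
have -> : lin (fun i => (C i : nat)%:Z - (C' i : nat)%:Z) = al C - al C'.
  by rewrite /al /lin -sumrB; apply: eq_bigr => i _; rewrite rmorphB /= mulrBl.
have := rP (C, q); have := rP (C', q); rewrite /= eq => -[_ h'] [_ h].
have er : r (C, q) = r (C', q) by have /ffunP/(_ q) := eC; rewrite !ffunE.
rewrite rmorphB /=; apply: (ideal_transB (prime_isideal prQ) h).
by rewrite er; exact: (ideal_symB sO (prime_isideal prQ)).
Qed.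

End Tau.

Lemma nat_root m : exists B : nat, (B ^ n <= m < B.+1 ^ n)%N.
Proof.
have n0 := transv_gt0.
have ex : exists B, (B ^ n <= m)%N by exists 0%N; rewrite exp0n.
have bd B : (B ^ n <= m)%N -> (B <= m)%N.
  by apply: leq_trans; case: B => // B; rewrite -{1}(expn1 B.+1) leq_pexp2l.
case: (ex_maxnP ex bd) => B hB maxB; exists B; rewrite hB /= ltnNge; apply/negP => h.
by have := maxB _ h; rewrite ltnn.
Qed.

(** An ideal [tau] of norm below [Z] contains a small element, whose norm is a multiple
    [k * tausize tau] with [k <= E0]. The ideal is recovered from the coordinates of this element
    (at most [3 ^ n * Z] choices), from [k], and from the values of [tau] at the [q <= E0]; the map
    [f] below records exactly these data. *)
Lemma tau_count : exists C : nat, forall X Z : nat, (0 < Z)%N ->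
  (#|finset (fun tau : {ffun 'I_X.+1 -> unit + G} => valid tau && (tausize tau < Z)%N)| <= C * Z)%N.
Proof.
have n0 := transv_gt0; have [E0 E0P] := cnorm_bound.
exists (3 ^ n * (E0.+1 * (1 + #|{: G}|) ^ E0.+1))%N => X Z Z0.
have [B /andP[BZ ZB]] := nat_root Z.
pose tT := {ffun 'I_X.+1 -> unit + G}.
have /choice[cz czP] : forall tau : tT, exists cz : ('I_n -> int) * int,
    valid tau && (tausize tau < Z)%N -> [/\ forall i, (`|cz.1 i| <= B)%N,
      cnorm J (lin cz.1) = cz.2%:~R, cz.2 != 0, (`|cz.2| <= E0 * tausize tau)%N
      & forall q x, tau q = inr x -> Q_ q (x (lin cz.1))].
  move=> tau; have [/andP[v lt]|_] := boolP (valid tau && _); last by exists (fun=> 0, 0).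
  have [b /andP[bm mb]] := nat_root (tausize tau).
  have [c [cb [i ci] cQ]] := tau_thue v mb.
  have [z ez] := cnorm_int FC (lin_alint c) (lin_fix c).
  have a0 : lin c != 0 by apply/eqP => /free_e /(_ i) /eqP; rewrite (negbTE ci).
  exists (c, z) => _ /=; split=> //.
  - move=> k; apply: leq_trans (cb k) _; rewrite leqNgt; apply/negP => Bb.
    have : (B.+1 ^ n <= b ^ n)%N by rewrite leq_exp2r.
    by move=> h; have := leq_trans (leq_trans ZB h) bm; rewrite ltnNge (ltnW lt).
  - by have := cnorm_neq0 J a0; rewrite ez; apply: contra_neq => ->.
  - by apply: leq_trans (E0P c b z cb ez) _; rewrite leq_mul2l bm orbT.
pose f (tau : tT) : {ffun 'I_n -> 'I_(2 * B).+1} * ('I_E0.+1 * {ffun 'I_E0.+1 -> unit + G}) :=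
  ([ffun i => inord (absz ((cz tau).1 i + B%:Z))], (inord (`|(cz tau).2| %/ tausize tau),
   [ffun j : 'I_E0.+1 => if (j <= X)%N then tau (inord j) else inl tt])).
apply: leq_trans (leq_card_in f _ _) _; last first.
  rewrite !card_prod !card_ffun !card_ord card_sum card_unit.
  rewrite [X in (_ <= X)%N]mulnAC leq_mul2r; apply/orP; right.
  case: (B) BZ => [|b] BZ; first by rewrite exp1n muln_gt0 expn_gt0 Z0.
  apply: leq_trans (_ : (3 ^ n * b.+1 ^ n <= _)%N); last by rewrite leq_mul2l BZ orbT.
  by rewrite -expnMn leq_exp2r //; lia.
move=> t1 t2; rewrite !inE => h1 h2.
have [cB1 ez1 z1 zb1 Q1] := czP _ h1; have [cB2 ez2 z2 zb2 Q2] := czP _ h2.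
have /andP[v1 _] := h1; have /andP[v2 _] := h2.
rewrite /f => -[/ffunP ec ek /ffunP es].
have ecc : (cz t1).1 = (cz t2).1.
  apply/funext => i; have := ec i; rewrite !ffunE => /(congr1 val) /=.
  rewrite !inordK; [|exact: shift_abs_lt|exact: shift_abs_lt].
  exact: shift_abs_inj.
have ezz : (cz t1).2 = (cz t2).2 by apply: (intrF_inj FC); rewrite -ez1 -ez2 ecc.
set z := (cz t1).2 in ez1 z1 zb1 ek ezz; rewrite -ezz in z2 zb2 ek ez2.
have dv (tau : tT) : valid tau -> (forall q x, tau q = inr x -> Q_ q (x (lin (cz t1).1))) ->
    (tausize tau %| `|z|)%N.
  move=> v Qt; rewrite -(partnT (tausize_gt0 v)) /= ; apply/dvdn_partP; rewrite ?partnT ?tausize_gt0 //.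
  move=> p; rewrite mem_primes => /and3P[p_pr _ pt].
  have [q eq] : exists q : 'I_X.+1, (q : nat) = p /\ exists x, tau q = inr x.
    have : (p %| tausize tau)%N by [].
    rewrite /tausize; elim/big_rec: _ => [|q m _ IH]; first by rewrite dvdn1 => /eqP p1; rewrite p1 in p_pr.
    case eq: (tau q) => [u0|x]; first by rewrite mul1n.
    rewrite Euclid_dvdM // => /orP[|//]; have [q_pr _ _] := validP v eq.
    by rewrite dvdn_prime2 // => /eqP ->; exists q; split=> //; exists x.
  case: eq => eqp [x eq]; have [q_pr ltq xq] := validP v eq; have [prQ Qq _ _] := goodP q_pr ltq.
  rewrite p_part -eqp (tausize_logn v eq) expn1.
  suff /(prime_over_int sO prQ q_pr Qq) : Q_ q z%:~R by rewrite dvdzE.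
  have xT : x \in T by move: xq; rewrite inE => /andP[].
  rewrite -ez1 /cnorm (bigD1 x) //=; apply: (idealM_r (prime_isideal prQ)); last exact: Qt.
  by apply: alint_prod => y _; apply/alint_gal; exact: lin_alint.
have d1 := dv _ v1 Q1; have d2 : (tausize t2 %| `|z|)%N by apply: dv => // q x; rewrite ecc; exact: Q2.
have za : (0 < `|z|)%N by rewrite absz_gt0.
have ekk : (`|z| %/ tausize t1 = `|z| %/ tausize t2)%N.
  move: ek => /(congr1 val) /=; rewrite !inordK //.
    by rewrite ltnS leq_divLR // mulnC in zb2 *; rewrite mulnC.
  by rewrite ltnS leq_divLR // mulnC in zb1 *; rewrite mulnC.
set k := (`|z| %/ tausize t1)%N in ekk.
have k0 : (0 < k)%N by rewrite divn_gt0 ?tausize_gt0 // dvdn_leq.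
have kE : (k <= E0)%N by rewrite /k leq_divLR // mulnC.
have zk1 : `|z|%N = (k * tausize t1)%N by rewrite divnK.
have zk2 : `|z|%N = (k * tausize t2)%N by rewrite ekk divnK.
have em : tausize t1 = tausize t2.
  by apply/eqP; rewrite -(eqn_pmul2l k0) -zk1 -zk2.
apply/ffunP => q; case e1: (t1 q) => [[]|x1].
  case e2: (t2 q) => [[]//|x2]; have [q_pr _ _] := validP v2 e2.
  have := tausize_dvd v1 q_pr; have := tausize_dvd v2 q_pr.
  by rewrite em e1 e2 => ->.
have [q_pr ltq xq1] := validP v1 e1.
case e2: (t2 q) => [[]|x2].
  have := tausize_dvd v1 q_pr; have := tausize_dvd v2 q_pr.
  by rewrite em e1 e2 => ->.
have [_ _ xq2] := validP v2 e2.
have [qE|Eq] := leqP q E0.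
  have := es (inord q); rewrite !ffunE inordK // -ltnS ltn_ord.
  by rewrite inord_val e1 e2.
(* As [k <= E0 < q], the prime [q] divides the norm [z] exactly once, whereas two distinct cosets at
   [q] would each contribute a factor. *)
have [/eqP -> //|nx] := boolP (x1 == x2).
have gQ := goodP q_pr ltq.
have lk : logn q k = 0%N.
  by apply/eqP; rewrite -leqn0 leqNgt logn_gt0 mem_primes q_pr k0 /=; apply/negP => /dvdn_leq;
     rewrite k0 => /(_ isT); rewrite leqNgt (leq_ltn_trans kE Eq).
have lz : logn q `|z| = 1%N by rewrite zk1 lognM ?tausize_gt0 // lk (tausize_logn v1 e1).
have a0 : lin (cz t1).1 != 0.
  by apply/eqP => a0; move: ez1; rewrite a0 /cnorm (bigD1 (repr (J :* 1)%g)) ?transv_repr //= rmorph0 mul0r => /esym/eqP;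
     rewrite -(rmorph0 intr) (inj_eq (intrF_inj FC)) (negbTE z1).
have ix (x : G) : alint (x (lin (cz t1).1)) by apply/alint_gal; exact: lin_alint.
have nx0 (x : G) : x (lin (cz t1).1) != 0 by rewrite fmorph_eq0.
have := qval_logn FC q_pr gQ z1; rewrite lz -ez1 /cnorm (qval_prod FC q_pr gQ (fun x _ => conj (ix x) (nx0 x))) => h.
have x1T : x1 \in T by move: xq1; rewrite inE => /andP[].
have x2T : x2 \in T by move: xq2; rewrite inE => /andP[].
have g1 : (0 < qval q (Q_ q) (x1 (lin (cz t1).1)))%N by apply/(qval_gt0 gQ (ix _) (nx0 _)); exact: Q1.
have g2 : (0 < qval q (Q_ q) (x2 (lin (cz t1).1)))%N by apply/(qval_gt0 gQ (ix _) (nx0 _)); rewrite ecc; exact: Q2.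
move: h; rewrite (bigD1 x1) //= (bigD1 x2) /=; last by rewrite x2T eq_sym.
move: g1 g2; case: (qval _ _ (x1 _)) => // k1 _; case: (qval _ _ (x2 _)) => // k2 _.
by rewrite !addSn !addnS.
Qed.

End UpperCount.

(** * Damped sums and their upper bound *)

Section WeightedSums.
Variable R : realType.

(** The number of binary digits of [q] for [q > 0]. Damping by it depends on the dyadic size alone,
    so that summing over ideals reduces to a geometric series. *)
Definition lam (q : nat) : nat := (trunc_log 2 q).+1.

(* These damped weights play the role of q ^ -s for s close to 1: the sums below are ln K + O(1). *)
Definition wt (K q : nat) : R := (1 - K%:R^-1) ^+ lam q / q%:R.

Lemma wt_base (K : nat) : (1 < K)%N -> 0 < 1 - K%:R^-1 :> R /\ 1 - K%:R^-1 <= 1 :> R.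
Proof.
move=> K1; have K0 : 0 < K%:R :> R by rewrite ltr0n; lia.
split; last by rewrite gerBl invr_ge0 ltW.
by rewrite subr_gt0 invf_lt1 // ltr1n.
Qed.

Lemma wt_ge0 K q : (1 < K)%N -> 0 <= wt K q.
Proof.
move=> /wt_base[t0 _]; rewrite /wt mulr_ge0 ?invr_ge0 ?ler0n //.
by apply: exprn_ge0; exact: ltW.
Qed.

Lemma wt_le K q : (1 < K)%N -> wt K q <= q%:R^-1.
Proof.
move=> /wt_base[t0 t1]; rewrite /wt ler_piMl ?invr_ge0 ?ler0n //.
by rewrite exprn_ile1 // ltW.
Qed.

Lemma sum_inv_sq (X : nat) (P : pred nat) :
  \sum_(q < X.+1 | P q) (q%:R^-1 ^+ 2 : R) <= 2.
Proof.
apply: (@le_trans _ _ (\sum_(q < X.+1) (q%:R^-1 ^+ 2 : R))).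
  rewrite [leRHS](bigID (fun q : 'I_X.+1 => P q)) /= lerDl.
  by apply: sumr_ge0 => q _; rewrite exprn_ge0 // invr_ge0.
case: X => [|X]; first by rewrite big_ord_recr big_ord0 /= invr0 expr0n /= addr0; lra.
(* Telescoping with 1 / (m + 1)^2 <= 1 / m - 1 / (m + 1). *)
apply: (@le_trans _ _ (2 - X.+1%:R^-1)); last by rewrite gerBl invr_ge0.
elim: X => [|X IH].
  by rewrite !big_ord_recr big_ord0 /= invr0 expr0n /= !add0r invr1 expr1n; lra.
rewrite big_ord_recr /=; apply: le_trans (lerD IH (lexx _)) _.
have X0 : 0 < X.+1%:R :> R by rewrite ltr0n.
have e2 : X.+2%:R = X.+1%:R + 1 :> R by rewrite -natr1.
move: X0; rewrite e2; move: (X.+1%:R) => x x0.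
rewrite -subr_ge0.
have -> : 2 - (x + 1)^-1 - (2 - x^-1 + (x + 1)^-1 ^+ 2) = x^-1 * (x + 1)^-1 ^+ 2 by field; lra.
by rewrite mulr_ge0 ?exprn_ge0 ?invr_ge0 //; lra.
Qed.

Lemma expR_1D_ge (u : R) : 0 <= u -> expR (u - u ^+ 2) <= 1 + u.
Proof.
move=> u0; have u1 : 0 < 1 + u by lra.
have -> : 1 + u = (1 + - (u / (1 + u)))^-1 by field; lra.
have h1 : u / (1 + u) < 1 by rewrite ltr_pdivrMr //; lra.
have h2 : 0 < 1 + - (u / (1 + u)) by lra.
rewrite -[X in _ <= X^-1](lnK (x := 1 + - (u / (1 + u)))) ?posrE // -expRN ler_expR.
have := @le_ln1Dx R (- (u / (1 + u))) _; rewrite ltrN2 => /(_ h1) h3.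
suff h4 : u - u ^+ 2 <= u / (1 + u) by lra.
rewrite ler_pdivlMr //; nra.
Qed.

Lemma geom_sum_le (t : R) I : 0 <= t -> t < 1 -> \sum_(i < I) t ^+ i <= (1 - t)^-1.
Proof.
move=> t0 t1; have h : 0 < 1 - t by lra.
rewrite -(ler_pM2l h) divff ?gt_eqF //.
have : (t - 1) * \sum_(i < I) t ^+ i = t ^+ I - 1 by rewrite subrX1.
by have : 0 <= t ^+ I by [exact: exprn_ge0]; nra.
Qed.

Section Upper.
Variables (F : splittingFieldType rat) (FC : {rmorphism F -> algC}).
Local Notation G := (gal_of {:F}).
Variables (D : nat) (Q_ : nat -> set F) (phi_ : nat -> G).
Hypothesis goodP : forall q, prime q -> (D < q)%N -> good_prime q (Q_ q) (phi_ q).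
Variable J : {group G}.
Local Notation fixq := (fixq phi_ J).
Local Notation valid := (valid D phi_ J).

(** A stand-in for the logarithm of the zeta function of the fixed field of [J] near 1: up to a
    bounded error only the primes of degree one count, and [fixq q] lists those over [q]. *)
Definition wsum K X : R :=
  \sum_(q < X.+1 | prime q && (D < q)%N) #|fixq q|%:R * wt K q.

Lemma tau_weight K X (tau : {ffun 'I_X.+1 -> unit + G}) : (1 < K)%N -> valid tau ->
  \prod_(q < X.+1) (if tau q is inr _ then wt K q else 1) <=
  (1 - K%:R^-1) ^+ trunc_log 2 (tausize tau) / 2 ^+ trunc_log 2 (tausize tau).
Proof.
move=> K1 v; have [t0 t1] := wt_base K1; set t := 1 - _ in t0 t1 *.
pose L := (\sum_(q < X.+1) (if tau q is inr _ then lam q else 0))%N.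
have m0 := tausize_gt0 v.
have -> : \prod_(q < X.+1) (if tau q is inr _ then wt K q else 1) = t ^+ L / (tausize tau)%:R.
  rewrite /L /tausize expr_sum natr_prod -prodf_div; apply: eq_bigr => q _.
  by case: (tau q) => // u0; rewrite expr0 divr1.
have mL : (tausize tau <= 2 ^ L)%N.
  rewrite /L /tausize expn_sum; apply: leq_prod => q _; case eq: (tau q) => [u0|x] //.
  by apply: ltnW; exact: trunc_log_ltn.
have lL : (trunc_log 2 (tausize tau) <= L)%N.
  rewrite -(@leq_exp2l 2) //; apply: leq_trans mL; exact: trunc_logP.
apply: ler_pM.
- by apply: exprn_ge0; exact: ltW.
- by rewrite invr_ge0.
- by apply: ler_wiXn2l => //; exact: ltW.
- rewrite lef_pV2 ?posrE ?exprn_gt0 ?ltr0n // -natrX ler_nat; exact: trunc_logP.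
Qed.

(** Expanding the product gives a sum over the ideals [tau]. By [tau_count] at most [C * 2 ^ i.+1]
    of them have binary logarithm [i], each of weight at most [t ^ i / 2 ^ i] with [t = 1 - 1 / K],
    and the series of [2 * C * t ^ i] is at most [2 * C * K]. *)
Lemma upper_prod : exists C : nat, forall K X, (1 < K)%N ->
  \prod_(q < X.+1 | prime q && (D < q)%N) (1 + #|fixq q|%:R * wt K q) <= C%:R * K%:R.
Proof.
have [e [ie fe fre]] := integral_basis FC J.
have [C CP] := tau_count FC goodP ie fe fre; exists (2 * C)%N => K X K1.
have [t0 t1] := wt_base K1; set t := 1 - _ in t0 t1.
pose f (q : 'I_X.+1) (o : unit + G) : R :=
  if o is inr x then (if [&& prime q, (D < q)%N & x \in fixq q] then wt K q else 0) else 1.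
have -> : \prod_(q < X.+1 | prime q && (D < q)%N) (1 + #|fixq q|%:R * wt K q) =
    \prod_(q < X.+1) \sum_(o : unit + G) f q o.
  rewrite big_mkcond; apply: eq_bigr => q _; rewrite big_sumType /= big_const card_unit /= addr0.
  case: ifP => [c|c]; last first.
    by rewrite big1 ?addr0 // => x _; rewrite andbA c.
  congr (_ + _); rewrite -big_mkcond /= (eq_bigl (fun x => x \in fixq q)); last first.
    by move=> x; rewrite andbA c.
  by rewrite sumr_const mulr_natl.
rewrite bigA_distr_bigA /=.
apply: (@le_trans _ _ (\sum_(tau : {ffun 'I_X.+1 -> unit + G} | valid tau)
    t ^+ trunc_log 2 (tausize tau) / 2 ^+ trunc_log 2 (tausize tau))).
  rewrite (bigID (fun tau : {ffun 'I_X.+1 -> unit + G} => valid tau)) /= [X in _ + X]big1 ?addr0 => [|tau nv].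
    apply: ler_sum => tau v; apply: le_trans (tau_weight K1 v).
    apply: ler_prod => q _; rewrite /f; case eq: (tau q) => [u0|x]; first by rewrite ler01 lexx.
    have [q_pr ltq xq] := validP v eq; rewrite q_pr ltq xq /= lexx andbT; exact: wt_ge0.
  move: nv; rewrite negb_forall => /existsP[q nq]; rewrite (bigD1 q) //= /f.
  by case: (tau q) nq => // x /negbTE ->; rewrite mul0r.
pose I := (\max_(tau : {ffun 'I_X.+1 -> unit + G}) trunc_log 2 (tausize tau)).+1.
have lI (tau : {ffun 'I_X.+1 -> unit + G}) : (trunc_log 2 (tausize tau) < I)%N.
  by rewrite ltnS; exact: leq_bigmax.
pose ell (tau : {ffun 'I_X.+1 -> unit + G}) : 'I_I := Ordinal (lI tau).
rewrite (partition_big ell predT) //=.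
apply: (@le_trans _ _ (\sum_(i < I) (2 * C)%:R * t ^+ i)); last first.
  rewrite -mulr_sumr ler_wpM2l ?ler0n //; apply: le_trans (geom_sum_le _ (ltW t0) _) _.
    by rewrite /t gtrBl invr_gt0 ltr0n; lia.
  by rewrite /t opprB addrC subrK invrK.
apply: ler_sum => i _.
apply: (@le_trans _ _ (\sum_(tau : {ffun 'I_X.+1 -> unit + G} | valid tau && (tausize tau < 2 ^ i.+1)%N) (t ^+ i / 2 ^+ i))).
  rewrite [leRHS](bigID (fun tau => ell tau == i)) /=.
  rewrite -[leLHS]addr0 lerD //; last first.
    by apply: sumr_ge0 => tau _; rewrite mulr_ge0 ?invr_ge0 ?exprn_ge0 // ltW.
  rewrite le_eqVlt; apply/orP; left; apply/eqP; apply: eq_big => [tau|tau /andP[_ /eqP <-] //].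
  case v: (valid tau) => //=; case: eqP => [<-|]; rewrite ?andbF ?andbT //=.
  by rewrite trunc_log_ltn.
rewrite sumr_const -[leLHS]mulr_natl.
have /(_ X) := CP ^~ (2 ^ i.+1)%N; rewrite expn_gt0 /= => /(_ isT) cle.
apply: (@le_trans _ _ ((C * 2 ^ i.+1)%:R * (t ^+ i / 2 ^+ i))).
  rewrite ler_wpM2r //; first by rewrite mulr_ge0 ?invr_ge0 ?exprn_ge0 // ltW.
  rewrite ler_nat; apply: leq_trans cle; rewrite leq_eqVlt; apply/orP; left; apply/eqP.
  by apply: eq_card => tau; rewrite !inE.
rewrite expnS !natrM natrX le_eqVlt; apply/orP; left; apply/eqP.
by have : (2 : R) ^+ i != 0 by [rewrite expf_neq0 // pnatr_eq0]; move=> ?; field.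
Qed.

(** Taking logarithms of [upper_prod] costs only the squares of the terms, whose sum is bounded
    independently of [K] and [X]. *)
Lemma upper_bound : exists C : R, forall K X, (1 < K)%N -> wsum K X <= ln K%:R + C.
Proof.
have [C CP] := upper_prod.
pose g : R := #|{: G}|%:R.
exists (ln C.+1%:R + 2 * g ^+ 2) => K X K1.
pose u q : R := #|fixq q|%:R * wt K q.
have u0 q : 0 <= u q by rewrite mulr_ge0 // wt_ge0.
have K0 : 0 < K%:R :> R by rewrite ltr0n; lia.
have C0 : 0 < C.+1%:R :> R by rewrite ltr0n.
have h1 : \sum_(q < X.+1 | prime q && (D < q)%N) (u q - u q ^+ 2) <= ln K%:R + ln C.+1%:R.
  rewrite -lnM ?posrE // -ler_expR lnK ?posrE ?mulr_gt0 // expR_sum.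
  apply: (@le_trans _ _ (\prod_(q < X.+1 | prime q && (D < q)%N) (1 + u q))).
    by apply: ler_prod => q _; rewrite expR_ge0 expR_1D_ge.
  apply: le_trans (CP K X K1) _; rewrite mulrC ler_wpM2l ?ler_nat // ltW //.
have h2 : \sum_(q < X.+1 | prime q && (D < q)%N) u q ^+ 2 <= g ^+ 2 * 2.
  apply: le_trans (_ : g ^+ 2 * \sum_(q < X.+1 | prime q && (D < q)%N) q%:R^-1 ^+ 2 <= _).
    rewrite mulr_sumr; apply: ler_sum => q _; rewrite -exprMn; apply: lerXn2r; rewrite ?nnegrE ?u0 //.
      by rewrite mulr_ge0 // /g.
    apply: ler_pM => //; first exact: wt_ge0; last exact: wt_le.
    by rewrite /g ler_nat max_card.
  by rewrite ler_wpM2l ?exprn_ge0 ?ler0n //; apply: (sum_inv_sq X (fun q => prime q && (D < q)%N)).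
have -> : wsum K X = \sum_(q < X.+1 | prime q && (D < q)%N) u q by [].
by move: h1; rewrite sumrB => h1; lra.
Qed.

End Upper.
End WeightedSums.

(** * Elements of a box and their factorisations *)

Section LowerCount.
Variables (F : splittingFieldType rat) (FC : {rmorphism F -> algC}).
Local Notation G := (gal_of {:F}).
Variables (D : nat) (Q_ : nat -> set F) (phi_ : nat -> G).
Hypothesis goodP : forall q, prime q -> (D < q)%N -> good_prime q (Q_ q) (phi_ q).
Variable J : {group G}.
Local Notation T := (transv J).
Local Notation n := #|T|.
Let sO := alint_subring F.
Variable e : 'I_n -> F.
Hypotheses (ie : forall i, alint (e i)) (fe : forall i, Jfix J (e i)).
Hypothesis free_e : forall c : 'I_n -> int,
  \sum_i (c i)%:~R * e i = 0 -> forall i, c i = 0.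
Variable M : nat.
Hypothesis MP : forall (c : 'I_n -> int) (B : nat) (x : G),
  (forall i, (`|c i| <= B)%N) -> `|FC (x (lin e c))| <= (B * M)%:R.

(** At least doubling with [j] ([centre_step]) outweighs the errors of one percent, so elements of
    boxes at different scales have different norms. *)
Definition centre j : nat := (1 + D`! * (100 * M + 1) * 4 ^ j)%N.

(* All conjugates of box j c lie within 1% of centre j, and box j c = 1 mod D!. *)
Definition box j (c : 'I_n -> int) : F := (centre j)%:R + (D`!)%:R * lin e c.

Section Bounded.
Variables (j : nat) (c : 'I_n -> int).
Hypothesis cj : forall i, (`|c i| <= 4 ^ j)%N.

Lemma box_alint : alint (box j c).
Proof.
apply: alintD; first exact: alint_nat.
by apply: alintM; [exact: alint_nat|exact: lin_alint].
Qed.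

Lemma box_fix : Jfix J (box j c).
Proof.
move=> g gJ; rewrite /box rmorphD rmorphM /= !rmorph_nat; congr (_ + _ * _).
exact: (lin_fix fe).
Qed.

Lemma box_near (x : G) : `|FC (x (box j c)) - (centre j)%:R| <= (D`! * (4 ^ j * M))%:R.
Proof.
have -> : FC (x (box j c)) - (centre j)%:R = (D`!)%:R * FC (x (lin e c)).
  by rewrite /box !(rmorphD, rmorphM) /= !rmorph_nat addrAC subrr add0r.
by rewrite normrM normr_nat natrM ler_wpM2l ?ler0n // MP.
Qed.

Lemma centre_gt : (100 * (D`! * (4 ^ j * M)) < centre j)%N.
Proof.
rewrite /centre add1n ltnS mulnDr mulnDl.
by apply: leq_trans (leq_addr _ _); rewrite !mulnA leq_eqVlt; apply/orP; left; apply/eqP; lia.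
Qed.

Lemma box_ge (x : G) : (99 * centre j)%:R <= 100 * `|FC (x (box j c))|.
Proof.
have h := box_near x; have := centre_gt; rewrite -(ltr_nat algC) => h2.
have h3 : `|(centre j)%:R : algC| <= `|FC (x (box j c))| + `|FC (x (box j c)) - (centre j)%:R|.
  rewrite -[X in `|X| <= _](subKr (FC (x (box j c)))).
  by apply: le_trans (ler_normB _ _) _.
rewrite normr_nat in h3.
have h4 : 100 * ((centre j)%:R : algC) <= 100 * (`|FC (x (box j c))| + (D`! * (4 ^ j * M))%:R).
  by rewrite ler_wpM2l //; apply: le_trans h3 _; rewrite lerD2l.
rewrite natrM in h2; rewrite mulrDr in h4.
have h5 := lt_le_trans (le_lt_trans h4 (_ : _ < 100 * `|FC (x (box j c))| + (centre j)%:R)) (lexx _).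
have {}h5 : 100 * ((centre j)%:R : algC) <= 100 * `|FC (x (box j c))| + (centre j)%:R.
  by apply: ltW; apply: le_lt_trans h4 _; rewrite ltrD2l.
rewrite natrM -lerBlDr in h5 *.
by rewrite (_ : 99%:R * (centre j)%:R = 100 * (centre j)%:R - (centre j)%:R :> algC) //; rewrite -[X in _ - X]mul1r -mulrBl; congr (_ * _); rewrite -[X in _ - X]/(1%:R) -natrB.
Qed.

Lemma box_le (x : G) : 100 * `|FC (x (box j c))| <= (101 * centre j)%:R.
Proof.
have h := box_near x; have := centre_gt; rewrite -(ltr_nat algC) natrM => h2.
have h3 : `|FC (x (box j c))| <= (centre j)%:R + (D`! * (4 ^ j * M))%:R.
  rewrite -[X in `|X| <= _](subrK (centre j)%:R) addrC.
  by apply: le_trans (ler_normD _ _) _; rewrite normr_nat lerD2l.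
have h4 : 100 * `|FC (x (box j c))| <= 100 * ((centre j)%:R + (D`! * (4 ^ j * M))%:R).
  by rewrite ler_wpM2l.
apply: le_trans h4 _; rewrite mulrDr (_ : (101 * centre j)%:R = 100 * (centre j)%:R + (centre j)%:R).
  by rewrite lerD2l ltW.
by rewrite natrM -[X in _ + X]mul1r -mulrDl; congr (_ * _); rewrite -[X in _ + X]/(1%:R) -natrD.
Qed.

Lemma box_neq0 : box j c != 0.
Proof.
apply/eqP => b0; have := box_ge 1%g; rewrite b0 rmorph0 rmorph0 normr0 mulr0.
by rewrite lern0 muln_eq0 /= /centre add1n.
Qed.

Lemma box_coprime (P : pred G) (z : int) (q : nat) :
  \prod_(x : G | P x) x (box j c) = z%:~R -> prime q -> (q %| z)%Z -> (D < q)%N.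
Proof.
move=> ez q_pr qz; rewrite ltnNge; apply/negP => qD.
have [Q [prQ Qq]] := prime_over_exists FC q_pr; have idQ := prime_isideal prQ.
have QD : Q (D`!)%:R by apply/(prime_over_nat sO prQ q_pr Qq); apply: dvdn_fact; rewrite prime_gt0.
have Qx (x : G) : Q (x (box j c) - 1).
  rewrite /box rmorphD rmorphM /= !rmorph_nat /centre natrD addrAC [1%:R + _]addrC addrK.
  rewrite -mulnA natrM; apply: (idealD idQ); apply: (idealM_r idQ) => //; first exact: alint_nat.
  by apply/alint_gal; exact: lin_alint.
have : Q (\prod_(x : G | P x) x (box j c) - 1).
  suff : alint (\prod_(x : G | P x) x (box j c)) /\ Q (\prod_(x : G | P x) x (box j c) - 1) by case.
  apply: (big_rec (fun a => alint a /\ Q (a - 1))) => [|x a _ [ia Qa]]; first by rewrite subrr; split; [exact: alint1|exact: (ideal0 idQ)].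
  have ib : alint (x (box j c)) by apply/alint_gal; exact: box_alint.
  split; first exact: alintM.
  by have := idealBM idQ ib (alint1 F) (Qx x) Qa; rewrite mulr1.
rewrite ez => h; apply: (primeN1 prQ); apply: (ideal_subr sO idQ h).
exact/(prime_over_int sO prQ q_pr Qq).
Qed.

Lemma box_norm (z : int) : cnorm J (box j c) = z%:~R ->
  ((99 * centre j) ^ n <= 100 ^ n * `|z|)%N /\ (100 ^ n * `|z| <= (101 * centre j) ^ n)%N.
Proof.
move=> ez; have e2 : (100 ^ n * `|z|)%:R = \prod_(x in T) (100 * `|FC (x (box j c))|).
  rewrite big_split /= prodr_const natrM natrX; congr (_ * _).
  by rewrite -normr_prod -rmorph_prod -/(cnorm J _) ez rmorph_int natr_absz intr_norm.
rewrite -!(ler_nat algC) e2 !natrX -!prodr_const; split.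
  by apply: ler_prod => x _; rewrite ler0n /= box_ge.
by apply: ler_prod => x _; rewrite box_le mulr_ge0.
Qed.

End Bounded.

Lemma centre_step j j' : (j < j')%N -> (2 * centre j <= centre j')%N.
Proof.
move=> lt; have : (4 ^ j.+1 <= 4 ^ j')%N by rewrite leq_exp2l.
rewrite expnS /centre => h; have d0 := fact_gt0 D.
have : (0 < D`! * (100 * M + 1) * 4 ^ j)%N by rewrite !muln_gt0 d0 expn_gt0 addn1.
have : (D`! * (100 * M + 1) * (4 * 4 ^ j) <= D`! * (100 * M + 1) * 4 ^ j')%N by rewrite leq_mul2l h orbT.
rewrite mulnCA; move: (D`! * (100 * M + 1) * 4 ^ j)%N (D`! * (100 * M + 1) * 4 ^ j')%N => u v; lia.
Qed.

(** For [a] and [b] fixed by [J] this compares their factorisations in the fixed field of [J] away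
    from the primes up to [D]: the valuation of [x a] at [Q_ q] is that of [a] at the prime obtained
    by pulling [Q_ q] back along [x]. *)
Definition same_data a b := forall q x, prime q -> (D < q)%N -> x \in T ->
  qval q (Q_ q) (x a) = qval q (Q_ q) (x b).

Lemma cnorm_logn a z q : alint a -> a != 0 -> cnorm J a = z%:~R -> prime q -> (D < q)%N ->
  logn q `|z| = (\sum_(x in T) qval q (Q_ q) (x a))%N.
Proof.
move=> ia a0 ez q_pr ltq; have gQ := goodP q_pr ltq.
have z0 : z != 0 by have := cnorm_neq0 J a0; rewrite ez; apply: contra_neq => ->.
rewrite -(qval_logn FC q_pr gQ z0) -ez /cnorm (qval_prod FC q_pr gQ) // => x _.
by split; [exact/alint_gal|rewrite fmorph_eq0].
Qed.

Lemma box_inj_scale j c j' c' : (forall i, (`|c i| <= 4 ^ j)%N) ->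
  (forall i, (`|c' i| <= 4 ^ j')%N) -> same_data (box j c) (box j' c') -> (j <= j')%N.
Proof.
move=> cj cj' sd; rewrite leqNgt; apply/negP => lt.
have [z ez] := cnorm_int FC (box_alint j c) (box_fix j c).
have [z' ez'] := cnorm_int FC (box_alint j' c') (box_fix j' c').
have b0 := box_neq0 cj; have b0' := box_neq0 cj'.
have z0 : z != 0 by have := cnorm_neq0 J b0; rewrite ez; apply: contra_neq => ->.
have z0' : z' != 0 by have := cnorm_neq0 J b0'; rewrite ez'; apply: contra_neq => ->.
have ezz : `|z|%N = `|z'|%N.
  apply: eqn_from_log; rewrite ?absz_gt0 // => q.
  have [q_pr|npr] := boolP (prime q); last by rewrite (lognE q `|z|) (lognE q `|z'|) (negbTE npr).
  have [ltq|geq] := boolP (D < q)%N.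
    rewrite (cnorm_logn (box_alint j c) b0 ez q_pr ltq) (cnorm_logn (box_alint j' c') b0' ez' q_pr ltq).
    by apply: eq_bigr => x xT; exact: sd.
  have nd k d w : cnorm J (box k d) = w%:~R -> logn q `|w| = 0%N.
    move=> ew; rewrite lognE; case: ifP => // /and3P[_ _ qw].
    by case/negP: geq; apply: (box_coprime ew q_pr); rewrite dvdzE.
  by rewrite (nd _ _ _ ez) (nd _ _ _ ez').
have [h1 _] := box_norm cj ez; have [_ h2] := box_norm cj' ez'.
have := leq_trans h1 (leq_trans _ h2); rewrite ezz leqnn => /(_ isT).
rewrite leq_exp2r ?transv_gt0 // => h3.
have := centre_step lt; have : (0 < centre j')%N by rewrite /centre add1n.
by move: (centre j) (centre j') h3 => u v; lia.
Qed.

(** The quotient of two box elements with the same factorisation is integral by [qval_dvd], and all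
    its conjugates differ from 1 by less than 1. The norm of the quotient minus 1 is thus an integer
    of absolute value below 1, so the quotient is 1. This closeness to the centre is what excludes
    units other than 1. *)
Lemma box_inj j c c' : (forall i, (`|c i| <= 4 ^ j)%N) ->
  (forall i, (`|c' i| <= 4 ^ j)%N) -> same_data (box j c) (box j c') -> forall i, c i = c' i.
Proof.
move=> cj cj' sd; have ib := box_alint j c; have ib' := box_alint j c'.
have b0 := box_neq0 cj; have b0' := box_neq0 cj'.
have iu : alint (box j c / box j c').
  apply: (qval_dvd FC goodP) => //.
    by move=> z q ez; exact: (box_coprime ez).
  move=> q x q_pr ltq; rewrite -(Jfix_repr x (box_fix j c')) -(Jfix_repr x (box_fix j c)).
  by rewrite (sd q _ q_pr ltq) // transv_repr.
have iv : alint (box j c / box j c' - 1) by apply: alintB => //; exact: alint1.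
have [z ez] := gal_norm_int FC iv.
have near (x : G) : `|FC (x (box j c / box j c' - 1))| < 1.
  have f0 : FC (x (box j c')) != 0 by rewrite !fmorph_eq0.
  rewrite !rmorphB rmorphM rmorph1 fmorphV /= rmorphM rmorph1 fmorphV /= -[X in _ - X](divff f0) -mulrBl.
  rewrite normrM normfV ltr_pdivrMr ?normr_gt0 // mul1r -(ltr_pM2l (_ : 0 < 100)) //.
  apply: lt_le_trans (box_ge cj' x).
  have h := box_near cj x; have h' := box_near cj' x; have h2 := centre_gt j.
  apply: le_lt_trans (_ : 100 * (D`! * (4 ^ j * M) + D`! * (4 ^ j * M))%:R < _); last first.
    by rewrite -natrM ltr_nat; lia.
  rewrite ler_wpM2l // -(subrKA (centre j)%:R) natrD.
  by apply: le_trans (ler_normD _ _) _; rewrite lerD // distrC.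
have z0 : z = 0.
  have : `|FC (\prod_(x : G) x (box j c / box j c' - 1))| < 1.
    rewrite rmorph_prod normr_prod (bigD1 1%g) //=.
    apply: le_lt_trans (near 1%g); rewrite ler_piMr ?normr_ge0 //.
    by apply: prodr_ile1 => x _; rewrite normr_ge0 ltW.
  by rewrite ez rmorph_int -intr_norm -[1]/(1%:~R) ltr_int; lia.
have : \prod_(x : G) x (box j c / box j c' - 1) == 0 by rewrite ez z0.
move/prodf_eq0 => [x _]; rewrite fmorph_eq0 subr_eq0 => /eqP eb.
have ebb : box j c = box j c' by rewrite -(divfK b0' (box j c)) eb mul1r.
have ell : lin e c = lin e c'.
  move: ebb; rewrite /box => /addrI /mulfI; apply.
  by apply: (natF_neq0 FC); rewrite fact_gt0.
move=> i; apply/eqP; rewrite -subr_eq0; apply/eqP; apply: (free_e (c := fun i => c i - c' i)).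
rewrite (eq_bigr (fun i => (c i)%:~R * e i - (c' i)%:~R * e i)).
  by rewrite sumrB -/(lin e c) -/(lin e c') ell subrr.
by move=> k _; rewrite rmorphB /= mulrBl.
Qed.

(** The valuations are constant along the orbits of [phi_ q] on the cosets. A total valuation of one
    at [q] is therefore concentrated on a fixed coset. *)
Lemma same_data_frob a q x : alint a -> a != 0 -> Jfix J a -> prime q -> (D < q)%N ->
  qval q (Q_ q) ((repr (J :* (x * phi_ q))%g) a) = qval q (Q_ q) (x a).
Proof.
move=> ia a0 fa q_pr ltq; have gQ := goodP q_pr ltq.
rewrite (Jfix_repr _ fa) galMf (qval_frob FC q_pr gQ) //; first exact/alint_gal.
by rewrite fmorph_eq0.
Qed.

End LowerCount.

(** * Lower bound for the damped sums *)

Section LowerBound.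
Variable R : realType.
Local Notation wt := (wt R).

(** Bernoulli's inequality for the exponent [K] gives only 0, but for half of [K] rounded up it
    gives 1/3, as this half is at most 2 K / 3; squaring yields 1/9. *)
Lemma wt_pow_ge (K : nat) : (1 < K)%N -> 9^-1 <= (1 - K%:R^-1) ^+ K :> R.
Proof.
move=> K1; have [t0 t1] := wt_base R K1; set t := 1 - _ in t0 t1 *.
have K0 : 0 < K%:R :> R by rewrite ltr0n; lia.
pose m := uphalf K.
have bern k : 1 - k%:R / K%:R <= t ^+ k.
  elim: k => [|k IH]; first by rewrite mul0r subr0 expr0.
  have h : t * (1 - k%:R / K%:R) <= t ^+ k.+1 by rewrite exprS ler_wpM2l // ltW.
  apply: le_trans h; rewrite /t -natr1 mulrDl mul1r.
  have : 0 <= K%:R^-1 * (k%:R / K%:R) :> R by rewrite !mulr_ge0 ?invr_ge0 ?ler0n.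
  by rewrite mulrBl mulrBr; lra.
have h : 3^-1 <= t ^+ m.
  apply: le_trans (bern m); have mK : (3 * m <= 2 * K)%N by rewrite /m; lia.
  have : m%:R / K%:R <= 2 / 3 :> R.
    rewrite ler_pdivrMr // mulrAC ler_pdivlMr // -!natrM ler_nat mulnC; exact: mK.
  by lra.
have : 3^-1 * 3^-1 <= t ^+ m * t ^+ m by apply: ler_pM.
rewrite -exprD => h2; apply: (@le_trans _ _ (t ^+ (m + m))); first by lra.
by apply: ler_wiXn2l => //; [exact: ltW|rewrite /m; lia].
Qed.

Lemma frac_cancel (a u v : R) : u != 0 -> v != 0 -> a / u = v * (a / (u * v)).
Proof. by move=> u0 v0; field; rewrite u0 v0. Qed.

Section Fixed.
Variables (F : splittingFieldType rat) (FC : {rmorphism F -> algC}).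
Local Notation G := (gal_of {:F}).
Variables (D : nat) (Q_ : nat -> set F) (phi_ : nat -> G).
Hypothesis goodP : forall q, prime q -> (D < q)%N -> good_prime q (Q_ q) (phi_ q).
Variable J : {group G}.
Local Notation T := (transv J).
Local Notation n := #|T|.
Local Notation fixq := (fixq phi_ J).

(** For a prime [lam q] is at most twice the integer part of the binary logarithm, and these integer
    parts add up to at most that of [m]; this is the factor 2 in the exponent. *)
Lemma weight_ge K X (m : nat) : (1 < K)%N -> (0 < m)%N -> (m <= X)%N ->
  (forall q, prime q -> (q %| m)%N -> (D < q)%N) ->
  (1 - K%:R^-1) ^+ (2 * trunc_log 2 m) / m%:R <=
  \prod_(q < X.+1 | prime q && (D < q)%N) wt K q ^+ logn q m.
Proof.
move=> K1 m0 mX mD; have [t0 t1] := wt_base R K1; set t := 1 - _ in t0 t1 *.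
have em : (\prod_(q < X.+1 | prime q && (D < q)%N) q ^ logn q m)%N = m.
  have := widen_partn \pi(m) mX; rewrite partn_pi // big_mkord => {2}->.
  rewrite big_mkcond [RHS]big_mkcond /=; apply: eq_bigr => q _.
  rewrite mem_primes m0 /=; case q_pr: (prime q) => //=.
  case: (boolP (q %| m)%N) => [qm|nqm]; first by rewrite (mD q q_pr qm).
  by rewrite lognE q_pr m0 (negbTE nqm) expn0 if_same.
pose L := (\sum_(q < X.+1 | prime q && (D < q)%N) lam q * logn q m)%N.
have -> : \prod_(q < X.+1 | prime q && (D < q)%N) wt K q ^+ logn q m = t ^+ L / m%:R.
  rewrite -[in RHS]em natr_prod -prodfV /L expr_sum -big_split /=; apply: eq_bigr => q _.
  by rewrite /wt expr_div_n exprM natrX.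
have LL : (L <= 2 * trunc_log 2 m)%N.
  pose L' := (\sum_(q < X.+1 | prime q && (D < q)%N) trunc_log 2 q * logn q m)%N.
  have h : (L' <= trunc_log 2 m)%N.
    rewrite trunc_log_max // -[X in (_ <= X)%N]em /L' expn_sum; apply: leq_prod => q /andP[q_pr _].
    rewrite expnM; case: (logn q m) => [//|k]; rewrite leq_exp2r //.
    by apply: trunc_logP => //; exact: prime_gt0.
  apply: leq_trans (_ : 2 * L' <= _)%N; last by rewrite leq_mul2l.
  rewrite /L /L' big_distrr /=; apply: leq_sum => q /andP[q_pr _]; rewrite mulnA leq_mul2r.
  apply/orP; right; have : (0 < trunc_log 2 q)%N by rewrite trunc_log_gt0 /= prime_gt1.
  by rewrite /lam; lia.
by rewrite ler_wpM2r ?invr_ge0 ?ler0n //; apply: ler_wiXn2l => //; exact: ltW.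
Qed.

Section DataSum.
Variables (K X : nat).
Hypotheses (K1 : (1 < K)%N) (X0 : (0 < X)%N).
Local Notation dT := {ffun G -> 'I_X.+1}.
Implicit Types g : dT.

Definition gsum g : nat := (\sum_(x : G) g x)%N.

(** Here [g] lists the valuations at one [q]. Total one must come from a fixed coset, by
    [same_data_frob]; totals of two or more are left unrestricted, since their weights contribute a
    bounded amount in all. *)
Definition okd q g : bool :=
  if prime q && (D < q)%N
  then (gsum g == 1%N) ==> [forall x, ((g x : nat) != 0%N) ==> (x \in fixq q)]
  else gsum g == 0%N.

Definition delta (x : G) : dT := [ffun y => if y == x then inord 1 else ord0].

Lemma half_sum : \sum_(g : dT) 2^-1 ^+ gsum g <= 2 ^+ #|{: G}| :> R.
Proof.
have -> : \sum_(g : dT) 2^-1 ^+ gsum g = \sum_(g : dT) \prod_(x : G) (2^-1 ^+ g x : R).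
  by apply: eq_bigr => g _; rewrite /gsum expr_sum.
rewrite -(bigA_distr_bigA (fun (x : G) (i : 'I_X.+1) => (2^-1 : R) ^+ i)) /= prodr_const.
apply: lerXn2r; rewrite ?nnegrE //; first by apply: sumr_ge0 => i _; rewrite exprn_ge0 // invr_ge0.
have e2 : (1 - 2^-1)^-1 = 2 :> R by field.
by rewrite -[X in _ <= X]e2; apply: geom_sum_le; [rewrite invr_ge0|lra].
Qed.

Lemma gsum0 g : gsum g = 0%N -> g = [ffun=> ord0].
Proof.
move=> /eqP; rewrite sum_nat_eq0 => /forallP h; apply/ffunP => x; rewrite ffunE.
by apply: val_inj; apply/eqP; exact: h.
Qed.

Lemma gsum1 g : gsum g = 1%N -> exists2 x, (g x : nat) != 0%N & g = delta x.
Proof.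
move=> /eqP/sum_nat_eq1[x [_ gx h]].
exists x; first by rewrite gx.
apply/ffunP => y; rewrite ffunE; case: eqP => [->|/eqP yx]; apply: val_inj => /=.
  by rewrite inordK.
exact: h.
Qed.

(** The three terms account for the totals 0, 1 and at least 2. In the last case [w <= 1/2] gives
    [w ^+ k <= 4 * w ^+ 2 * 2^-1 ^+ k], and the sum of [2^-1 ^+ gsum g] over all vectors is bounded
    independently of [X]. *)
Lemma local_weight_sum q : prime q -> (D < q)%N ->
  \sum_(g : dT | okd q g) wt K q ^+ gsum g <=
  1 + #|fixq q|%:R * wt K q + 4 * 2 ^+ #|{: G}| * wt K q ^+ 2.
Proof.
move=> q_pr ltq; set w := wt K q; have w0 : 0 <= w by exact: wt_ge0.
have i2 : 0 <= 2^-1 :> R by rewrite invr_ge0.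
have w2 : w <= 2^-1.
  apply: le_trans (wt_le _ q K1) _; rewrite lef_pV2 ?posrE ?ltr0n ?prime_gt0 // ler_nat.
  exact: prime_gt1.
pose h0 g : R := (g == [ffun=> ord0])%:R.
pose h1 g : R := \sum_(x in fixq q) (g == delta x)%:R * w.
pose h2 g : R := 4 * w ^+ 2 * 2^-1 ^+ gsum g.
have pt g : okd q g -> w ^+ gsum g <= h0 g + h1 g + h2 g.
  have p0 : 0 <= h0 g by rewrite ler0n.
  have p1 : 0 <= h1 g by apply: sumr_ge0 => x _; rewrite mulr_ge0 ?ler0n.
  have p2 : 0 <= h2 g by rewrite mulr_ge0 ?exprn_ge0 // mulr_ge0 ?exprn_ge0.
  rewrite /okd q_pr ltq /=; case e: (gsum g) => [|[|k]] /=.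
  - move=> _; rewrite expr0; have -> : h0 g = 1 by rewrite /h0 (gsum0 e) eqxx.
    by rewrite -addrA lerDl addr_ge0.
  - move=> /forallP ok; have [x gx eg] := gsum1 e; rewrite expr1.
    have xq : x \in fixq q by have := ok x; rewrite gx.
    have le1 : w <= h1 g.
      rewrite /h1 (bigD1 x) //= -eg eqxx mul1r lerDl.
      by apply: sumr_ge0 => y _; rewrite mulr_ge0 ?ler0n.
    by rewrite addrAC; apply: le_trans le1 _; rewrite lerDr addr_ge0.
  - move=> _; have le2 : w ^+ k.+2 <= h2 g.
      rewrite /h2 e -addn2 [w ^+ _]exprD [2^-1 ^+ _]exprD.
      have : w ^+ k <= 2^-1 ^+ k by apply: lerXn2r; rewrite ?nnegrE ?invr_ge0.
      move=> le; have -> : 4 * w ^+ 2 * (2^-1 ^+ k * 2^-1 ^+ 2) = 2^-1 ^+ k * w ^+ 2.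
        by move: (2^-1 ^+ k) (w ^+ 2) => u v; field.
      by rewrite ler_wpM2r // exprn_ge0.
    by apply: le_trans le2 _; rewrite lerDr addr_ge0.
apply: (@le_trans _ _ (\sum_(g : dT) (h0 g + h1 g + h2 g))).
  rewrite [leRHS](bigID (okd q)) /= -[leLHS]addr0 lerD //; first exact: ler_sum.
  apply: sumr_ge0 => g _; rewrite !addr_ge0 ?ler0n //.
    by apply: sumr_ge0 => x _; rewrite mulr_ge0 ?ler0n.
  by rewrite mulr_ge0 ?exprn_ge0 // mulr_ge0 ?exprn_ge0.
rewrite !big_split /=; apply: lerD; first apply: lerD.
- rewrite /h0 (bigD1 [ffun=> ord0]) //= eqxx big1 ?addr0 // => g /negbTE ->; by [].
- rewrite /h1 exchange_big /= -sum1_card natr_sum mulr_suml; apply: ler_sum => x _.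
  rewrite -mulr_suml (bigD1 (delta x)) //= eqxx big1 ?addr0 // => g /negbTE ->; by [].
- rewrite /h2 -mulr_sumr [leRHS]mulrAC ler_wpM2l ?half_sum //.
  by rewrite mulr_ge0 // exprn_ge0.
Qed.

Lemma data_sum :
  \sum_(d : {ffun 'I_X.+1 -> dT} | [forall q : 'I_X.+1, okd q (d q)])
    \prod_(q < X.+1 | prime q && (D < q)%N) wt K q ^+ gsum (d q) <=
  expR (wsum R D phi_ J K X + 8 * 2 ^+ #|{: G}|).
Proof.
pose f (q : 'I_X.+1) g : R :=
  if okd q g then (if prime q && (D < q)%N then wt K q ^+ gsum g else 1) else 0.
apply: (@le_trans _ _ (\prod_(q < X.+1) \sum_(g : dT) f q g)).
  rewrite bigA_distr_bigA /= [leRHS](bigID (fun d : {ffun 'I_X.+1 -> dT} => [forall q : 'I_X.+1, okd q (d q)])) /=.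
  rewrite -[leLHS]addr0 lerD //; last first.
    apply: sumr_ge0 => d _; apply: prodr_ge0 => q _; rewrite /f.
    by case: ifP => // _; case: ifP => // _; rewrite exprn_ge0 // wt_ge0.
  apply: ler_sum => d /forallP ok; rewrite big_mkcond /= le_eqVlt; apply/orP; left; apply/eqP.
  by apply: eq_bigr => q _; rewrite /f ok.
pose c : R := 4 * 2 ^+ #|{: G}|.
have c0 : 0 <= c by rewrite mulr_ge0 // exprn_ge0.
apply: (@le_trans _ _ (\prod_(q < X.+1 | prime q && (D < q)%N)
    expR (#|fixq q|%:R * wt K q + c * q%:R^-1 ^+ 2))).
  rewrite [leRHS]big_mkcond /=; apply: ler_prod => q _; apply/andP; split.
    apply: sumr_ge0 => g _; rewrite /f.
    by case: ifP => // _; case: ifP => // _; rewrite exprn_ge0 // wt_ge0.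
  rewrite /f -big_mkcond /=; case: ifP => [/andP[q_pr ltq]|c'].
    apply: le_trans (local_weight_sum q_pr ltq) _; apply: le_trans (expR_ge1Dx _).
    rewrite -addrA lerD2l lerD2l ler_wpM2l //; apply: lerXn2r; rewrite ?nnegrE ?invr_ge0 ?wt_ge0 //.
    exact: wt_le.
  rewrite (eq_bigl (pred1 [ffun=> ord0])) ?big_pred1_eq // => g; rewrite /okd c' /=.
  apply/eqP/eqP => [/gsum0 //|->]; rewrite /gsum big1 // => x _; by rewrite ffunE.
rewrite -expR_sum ler_expR big_split /= lerD2l -mulr_sumr.
apply: le_trans (_ : c * 2 <= _); last by rewrite /c mulrAC -natrM.
by rewrite ler_wpM2l //; apply: (sum_inv_sq R X (fun q => prime q && (D < q)%N)).
Qed.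

End DataSum.

(** At scale [j] there are [(4 ^ j) ^ n] box elements, each of norm at most a constant times this
    number, so every scale contributes at least a constant [c1] to the sum of the weights of norms.
    The [K] scales together give [c1 * K]. The elements have distinct factorisations, so [data_sum]
    bounds this from above by the exponential of [wsum] up to a constant factor. The threshold [X0]
    makes room for all norms that occur. *)
Lemma lower_bound : exists C : R, forall K, (1 < K)%N -> exists X0, forall X,
  (X0 <= X)%N -> ln K%:R - C <= wsum R D phi_ J K X.
Proof.
have [e [ie fe fre]] := integral_basis FC J.
have [M MP] := lin_bound FC e.
pose M1 := (D`! * (100 * M + 1))%N.
have cb j : (centre D M j <= (1 + M1) * 4 ^ j)%N.
  by rewrite /centre -/M1 mulnDl mul1n leq_add2r expn_gt0.
(* Norms at scales below [K] have binary logarithm at most [A * K], so by [weight_ge] the damping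
   costs at most [(1 - 1 / K) ^ (2 * A * K)], which is at least [9 ^ - (2 * A)]. *)
pose A := (n * ((trunc_log 2 (1 + M1)).+1 + 3))%N.
pose c1 : R := (9^-1 ^+ (2 * A)) / (2 * (1 + M1))%:R ^+ n.
have c10 : 0 < c1 by rewrite /c1 mulr_gt0 ?invr_gt0 ?exprn_gt0 ?invr_gt0 ?ltr0n.
exists (8 * 2 ^+ #|{: G}| - ln c1) => K K1.
exists ((2 * (1 + M1) * 4 ^ K) ^ n)%N => X hX.
have [t0 t1] := wt_base R K1; set t := 1 - _ in t0 t1.
pose pT := ('I_K * {ffun 'I_n -> 'I_(4 ^ K).+1})%type.
pose S : {set pT} := finset (fun p : pT => [forall i, (p.2 i < 4 ^ p.1)%N]).
pose al (p : pT) := box D e M p.1 (fun i => (p.2 i : nat)%:Z).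
have bnd p : p \in S -> forall i, (`|(p.2 i : nat)%:Z| <= 4 ^ p.1)%N.
  by rewrite inE => /forallP h i; apply: ltnW; exact: h.
have ial p : alint (al p) by exact: box_alint.
have fal p : Jfix J (al p) by exact: box_fix.
have al0 p : p \in S -> al p != 0 by move=> pS; exact: (box_neq0 D MP (bnd p pS)).
have /choice[z zP] : forall p, exists z : int, cnorm J (al p) = z%:~R by move=> p; exact: cnorm_int.
have n0 : (0 < n)%N := transv_gt0 J.
have z0 p : p \in S -> (0 < `|z p|)%N.
  move=> pS; rewrite absz_gt0; have := cnorm_neq0 J (al0 p pS).
  by rewrite zP; apply: contra_neq => ->.
have zle p : p \in S -> (`|z p| <= (2 * (1 + M1) * 4 ^ p.1) ^ n)%N.
  move=> pS; have [_ h] := box_norm MP (bnd p pS) (zP p).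
  have h2 : (100 ^ n * `|z p| <= 100 ^ n * (2 * (1 + M1) * 4 ^ p.1) ^ n)%N.
    apply: leq_trans h _; rewrite -expnMn leq_exp2r // -mulnA.
    by have := cb p.1; move: (centre _ _ _) ((1 + M1) * 4 ^ p.1)%N => u v; lia.
  by move: h2; rewrite leq_pmul2l ?expn_gt0.
have zX p : p \in S -> (`|z p| <= X)%N.
  move=> pS; apply: leq_trans (zle p pS) (leq_trans _ hX).
  by rewrite leq_exp2r // leq_mul2l leq_exp2l // (ltnW (ltn_ord p.1)) orbT.
have zD p q : prime q -> (q %| `|z p|)%N -> (D < q)%N.
  by move=> q_pr qz; apply: (box_coprime FC ie (zP p) q_pr); rewrite dvdzE.
have X0 : (0 < X)%N by apply: leq_trans hX; rewrite expn_gt0 !muln_gt0 expn_gt0.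
pose dat (p : pT) : {ffun 'I_X.+1 -> {ffun G -> 'I_X.+1}} := [ffun q : 'I_X.+1 => [ffun x : G =>
  if [&& prime q, (D < q)%N & x \in T] then inord (qval q (Q_ q) (x (al p))) else ord0]].
have qvX p (q : nat) (x : G) : p \in S -> prime q -> (D < q)%N -> x \in T -> (qval q (Q_ q) (x (al p)) < X.+1)%N.
  move=> pS q_pr ltq xT; rewrite ltnS; apply: leq_trans (zX p pS).
  apply: leq_trans (_ : logn q `|z p| <= _)%N; last by apply: ltnW; apply: ltn_logl; exact: z0.
  by rewrite (cnorm_logn FC goodP (ial p) (al0 p pS) (zP p) q_pr ltq) (bigD1 x) //= leq_addr.
have gdat p (q : 'I_X.+1) : p \in S -> prime q -> (D < q)%N -> gsum (dat p q) = logn q `|z p|.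
  move=> pS q_pr ltq; rewrite (cnorm_logn FC goodP (ial p) (al0 p pS) (zP p) q_pr ltq).
  rewrite /gsum [RHS]big_mkcond /=; apply: eq_bigr => x _; rewrite !ffunE q_pr ltq /=.
  by case: ifP => // xT; rewrite inordK //; exact: qvX.
have okdat p : p \in S -> [forall q : 'I_X.+1, okd q (dat p q)].
  move=> pS; apply/forallP => q; rewrite /okd; case: ifP => [/andP[q_pr ltq]|c']; last first.
    by rewrite /gsum big1 // => x _; rewrite !ffunE andbA c'.
  apply/implyP => /eqP g1; apply/forallP => x; apply/implyP => gx.
  have [y gy eg] := gsum1 X0 g1.
  have uniq u v : (dat p q u : nat) != 0%N -> (dat p q v : nat) != 0%N -> u = v.
    by rewrite eg !ffunE; have [->|_] := eqVneq u y => //; have [->|_] := eqVneq v y.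
  have val u : u \in T -> (dat p q u : nat) = qval q (Q_ q) (u (al p)).
    by move=> uT; rewrite !ffunE q_pr ltq uT /= inordK //; exact: qvX.
  have xT : x \in T by move: gx; rewrite !ffunE q_pr ltq /=; case: ifP.
  rewrite inE xT /=; have ex : repr (J :* (x * phi_ q))%g = x.
    apply: uniq => //; rewrite val ?transv_repr //.
    by rewrite (same_data_frob FC goodP _ (ial p) (al0 p pS) (fal p) q_pr ltq) -val.
  have [j jJ ej] := repr_cosetP J (x * phi_ q)%g; rewrite ex in ej.
  have -> : (x * phi_ q * x^-1)%g = j^-1%g by rewrite {2}ej invMg mulgA mulgV mul1g.
  by rewrite groupV.
have injd : {in S &, injective dat}.
  move=> p p' pS pS' ed.
  have sd : same_data D Q_ J (al p) (al p').
    move=> q x q_pr ltq xT; have [qX|Xq] := leqP q X.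
      have := congr1 (fun d : {ffun 'I_X.+1 -> {ffun G -> 'I_X.+1}} => (d (inord q) x : nat)) ed.
      by rewrite !ffunE inordK // q_pr ltq xT /= !inordK //; exact: qvX.
    have nz p0 : p0 \in S -> qval q (Q_ q) (x (al p0)) = 0%N.
      move=> p0S; apply/eqP; rewrite -leqn0.
      apply: leq_trans (_ : logn q `|z p0| <= _)%N.
        by rewrite (cnorm_logn FC goodP (ial p0) (al0 p0 p0S) (zP p0) q_pr ltq) (bigD1 x) //= leq_addr.
      rewrite leqNgt logn_gt0 mem_primes q_pr z0 //=; apply/negP => /dvdn_leq; rewrite z0 // => /(_ isT).
      by rewrite leqNgt (leq_ltn_trans (zX p0 p0S) Xq).
    by rewrite !nz.
  have ej : (p.1 : nat) = p'.1.
    apply/eqP; rewrite eqn_leq; apply/andP; split.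
      exact: (box_inj_scale goodP ie fe MP (bnd p pS) (bnd p' pS') sd).
    by apply: (box_inj_scale goodP ie fe MP (bnd p' pS') (bnd p pS)) => q x *; rewrite sd.
  case: p p' pS pS' sd ej {ed} => [j c] [j' c'] /= pS pS' sd /val_inj ej; subst j'.
  congr (_, _); apply/ffunP => i; apply: val_inj; apply/eqP; rewrite -eqz_nat; apply/eqP.
  exact: (box_inj goodP ie fe fre MP (bnd _ pS) (bnd _ pS') sd).
have key : c1 * K%:R <= expR (wsum R D phi_ J K X + 8 * 2 ^+ #|{: G}|).
  apply: le_trans (data_sum K1 X0).
  apply: (@le_trans _ _ (\sum_(d in dat @: S) \prod_(q < X.+1 | prime q && (D < q)%N) wt K q ^+ gsum (d q))); last first.
    rewrite [leRHS](bigID (fun d => d \in dat @: S)) /= -[leLHS]addr0 lerD //; last first.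
      by apply: sumr_ge0 => d _; apply: prodr_ge0 => q _; rewrite exprn_ge0 // wt_ge0.
    rewrite le_eqVlt; apply/orP; left; apply/eqP; apply: eq_bigl => d.
    case: (boolP (d \in dat @: S)) => [/imsetP[p pS ->]|]; rewrite ?andbF //.
    by rewrite andbT okdat.
  rewrite big_imset //=.
  apply: (@le_trans _ _ (\sum_(p in S) (9^-1 ^+ (2 * A)) / ((2 * (1 + M1) * 4 ^ p.1) ^ n)%:R)).
    rewrite (partition_big (fun p : pT => p.1) predT) //=.
    rewrite -[K in leLHS]card_ord -sum1_card natr_sum mulr_sumr; apply: ler_sum => j _; rewrite mulr1.
    rewrite (eq_bigr (fun=> (9^-1 ^+ (2 * A)) / ((2 * (1 + M1) * 4 ^ j) ^ n)%:R)); last by move=> p /andP[_ /eqP->].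
    rewrite sumr_const -[leRHS]mulr_natl.
    have cardS : ((4 ^ j) ^ n <= #|[pred p : pT | (p \in S) && (p.1 == j)]|)%N.
      pose h (c : {ffun 'I_n -> 'I_(4 ^ j)}) : pT := (j, [ffun i => inord (c i)]).
      have jK : (4 ^ j <= 4 ^ K)%N by rewrite leq_exp2l // ltnW.
      have hi (c : {ffun 'I_n -> 'I_(4 ^ j)}) i : ((inord (c i) : 'I_(4 ^ K).+1) : nat) = c i.
        by rewrite inordK // ltnS; apply: leq_trans jK; exact: ltnW.
      have hinj : injective h.
        move=> c c' [] /ffunP ec; apply/ffunP => i; apply: val_inj; have := ec i; rewrite !ffunE => /(congr1 val) /=.
        by rewrite !hi.
      have -> : ((4 ^ j) ^ n)%N = #|{: {ffun 'I_n -> 'I_(4 ^ j)}}| by rewrite card_ffun !card_ord.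
      rewrite -(fintype.card_image hinj); apply: subset_leq_card; apply/fintype.subsetP => _ /fintype.imageP[c _ ->].
      by rewrite !inE eqxx andbT; apply/forallP => i; rewrite ffunE hi.
    apply: (@le_trans _ _ (((4 ^ j) ^ n)%:R * ((9^-1 ^+ (2 * A)) / ((2 * (1 + M1) * 4 ^ j) ^ n)%:R))); last first.
      by rewrite ler_wpM2r ?ler_nat // mulr_ge0 ?invr_ge0 ?exprn_ge0.
    rewrite /c1 le_eqVlt; apply/orP; left; apply/eqP.
    rewrite (expnMn (2 * (1 + M1)) (4 ^ j)) [in RHS]natrM -natrX.
    by apply: frac_cancel; rewrite pnatr_eq0 -lt0n expn_gt0 ?expn_gt0.
  apply: ler_sum => p pS.
  have -> : \prod_(q < X.+1 | prime q && (D < q)%N) wt K q ^+ gsum (dat p q) =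
     \prod_(q < X.+1 | prime q && (D < q)%N) wt K q ^+ logn q `|z p|.
    by apply: eq_bigr => q /andP[q_pr ltq]; rewrite gdat.
  apply: le_trans (weight_ge K1 (z0 p pS) (zX p pS) (zD p)); apply: ler_pM.
  - by rewrite exprn_ge0 // invr_ge0.
  - by rewrite invr_ge0.
  - apply: (@le_trans _ _ (t ^+ (K * (2 * A)))).
      rewrite (exprM t K); apply: lerXn2r; last exact: wt_pow_ge.
        by rewrite nnegrE invr_ge0.
      by rewrite nnegrE exprn_ge0 // ltW.
    apply: ler_wiXn2l => //; first exact: ltW.
    rewrite mulnCA leq_mul2l /=.
    have le1 := leq_trunc_log 2 (zle p pS); apply: leq_trans le1 _.
    rewrite -(@leq_exp2l 2) //; apply: leq_trans (trunc_logP _ _) _ => //.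
      by rewrite expn_gt0 !muln_gt0 expn_gt0.
    rewrite /A mulnCA [X in (_ <= 2 ^ X)%N]mulnC expnM leq_exp2r //.
    have h1 : (1 + M1 <= 2 ^ (trunc_log 2 (1 + M1)).+1)%N by apply: ltnW; exact: trunc_log_ltn.
    have h2 : (4 ^ p.1 <= 2 ^ (2 * K))%N by rewrite (expnM 2 2) leq_exp2l // ltnW.
    apply: leq_trans (leq_mul (leq_mul (leqnn 2) h1) h2) _.
    rewrite -expnS -expnD leq_exp2l //.
    by move: (trunc_log 2 _).+1 => u; clear - K1; nia.
  - rewrite lef_pV2 ?posrE ?ltr0n ?z0 // ?expn_gt0 ?muln_gt0 ?expn_gt0 // ler_nat; exact: zle.
have K0 : 0 < K%:R :> R by rewrite ltr0n; lia.
have : ln (c1 * K%:R) <= wsum R D phi_ J K X + 8 * 2 ^+ #|{: G}|.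
  by rewrite -ler_expR lnK ?posrE ?mulr_gt0.
by rewrite lnM ?posrE // opprB addrA lerBlDr [ln K%:R + _]addrC.
Qed.

End Fixed.
End LowerBound.

(** * The covering inequality *)

Section FrobeniusCover.
Variable R : realType.
Variables (F : splittingFieldType rat) (FC : {rmorphism F -> algC}).
Local Notation G := (gal_of {:F}).
Variables (D : nat) (Q_ : nat -> set F) (phi_ : nat -> G).
Hypothesis goodP : forall q, prime q -> (D < q)%N -> good_prime q (Q_ q) (phi_ q).

(** After multiplication by the order of [J], the counts for different subgroups refer to subsets of
    the same set [G] and can be compared. *)
Lemma fixq_count (J : {group G}) q :
  (#|J| * #|fixq phi_ J q|)%N = #|finset (fun x : G => (x * phi_ q * x^-1)%g \in J)|.
Proof.
rewrite -cardsX -(card_in_imset (f := fun jx : G * G => (jx.1 * jx.2)%g)).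
  apply: eq_card => x; apply/imsetP/idP => [[[j y] /setXP[/= jJ] yq ->]|].
    move: yq; rewrite !inE => /andP[_ yJ].
    by rewrite invMg !mulgA -2![in X in X \in _](mulgA j) groupMr ?groupV // groupMl.
  rewrite inE => xJ; have [j jJ ej] := repr_cosetP J x.
  exists (j^-1%g, (j * x)%g); last by rewrite /= mulKg.
  rewrite !inE groupV jJ -ej rcoset_repr eqxx /= ej invMg !mulgA.
  by rewrite -2![in X in X \in _](mulgA j) groupMr ?groupV // groupMl.
move=> [j y] [j' y'] /setXP[/= jJ yq] /setXP[/= jJ' yq'] /= e.
move: yq yq'; rewrite !inE => /andP[yT _] /andP[yT' _].
have ey : y = y'.
  apply: (transv_inj (J := J)); rewrite ?inE //.
  apply/rcoset_eqP; apply/rcosetP; exists (j^-1 * j')%g; first by rewrite groupM ?groupV.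
  by rewrite -mulgA -e mulKg.
by move: e; rewrite ey => /mulIg ->.
Qed.

(** By the covering, [|H|] times the sum for [H] is at most the sum of [|Hi|] times the sums for the
    [Hi]. All these sums are [ln K] up to constants, so [|H|] exceeding the total of the [|Hi|]
    would bound [ln K]. The cut-off [X0] is chosen after [K]. *)
Lemma frobenius_cover (H : {group G}) (I : finType) (Hi : I -> {group G}) :
  (forall q x, prime q -> (D < q)%N -> (x * phi_ q * x^-1)%g \in H ->
     exists i, (x * phi_ q * x^-1)%g \in Hi i) ->
  (#|H| <= \sum_i #|Hi i|)%N.
Proof.
move=> cov; rewrite leqNgt; apply/negP => lt.
have cnt q : prime q -> (D < q)%N ->
    (#|H| * #|fixq phi_ H q| <= \sum_i #|Hi i| * #|fixq phi_ (Hi i) q|)%N.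
  move=> q_pr ltq; rewrite fixq_count.
  under eq_bigr => i _ do rewrite fixq_count.
  apply: leq_trans (_ : #|\big[@finset.setU G/@finset.set0 G]_i finset (fun x : G => (x * phi_ q * x^-1)%g \in Hi i)| <= _)%N.
    apply: subset_leq_card; apply/fintype.subsetP => x; rewrite inE => /(cov q x q_pr ltq)[i xi].
    by apply/finset.bigcupP; exists i => //; rewrite inE.
  elim/big_rec2: _ => [|i m A _ IH]; first by rewrite cards0.
  by rewrite cardsU; apply: leq_trans (leq_subr _ _) _; rewrite leq_add2l.
have [C CP] := lower_bound R FC goodP H.
have /choice[Ci CiP] : forall i, exists C : R, forall K X, (1 < K)%N ->
    wsum R D phi_ (Hi i) K X <= ln K%:R + C.
  by move=> i; exact: (upper_bound R FC goodP).
pose B : R := \sum_i #|Hi i|%:R * Ci i + #|H|%:R * C.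
have bound K : (1 < K)%N -> ln K%:R <= B.
  move=> K1; have [X0 XP] := CP K K1; have lo := XP X0 (leqnn _).
  have le : #|H|%:R * wsum R D phi_ H K X0 <= \sum_i #|Hi i|%:R * wsum R D phi_ (Hi i) K X0.
    rewrite /wsum mulr_sumr; under [leRHS]eq_bigr => i _ do rewrite mulr_sumr.
    rewrite exchange_big /=; apply: ler_sum => q /andP[q_pr ltq].
    rewrite mulrA; under eq_bigr => i _ do rewrite mulrA.
    rewrite -mulr_suml ler_wpM2r ?wt_ge0 // -natrM.
    under eq_bigr => i _ do rewrite -natrM.
    by rewrite -natr_sum ler_nat cnt.
  have up : \sum_i #|Hi i|%:R * wsum R D phi_ (Hi i) K X0 <=
      (\sum_i #|Hi i|)%:R * ln K%:R + \sum_i #|Hi i|%:R * Ci i.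
    rewrite natr_sum mulr_suml -big_split /=; apply: ler_sum => i _.
    by rewrite -mulrDr ler_wpM2l // CiP.
  have lo' : #|H|%:R * (ln K%:R - C) <= #|H|%:R * wsum R D phi_ H K X0 by rewrite ler_wpM2l.
  have lnK0 : 0 <= ln K%:R :> R by rewrite ln_ge0 // ler1n ltnW.
  have : (\sum_i #|Hi i|)%:R + 1 <= #|H|%:R :> R by rewrite natr1 ler_nat.
  rewrite /B; move: le up lo'; rewrite mulrBr.
  move: (\sum_i #|Hi i|)%N (\sum_i _ * wsum _ _ _ _ _ _) (\sum_i _ * Ci i) (wsum _ _ _ _ _ _) => s a b c.
  move: (#|H|%:R) (ln K%:R) lnK0 => h L L0 {}lo {}le up hh; clear - L0 lo le up hh; nra.
have [K1 KP] : exists K : nat, (1 < K)%N /\ expR B < K%:R.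
  exists (Num.bound (expR B)).+2; split=> //.
  apply: lt_le_trans (archi_boundP (expR_ge0 _)) _; rewrite ler_nat; lia.
case: KP => K1' /[dup] ltB; rewrite -ltr_ln ?posrE ?expR_gt0 ?ltr0n ?(ltn_trans _ K1') //.
by rewrite expRK ltNge bound.
Qed.

End FrobeniusCover.

(** * Embeddings of number fields *)

Local Notation autC := {rmorphism algC -> algC}.

Lemma galois_field_exists (s : seq algC) :
  exists (F : splittingFieldType rat) (FC : {rmorphism F -> algC}),
  forall z, z \in s -> exists a, FC a = z.
Proof.
have /choice[r rP] : forall z : algC, exists r : {poly rat}, minCpoly z = map_poly ratr r.
  by move=> z; have [r [e _] _] := minCpolyP z; exists r.
pose p := \prod_(z <- s) r z.
have [rs ers] := closed_field_poly_normal (map_poly ratr p : {poly algC}).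
have mp : lead_coef (map_poly ratr p : {poly algC}) = 1.
  apply/eqP; rewrite -monicE rmorph_prod /= monic_prod // => z _.
  by rewrite -rP minCpoly_monic.
rewrite mp scale1r in ers.
have [Qs [QsC [s1 es1 gens1]]] := num_field_exists rs.
have emap (q : {poly rat}) : map_poly QsC (map_poly (in_alg Qs) q) = map_poly ratr q.
  rewrite -map_poly_comp; apply: eq_map_poly => a /=.
  by rewrite rmorphZ_num rmorph1 mulr1.
have ep : map_poly (in_alg Qs) p = \prod_(x <- s1) ('X - x%:P).
  apply: (map_poly_inj QsC); rewrite emap ers rmorph_prod /= -es1 big_map.
  by apply: eq_bigr => x _; rewrite map_polyXsubC.
have ax : splitting_field_axiom Qs.
  exists (map_poly (in_alg Qs) p).
    by apply/polyOverP => i; rewrite coef_map /= memvZ ?mem1v.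
  by exists s1 => //; rewrite ep eqpxx.
pose M := FieldExt_isSplittingField.Build rat Qs ax.
pose F : splittingFieldType rat := HB.pack Qs M.
exists F, (QsC : {rmorphism F -> algC}) => z zs.
have : root (map_poly ratr p) z.
  rewrite /root rmorph_prod horner_prod prodf_seq_eq0.
  by apply/hasP; exists z => //=; rewrite -rP; exact: root_minCpoly.
by rewrite ers root_prod_XsubC -es1 => /mapP[a _ ->]; exists a.
Qed.

Section Lifting.
Variables (F : splittingFieldType rat) (FC : {rmorphism F -> algC}).
Local Notation G := (gal_of {:F}).

Lemma gal_lift (x : G) : exists nu : autC, forall a, nu (FC a) = FC (x a).
Proof.
have [nu nuP] := extend_algC_subfield_aut FC (x : {rmorphism F -> F}).
by exists nu => a; rewrite nuP.
Qed.

Lemma gal_restrict (nu : autC) : exists x : G, forall a, nu (FC a) = FC (x a).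
Proof.
have [nu0 nu0P] := restrict_aut_to_normal_num_field FC nu.
have kh : kHom 1 {:F} (linfun nu0).
  apply/kHomP_tmp; split=> [a|a b _ _].
    by move=> /vlineP[r ->]; rewrite lfunE /= linearZ /= rmorph1.
  by rewrite !lfunE /= rmorphM.
have [|x _ xP] := kHom_to_gal (K := 1%AS) (M := {:F}%AS) (E := {:F}%AS) _ (normalFieldf _) kh.
  by rewrite sub1v subvf.
by exists x => a; rewrite -nu0P -xP ?memvf // lfunE.
Qed.

End Lifting.

Section NumberFieldGenerator.
Variable K : fieldExtType rat.

Definition kgen : K := separable_generator 1%AS {:K}.

Lemma kgenP (b : K) : exists p : {poly rat}, b = (map_poly (in_alg K) p).[kgen].
Proof.
have sepK : separable 1%AS {:K}.
  apply/separableP => a _; apply: pcharf0_separable => p; rewrite pchar_lalg; exact: pchar_num.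
have eK := eq_adjoin_separable_generator sepK (subvf _).
have : b \in <<1; kgen>>%VS by rewrite -eK memvf.
move=> /Fadjoin_polyP[p /polyOverP Qp ->].
have /choice[c cP] : forall i, exists k, p`_i = k%:A.
  by move=> i; have /vlineP[k ->] := Qp i; exists k.
exists (\poly_(i < size p) c i); congr _.[_]; apply/polyP => i.
by rewrite coef_map coef_poly /=; case: ltnP => h; [rewrite cP|rewrite nth_default // scale0r].
Qed.

Lemma rmorph_kgen (E : fieldType) (i : {rmorphism rat -> E}) (f : {rmorphism K -> E}) p :
  f (map_poly (in_alg K) p).[kgen] = (map_poly i p).[f kgen].
Proof.
rewrite -horner_map -map_poly_comp; congr _.[_]; apply: eq_map_poly => a /=.
have eq_rat (g h : {rmorphism rat -> E}) : g =1 h.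
  move=> r; rewrite -(divq_num_den r) !fmorph_div /= !rmorph_int; by [].
exact: (eq_rat (f \o in_alg K : {rmorphism rat -> E}) i).
Qed.

Lemma rmorph_kgen_ext (E : fieldType) (f g : {rmorphism K -> E}) : f kgen = g kgen -> f =1 g.
Proof.
move=> e b; have [p ->] := kgenP b.
pose i : {rmorphism rat -> E} := f \o in_alg K.
by rewrite (rmorph_kgen i f) (rmorph_kgen i g) e.
Qed.

Lemma field_embedding (F : fieldExtType rat) (FC : {rmorphism F -> algC})
    (eps : {rmorphism K -> algC}) : (exists a, FC a = eps kgen) ->
  exists k : {rmorphism K -> F}, forall b, FC (k b) = eps b.
Proof.
move=> [g eg]; have /choice[k kP] : forall b, exists a, FC a = eps b.
  move=> b; have [p ->] := kgenP b; exists (map_poly (in_alg F) p).[g].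
  rewrite (rmorph_kgen (ratr : {rmorphism rat -> algC}) eps) -eg -horner_map -map_poly_comp.
  by congr _.[_]; apply: eq_map_poly => a /=; rewrite rmorphZ_num rmorph1 mulr1.
have ka : zmod_morphism k by move=> a b; apply: (fmorph_inj FC); rewrite rmorphB /= !kP rmorphB.
have km : GRing.monoid_morphism k.
  split=> [|a b]; apply: (fmorph_inj FC); rewrite ?rmorph1 ?kP ?rmorph1 //.
  by rewrite [RHS]rmorphM /= !kP rmorphM.
pose kaM := GRing.isZmodMorphism.Build K F k ka.
pose kmM := GRing.isMonoidMorphism.Build K F k km.
by exists (HB.pack k kaM kmM : {rmorphism K -> F}).
Qed.

Lemma embeddings_conjugate (e1 e2 : {rmorphism K -> algC}) :
  exists nu : autC, forall b, nu (e1 b) = e2 b.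
Proof.
have [F [FC FP]] := galois_field_exists [:: e1 kgen; e2 kgen].
have [k1 k1P] := field_embedding (FP (e1 kgen) (mem_head _ _)).
have [k2 k2P] : exists k : {rmorphism K -> F}, forall b, FC (k b) = e2 b.
  by apply: field_embedding; apply: FP; rewrite !inE eqxx orbT.
have rt : root (minPoly 1%AS (k1 kgen)) (k2 kgen).
  have /polyOverP Qp := minPolyOver 1%AS (k1 kgen).
  have /choice[c cP] : forall i, exists k, (minPoly 1%AS (k1 kgen))`_i = k%:A.
    by move=> i; have /vlineP[k ->] := Qp i; exists k.
  pose p := \poly_(i < size (minPoly 1%AS (k1 kgen))) c i.
  have ep : minPoly 1%AS (k1 kgen) = map_poly (in_alg F) p.
    by apply/polyP => i; rewrite coef_map coef_poly /=; case: ltnP => h; [rewrite cP|rewrite nth_default // scale0r].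
  have := root_minPoly 1%AS (k1 kgen); rewrite ep /root -!(rmorph_kgen (in_alg F : {rmorphism rat -> F})).
  by rewrite !fmorph_eq0.
have [x _ ex] := normalField_root_minPoly (subvf _) (normalFieldf 1%AS) (memvf (k1 kgen)) rt.
have [nu nuP] := gal_lift FC x; exists nu => b.
have := @rmorph_kgen_ext algC (nu \o e1 : {rmorphism K -> algC}) e2; apply => /=.
by rewrite -k1P nuP ex k2P.
Qed.

(** The Galois correspondence inside a finite Galois field containing [z] and the image of [K],
    whose automorphisms all extend to [algC]. *)
Lemma fixed_by_stabilizer (eps : {rmorphism K -> algC}) (z : algC) :
  (forall nu : autC, (forall b, nu (eps b) = eps b) -> nu z = z) -> exists b, z = eps b.
Proof.
move=> fz; have [F [FC FP]] := galois_field_exists [:: eps kgen; z].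
have [k kP] := field_embedding (FP (eps kgen) (mem_head _ _)).
have [a ea] : exists a, FC a = z by apply: FP; rewrite !inE eqxx orbT.
have : a \in fixedField 'Gal({:F} / <<1; k kgen>>)%g.
  apply/fixedFieldP; first exact: memvf.
  move=> x xG; have [nu nuP] := gal_lift FC x; apply: (fmorph_inj FC); rewrite -nuP ea; apply: fz.
  move=> b; have := @rmorph_kgen_ext algC (nu \o eps : {rmorphism K -> algC}) eps; apply => /=.
  by rewrite -kP nuP (fixed_gal _ xG) ?memv_adjoin // subvf.
have /galois_fixedField -> := galois_full <<1; k kgen>>%AS.
move=> /Fadjoin_polyP[p /polyOverP Qp eap].
have /choice[c cP] : forall i, exists k, p`_i = k%:A.
  by move=> i; have /vlineP[r ->] := Qp i; exists r.
pose q := \poly_(i < size p) c i.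
have ep : p = map_poly (in_alg F) q.
  by apply/polyP => i; rewrite coef_map coef_poly /=; case: ltnP => h; [rewrite cP|rewrite nth_default // scale0r].
exists (map_poly (in_alg K) q).[kgen]; rewrite -ea eap ep -kP.
by rewrite (rmorph_kgen (in_alg F : {rmorphism rat -> F}) k).
Qed.

End NumberFieldGenerator.

(** * Embedding an algebraic closure of the rationals *)

Section ClosureEmbedding.
Variables (E : closedFieldType) (i : {rmorphism rat -> E}) (Omega : numClosedFieldType).
Hypothesis algE : forall x : E, algebraicOver i x.

Lemma simple_generation (s : seq E) : exists z : E,
  forall a, a \in s -> exists p : {poly rat}, a = (map_poly i p).[z].
Proof.
elim: s => [|x s [z zP]]; first by exists 0.
have [px px0 pxr] := algE x; have [pz pz0 pzr] := algE z.
have [n [[qx ex] [qz ez]]] := pchar0_PET px0 pxr pz0 pzr (pchar_num _).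
exists (z *+ n - x) => a; rewrite in_cons => /orP[/eqP->|/zP[p ->]]; first by exists qx.
by exists (p \Po qz); rewrite map_comp_poly horner_comp ez.
Qed.

(** A primitive element [z] for [s] is sent to a root [z'] of its minimal polynomial; outside Q(z)
    the value is 0. The last clause confines [f a] to finitely many values whatever [s] is, which
    the limit along an ultrafilter requires. *)
Lemma finite_embedding (s : seq E) : exists f : E -> Omega,
  [/\ f 1 = 1, forall a b, a \in s -> b \in s -> f (a - b) = f a - f b,
      forall a b, a \in s -> b \in s -> f (a * b) = f a * f b
    & forall a (p : {poly rat}), a \in s -> root (map_poly i p) a -> root (map_poly ratr p) (f a)].
Proof.
have [z zP] := simple_generation s.
have ex : exists n, `[< exists p : {poly rat}, [/\ p != 0, root (map_poly i p) z & size p = n] >].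
  by have [p p0 pr] := algE z; exists (size p); apply/asboolP; exists p.
case: (ex_minnP ex) => n /asboolP[p [p0 pr sp]] minp.
have dvp (g : {poly rat}) : root (map_poly i g) z -> p %| g.
  move=> gr; rewrite /dvdp; apply/negPn/negP => r0.
  have : (n <= size (g %% p)%R)%N.
    apply: minp; apply/asboolP; exists (g %% p)%R; split=> //.
    move: gr; rewrite {1}(divp_eq g p) rmorphD rmorphM /= /root !hornerE.
    by rewrite (eqP pr) mulr0 add0r.
  by rewrite -sp leqNgt ltn_modp p0.
have p1 : size (map_poly ratr p : {poly Omega}) != 1%N.
  rewrite size_map_poly; apply/eqP => /eqP /size_poly1P[c c0 pc].
  by move: pr; rewrite pc map_polyC /= rootC fmorph_eq0 (negbTE c0).
have [z' z'r] := closed_rootP _ p1.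
have /choice[g gP] : forall a, exists g : {poly rat},
    (exists q, a = (map_poly i q).[z]) -> a = (map_poly i g).[z].
  by move=> a; have [[q eq]|no] := pselect (exists q, a = (map_poly i q).[z]); [exists q|exists 0 => /no].
pose f a := (map_poly (ratr : rat -> Omega) (g a)).[z'].
have fE a q : a = (map_poly i q).[z] -> f a = (map_poly ratr q).[z'].
  move=> ea; have eg := gP a (ex_intro _ q ea).
  have : p %| g a - q by apply: dvp; rewrite rmorphB /root hornerD hornerN /= -eg -ea subrr.
  move=> /dvdpP[h eh]; apply/eqP; rewrite -subr_eq0 /f -hornerN -hornerD -rmorphN -rmorphD /= eh.
  by rewrite rmorphM hornerM /= (eqP z'r) mulr0.
exists f; split.
- by rewrite (fE 1 1) ?rmorph1 ?hornerC.
- move=> a b /zP[pa ea] /zP[pb eb]; rewrite (fE a pa ea) (fE b pb eb) (fE (a - b) (pa - pb)).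
    by rewrite rmorphB hornerD hornerN.
  by rewrite rmorphB /= hornerD hornerN -ea -eb.
- move=> a b /zP[pa ea] /zP[pb eb]; rewrite (fE a pa ea) (fE b pb eb) (fE (a * b) (pa * pb)).
    by rewrite rmorphM hornerM.
  by rewrite rmorphM /= hornerM -ea -eb.
- move=> a r /zP[pa ea] rr; rewrite /root (fE a pa ea) -horner_comp -map_comp_poly.
  have h : 0 = (map_poly i (r \Po pa)).[z] by rewrite map_comp_poly horner_comp -ea (eqP rr).
  by rewrite -(fE 0 _ h) (fE 0 0) ?rmorph0 ?horner0.
Qed.

(* A limit of the finite embeddings along an ultrafilter: the value at x stays in
   the finite set of roots of a polynomial killing x, hence stabilises. *)
Lemma closed_field_embedding : exists e : {rmorphism E -> Omega}, True.
Proof.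
have [U [ultU totU]] := ultraFilterLemma (@totally_filter E).
have /choice[f fP] := finite_embedding.
pose fB (B : {fset E}) := f (enum_fset B).
have UB (A : {fset E}) : U [set B : {fset E} | (A `<=` B)%fset].
  by apply: totU; exists A.
have Um x : U [set B : {fset E} | x \in B].
  by apply: (@filterS _ U _ _ _ _ (UB [fset x]%fset)) => B /= /fsubsetP; apply; rewrite inE.
have /choice[e eP] : forall x, exists v, U [set B | fB B x = v].
  move=> x; have [p p0 pr] := algE x.
  have [rs ers] := closed_field_poly_normal (map_poly ratr p : {poly Omega}).
  have : U [set B | fB B x \in rs].
    apply: (@filterS _ U _ _ _ _ (Um x)) => B /= xB.
    have [_ _ _ h] := fP (enum_fset B); have := h x p xB pr.
    by rewrite ers rootZ ?root_prod_XsubC // lead_coef_eq0 map_poly_eq0.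
  elim: rs {ers} => [|v rs IH] Ux.
    by have [B] := @filter_ex _ U _ _ Ux.
  have [Uv|nUv] := in_ultra_setVsetC [set B | fB B x = v] ultU; first by exists v.
  apply: IH; apply: (@filterS _ U _ _ _ _ (filterI Ux nUv)) => B /= [].
  by rewrite in_cons => /orP[/eqP|].
have pick3 x y w (P : {fset E} -> Prop) : (forall B, x \in B -> y \in B -> P B) ->
    exists B, [/\ P B, fB B x = e x, fB B y = e y & fB B w = e w].
  move=> h; have [B [[[[/= xB yB] ex] ey] ew]] := @filter_ex _ U _ _
    (filterI (filterI (filterI (filterI (Um x) (Um y)) (eP x)) (eP y)) (eP w)).
  by exists B; split=> //; exact: h.
have ea : zmod_morphism e.
  move=> x y; have [B [h ex ey ew]] := pick3 x y (x - y) (fun B => fB B (x - y) = fB B x - fB B y)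
    (fun B xB yB => let: And4 _ h _ _ := fP (enum_fset B) in h x y xB yB).
  by rewrite -ew h ex ey.
have em : GRing.monoid_morphism e.
  split=> [|x y].
    have [B [h _ _ ew]] := pick3 1 1 1 (fun B => fB B 1 = 1)
      (fun B _ _ => let: And4 h _ _ _ := fP (enum_fset B) in h).
    by rewrite -ew h.
  have [B [h ex ey ew]] := pick3 x y (x * y) (fun B => fB B (x * y) = fB B x * fB B y)
    (fun B xB yB => let: And4 _ _ h _ := fP (enum_fset B) in h x y xB yB).
  by rewrite -ew h ex ey.
pose eaM := GRing.isZmodMorphism.Build E Omega e ea.
pose emM := GRing.isMonoidMorphism.Build E Omega e em.
by have e' : {rmorphism E -> Omega} := HB.pack e eaM emM; exists e'.
Qed.

End ClosureEmbedding.

Lemma closure_embedding (E : closedFieldType) (i : {rmorphism rat -> E}) :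
  (forall x : E, algebraicOver i x) -> exists e : {rmorphism E -> algC}, bijective e.
Proof.
move=> algE; have [e' _] := closed_field_embedding algC algE.
have /choice[h hP] : forall y, exists x, e' x = y.
  move=> y; have [r [er rm] _] := minCpolyP y.
  have [rs ers] := closed_field_poly_normal (map_poly i r : {poly E}).
  have : root (map_poly ratr r) y by rewrite -er root_minCpoly.
  have -> : map_poly ratr r = map_poly e' (map_poly i r).
    rewrite -map_poly_comp; apply: eq_map_poly => a /=.
    by have /= -> := fmorph_eq_rat (e' \o i : {rmorphism rat -> algC}) a.
  rewrite ers map_polyZ /= rmorph_prod /= rootZ.
    under eq_bigr => x _ do rewrite map_polyXsubC.
    by rewrite -(big_map e' predT (fun x => 'X - x%:P)) root_prod_XsubC => /mapP[x _ ->]; exists x.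
  by rewrite fmorph_eq0 lead_coef_eq0 map_poly_eq0 monic_neq0.
by exists e', h => [x|//]; apply: (fmorph_inj e'); rewrite hP.
Qed.

(** * Local structure at a prime ideal *)

Lemma nat_pigeonhole (T : finType) (f : nat -> T) : exists i j, (i < j)%N /\ f i = f j.
Proof.
have : ~ injective (fun i : 'I_#|T|.+1 => f i).
  by move=> /leq_card; rewrite card_ord ltnn.
apply: contra_notP => no i j eij; apply/val_inj/eqP; rewrite eqn_leq; apply/andP.
by split; rewrite leqNgt; apply/negP => lt; apply: no; [exists j, i|exists i, j].
Qed.

Section LocalUniformizer.
Variables (E : fieldType) (A : set E).
Hypothesis sA : is_subring A.
Hypothesis iA : A `<=` @alint E.
Hypothesis closedA : forall a b, A a -> A b -> b != 0 -> alint (a / b) -> A (a / b).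
Hypothesis finA : forall n, (0 < n)%N -> exists (T : finType) (c : E -> T), forall a b,
  A a -> A b -> c a = c b -> exists2 w, A w & a - b = n%:R * w.
Hypothesis normA : forall d, A d -> d != 0 ->
  exists n d', [/\ (0 < n)%N, A d' & n%:R = d * d'].
Hypothesis char0 : forall n, (0 < n)%N -> (n%:R : E) != 0.
Variables (q : nat) (P : set E).
Hypothesis q_pr : prime q.
Hypothesis prP : is_prime_ideal A P.
Hypothesis Pq : P q%:R.

Let idP := prime_isideal prP.
Let PA x : P x -> A x := @ideal_sub _ _ _ idP x.
Let AM := @subringM _ _ sA.
Let A1 := subring1 sA.
Let AN n : A n%:R := subring_nat sA n.

(* [locdiv b s]: [b] divides [s] in the localization of [A] at [P] *)
Definition locdiv (b s : E) := exists t w, [/\ A t, ~ P t, A w & t * s = b * w].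

Lemma locdivM b s a : A a -> locdiv b s -> locdiv b (a * s).
Proof.
move=> Aa [t [w [At nPt Aw e]]]; exists t, (a * w); split=> //; first exact: AM.
by rewrite mulrCA e mulrCA.
Qed.

Lemma locdivD b s s' : locdiv b s -> locdiv b s' -> locdiv b (s + s').
Proof.
move=> [t [w [At nPt Aw e]]] [t' [w' [At' nPt' Aw' e']]].
exists (t * t'), (t' * w + t * w'); split; first exact: AM.
- exact: (primeNM prP).
- by apply: subringD => //; exact: AM.
- by rewrite !mulrDr -mulrA [t * _]mulrCA e -mulrA e' !(mulrCA b).
Qed.

Lemma locdiv_refl b w : A w -> locdiv b (b * w).
Proof. by move=> Aw; exists 1, w; split; rewrite ?mul1r //; exact: primeN1 prP. Qed.

Lemma locdivB b s s' : locdiv b s -> locdiv b s' -> locdiv b (s - s').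
Proof.
move=> h h'; apply: locdivD => //; rewrite -mulN1r; apply: locdivM => //.
exact: subringN.
Qed.

Lemma locdiv_cancel b s u : A u -> ~ P u -> locdiv b (u * s) -> locdiv b s.
Proof.
move=> Au nPu [t [w [At nPt Aw e]]]; exists (t * u), w; split=> //; first exact: AM.
  exact: (primeNM prP).
by rewrite -mulrA.
Qed.

Lemma locdiv_mul b b' s s' : locdiv b s -> locdiv b' s' -> locdiv (b * b') (s * s').
Proof.
move=> [t [w [At nPt Aw e]]] [t' [w' [At' nPt' Aw' e']]].
exists (t * t'), (w * w'); split; [exact: AM|exact: (primeNM prP)|exact: AM|].
by rewrite mulrACA e e' mulrACA.
Qed.

Let q0 : (q%:R : E) != 0. Proof. by rewrite char0 ?prime_gt0. Qed.

(* A maximal proper annihilator in A / qA localized at P is prime, hence equal to P. *)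
Lemma annihilator_prime : exists s, [/\ A s, ~ locdiv q%:R s
  & forall m, P m -> locdiv q%:R (m * s)].
Proof.
have [T [c cP]] := finA (prime_gt0 q_pr).
pose ann s : set E := [set b | A b /\ locdiv q%:R (b * s)].
(* [ann s] contains the multiples of [q], so it is determined by its residues modulo [q]; the
   cardinality of this finite set serves to choose a maximal one. *)
pose cl s : {set T} := finset (fun x => `[< exists2 b, ann s b & c b = x >]).
pose S s := A s /\ ~ locdiv q%:R s.
have S1 : S 1.
  split=> // -[t [w [At nPt Aw e]]]; apply: nPt.
  by move: e; rewrite mulr1 => ->; exact: (idealM_r idP).
have ex : exists n, `[< exists2 s, S s & #|cl s| = n >].
  by exists #|cl 1|; apply/asboolP; exists 1.
have bd n : `[< exists2 s, S s & #|cl s| = n >] -> (n <= #|T|)%N.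
  by move=> /asboolP[s _ <-]; exact: max_card.
case: (ex_maxnP ex bd) => n /asboolP[s [As nls] en] maxn.
have annq w : A w -> A (q%:R * w) /\ ann s (q%:R * w).
  move=> Aw; split; first exact: AM.
  by split; [exact: AM|rewrite -mulrA; apply: locdiv_refl; exact: AM].
have maxs s' : S s' -> ann s `<=` ann s' -> ann s' `<=` ann s.
  move=> Ss' sub b [Ab lb].
  have scl : cl s \subset cl s'.
    apply/fintype.subsetP => x; rewrite inE => /asboolP[b0 /sub h <-].
    by rewrite inE; apply/asboolP; exists b0.
  have ecl : cl s = cl s'.
    by apply/eqP; rewrite eqEcard scl en; apply: maxn; apply/asboolP; exists s'.
  have : c b \in cl s by rewrite ecl inE; apply/asboolP; exists b.
  rewrite inE => /asboolP[b0 [Ab0 lb0] ecb].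
  have [w Aw ew] := cP b b0 Ab Ab0 (esym ecb).
  split=> //; rewrite -(subrK b0 b) ew mulrDl; apply: locdivD => //.
  by rewrite -mulrA; apply: locdiv_refl; exact: AM.
have prAnn : is_prime_ideal A (ann s).
  split.
  - split=> [b []//| |x y [Ax lx] [Ay ly]|a x Aa [Ax lx]].
    + by split; [exact: subring0|rewrite mul0r -(mulr0 q%:R); apply: locdiv_refl; exact: subring0].
    + by split; [exact: subringD|rewrite mulrDl; exact: locdivD].
    + by split; [exact: AM|rewrite -mulrA; exact: locdivM].
  - by move=> [_]; rewrite mul1r.
  - move=> x y Ax Ay [_ lxy]; have [ly|nly] := pselect (locdiv q%:R (y * s)); first by right.
    left; apply: (maxs (y * s)).
    + by split=> //; exact: AM.
    + by move=> b [Ab lb]; split=> //; rewrite mulrCA; exact: locdivM.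
    + by split=> //; rewrite mulrA.
exists s; split=> // m Pm.
have sub : ann s `<=` P.
  move=> b [Ab lb]; apply: contrapT => nPb; apply: nls; exact: locdiv_cancel lb.
have := @prime_over_max _ A A (ann s) P q sA sA iA (@subset_refl _ _) q_pr prAnn prP _ sub m (PA Pm) Pm.
by case=> //; rewrite -(mulr1 q%:R); exact: (annq 1 A1).2.
Qed.

(** Multiplying the relation by [t ^+ j.-1] gives a monic equation for [t * g] with coefficients in
    [A]. *)
Lemma alint_root_locdiv (g t v : E) i j : (i < j)%N -> A t -> A v ->
  t * g ^+ j = t * g ^+ i - v -> alint (t * g).
Proof.
move=> ij At Av e.
pose p : {poly E} := 'X^j - (t ^+ (j - i) *: 'X^i - (v * t ^+ j.-1)%:P).
have sp : (size (t ^+ (j - i) *: 'X^i - (v * t ^+ j.-1)%:P)%R < size ('X^j : {poly E}))%N.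
  rewrite size_polyXn ltnS; apply: leq_trans (size_polyD _ _) _; rewrite geq_max size_polyN.
  rewrite (leq_trans (size_scale_leq _ _)) ?size_polyXn //=.
  by apply: leq_trans (size_polyC_leq1 _) _; exact: leq_ltn_trans ij.
have mp : p \is monic by rewrite monicE lead_coefDl ?size_polyN // lead_coefXn.
have j0 : (0 < j)%N by exact: leq_ltn_trans ij.
apply: (integral_root_monic mp).
  rewrite /root !hornerE; apply/eqP.
  have -> : (t * g) ^+ j = t ^+ j.-1 * (t * g ^+ j) by rewrite exprMn mulrA -exprSr prednK.
  have -> : t ^+ (j - i) * (t * g) ^+ i = t ^+ j.-1 * (t * g ^+ i).
    by rewrite exprMn !mulrA -exprSr prednK // -exprD subnK // ltnW.
  by rewrite e; ring.
move=> _ /(nthP 0)[k _ <-]; apply: iA; rewrite !coefE.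
apply: (subringB sA); first by case: eqP => // _; exact: subring0.
apply: (subringB sA).
  by apply: AM; [exact: subringX|case: eqP => // _; exact: subring0].
by case: eqP => _; [apply: AM => //; exact: subringX|exact: subring0].
Qed.

(** With [s] from [annihilator_prime], either some [m] in [P] satisfies [m * s = q] up to a unit at
    [P], and this [m] generates [P] locally; or multiplication by [s / q] maps the localised [P]
    into itself. In the latter case [s / q] is locally integral, so [q] would divide [s], which was
    excluded. *)
Lemma local_generator : exists2 b, P b & forall m, P m -> locdiv b m.
Proof.
have [s [As nls sP]] := annihilator_prime.
have [[m [t0 [w0 [Pm At0 nPt0 [[Aw0 nPw0] e0]]]]]|no] := pselect (exists m t w,
   [/\ P m, A t, ~ P t & (A w /\ ~ P w) /\ t * (m * s) = q%:R * w]).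
  exists m => // m' Pm'; have [t1 [w1 [At1 nPt1 Aw1 e1]]] := sP m' Pm'.
  exists (w0 * t1), (t0 * w1); split; [exact: AM|exact: (primeNM prP)|exact: AM|].
  apply: (mulfI q0); have s0 : s != 0.
    by apply: contra_notN nls => /eqP->; rewrite -(mulr0 q%:R); apply: locdiv_refl; exact: subring0.
  transitivity (q%:R * w0 * (t1 * m')); first by ring.
  rewrite -e0; transitivity (t0 * m * (t1 * (m' * s))); first by ring.
  by rewrite e1; ring.
exfalso; apply: nls.
have step w : P w -> exists w' t', [/\ P w', A t', ~ P t' & t' * (w * s) = q%:R * w'].
  move=> Pw; have [t' [w' [At' nPt' Aw' e']]] := sP w Pw.
  exists w', t'; split=> //; apply: contrapT => nPw'.
  by apply: no; exists w, t', w'.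
pose g := s / q%:R.
have /choice[f fP] : forall i, exists wt : E * E,
    [/\ P wt.1, A wt.2, ~ P wt.2 & wt.2 * (q%:R * g ^+ i) = wt.1].
  elim=> [|i [[w t] /= [Pw At nPt e]]].
    by exists (q%:R, 1); split=> //=; [exact: primeN1 prP|rewrite mul1r expr0 mulr1].
  have [w' [t' [Pw' At' nPt' e']]] := step w Pw.
  exists (w', t' * t); split=> //=; [exact: AM|exact: (primeNM prP)|].
  apply: (mulfI q0); rewrite -e' -e exprS /g; field; exact: q0.
(* Integrality of [g = s / q] by pigeonhole on its powers. Only [q * g ^+ i] is known to be locally
   in [P], so the residues are taken modulo [q * q] to leave a factor [q] after the division by
   [q]. *)
have qq0 : (0 < q * q)%N by rewrite muln_gt0 prime_gt0.
have [T [c cP]] := finA qq0.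
have [i [j [ij]]] := nat_pigeonhole (fun i => (c (f i).1, c (f i).2)).
have [Pwi Ati nPti ei] := fP i; have [Pwj Atj nPtj ej] := fP j.
move=> [/(cP _ _ (PA Pwi) (PA Pwj))[w Aw ew] /(cP _ _ Ati Atj)[u Au eu]].
pose t := (f i).2 * (f j).2; have At : A t by exact: AM.
have nPt : ~ P t by exact: (primeNM prP).
pose v := (f i).2 * w - (f i).1 * u.
have Av : A v by apply: subringB => //; apply: AM => //; exact: PA.
have key : t * g ^+ j = t * g ^+ i - q%:R * v.
  apply: (mulfI q0).
  have -> : q%:R * (t * g ^+ j) = (f i).2 * (f j).1 by rewrite -ej /t; ring.
  have -> : q%:R * (t * g ^+ i - q%:R * v) = (f j).2 * (f i).1 - (q * q)%:R * v.
    by rewrite -ei /t natrM; ring.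
  rewrite /v mulrBr -[(q * q)%:R * (_ * w)]mulrCA -ew -[(q * q)%:R * (_ * u)]mulrCA -eu; ring.
have ig := alint_root_locdiv ij At (AM (AN q) Av) key.
have Atg : A (t * s / q%:R) by apply: closedA => //; [exact: AM|rewrite -mulrA].
by exists t, (t * s / q%:R); split=> //; rewrite [RHS]mulrC divfK.
Qed.

Lemma prime_unit_power t : A t -> ~ P t -> exists2 t', A t' & P (t * t' - 1).
Proof.
move=> At nPt; have [T [c cP]] := finA (prime_gt0 q_pr).
have [i [j [ij /(cP _ _ (subringX sA i At) (subringX sA j At))[w Aw ew]]]] :=
  nat_pigeonhole (fun i => c (t ^+ i)).
exists (t ^+ (j - i).-1); first exact: subringX.
rewrite -exprS prednK ?subn_gt0 //.
have : P (t ^+ i * (1 - t ^+ (j - i))).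
  by rewrite mulrBr mulr1 -exprD subnKC ?(ltnW ij) // ew; exact: (idealM_r idP).
move=> /(primeM prP)[||h|h].
- exact: subringX.
- by apply: subringB => //; exact: subringX.
- by case: nPt; exact: (primeX sA prP At h).
- exact: (ideal_symB sA idP).
Qed.

Lemma ideal_exp2 a b c d : P a -> P b -> P c -> P d -> ideal_exp A P 2 (a * b + c * d).
Proof.
move=> Pa Pb Pc Pd; exists 2%N, (fun i => if i == ord0 then a else c), (fun i => if i == ord0 then b else d).
split=> [i|i|]; first by case: ifP.
  exists 1%N, (fun=> if i == ord0 then b else d), (fun=> 1).
  by split=> [_|_|]; rewrite ?big_ord1 ?mulr1 //; case: ifP.
by rewrite big_ord_recl big_ord1.
Qed.

(** Locally [pi] is a generator times some [w], and [w] in [P] would put [pi] into the square of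
    [P]; so [w] is a unit at [P]. *)
Lemma local_uniformizer pi : P pi -> ~ ideal_exp A P 2 pi -> forall m, P m -> locdiv pi m.
Proof.
move=> Ppi npi m Pm; have [b Pb bP] := local_generator.
have [t [w [At nPt Aw e]]] := bP pi Ppi; have [t1 [w1 [At1 nPt1 Aw1 e1]]] := bP m Pm.
have nPw : ~ P w.
  move=> Pw; apply: npi; have [t' At' Pt'] := prime_unit_power At nPt.
  have -> : pi = b * (w * t') + (- (t * t' - 1)) * pi by rewrite mulrA -e; ring.
  by apply: ideal_exp2 => //; [exact: (idealM_r idP)|exact: (idealN sA idP)].
exists (t1 * w), (t * w1); split; [exact: AM|exact: (primeNM prP)|exact: AM|].
transitivity (t1 * m * w); first by ring.
rewrite e1; transitivity (b * w * w1); first by ring.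
by rewrite -e; ring.
Qed.

Section Inertia.
Variables (h : {rmorphism E -> E}) (pi : E).
Hypothesis hA : forall x, A x -> A (h x).
Hypothesis hP : forall x, A x -> P (h x - x).
Hypothesis hpi : h pi = pi.
Hypothesis Ppi : P pi.
Hypothesis npi : ~ ideal_exp A P 2 pi.

Let piP := local_uniformizer Ppi npi.
Let Api : A pi := PA Ppi.

(** The cofactor of [u - v] in [u ^+ q - v ^+ q] is congruent to [q * v ^+ q.-1] modulo [P], hence
    lies in [P] and supplies one more factor [pi]. *)
Lemma locdiv_exp j u v : A u -> A v -> locdiv (pi ^+ j.+1) (u - v) ->
  locdiv (pi ^+ j.+2) (u ^+ q - v ^+ q).
Proof.
move=> Au Av luv; rewrite subrXX exprSr; apply: locdiv_mul => //.
have [t [w [At nPt Aw e]]] := luv.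
have Puv : P (u - v).
  have : P (t * (u - v)).
    by rewrite e exprS -mulrA; apply: (idealM_r idP) => //; apply: (subringM sA) => //; exact: subringX.
  by move=> /(primeM prP)[||//|//] //; exact: subringB.
apply: piP; apply: (ideal_subl idP (y := \sum_(i < q) v ^+ (q.-1 - i) * v ^+ i)).
  rewrite -sumrB; apply: (ideal_sum idP) => i _; rewrite -mulrBl; apply: (idealM_r idP).
    exact: subringX.
  exact: (idealBX sA idP).
rewrite (eq_bigr (fun=> v ^+ q.-1)) => [|i _]; last by rewrite -exprD subnK // -ltnS prednK ?prime_gt0.
rewrite sumr_const card_ord -mulr_natl; apply: (idealM_r idP) => //; exact: subringX.
Qed.

Lemma locdiv_frob n u v : A u -> A v -> P (u - v) ->
  locdiv (pi ^+ n.+1) (u ^+ (q ^ n) - v ^+ (q ^ n)).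
Proof.
move=> Au Av Puv; elim: n => [|n IH]; first by rewrite expn0 !expr1; exact: piP.
by rewrite expnSr !exprM; apply: locdiv_exp => //; exact: subringX.
Qed.

Lemma prime_frobB u v : A u -> A v -> P (u ^+ q - v ^+ q) -> P (u - v).
Proof.
move=> Au Av Puv; have AB : A (u - v) by exact: subringB.
apply: (primeX sA prP (n := q) AB).
apply: (ideal_subl idP _ Puv); apply: (ideal_symB sA idP).
have := prime_frobD sA prP q_pr Pq AB Av; rewrite subrK opprD addrA addrAC.
by [].
Qed.

Lemma residue_period x : A x -> exists2 d, (0 < d)%N & P (x ^+ (q ^ d) - x).
Proof.
move=> Ax; have [T [c cP]] := finA (prime_gt0 q_pr).
have [i [j [ij /(cP _ _ (subringX sA _ Ax) (subringX sA _ Ax))[w Aw ew]]]] :=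
  nat_pigeonhole (fun i => c (x ^+ (q ^ i))).
exists (j - i)%N; first by rewrite subn_gt0.
have : P (x ^+ (q ^ j) - x ^+ (q ^ i)).
  by apply: (ideal_symB sA idP); rewrite ew; exact: (idealM_r idP).
rewrite -{1}(subnK (ltnW ij)) {ew}; move: (j - i)%N => d; elim: {ij} i => [|i IH]; first by rewrite addn0.
rewrite addnS !expnSr !exprM => Pd; apply: IH; apply: prime_frobB Pd; exact: subringX.
Qed.

(* Modulo P, x is its own (q ^ (d * k))-th power, and h moves such a power only by a
   multiple of pi ^ (d * k + 1). *)
Lemma inertia_locdiv k x : A x -> locdiv (pi ^+ k) (h x - x).
Proof.
elim: k x => [|k IH] x Ax.
  by rewrite -(mul1r (h x - x)) expr0; apply: locdiv_refl; apply: subringB => //; exact: hA.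
have [d d0 Pd] := residue_period Ax.
have Pdk : P (x ^+ (q ^ (d * k)) - x).
  elim: k {IH} => [|k IHk]; first by rewrite muln0 expn0 expr1 subrr; exact: ideal0 idP.
  rewrite mulnS expnD exprM.
  apply: (ideal_transB idP (y := x ^+ (q ^ (d * k)))) => //.
  by apply: (idealBX sA idP) => //; exact: subringX.
have [t [y [At nPt Ay e]]] := piP Pdk.
have nPht : ~ P (h t) by move=> Pht; apply: nPt; exact: (ideal_subr sA idP (hP At)).
set m := x ^+ _ - x in Pdk e.
have -> : h x - x = (h (x ^+ (q ^ (d * k))) - x ^+ (q ^ (d * k))) - (h m - m).
  by rewrite /m rmorphB /=; ring.
apply: locdivB.
  have [t' [w' [At' nPt' Aw' e']]] := locdiv_frob (d * k) (hA Ax) Ax (hP Ax).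
  rewrite rmorphXn /=; exists t', (pi ^+ (d * k - k) * w'); split=> //.
    by apply: (subringM sA) => //; exact: subringX.
  by rewrite e' mulrA -exprD addSn subnKC // leq_pmull.
apply: (locdiv_cancel (u := t * h t)); [by apply: (subringM sA) => //; exact: hA|
  by apply: (primeNM prP) => //; exact: hA|].
have -> : t * h t * (h m - m) = pi * (t * (h y - y) - y * (h t - t)).
  have he : h t * h m = pi * h y by rewrite -rmorphM e rmorphM hpi.
  transitivity (t * (h t * h m) - h t * (t * m)); first by ring.
  by rewrite he e; ring.
rewrite exprS; apply: locdiv_mul; first by rewrite -[X in locdiv _ X]mulr1; exact: locdiv_refl.
by apply: locdivB; apply: locdivM => //; exact: IH.
Qed.

(** If [h x - x] were not 0 it would divide a positive integer [n], and every power of [pi] would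
    divide [n] locally. But by finiteness [n] divides [pi ^+ i - pi ^+ j] for some [i < j];
    divisibility by [pi ^+ i.+1] then puts [1 - pi ^+ (j - i)] into [P], which is absurd. *)
Lemma inertia_trivial x : A x -> h x = x.
Proof.
move=> Ax; apply/eqP; rewrite -subr_eq0; apply/negP => /negP d0.
have Ad : A (h x - x) by apply: subringB => //; exact: hA.
have [n [d' [n0 Ad' en]]] := normA Ad d0.
have ln k : locdiv (pi ^+ k) n%:R.
  by rewrite en mulrC; apply: locdivM => //; exact: inertia_locdiv.
have [T [c cP]] := finA n0.
have [i [j [ij /(cP _ _ (subringX sA _ Api) (subringX sA _ Api))[w Aw ew]]]] :=
  nat_pigeonhole (fun i => c (pi ^+ i)).
have [t [v [At nPt Av e]]] := ln i.+1.
have pi0 : pi != 0.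
  apply: contra_notN npi => /eqP->; have := ideal_exp2 (ideal0 idP) (ideal0 idP) (ideal0 idP) (ideal0 idP).
  by rewrite mul0r addr0.
have key : t * (1 - pi ^+ (j - i)) = pi * (v * w).
  apply: (mulfI (expf_neq0 i pi0)).
  transitivity (t * (pi ^+ i - pi ^+ j)).
    by rewrite -[in RHS](subnKC (ltnW ij)) exprD; ring.
  by rewrite ew mulrA e exprS; ring.
have : P (t * (1 - pi ^+ (j - i))) by rewrite key; apply: (idealM_r idP) => //; exact: (subringM sA).
move=> /(primeM prP)[||//|h1] //; first by apply: subringB => //; exact: subringX.
apply: (primeN1 prP); apply: (ideal_subl idP h1).
by rewrite -(prednK (n := j - i)) ?subn_gt0 // exprS; apply: (idealM_r idP) => //; exact: subringX.
Qed.

End Inertia.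
End LocalUniformizer.

(** * Integers of the fixed field of a subgroup *)

Section FixedIntegers.
Variables (F : splittingFieldType rat) (FC : {rmorphism F -> algC}).
Local Notation G := (gal_of {:F}).
Implicit Types (a b : F) (x y : G).

Lemma alint_dvd_int (d : F) : alint d -> d != 0 ->
  exists n d', [/\ (0 < n)%N, alint d' & n%:R = d * d'].
Proof.
move=> id d0; have [z ez] := gal_norm_int FC id.
have z0 : z != 0.
  by have := gal_norm_neq0 d0; rewrite ez; apply: contra_neq => ->.
exists `|z|%N, ((Num.sg z)%:~R * \prod_(x : G | x != 1%g) x d); split.
- by rewrite absz_gt0.
- by apply: alintM; [exact: alint_int|apply: alint_prod => x _; exact/alint_gal].
- have -> : (`|z|%N%:R : F) = (Num.sg z)%:~R * z%:~R.
    by rewrite -rmorphM /= -normrEsg -abszE -pmulrn.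
  by rewrite -ez (bigD1 1%g) //= gal_id mulrCA.
Qed.

Lemma lagrange_size (theta a : F) : (size (lagrange theta a) <= #|{: G}|)%N.
Proof.
apply: (leq_trans (size_sum _ _ _)); apply/bigmax_leqP => x _; rewrite mul_polyC.
apply: leq_trans (size_scale_leq _ _) _.
rewrite (eq_bigl (mem (predC1 x))) // -big_enum size_prod_XsubC -cardE cardC1.
by rewrite prednK //; apply/card_gt0P; exists x.
Qed.

(** The colouring [c] reads the integer coefficients of [lagrange theta a] modulo [n * N], where [N]
    is a positive integer divisible by [different]: the factor [N] pays for the passage from
    Z[theta] to all integers. *)
Lemma alint_mod_finite n : (0 < n)%N -> exists (T : finType) (c : F -> T), forall a b,
  alint a -> alint b -> c a = c b -> exists2 w, alint w & a - b = n%:R * w.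
Proof.
move=> n0; have [theta [ith sep]] := primitive_exists FC.
have id : alint (different theta) by exact: different_alint.
have d0 : different theta != 0 by exact: different_neq0.
have [N [d' [N0 id' eN]]] := alint_dvd_int id d0.
have /choice[P PP] : forall a, exists p : {poly int}, alint a -> lagrange theta a = map_poly intr p.
  move=> a; have [ia|nia] := pselect (alint a); last by exists 0.
  by have [p ep] := lagrange_int FC ith ia; exists p.
pose m := (n * N)%N; have m0 : (0 < m)%N by rewrite muln_gt0 n0.
exists {ffun 'I_#|{: G}| -> 'I_m.-1.+1}, (fun a => [ffun i : 'I_ _ => inord `|((P a)`_i %% m)%Z|%N]).
move=> a b ia ib /ffunP eab.
have /choice[w wP] : forall i : 'I_#|{: G}|, exists w : int, (P a)`_i - (P b)`_i = m%:Z * w.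
  move=> i; have := congr1 (@nat_of_ord _) (eab i); rewrite !ffunE.
  have lt (z : int) : (`|(z %% m)%Z| < m.-1.+1)%N.
    rewrite prednK // -ltz_nat gez0_abs ?modz_ge0 ?ltz_pmod //.
    by rewrite eqz_nat -lt0n.
  rewrite !inordK // => /(congr1 Posz); rewrite !gez0_abs ?modz_ge0 ?eqz_nat -?lt0n // => /eqP.
  by rewrite eqz_mod_dvd => /dvdzP[w ew]; exists w; rewrite mulrC -ew.
pose W := \sum_i (w i)%:~R * theta ^+ i.
have iW : alint W by apply: alint_sum => i _; apply: alintM; [exact: alint_int|exact: alintX].
exists (d' * W); first exact: alintM.
apply: (mulfI d0); rewrite mulrBr -(lagrange_horner theta a) -(lagrange_horner theta b).
rewrite !(horner_coef_wide _ (lagrange_size theta _)) -sumrB.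
transitivity (m%:R * W); last by rewrite /m natrM eN; ring.
rewrite /W mulr_sumr; apply: eq_bigr => i _.
by rewrite !PP // !coef_map /= -mulrBl -rmorphB /= wP rmorphM /= mulrA.
Qed.

Variable J : {group G}.

Definition Jint : set F := [set a | alint a /\ Jfix J a].

Lemma Jint_subring : is_subring Jint.
Proof.
split=> [|a b [ia fa] [ib fb]|a b [ia fa] [ib fb]]; split.
- exact: alint1.
- by move=> j _; rewrite rmorph1.
- exact: alintB.
- by move=> j jJ; rewrite rmorphB /= fa ?fb.
- exact: alintM.
- by move=> j jJ; rewrite rmorphM /= fa ?fb.
Qed.

Lemma Jint_alint : Jint `<=` @alint F. Proof. by move=> a []. Qed.

Lemma Jfix_div a b : Jfix J a -> Jfix J b -> Jfix J (a / b).
Proof. by move=> fa fb j jJ; rewrite fmorph_div /= fa ?fb. Qed.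

Lemma Jint_closed a b : Jint a -> Jint b -> b != 0 -> alint (a / b) -> Jint (a / b).
Proof. by move=> [_ fa] [_ fb] _ iab; split=> //; exact: Jfix_div. Qed.

Lemma Jfix_nat n : Jfix J n%:R.
Proof. by move=> j _; rewrite rmorph_nat. Qed.

Lemma Jint_mod_finite n : (0 < n)%N -> exists (T : finType) (c : F -> T), forall a b,
  Jint a -> Jint b -> c a = c b -> exists2 w, Jint w & a - b = n%:R * w.
Proof.
move=> n0; have [T [c cP]] := alint_mod_finite n0; exists T, c => a b [ia fa] [ib fb] eab.
have [w iw ew] := cP a b ia ib eab; exists w => //; split=> //.
have -> : w = (a - b) / n%:R by rewrite ew [_ * w]mulrC mulfK // (natF_neq0 FC).
apply: Jfix_div; last exact: Jfix_nat.
by move=> j jJ; rewrite rmorphB /= fa ?fb.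
Qed.

Lemma Jint_dvd_int (d : F) : Jint d -> d != 0 ->
  exists n d', [/\ (0 < n)%N, Jint d' & n%:R = d * d'].
Proof.
move=> [id fd] d0; have [n [d' [n0 id' e]]] := alint_dvd_int id d0.
exists n, d'; split=> //; split=> //.
have -> : d' = n%:R / d by rewrite e mulrC mulKf.
by apply: Jfix_div => //; exact: Jfix_nat.
Qed.

Lemma Jint_prime_over (P : set F) : is_nonzero_prime Jint P -> exists2 q, prime q & P q%:R.
Proof.
move=> nzP; have prP := is_nonzero_prime_ideal nzP; have idP := prime_isideal prP.
have [_ _ _ [d Pd d0]] := nzP.
have [n [d' [n0 id' e]]] := Jint_dvd_int (ideal_sub idP Pd) d0.
have : P n%:R by rewrite e; exact: (idealM_r idP).
rewrite (prod_prime_decomp n0) prime_decompE big_map natr_prod /= => h.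
have [||p pn] := prime_prod Jint_subring prP (r := primes n) (f := fun p => (p ^ logn p n)%:R).
- by move=> p _; exact: (subring_nat Jint_subring).
- by [].
rewrite natrX => /(primeX Jint_subring prP) Pp; exists p.
  by move: pn; rewrite mem_primes => /andP[].
by apply: Pp; exact: (subring_nat Jint_subring).
Qed.

Lemma Jint_inertia q P pi (h : G) : prime q -> is_prime_ideal Jint P -> P q%:R ->
  (forall a, Jint a -> Jint (h a)) -> (forall a, Jint a -> P (h a - a)) ->
  h pi = pi -> P pi -> ~ ideal_exp Jint P 2 pi -> forall a, Jint a -> h a = a.
Proof.
move=> q_pr prP Pq hJ hP hpi Ppi npi a; apply: (inertia_trivial (E := F) Jint_subring Jint_alint _ _ _ _
  q_pr prP Pq (h := h : {rmorphism F -> F}) hJ hP hpi Ppi npi).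
- exact: Jint_closed.
- exact: Jint_mod_finite.
- exact: Jint_dvd_int.
- by move=> n; exact: (natF_neq0 FC).
Qed.

End FixedIntegers.

(** * Characters of the absolute Galois group *)

Lemma algebraic_rat (K : fieldExtType rat) (a : K) : algebraicOver (in_alg K) a.
Proof.
have /polyOverP Qp := minPolyOver 1%AS a.
have /choice[c cP] : forall i, exists k, (minPoly 1%AS a)`_i = k%:A.
  by move=> i; have /vlineP[k ->] := Qp i; exists k.
pose p := \poly_(i < size (minPoly 1%AS a)) c i.
have ep : minPoly 1%AS a = map_poly (in_alg K) p.
  apply/polyP => i; rewrite coef_map coef_poly /=.
  by case: ltnP => h; [rewrite cP|rewrite nth_default // scale0r].
exists p; last by rewrite -ep root_minPoly.
by rewrite -(map_poly_eq0 (in_alg K)) -ep monic_neq0 // monic_minPoly.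
Qed.

Lemma closure_iso (K : fieldExtType rat) (Kb : algClosure K) :
  exists (e : {rmorphism Kb -> algC}) (e' : {rmorphism algC -> Kb}), cancel e e' /\ cancel e' e.
Proof.
pose i : {rmorphism rat -> Kb} := acl_emb Kb \o in_alg K.
have algE (x : Kb) : algebraicOver i x.
  have [p p0 pr] := acl_alg x; apply/integral_algebraic.
  apply: (integral_root (p := map_poly (acl_emb Kb) p)) pr _; first by rewrite map_poly_eq0.
  move=> _ /(nthP 0)[j _ <-]; rewrite coef_map /=.
  have [r r0 rr] := algebraic_rat p`_j; apply/integral_algebraic; exists r => //.
  have -> : map_poly i r = map_poly (acl_emb Kb) (map_poly (in_alg K) r).
    by rewrite -map_poly_comp; apply: eq_map_poly.
  by rewrite fmorph_root.
have [e [f ef fe]] := closure_embedding algE.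
have fa : zmod_morphism f by move=> x y; apply: (can_inj ef); rewrite rmorphB /= !fe.
have fm : GRing.monoid_morphism f.
  split=> [|x y]; apply: (can_inj ef); first by rewrite fe rmorph1.
  by rewrite [RHS]rmorphM /= !fe.
pose faM := GRing.isZmodMorphism.Build algC Kb f fa.
pose fmM := GRing.isMonoidMorphism.Build algC Kb f fm.
have fr : {rmorphism algC -> Kb} := HB.pack f faM fmM.
by exists e, (HB.pack f faM fmM : {rmorphism algC -> Kb}).
Qed.

Section AbsoluteGalois.
Variables (K : fieldType) (Kb : algClosure K).
Implicit Types g h : absGal Kb.

Lemma absGal_rmorph g : exists f : {rmorphism Kb -> Kb}, f =1 g.
Proof.
pose fa := GRing.isZmodMorphism.Build Kb Kb g (gal_zmod_morphism g).
pose fm := GRing.isMonoidMorphism.Build Kb Kb g (gal_monoid_morphism g).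
by exists (HB.pack (gal_fun g) fa fm : {rmorphism Kb -> Kb}).
Qed.

Lemma absGal_build (f f' : {rmorphism Kb -> Kb}) : cancel f f' -> cancel f' f ->
  (forall b, f (acl_emb Kb b) = acl_emb Kb b) -> exists g : absGal Kb, g =1 f.
Proof.
move=> ff' f'f fK.
by exists (@AbsGal _ _ f (rmorphB f) (conj (rmorph1 f) (rmorphM f)) (Bijective ff' f'f) fK).
Qed.

Lemma absGalM g h x : (g * h)%g x = g (h x). Proof. by []. Qed.
Lemma absGalVK g x : (g^-1)%g (g x) = x.
Proof. by rewrite -absGalM mulVg. Qed.
Lemma absGalKV g x : g ((g^-1)%g x) = x.
Proof. by rewrite -absGalM mulgV. Qed.

End AbsoluteGalois.

Section CharacterLevel.
Variables (R : realType) (K : fieldType) (Kb : algClosure K).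
Local Notation C := (complexNumField R).
Implicit Types (chi : dirichletChar R Kb) (g h : absGal Kb) (s : seq Kb).

Lemma dchar1 chi : chi 1%g = 1.
Proof.
by apply: (mulfI (dchar_neq0 chi 1%g)); rewrite -dcharM mulg1 mulr1.
Qed.

Lemma dcharV chi g : chi (g^-1)%g = (chi g)^-1.
Proof.
apply: (mulfI (dchar_neq0 chi g)).
by rewrite -dcharM mulgV dchar1 mulfV // dchar_neq0.
Qed.

Lemma dcharJ chi g h : chi (h * g * h^-1)%g = chi g.
Proof. by rewrite !dcharM dcharV mulrAC mulfV ?mul1r // dchar_neq0. Qed.

Lemma dcharX chi n g : (chi ^+ n)%g g = chi g ^+ n.
Proof.
elim: n => [|n IH]; first by rewrite expg0 expr0.
by rewrite expgS exprS -IH.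
Qed.

Lemma krull_nbhsP g (U : set (absGal Kb)) :
  nbhs g U <-> exists s, forall h, {in s, h =1 g} -> U h.
Proof.
rewrite nbhsE; split=> [[B [oB Bg] BU]|[s sU]].
  move: oB => [D' _ eB]; move: Bg; rewrite -eB => -[i D'i ig].
  exists i.2 => h hg; apply: BU; rewrite -eB; exists i => // x xs.
  by rewrite hg // ig.
exists (krull_base (g, s)); last by move=> h hs; exact: sU.
split=> //; exists [set (g, s)] => //; first by rewrite bigcup_set1.
Qed.

Definition level chi s := forall g, {in s, g =1 id} -> chi g = 1.

(** For [z != 1] the powers of [z] sum to 0, so [n] is the sum of the [1 - z ^+ i], of norm at most
    [n ^ 2 * |z - 1|]. *)
Lemma root_of_unity_close n (z : C) : (0 < n)%N -> z ^+ n = 1 -> `|z - 1| < n%:R^-1 -> z = 1.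
Proof.
move=> n0 zn lt; apply/eqP; rewrite -subr_eq0; apply/negP => /negP z1.
have nz : `|z| = 1.
  have := congr1 (fun x : C => `|x|) zn; rewrite normrX normr1 => /eqP.
  by rewrite pexpr_eq1 // => /eqP.
have s0 : \sum_(i < n) z ^+ i = 0.
  apply/eqP; have := subrX1 z n; rewrite zn subrr => /esym/eqP.
  by rewrite mulf_eq0 (negbTE z1).
have bi (i : nat) : `|1 - z ^+ i| <= i%:R * `|z - 1|.
  rewrite distrC subrX1 normrM mulrC ler_wpM2r //.
  apply: le_trans (ler_norm_sum _ _ _) _.
  under eq_bigr => j _ do rewrite normrX nz expr1n.
  by rewrite sumr_const card_ord.
have : n%:R <= \sum_(i < n) n%:R * `|z - 1|.
  have {1}-> : n%:R = `|\sum_(i < n) (1 - z ^+ i)|.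
    by rewrite sumrB s0 subr0 sumr_const card_ord normr_nat.
  apply: le_trans (ler_norm_sum _ _ _) _; apply: ler_sum => i _.
  by apply: le_trans (bi i) _; rewrite ler_wpM2r // ler_nat ltnW.
have n0' : 0 < n%:R :> C by rewrite ltr0n.
rewrite sumr_const card_ord -[leRHS]mulr_natl -[leLHS]mulr1 ler_pM2l //.
by rewrite -ler_pdivrMl // mulr1 => /(lt_le_trans lt); rewrite ltxx.
Qed.

Lemma level_exists chi l : (0 < l)%N -> (forall g, chi g ^+ l = 1) -> exists s, level chi s.
Proof.
move=> l0 chil.
have e0 : 0 < l%:R^-1 :> C by rewrite invr_gt0 ltr0n.
have /krull_nbhsP[s sP] : nbhs (1%g : absGal Kb) [set g | `|chi 1%g - chi g| < l%:R^-1].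
  have := @dchar_continuous _ _ _ chi 1%g; move=> /cvgrPdist_lt; exact.
exists s => g gs; apply: (root_of_unity_close l0) => //.
by have /= := sP g gs; rewrite dchar1 distrC.
Qed.

Lemma level_continuous (f : absGal Kb -> C) s :
  (forall g h, f (g * h)%g = f g * f h) -> (forall g, {in s, g =1 id} -> f g = 1) -> continuous f.
Proof.
move=> fM fs g; suff : f @ nbhs g --> nbhs (f g) by [].
apply/(@cvgrPdist_lt _ _ _ (nbhs g)) => e e0; apply/krull_nbhsP.
exists s => h hg /=; have -> : h = (g * (g^-1 * h))%g by rewrite mulKVg.
rewrite fM [f (g^-1 * h)%g]fs ?mulr1 ?subrr ?normr0 // => x xs.
by rewrite absGalM hg // absGalVK.
Qed.

End CharacterLevel.

Section OrderL.
Variables (R : realType) (K : fieldType) (Kb : algClosure K) (l : nat).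
Hypothesis l_pr : prime l.
Implicit Types (chi : dirichletChar R Kb) (g h : absGal Kb).

Lemma charGen_exp chi : chi \in charGen l -> forall g, chi g ^+ l = 1.
Proof.
rewrite inE => /(_ [set chi | forall g, chi g ^+ l = 1]); apply; split.
  split; first by rewrite inE => g; rewrite /= expr1n.
  move=> x y; rewrite !inE => xl yl g /=; rewrite exprMn exprVn xl yl.
  by rewrite invr1 mulr1.
by move=> x [_ xl _] g; rewrite -dcharX xl.
Qed.

(** As [l] is prime, a non-trivial character killed by [l] has order exactly [l] and is one of the
    generators. With [charGen_exp] this identifies the generated group with the [l]-torsion. *)
Lemma charGenP chi : (forall g, chi g ^+ l = 1) -> chi \in charGen l.
Proof.
move=> chil; have chil1 : (chi ^+ l)%g = 1%g.
  by apply: dchar_ext => g; rewrite dcharX chil.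
have [->|c1] := eqVneq chi 1%g.
  by have [] := generated_group_closed [set chi : dirichletChar R Kb | has_order chi l].
rewrite inE => H [_]; apply; split=> //; first exact: prime_gt0.
move=> m /andP[m0 ml] cm; move/eqP: c1; apply.
have cop : coprime m l by rewrite coprime_sym prime_coprime // gtnNdvd.
have [u v euv _] := egcdnP l m0.
have : (chi ^+ (u * m))%g = (chi ^+ (v * l + gcdn m l))%g by rewrite euv.
rewrite (eqP cop) mulnC expgM cm expg1n mulnC addn1 expgS expgM chil1 expg1n mulg1.
by move=> <-.
Qed.

End OrderL.

(** * Reading characters on a finite Galois group *)

Section Bridge.
Variables (R : realType) (K : fieldExtType rat) (Kb : algClosure K).
Variables (F : splittingFieldType rat).
Local Notation G := (gal_of {:F}).
Local Notation C := (complexNumField R).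

(* [tw_k] and [tw_i] exhibit [F] as a field between [K] and [Kb]. *)
Record tower := Tower {
  tw_k : {rmorphism K -> F};
  tw_i : {rmorphism F -> Kb};
  tw_e : {rmorphism Kb -> algC};
  tw_e' : {rmorphism algC -> Kb};
  tw_ik : forall b, tw_i (tw_k b) = acl_emb Kb b;
  tw_eK : cancel tw_e tw_e';
  tw_e'K : cancel tw_e' tw_e }.

Variable T : tower.
Local Notation k := (tw_k T).
Local Notation i := (tw_i T).
Local Notation e := (tw_e T).
Local Notation e' := (tw_e' T).
Local Notation ik := (tw_ik T).
Local Notation eK := (tw_eK T).
Local Notation e'K := (tw_e'K T).
Implicit Types (a : F) (b : K) (x y : G) (g h : absGal Kb).

Definition tw_FC : {rmorphism F -> algC} := e \o i.
Local Notation FC := tw_FC.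

Lemma twE a : FC a = e (i a). Proof. by []. Qed.

Definition stabK_set : {set G} := finset (fun x : G => x (k (kgen K)) == k (kgen K)).

Lemma stabK_setP x : reflect (forall b, x (k b) = k b) (x \in stabK_set).
Proof.
apply: (iffP idP) => [|xk]; last by rewrite inE xk.
rewrite inE => /eqP xk b.
exact: (@rmorph_kgen_ext K F ((x : {rmorphism F -> F}) \o k : {rmorphism K -> F}) k).
Qed.

Lemma stabK_group_set : group_set stabK_set.
Proof.
apply/group_setP; split=> [|x y /stabK_setP xk /stabK_setP yk].
  by apply/stabK_setP => b; rewrite gal_id.
by apply/stabK_setP => b; rewrite galMf xk yk.
Qed.

Definition stabK : {group G} := Group stabK_group_set.

Lemma stabKP x : reflect (forall b, x (k b) = k b) (x \in stabK).
Proof. exact: stabK_setP. Qed.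

Lemma stabK_fixed a : Jfix stabK a -> exists b, a = k b.
Proof.
move=> fa; have [|b eb] := @fixed_by_stabilizer K (FC \o k : {rmorphism K -> algC}) (FC a).
  move=> nu nuk; have [x xP] := gal_restrict FC nu.
  rewrite xP; congr (FC _); apply: fa; apply/stabKP => b; apply: (fmorph_inj FC).
  by rewrite -xP; exact: (nuk b).
by exists b; exact: (fmorph_inj FC).
Qed.

Lemma Jfix_k b : Jfix stabK (k b).
Proof. by move=> x /stabKP. Qed.

(** [x] is the restriction of [g] to [F]. *)
Definition lifts g x := forall a, g (i a) = i (x a).

Lemma lifts_uniq g x y : lifts g x -> lifts g y -> x = y.
Proof. by move=> gx gy; apply: gal_extf => a; apply: (fmorph_inj i); rewrite -gx -gy. Qed.

Lemma lifts_exists x : x \in stabK -> exists g, lifts g x.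
Proof.
move=> /stabKP xk; have [nu nuP] := gal_lift FC x.
pose f : {rmorphism Kb -> Kb} := e' \o nu \o e.
pose f' : {rmorphism Kb -> Kb} := e' \o algC_invaut nu \o e.
have fi a : f (i a) = i (x a).
  by apply: (can_inj eK); rewrite /f /= e'K -[nu _]/(nu (FC a)) nuP.
have [|||g gP] := @absGal_build K Kb f f'.
- by move=> z; rewrite /f /f' /= e'K algC_autK eK.
- by move=> z; rewrite /f /f' /= e'K algC_invautK eK.
- by move=> b; rewrite -ik fi xk.
by exists g => a; rewrite gP fi.
Qed.

Lemma res_exists g : exists2 x, x \in stabK & lifts g x.
Proof.
have [f fP] := absGal_rmorph g.
pose nu : {rmorphism algC -> algC} := e \o f \o e'.
have [x xP] := gal_restrict FC nu.
have lx : lifts g x.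
  move=> a; apply: (can_inj eK).
  by have := xP a; rewrite /nu /= eK fP.
exists x => //; apply/stabKP => b; apply: (fmorph_inj i).
by rewrite -lx ik gal_fix.
Qed.

Lemma liftsM g h x y : lifts g x -> lifts h y -> lifts (g * h)%g (y * x)%g.
Proof. by move=> gx hy a; rewrite absGalM hy gx galMf. Qed.

Lemma lifts1 : lifts 1%g 1%g.
Proof. by move=> a; rewrite gal_id. Qed.

Lemma liftsV g x : lifts g x -> lifts (g^-1)%g (x^-1)%g.
Proof.
move=> gx a; apply: (can_inj (absGalVK g)).
by rewrite absGalKV gx galVf.
Qed.

Section Char.
Variable chi : dirichletChar R Kb.
Hypothesis chi_level : forall g, lifts g 1%g -> chi g = 1.

(** The character induced by [chi] on [stabK], evaluated through an arbitrary lift. An element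
    outside [stabK] has no lift and receives the value [chi 1]. *)
Definition chiF x : C := chi (xget 1%g [set g | lifts g x]).

Lemma chiF_lifts g x : lifts g x -> chi g = chiF x.
Proof.
move=> gx; rewrite /chiF; case: xgetP => [h _ hx|no]; last by have := no g gx.
have : chi (h^-1 * g)%g = 1.
  by apply: chi_level; rewrite -(mulgV x); apply: liftsM => //; exact: liftsV.
rewrite dcharM dcharV => e1; apply: (mulfI (invr_neq0 (dchar_neq0 chi h))).
by rewrite e1 mulVf // dchar_neq0.
Qed.

Lemma chiFM x y : x \in stabK -> y \in stabK -> chiF (x * y)%g = chiF x * chiF y.
Proof.
move=> /lifts_exists[g gx] /lifts_exists[h hy].
by rewrite -(chiF_lifts gx) -(chiF_lifts hy) -(chiF_lifts (liftsM hy gx)) dcharM mulrC.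
Qed.

Lemma chiF1 : chiF 1%g = 1.
Proof. by rewrite -(chiF_lifts lifts1) dchar1. Qed.

Lemma chiFV x : x \in stabK -> chiF (x^-1)%g = (chiF x)^-1.
Proof.
move=> /lifts_exists[g gx].
by rewrite -(chiF_lifts gx) -(chiF_lifts (liftsV gx)) dcharV.
Qed.

Lemma chiF_neq0 x : chiF x != 0. Proof. exact: dchar_neq0. Qed.

Lemma chiFJ x y : x \in stabK -> y \in stabK -> chiF (y * x * y^-1)%g = chiF x.
Proof.
by move=> xH yH; rewrite !chiFM ?groupM ?groupV // chiFV // mulrAC mulfV ?mul1r // chiF_neq0.
Qed.

Definition kerF_set : {set G} := finset (fun x => (x \in stabK) && (chiF x == 1)).

Lemma kerF_setP x : reflect (x \in stabK /\ chiF x = 1) (x \in kerF_set).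
Proof. by rewrite [x \in kerF_set]inE; apply: (iffP andP) => -[? /eqP]. Qed.

Lemma kerF_group_set : group_set kerF_set.
Proof.
apply/group_setP; split=> [|x y /kerF_setP[xH cx] /kerF_setP[yH cy]].
  by apply/kerF_setP; rewrite group1 chiF1.
by apply/kerF_setP; rewrite groupM // chiFM // cx cy mulr1.
Qed.

Definition kerF : {group G} := Group kerF_group_set.

Lemma kerFP x : reflect (x \in stabK /\ chiF x = 1) (x \in kerF).
Proof. exact: kerF_setP. Qed.

Lemma charFieldP z : charField chi z <-> exists2 a, Jfix kerF a & z = i a.
Proof.
split=> [cz|[a fa ->] g cg].
  have [a ea] : exists a, z = i a.
    have [|a ea] := @fixed_by_stabilizer F FC (e z).
      move=> nu nuF.
      pose f : {rmorphism Kb -> Kb} := e' \o nu \o e.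
      pose f' : {rmorphism Kb -> Kb} := e' \o algC_invaut nu \o e.
      have fi a : f (i a) = i a.
        by apply: (can_inj eK); rewrite /f /= e'K -[nu _]/(nu (FC a)) nuF.
      have [|||g gP] := @absGal_build K Kb f f'.
      - by move=> y; rewrite /f /f' /= e'K algC_autK eK.
      - by move=> y; rewrite /f /f' /= e'K algC_invautK eK.
      - by move=> b; rewrite -ik fi.
      have gz : g z = z by apply: cz; apply: chi_level => a; rewrite gP fi gal_id.
      by apply: (can_inj e'K); rewrite eK -[RHS]gz gP.
    by exists a; apply: (can_inj eK).
  exists a => // x /kerFP[xH cx]; have [g gx] := lifts_exists xH.
  apply: (fmorph_inj i); rewrite -gx -ea; apply: cz.
  by rewrite (chiF_lifts gx).
have [x xH gx] := res_exists g.
by rewrite gx fa //; apply/kerFP; rewrite -(chiF_lifts gx).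
Qed.

Lemma charIntP z : charInt chi z <-> exists2 a, Jint kerF a & z = i a.
Proof.
split=> [[/charFieldP[a fa ->] /(alint_rmorph i a) ia]|[a [ia fa] ->]]; first by exists a.
by split; [apply/charFieldP; exists a|exact/(alint_rmorph i a)].
Qed.

End Char.

Lemma intKP b : ringOfIntegers [set: K] b <-> Jint stabK (k b).
Proof.
split=> [[_ ib]|[ib _]]; last by split=> //; exact/(alint_rmorph k b).
by split; [exact/(alint_rmorph k b)|exact: Jfix_k].
Qed.

End Bridge.

Lemma tower_exists (K : fieldExtType rat) (Kb : algClosure K) (e : {rmorphism Kb -> algC})
    (e' : {rmorphism algC -> Kb}) (F : splittingFieldType rat) (FC : {rmorphism F -> algC}) :
  cancel e e' -> cancel e' e -> (exists a, FC a = e (acl_emb Kb (kgen K))) ->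
  exists T : tower Kb F, tw_FC T =1 FC /\ tw_e T = e.
Proof.
move=> ee' e'e hk.
have [k kP] := @field_embedding K F FC (e \o acl_emb Kb : {rmorphism K -> algC}) hk.
pose i : {rmorphism F -> Kb} := e' \o FC.
have ik b : i (k b) = acl_emb Kb b by rewrite /i /= kP /= ee'.
by exists (Tower ik ee' e'e); split=> // a; rewrite /tw_FC /= e'e.
Qed.

Section ImageIdeals.
Variables (E1 E2 : fieldType) (f : {rmorphism E1 -> E2}).
Implicit Types (A I P : set E1).

Lemma fmorph_image I x : (f @` I) (f x) = I x.
Proof. by rewrite propeqE; split=> [[y Iy /(fmorph_inj f) <-]|Ix]; [|exists x]. Qed.

Lemma nonzero_prime_image A P : is_nonzero_prime A P -> is_nonzero_prime (f @` A) (f @` P).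
Proof.
move=> [[PA P0 PD PM] P1 Pp [d Pd d0]]; split.
- split=> [_ [x Px <-]||_ _ [x Px <-] [y Py <-]|_ _ [a Aa <-] [x Px <-]].
  + by exists x => //; exact: PA.
  + by exists 0 => //; rewrite rmorph0.
  + by exists (x + y); rewrite ?rmorphD //; exact: PD.
  + by exists (a * x); rewrite ?rmorphM //; exact: PM.
- by rewrite -(rmorph1 f) fmorph_image.
- move=> _ _ [x Ax <-] [y Ay <-]; rewrite -rmorphM fmorph_image => /(Pp x y Ax Ay)[?|?].
    by left; exists x.
  by right; exists y.
- by exists (f d); [exists d|rewrite fmorph_eq0].
Qed.

Lemma nonzero_prime_preimage A (P' : set E2) : is_nonzero_prime (f @` A) P' -> is_nonzero_prime A (f @^-1` P').
Proof.
move=> [[PA P0 PD PM] P1 Pp [d Pd d0]]; split.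
- split=> [x /PA|||a x Aa]; rewrite ?fmorph_image //=.
  + by rewrite rmorph0.
  + by move=> x y; rewrite rmorphD; exact: PD.
  + by rewrite rmorphM; apply: PM; exists a.
- by rewrite /= rmorph1.
- by move=> x y Ax Ay; rewrite /= rmorphM; apply: Pp; [exists x|exists y].
- have [x Ax ex] := PA d Pd; exists x; first by rewrite /= ex.
  by apply: contra_neq d0 => x0; rewrite -ex x0 rmorph0.
Qed.

Lemma image_preimage A (P' : set E2) : P' `<=` f @` A -> f @` (f @^-1` P') = P'.
Proof.
move=> PA; apply/seteqP; split=> [_ [x Px <-] //|y /[dup] Py /PA[x Ax ex]].
by exists x => //=; rewrite ex.
Qed.

Lemma ideal_mul_image (I J : set E1) : ideal_mul (f @` I) (f @` J) = f @` (ideal_mul I J).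
Proof.
apply/seteqP; split=> [z [n [a [b [aI bJ ->]]]]|_ [x [n [a [b [aI bJ ->]]]] <-]].
  have /choice[a' a'P] : forall i, exists y, I y /\ f y = a i by move=> i; have [y ? ?] := aI i; exists y.
  have /choice[b' b'P] : forall i, exists y, J y /\ f y = b i by move=> i; have [y ? ?] := bJ i; exists y.
  exists (\sum_i a' i * b' i).
    by exists n, a', b'; split=> // i; [case: (a'P i)|case: (b'P i)].
  by rewrite rmorph_sum; apply: eq_bigr => i _; rewrite rmorphM /= (a'P i).2 (b'P i).2.
exists n, (f \o a), (f \o b); split=> [i|i|]; [by exists (a i)|by exists (b i)|].
by rewrite rmorph_sum; apply: eq_bigr => i _; rewrite rmorphM.
Qed.

Lemma ideal_exp_image A P n : ideal_exp (f @` A) (f @` P) n = f @` (ideal_exp A P n).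
Proof. by elim: n => [|n IH] //=; rewrite IH ideal_mul_image. Qed.

Lemma cosets_image A P : is_subring A -> is_ideal A P ->
  cosets (f @` A) (f @` P) = (fun c => f @` c) @` cosets A P.
Proof.
move=> sA idP.
have cE x : A x -> [set y | (f @` A) y /\ (f @` P) (y - f x)] = f @` [set y | A y /\ P (y - x)].
  move=> Ax; apply/seteqP; split=> [z [[y Ay <-]]|_ [y [Ay Py] <-]].
    by move=> [w Pw]; rewrite -rmorphB => /(fmorph_inj f) ew; exists y => //; split=> //; rewrite -ew.
  by split; [exists y|rewrite -rmorphB fmorph_image].
apply/seteqP; split=> [c [_ [x Ax <-] <-]|_ [_ [x Ax <-] <-]].
  by rewrite cE //; exists [set y | A y /\ P (y - x)] => //; exists x.
by rewrite -cE //; exists (f x) => //; exists x.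
Qed.

Lemma ideal_norm_image A P : is_subring A -> is_ideal A P -> finite_set (cosets A P) ->
  ideal_norm (f @` A) (f @` P) = ideal_norm A P.
Proof.
move=> sA idP fin; rewrite /ideal_norm cosets_image // fset_set_image //.
rewrite card_imfset //= => c c' ecc; apply/seteqP; split=> x cx.
  by rewrite -(fmorph_image c') -ecc; exists x.
by rewrite -(fmorph_image c) ecc; exists x.
Qed.

End ImageIdeals.

Section NormDivisibility.
Variables (E : fieldType) (A P : set E) (q : nat).
Hypotheses (sA : is_subring A) (prP : is_prime_ideal A P) (q_pr : prime q) (Pq : P q%:R).
Hypothesis fin : finite_set (cosets A P).
Let idP := prime_isideal prP.

Definition coset_of_elt x : set E := [set y | A y /\ P (y - x)].

Lemma coset_eltP x y : A x -> (coset_of_elt x = coset_of_elt y) <-> P (x - y).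
Proof.
move=> Ax; split=> [e|Pxy].
  have : coset_of_elt x x by split; rewrite ?subrr //; exact: ideal0 idP.
  by rewrite e => -[].
apply/seteqP; split=> z [Az Pz]; split=> //.
  exact: (ideal_transB idP Pz).
by apply: (ideal_transB idP Pz); exact: (ideal_symB sA idP).
Qed.

(** Translation by 1 acts on the cosets of [P] with all orbits of length [q]. *)
Lemma prime_dvd_norm : (q %| ideal_norm A P)%N.
Proof.
pose S := fset_set (cosets A P).
have SP c : (c \in S) <-> exists2 x, A x & coset_of_elt x = c.
  by rewrite in_fset_set // inE.
pose shift (c : set E) : set E := [set y | c (y - 1)].
have shiftE x : A x -> shift (coset_of_elt x) = coset_of_elt (x + 1).
  move=> Ax; apply/seteqP; split=> y.
    move=> [Ay Py]; split; last by rewrite opprD addrA addrAC.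
    by rewrite -(subrK 1 y); apply: (subringD sA) => //; exact: subring1.
  move=> [Ay Py]; split; last by rewrite addrAC -addrA -opprD.
  by apply: (subringB sA) => //; exact: subring1.
have A1 x : A x -> A (x + 1) by move=> Ax; apply: (subringD sA) => //; exact: subring1.
have shiftS (c : S) : shift (val c) \in S.
  have /SP[x Ax <-] := valP c; rewrite shiftE //; apply/SP.
  by exists (x + 1) => //; exact: A1.
pose f (c : S) : S := [` shiftS c]%fset.
have fE n (c : S) x : A x -> coset_of_elt x = val c -> val (iter n f c) = coset_of_elt (x + n%:R).
  move=> Ax ex; elim: n => [|n IH]; first by rewrite addr0.
  rewrite iterS /= IH shiftE -?addrA ?natr1 //.
  by apply: (subringD sA) => //; exact: subring_nat.
have f_inj : injective f.
  move=> c c' /(congr1 val) /= e; apply: val_inj; apply/seteqP.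
  have s1 (u v : set E) : shift u = shift v -> u `<=` v.
    move=> uv y uy; have : shift u (y + 1) by rewrite /shift /= addrK.
    by rewrite uv /shift /= addrK.
  by split; exact: s1.
have q0 := prime_gt0 q_pr.
have itq c m n : (m < q)%N -> (n < q)%N -> iter m f c = iter n f c -> m = n.
  wlog le : m n / (m <= n)%N.
    by move=> w mq nq; case: (leqP m n) => [le|/ltnW le] e; [exact: w|apply/esym; exact: w].
  move=> mq nq /(congr1 val); have /SP[x Ax ex] := valP c; rewrite !(fE _ c x) // => /esym e.
  have : P (n - m)%N%:R.
    have := (coset_eltP (x + m%:R) (subringD sA Ax (subring_nat sA n))).1 e.
    by rewrite natrB // opprD addrACA subrr add0r.
  move=> /(prime_over_nat sA prP q_pr Pq)/dvdn_leq; rewrite subn_gt0.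
  by case: ltnP => [lt /(_ isT)|le' _]; [lia|apply/eqP; rewrite eqn_leq le le'].
have itq1 c : iter q f c = c.
  have /SP[x Ax ex] := valP c; apply: val_inj; rewrite (fE _ c x) // -ex; apply/coset_eltP.
    by apply: (subringD sA) => //; exact: subring_nat.
  by rewrite addrC addKr.
have ordq c : fingraph.order f c = q.
  have cyc : fcycle f (traject f c q).
    rewrite -(prednK q0) /=.
    have {3}-> : c = iter q.-1 f (f c) by rewrite -iterSr prednK // itq1.
    by rewrite -trajectSr; exact: fpath_traject.
  have un : uniq (traject f c q).
    apply/(uniqP c) => m n; rewrite !inE size_traject => mq nq.
    by rewrite !nth_traject //; exact: itq.
  have cin : c \in traject f c q by rewrite -(prednK q0) inE eqxx.
  by rewrite (order_cycle cyc un cin) size_traject.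
have := @fcard_order_set _ f f_inj q [pred c | true].
rewrite /ideal_norm -/S cardfE => <- //; first exact: dvdn_mull.
by apply/fintype.subsetP => c _; rewrite inE ordq.
Qed.

Lemma ideal_norm_gt1 : (1 < ideal_norm A P)%N.
Proof.
have := dvdn_leq _ prime_dvd_norm => h; apply: leq_trans (h _); first exact: prime_gt1.
rewrite /ideal_norm cardfs_gt0; apply/fset0Pn; exists (coset_of_elt 0).
by rewrite in_fset_set // inE; exists 0 => //; exact: subring0.
Qed.

End NormDivisibility.

(** * Frobenius elements at unramified primes *)

Section TowerPrimes.
Variables (K : fieldExtType rat) (Kb : algClosure K) (F : splittingFieldType rat).
Variable T : tower Kb F.
Local Notation G := (gal_of {:F}).
Local Notation k := (tw_k T).
Local Notation i := (tw_i T).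
Local Notation FC := (tw_FC T).
Local Notation H := (stabK T).
Local Notation OK := (ringOfIntegers [set: K]).

Lemma OKE : OK = @alint K.
Proof. by apply/seteqP; split=> b //; case. Qed.

Lemma OK_image : k @` OK = Jint H.
Proof.
apply/seteqP; split=> [_ [b /(intKP T) ib <-] //|a [ia /stabK_fixed[b eb]]].
by subst a; exists b => //; apply/(intKP T); split=> //; exact: Jfix_k.
Qed.

Lemma OK_subring : is_subring OK.
Proof. by rewrite OKE; exact: alint_subring. Qed.

Section Prime.
Variable p : set K.
Hypothesis nzp : is_nonzero_prime OK p.

Lemma primeK_image : is_nonzero_prime (Jint H) (k @` p).
Proof. by rewrite -OK_image; exact: nonzero_prime_image. Qed.

Lemma primeK_over : exists2 q, prime q & p q%:R.
Proof.
have [q q_pr] := Jint_prime_over FC primeK_image.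
by rewrite -(rmorph_nat k) fmorph_image => pq; exists q.
Qed.

Lemma primeK_finite : finite_set (cosets OK p).
Proof.
have [q q_pr pq] := primeK_over.
have idp := prime_isideal (is_nonzero_prime_ideal nzp).
have [U [c cP]] := Jint_mod_finite FC H (prime_gt0 q_pr).
pose co b := [set y | OK y /\ p (y - b)].
have /choice[r rP] : forall u : U, exists b, (exists2 b', OK b' & c (k b') = u) -> OK b /\ c (k b) = u.
  move=> u; have [[b ? ?]|no] := pselect (exists2 b', OK b' & c (k b') = u); first by exists b.
  by exists 0 => /no.
apply: (@sub_finite_set _ _ ((fun u => co (r u)) @` [set: U])); last first.
  by apply: finite_image; exact: finite_finset.
move=> _ [b Ob <-]; exists (c (k b)) => //.
have [Or er] := rP (c (k b)) (ex_intro2 _ _ b Ob erefl).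
apply/(coset_eltP OK_subring (is_nonzero_prime_ideal nzp)) => //.
have [w iw ew] := cP _ _ ((intKP T _).1 Or) ((intKP T _).1 Ob) er.
rewrite -(fmorph_image k p) rmorphB ew -(rmorph_nat k).
have := idealM_r (prime_isideal (is_nonzero_prime_ideal primeK_image)) iw; apply.
by rewrite fmorph_image.
Qed.

Lemma primeK_conj q (Q : set F) : prime q -> p q%:R -> is_prime_ideal (@alint F) Q -> Q q%:R ->
  exists x : G, forall b, alint b -> (p b <-> Q (x (k b))).
Proof.
move=> q_pr pq prQ Qq; have nzP := primeK_image.
have Pq : (k @` p) q%:R by rewrite -(rmorph_nat k) fmorph_image.
have [x xP] := primes_conjugate FC q_pr (Jint_subring H) (@Jint_alint _ H)
  (is_nonzero_prime_ideal nzP) Pq prQ Qq.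
exists x => b ib; rewrite -(fmorph_image k p); apply: xP.
by apply/(intKP T); rewrite OKE.
Qed.

Lemma primeK_dvd_norm q : prime q -> p q%:R -> (q %| ideal_norm OK p)%N.
Proof.
move=> q_pr pq; apply: prime_dvd_norm => //; first exact: OK_subring.
  exact: is_nonzero_prime_ideal.
exact: primeK_finite.
Qed.

Lemma primeK_norm_gt1 : (1 < ideal_norm OK p)%N.
Proof.
have [q q_pr pq] := primeK_over; apply: (ideal_norm_gt1 OK_subring _ q_pr pq).
  exact: is_nonzero_prime_ideal.
exact: primeK_finite.
Qed.

End Prime.

Lemma fixed_ints_in_group (J : {group G}) (x : G) : (forall a, Jint J a -> x a = a) -> x \in J.
Proof.
move=> xa; suff : x \in 'Gal({:F} / fixedField J)%g by rewrite gal_fixedField.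
rewrite gal_kHom; last exact: subvf.
apply/kHomP_tmp; split=> [a aJ|a b _ _]; last by rewrite rmorphM.
have fa : Jfix J a by move=> j jJ; exact: (fixedFieldP (memvf a) aJ).
have [m m0 im] := alint_scale FC a.
have : x (m%:~R * a) = m%:~R * a.
  by apply: xa; split=> // j jJ; rewrite rmorphM rmorph_int /= fa.
rewrite rmorphM rmorph_int; apply: mulfI.
by apply: contra_neq m0 => e0; apply: (intrF_inj FC).
Qed.

End TowerPrimes.

Section TowerCharacter.
Variables (R : realType) (K : fieldExtType rat) (Kb : algClosure K) (F : splittingFieldType rat).
Variable T : tower Kb F.
Local Notation G := (gal_of {:F}).
Local Notation C := (complexNumField R).
Local Notation k := (tw_k T).
Local Notation i := (tw_i T).
Local Notation FC := (tw_FC T).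
Local Notation H := (stabK T).
Local Notation OK := (ringOfIntegers [set: K]).
Variable chi : dirichletChar R Kb.
Hypothesis lchi : forall g, lifts T g 1%g -> chi g = 1.
Local Notation J := (kerF lchi).
Implicit Types (p : primeOf K) (P : set Kb) (g : absGal Kb).

Lemma charInt_image : charInt chi = i @` Jint J.
Proof.
apply/seteqP; split=> [z /(charIntP lchi)[a Ja ->]|_ [a Ja <-]]; first by exists a.
by apply/(charIntP lchi); exists a.
Qed.

Lemma primeOfP p : is_nonzero_prime OK (val p).
Proof. by have := valP p; rewrite inE. Qed.

Lemma charInt_gal g z : charInt chi z -> charInt chi (g z).
Proof.
move=> [cz iz]; split.
  move=> h ch; have : (g^-1 * h * g)%g z = z.
    by apply: cz; rewrite -{2}(invgK g) dcharJ.
  by rewrite !absGalM => /(congr1 g); rewrite absGalKV.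
have [f fP] := absGal_rmorph g; rewrite -fP; exact/(alint_rmorph f z).
Qed.

Lemma aboveF p P : prime_above chi p P -> is_nonzero_prime (Jint J) (i @^-1` P).
Proof. by move=> [nzP _]; apply: nonzero_prime_preimage; rewrite -charInt_image. Qed.

Lemma above_val p P b : prime_above chi p P -> P (i (k b)) <-> val p b.
Proof. by move=> [_ <-]; rewrite /= tw_ik. Qed.

Lemma above_conj p P q (Q : set F) : prime_above chi p P -> prime q -> val p q%:R ->
  is_prime_ideal (@alint F) Q -> Q q%:R ->
  exists z : G, forall a, Jint J a -> (P (i a) <-> Q (z a)).
Proof.
move=> aP q_pr pq prQ Qq; have nzP := aboveF aP.
have Pq : (i @^-1` P) q%:R by rewrite /= -(rmorph_nat k); apply/(above_val _ aP).
exact: (primes_conjugate FC q_pr (Jint_subring J) (@Jint_alint _ J)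
  (is_nonzero_prime_ideal nzP) Pq prQ Qq).
Qed.

Lemma kerF_sub (x : G) : x \in J -> x \in H. Proof. by move=> /kerFP[]. Qed.

Lemma Jint_k b : alint b -> Jint J (k b).
Proof.
by move=> ib; split; [exact/(alint_rmorph k b)|move=> x /kerF_sub; exact: Jfix_k].
Qed.

Lemma above_exists p : exists P, prime_above chi p P.
Proof.
have [q q_pr pq] := primeK_over T (primeOfP p).
have [Q [prQ Qq]] := prime_over_exists FC q_pr.
have [x xP] := primeK_conj T (primeOfP p) q_pr pq prQ Qq.
pose PF : set F := [set a | Jint J a /\ Q (x a)].
have idQ := prime_isideal prQ.
have nzPF : is_nonzero_prime (Jint J) PF.
  have := prime_subring (Jint_subring J) (@Jint_alint _ J) (gal_prime x prQ).
  move=> [[s0 z0 aD aM] n1 pM]; split.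
  - split=> [a [Ja _]//||a b|a b].
    + by split; [exact: (subring0 (Jint_subring J))|rewrite rmorph0; exact: ideal0 idQ].
    + move=> [Ja Qa] [Jb Qb]; split; first exact: (subringD (Jint_subring J)).
      by rewrite rmorphD; exact: (idealD idQ).
    + move=> Ja [Jb Qb]; split; first exact: (subringM (Jint_subring J)).
      by rewrite rmorphM; apply: (idealM_l idQ) => //; apply/alint_gal; case: Ja.
  - by move=> [_]; rewrite rmorph1; exact: (primeN1 prQ).
  - move=> a b Ja Jb [_]; rewrite rmorphM => /(primeM prQ)[||Qa|Qb].
    + by apply/alint_gal; case: Ja.
    + by apply/alint_gal; case: Jb.
    + by left.
    + by right.
  - exists q%:R; last exact: (natF_neq0 FC (prime_gt0 q_pr)).
    by split; [exact: (subring_nat (Jint_subring J))|rewrite rmorph_nat].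
exists (i @` PF); split; first by rewrite charInt_image; exact: nonzero_prime_image.
apply/seteqP; split=> b /=; rewrite -(tw_ik T).
  move=> [a [[ia _] Qa] /(fmorph_inj i) ea]; subst a; apply/xP => //; exact/(alint_rmorph k b).
move=> pb; exists (k b) => //.
have ib : alint b by rewrite -OKE; exact: (ideal_sub (prime_isideal (is_nonzero_prime_ideal (primeOfP p))) pb).
by split; [exact: Jint_k|exact/xP].
Qed.

(** Triviality of inertia: [h = g2 * g1^-1] acts trivially modulo [P], and unramifiedness provides
    an element of [p] outside the square of [P], that is, a uniformizer that [h] fixes because it
    comes from [K]. So [h] fixes all integers of the field of [chi]. *)
Lemma frobenius_unique p g1 g2 : unramified chi p -> is_frobenius chi p g1 ->
  is_frobenius chi p g2 -> chi g1 = chi g2.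
Proof.
move=> unr f1 f2; have [P aP] := above_exists p.
have [q q_pr pq] := primeK_over T (primeOfP p).
have [_ ram] := unr P aP.
have [b pb nb] : exists2 b, val p b & ~ ideal_exp (charInt chi) P 2 (acl_emb Kb b).
  apply: contrapT => no; apply: ram => _ [b pb <-].
  by apply: contrapT => nb; apply: no; exists b.
pose h := (g2 * g1^-1)%g; have [x xH lx] := res_exists T h.
have nzP := aboveF aP; have idP := prime_isideal (is_nonzero_prime_ideal aP.1).
have Ppow : ideal_exp (charInt chi) P 2 = i @` ideal_exp (Jint J) (i @^-1` P) 2.
  rewrite -ideal_exp_image -charInt_image (image_preimage (A := Jint J)) //.
  by rewrite -charInt_image; case: idP.
have sub : is_subring (charInt chi).
  rewrite charInt_image; have sJ := Jint_subring J; split.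
  - by exists 1; [exact: subring1|rewrite rmorph1].
  - by move=> _ _ [u Ju <-] [v Jv <-]; exists (u - v); [exact: (subringB sJ)|rewrite rmorphB].
  - by move=> _ _ [u Ju <-] [v Jv <-]; exists (u * v); [exact: (subringM sJ)|rewrite rmorphM].
have hP z : charInt chi z -> P (h z - z).
  move=> cz; have cz' := charInt_gal (g1^-1)%g cz.
  have := idealB sub idP (f2 P aP _ cz') (f1 P aP _ cz').
  by rewrite opprB addrA subrK -absGalM absGalKV.
have xJ : x \in J.
  apply: (fixed_ints_in_group T); apply: (Jint_inertia FC q_pr (is_nonzero_prime_ideal nzP)
     (pi := k b) (h := x)).
  - by rewrite /= -(rmorph_nat k); apply/(above_val _ aP).
  - move=> a Ja; have : charInt chi (h (i a)) by apply: charInt_gal; rewrite charInt_image fmorph_image.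
    by rewrite lx charInt_image fmorph_image.
  - move=> a Ja; have := hP (i a); rewrite charInt_image fmorph_image lx -rmorphB; exact.
  - by have /stabKP -> := xH.
  - by apply/(above_val _ aP).
  - by move=> nb'; apply: nb; rewrite Ppow -(tw_ik T) fmorph_image.
have : chi h = 1 by rewrite (chiF_lifts lchi lx); have /kerFP[] := xJ.
by rewrite dcharM dcharV => /divr1_eq.
Qed.

Lemma char_at_frobenius p g : unramified chi p -> is_frobenius chi p g -> char_at chi p = chi g.
Proof.
move=> unr fg; rewrite /char_at; case: asboolP => // _.
apply: (frobenius_unique unr _ fg).
exact: (getPex (P := [set g | is_frobenius chi p g]) (ex_intro _ g fg)).
Qed.

End TowerCharacter.

(** * Character sums over the primes of norm q *)

Section LocalSum.
Variables (R : realType) (K : fieldExtType rat) (Kb : algClosure K) (F : splittingFieldType rat).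
Variable T : tower Kb F.
Local Notation G := (gal_of {:F}).
Local Notation C := (complexNumField R).
Local Notation k := (tw_k T).
Local Notation i := (tw_i T).
Local Notation FC := (tw_FC T).
Local Notation H := (stabK T).
Local Notation OK := (ringOfIntegers [set: K]).
Variables (D : nat) (Q_ : nat -> set F) (phi_ : nat -> G).
Hypothesis goodP : forall q, prime q -> (D < q)%N -> good_prime q (Q_ q) (phi_ q).
Implicit Types (p : primeOf K) (P : set Kb) (g : absGal Kb) (x y : G).

Lemma integral_generator : exists b0 : K, alint b0 /\
  forall x y, x (k b0) = y (k b0) -> (x * y^-1)%g \in H.
Proof.
have [m m0 im] := alint_scale FC (k (kgen K)).
exists (m%:~R * kgen K); split.
  by apply/(alint_rmorph k _); rewrite rmorphM rmorph_int.
move=> x y; rewrite !rmorphM !rmorph_int => e.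
have mF : (m%:~R : F) != 0 by apply: contra_neq m0 => e0; apply: (intrF_inj FC).
by rewrite inE galMf (mulfI mF e) gal_Vf eqxx.
Qed.

(** Discarding the finitely many [q] that meet a difference of distinct conjugates of [b0], so that
    for a generator [b0] a residue modulo [Q] determines the coset of the stabiliser. *)
Lemma conjugates_separated b0 : alint b0 -> exists D0, forall q Q, prime q -> (D0 < q)%N ->
  is_prime_ideal (@alint F) Q -> Q q%:R -> forall x y, Q (x (k b0) - y (k b0)) -> x (k b0) = y (k b0).
Proof.
move=> ib; pose r (xy : G * G) := xy.1 (k b0) - xy.2 (k b0).
have ir xy : alint (r xy) by apply: alintB; apply/alint_gal; apply/(alint_rmorph k b0).
have [||D0 DP] := @prime_not_dividing F FC (\prod_(xy : G * G | r xy != 0) r xy).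
- by apply: alint_prod => xy _; exact: ir.
- exact/prodf_neq0.
exists D0 => q Q q_pr ltq prQ Qq x y Qxy; apply/eqP; rewrite -subr_eq0; apply/negP => /negP n0.
apply: (DP q Q q_pr ltq prQ Qq); rewrite (bigD1 (x, y)) //=.
apply: (idealM_r (prime_isideal prQ)) => //; apply: alint_prod => xy _; exact: ir.
Qed.

Section NormResidues.
Variables (p : primeOf K) (q : nat).
Hypothesis q_pr : prime q.

Let prp := is_nonzero_prime_ideal (primeOfP p).
Let idp := prime_isideal prp.
Let S := fset_set (cosets OK (val p)).

Let SP c : (c \in S) <-> exists2 b, OK b & coset_of_elt OK (val p) b = c.
Proof. by rewrite in_fset_set ?inE //; exact: (primeK_finite T (primeOfP p)). Qed.

Lemma primeNorm_over : primeNorm p = q -> val p q%:R.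
Proof.
move=> Np; have [q' q'_pr pq'] := primeK_over T (primeOfP p).
have := primeK_dvd_norm T (primeOfP p) q'_pr pq'; rewrite -[ideal_norm _ _]/(primeNorm p) Np.
by rewrite dvdn_prime2 // => /eqP <-.
Qed.

(** The integers from 0 to [q - 1] are incongruent modulo [p], and there are as many of them as
    residue classes. *)
Lemma primeNorm_residue b : primeNorm p = q -> alint b -> exists r : 'I_q, val p (b - (r : nat)%:R).
Proof.
move=> Np ib; have pq := primeNorm_over Np.
have inS (b' : K) : alint b' -> coset_of_elt OK (val p) b' \in S.
  by move=> ib'; apply/SP; exists b' => //; rewrite OKE.
pose f (r : 'I_q) : S := [` inS _ (alint_nat K r)]%fset.
have finj : injective f.
  move=> r r' /(congr1 val) /=.
  move=> /(coset_eltP (OK_subring K) prp _ (subring_nat (OK_subring K) r)).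
  wlog le : r r' / (r' <= r)%N.
    move=> w pr; case: (leqP r' r) => [le|/ltnW le]; first exact: w.
    by apply/esym; apply: w => //; exact: (ideal_symB (OK_subring K) idp).
  rewrite -natrB // => /(prime_over_nat (OK_subring K) prp q_pr pq)/dvdn_leq h.
  by apply: val_inj => /=; move: h; rewrite subn_gt0; have := ltn_ord r; lia.
have card : (#|{: S}| <= #|{: 'I_q}|)%N by rewrite -cardfE card_ord -Np.
have [f' _ f'K] := inj_card_bij finj card.
exists (f' [` inS b ib]%fset); have := congr1 val (f'K [` inS b ib]%fset) => /=.
move=> /(coset_eltP (OK_subring K) prp _ (subring_nat (OK_subring K) _)).
exact: (ideal_symB (OK_subring K) idp).
Qed.

Lemma primeNorm_of_residue : val p q%:R ->
  (forall b, alint b -> exists r : 'I_q, val p (b - (r : nat)%:R)) -> primeNorm p = q.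
Proof.
move=> pq res; apply/eqP; rewrite eqn_leq; apply/andP; split; last first.
  apply: dvdn_leq; last exact: (primeK_dvd_norm T (primeOfP p) q_pr pq).
  by apply: ltnW; exact: (primeK_norm_gt1 T (primeOfP p)).
have sz : size [seq coset_of_elt OK (val p) (nat_of_ord r)%:R | r : 'I_q <- enum 'I_q] = q.
  by rewrite size_map -cardE card_ord.
rewrite -[X in (_ <= X)%N]sz; apply: uniq_leq_size; first exact: fset_uniq.
move=> c /SP[b Ob <-]; have [r pr] := res b (Ob.2).
apply/mapP; exists r; first by rewrite mem_enum.
exact/(coset_eltP (OK_subring K) prp).
Qed.

End NormResidues.

(** Elements of [Q] are locally multiples of [q], so a sum of products of two of them is locally a
    multiple of [q ^ 2]. That [q] is not such a sum is what shows the primes of [K] over [q] to be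
    unramified in the field of a character. *)
Lemma good_prime_square q Q phi : prime q -> good_prime q Q phi ->
  forall n (a c : 'I_n -> F), (forall j, Q (a j)) -> (forall j, Q (c j)) ->
  \sum_j a j * c j <> q%:R.
Proof.
move=> q_pr [prQ Qq _ hv] n a c Qa Qc e; have sO := alint_subring F; have idQ := prime_isideal prQ.
have q0 : (q%:R : F) != 0 := natF_neq0 FC (prime_gt0 q_pr).
have ld b : Q b -> locdiv (@alint F) Q q%:R b.
  move=> Qb; have ib : alint b := ideal_sub idQ Qb.
  have [->|b0] := eqVneq b 0; first by rewrite -(mulr0 q%:R); apply: (locdiv_refl _ prQ) => //; exact: alint0.
  have [m hm] := hv b ib b0.
  have m0 : (0 < m)%N by apply/(hasval_gt0 prQ Qq ib hm).
  have [t [u [it iu nt nu etu]]] := hm.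
  exists t, (q%:R ^+ m.-1 * u); split=> //; first by apply: alintM => //; apply: alintX; exact: alint_nat.
  by rewrite mulrA -exprS prednK.
have : locdiv (@alint F) Q (q%:R * q%:R) (\sum_j a j * c j).
  elim/big_ind: _ => [||j _].
  - by rewrite -(mulr0 (q%:R * q%:R)); apply: (locdiv_refl _ prQ) => //; exact: alint0.
  - by move=> u v; exact: (locdivD sO prQ).
  - by apply: (locdiv_mul sO prQ); exact: ld.
rewrite e => -[t [w [it nt iw]]]; rewrite mulrC -mulrA => /(mulfI q0) et.
by apply: nt; rewrite et; exact: (idealM_r idQ).
Qed.

Section AtPrime.
Variables (b0 : K) (D0 q : nat).
Hypothesis ib0 : alint b0.
Hypothesis gen0 : forall x y, x (k b0) = y (k b0) -> (x * y^-1)%g \in H.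
Hypothesis sep0 : forall q Q, prime q -> (D0 < q)%N ->
  is_prime_ideal (@alint F) Q -> Q q%:R -> forall x y, Q (x (k b0) - y (k b0)) -> x (k b0) = y (k b0).
Hypotheses (q_pr : prime q) (ltD : (D < q)%N) (ltD0 : (D0 < q)%N).

Local Notation Q := (Q_ q).
Local Notation phi := (phi_ q).

Let gQ : good_prime q Q phi := goodP q_pr ltD.
Let prQ : is_prime_ideal (@alint F) Q. Proof. by case: gQ. Qed.
Let Qq : Q q%:R. Proof. by case: gQ. Qed.
Let idQ := prime_isideal prQ.
Let sO := alint_subring F.

Lemma prime_at_exists x : exists p : primeOf K, forall b, val p b <-> alint b /\ Q (x (k b)).
Proof.
pose p : set K := [set b | alint b /\ Q (x (k b))].
have ik (b : K) : alint b -> alint (x (k b)) by move=> ib; apply/alint_gal; exact/(alint_rmorph k b).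
have nzp : is_nonzero_prime OK p.
  rewrite OKE; split.
  - split=> [b []//||a b [ia Qa] [ib Qb]|a b ia [ib Qb]].
    + by split; [exact: alint0|rewrite !rmorph0; exact: ideal0 idQ].
    + by split; [exact: alintD|rewrite !rmorphD; exact: (idealD idQ)].
    + by split; [exact: alintM|rewrite !rmorphM; apply: (idealM_l idQ) => //; exact: ik].
  - by move=> [_]; rewrite !rmorph1; exact: (primeN1 prQ).
  - by move=> a b ia ib [_]; rewrite !rmorphM => /(primeM prQ (ik _ ia) (ik _ ib))[?|?]; [left|right].
  - exists q%:R; first by split; [exact: alint_nat|rewrite !rmorph_nat].
    by rewrite -(fmorph_eq0 k) rmorph_nat (natF_neq0 FC (prime_gt0 q_pr)).
have pin : p \in @primeSet K by rewrite inE.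
by exists (exist _ p pin).
Qed.

Lemma primeNorm_at x p : x \in fixq phi_ H q -> (forall b, val p b <-> alint b /\ Q (x (k b))) ->
  primeNorm p = q.
Proof.
move=> xf px; apply: primeNorm_of_residue => //.
  by apply/px; split; [exact: alint_nat|rewrite !rmorph_nat].
move=> b ib; have ik : alint (k b) by exact/(alint_rmorph k b).
have [r Qr] := fixq_residue goodP q_pr ltD xf ik (Jfix_k (T := T) b); exists r.
apply/px; split; first by apply: alintB => //; exact: alint_nat.
by rewrite !rmorphB !rmorph_nat.
Qed.

Lemma prime_at_inj x (w : G) : x \in fixq phi_ H q ->
  (forall b, alint b -> Q (x (k b)) -> Q (w (k b))) -> (w * x^-1)%g \in H.
Proof.
move=> xf xw; apply: gen0; have ik : alint (k b0) by exact/(alint_rmorph k b0).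
have [r Qr] := fixq_residue goodP q_pr ltD xf ik (Jfix_k (T := T) b0).
apply: (sep0 q_pr ltD0 prQ Qq).
have : Q (w (k (b0 - (r : nat)%:R))).
  by apply: xw; [apply: alintB => //; exact: alint_nat|rewrite !rmorphB !rmorph_nat].
rewrite !rmorphB !rmorph_nat => Qw.
by apply: (ideal_transB idQ Qw); exact: (ideal_symB sO idQ).
Qed.

(** For a prime of norm [q] the conjugate [x (k b0)] is congruent to an integer modulo [Q], so it is
    congruent to its own image under the Frobenius. By [sep0] and [gen0] the congruence becomes the
    equality of the cosets of [x * phi] and [x]. *)
Lemma prime_at_surj p : primeNorm p = q ->
  exists2 x, x \in fixq phi_ H q & forall b, val p b <-> alint b /\ Q (x (k b)).
Proof.
move=> Np; have pq := primeNorm_over q_pr Np.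
have [x xP] := primeK_conj T (primeOfP p) q_pr pq prQ Qq.
have [h hH eh] := repr_cosetP H x.
have xh b : repr (H :* x)%g (k b) = x (k b) by rewrite Jfix_repr //; exact: Jfix_k.
exists (repr (H :* x)%g); last first.
  move=> b; rewrite xh; split=> [pb|[ib Qb]]; last exact/xP.
  have ib : alint b by rewrite -OKE; exact: (ideal_sub (prime_isideal (is_nonzero_prime_ideal (primeOfP p))) pb).
  by split=> //; exact/xP.
suff xH : (x * phi * x^-1)%g \in H.
  rewrite [_ \in fixq _ _ _]inE transv_repr /= eh invMg.
  have -> : (h * x * phi * (x^-1 * h^-1))%g = (h * (x * phi * x^-1) * h^-1)%g by rewrite !mulgA.
  exact: (groupM (groupM hH xH) (groupVr hH)).
apply: (gen0 (x := (x * phi)%g)); apply: (sep0 q_pr ltD0 prQ Qq).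
have ixb : alint (x (k b0)) by apply/alint_gal; exact/(alint_rmorph k b0).
have [r pr] := primeNorm_residue q_pr Np ib0.
have Qr : Q (x (k b0) - (r : nat)%:R).
  have := (xP _ (alintB ib0 (alint_nat K r))).1 pr.
  by rewrite !rmorphB !rmorph_nat.
have [_ _ fr _] := gQ; rewrite galMf.
apply: (ideal_transB idQ (fr _ ixb)).
apply: (ideal_transB idQ (y := (r : nat)%:R ^+ q)).
  by apply: (idealBX sO idQ) => //; exact: alint_nat.
apply: (ideal_transB idQ (y := (r : nat)%:R)); last exact: (ideal_symB sO idQ).
by have := frob_int q_pr prQ Qq r%:Z; rewrite -pmulrn.
Qed.

Variable chi : dirichletChar R Kb.
Hypothesis lchi : forall g, lifts T g 1%g -> chi g = 1.
Local Notation J := (kerF lchi).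

(** Both unramifiedness and the Frobenius condition concern every [P] above [p]. Such a [P] is the
    pullback of [Q] along some [w = h * x] with [h] in [H], and conjugation by [h] changes
    [x * phi * x^-1] only by an element of the kernel of [chi]. *)
Lemma char_at_prime x p : x \in fixq phi_ H q -> (forall b, val p b <-> alint b /\ Q (x (k b))) ->
  char_at chi p = chiF T chi (x * phi * x^-1)%g.
Proof.
move=> xf px; have Np := primeNorm_at xf px; have pq := primeNorm_over q_pr Np.
have yH : (x * phi * x^-1)%g \in H by move: xf; rewrite [_ \in fixq _ _ _]inE => /andP[].
have [g gy] := lifts_exists yH; rewrite -(chiF_lifts lchi gy).
apply: (char_at_frobenius lchi) => [P aP|P aP z].
  have [z zP] := above_conj lchi aP q_pr pq prQ Qq.
  split.
    move=> _ [b pb <-]; exists 1%N, (fun=> acl_emb Kb b), (fun=> 1); split=> [_|_|].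
    - by rewrite -(tw_ik T); apply/(above_val T _ aP).
    - rewrite (charInt_image lchi); exists 1; last by rewrite rmorph1.
      exact: (subring1 (Jint_subring J)).
    - by rewrite big_ord1 mulr1.
  move=> sub; have := sub (acl_emb Kb q%:R) (ex_intro2 _ _ q%:R pq erefl).
  have idP := prime_isideal (is_nonzero_prime_ideal aP.1).
  have nzP := aboveF lchi aP; have idPF := prime_isideal (is_nonzero_prime_ideal nzP).
  have -> : ideal_exp (charInt chi) P 2 = i @` ideal_exp (Jint J) (i @^-1` P) 2.
    rewrite -ideal_exp_image -charInt_image (image_preimage (A := Jint J)) //.
    by rewrite -charInt_image; case: idP.
  rewrite -(tw_ik T) fmorph_image => -[n [a [c [aP' cP' e]]]].
  have PQ v : (i @^-1` P) v -> Q (z v) by move=> Pv; apply/zP => //; exact: (ideal_sub idPF).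
  apply: (good_prime_square q_pr gQ (a := z \o a) (c := z \o c)) => [j|j|].
  - exact: PQ.
  - have [n' [a' [c' [a'P c'P ec]]]] := cP' j; apply: PQ; rewrite ec.
    by apply: (ideal_sum idPF) => j' _; apply: (idealM_r idPF).
  - have := congr1 z e; rewrite !rmorph_nat rmorph_sum => ->.
    by apply: eq_bigr => j _; rewrite rmorphM.
rewrite (charInt_image lchi) => -[a Ja <-]; rewrite gy Np -rmorphXn -rmorphB.
have [w wP] := above_conj lchi aP q_pr pq prQ Qq.
have [ia fa] := Ja.
have iy : Jint J ((x * phi * x^-1)%g a).
  have := charInt_gal (chi := chi) g (z := i a); rewrite (charInt_image lchi) gy !fmorph_image; exact.
apply/wP.
  by apply: (subringB (Jint_subring J)) => //; exact: (subringX (Jint_subring J)).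
have hH : (w * x^-1)%g \in H.
  apply: (prime_at_inj xf) => b ib Qb.
  have pb : val p b by apply/px.
  by apply/(wP _ (Jint_k lchi ib)); apply/(above_val T _ aP).
set h := (w * x^-1)%g in hH; have ew : w = (h * x)%g by rewrite mulgKV.
have ey : (x * phi * x^-1)%g a = (w * phi * w^-1)%g a.
  set y := (x * phi * x^-1)%g in yH *.
  have -> : (w * phi * w^-1)%g = (h * y * h^-1)%g by rewrite ew invMg /y !mulgA.
  have yhH : (h * y * h^-1)%g \in H := groupM (groupM hH yH) (groupVr hH).
  have jJ : (y * (h * y * h^-1)^-1)%g \in J.
    apply/kerFP; split; first by rewrite groupM ?groupV.
    by rewrite chiFM ?groupV // chiFV // chiFJ // mulfV // chiF_neq0.
  have eu : (y * (h * y * h^-1)^-1 * (h * y * h^-1))%g a = y a by rewrite mulgKV.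
  by rewrite -eu galMf (fa _ jJ).
have ew' : w ((w * phi * w^-1)%g a) = phi (w a) by rewrite !galMf galVf.
rewrite rmorphB rmorphXn /= ey ew'.
by have [_ _ fr _] := gQ; apply: fr; exact/alint_gal.
Qed.

Lemma local_sum (S : {fset primeOf K}) : (forall p, p \in S <-> primeNorm p = q) ->
  \sum_(p <- S) char_at chi p = \sum_(x in fixq phi_ H q) chiF T chi (x * phi * x^-1)%g.
Proof.
move=> SP; have /choice[pf pfP] := prime_at_exists.
have pS : perm_eq S (map pf (enum (fixq phi_ H q))).
  apply: uniq_perm; first exact: fset_uniq.
    rewrite map_inj_in_uniq ?enum_uniq // => x y; rewrite !mem_enum => xf yf e.
    have hH : (y * x^-1)%g \in H.
      by apply: (prime_at_inj xf) => b ib Qb; have /pfP[] : val (pf y) b by rewrite -e; apply/pfP.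
    move: xf yf; rewrite ![_ \in fixq _ _ _]inE => /andP[xT _] /andP[yT _].
    by apply/esym; apply: (transv_inj yT xT); apply/rcoset_eqP; rewrite mem_rcoset.
  move=> p; apply/idP/mapP => [/SP/prime_at_surj[x xf px]|[x]].
    exists x; first by rewrite mem_enum.
    apply: val_inj; apply/seteqP; split=> b.
      by move=> /px /pfP.
    by move=> /pfP /px.
  by rewrite mem_enum => xf ->; apply/SP; apply: (primeNorm_at xf); exact: pfP.
rewrite (perm_big _ pS) big_map big_enum; apply: eq_bigr => x xf.
by apply: char_at_prime => //; exact: pfP.
Qed.

End AtPrime.
End LocalSum.

(** * Uniqueness of Euler products *)

Section ComplexNorm.
Variable R : realType.
Local Notation C := (complexNumField R).
Implicit Types (z w : C) (r : R).

(** The norm of a complex number is itself of complex type; the estimates are carried out with the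
    underlying real number. *)
Definition nrm z : R := complex.Re `|z|.

Lemma nrmE z : `|z| = (nrm z)%:C%C.
Proof. by rewrite /nrm RRe_real // normr_real. Qed.

Lemma cplx_inj r r' : r%:C%C = r'%:C%C -> r = r'.
Proof. by case. Qed.

Lemma nrm_ge0 z : 0 <= nrm z.
Proof. by rewrite -lecR -nrmE normr_ge0. Qed.

Lemma nrm0 : nrm 0 = 0.
Proof. by apply: cplx_inj; rewrite -nrmE normr0. Qed.

Lemma nrm1 : nrm 1 = 1.
Proof. by apply: cplx_inj; rewrite -nrmE normr1. Qed.

Lemma nrm_eq0 z : nrm z = 0 -> z = 0.
Proof. by move=> z0; apply/eqP; rewrite -normr_eq0 nrmE z0. Qed.

Lemma nrmM z w : nrm (z * w) = nrm z * nrm w.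
Proof. by apply: cplx_inj; rewrite rmorphM /= -!nrmE normrM. Qed.

Lemma nrmN z : nrm (- z) = nrm z.
Proof. by apply: cplx_inj; rewrite -!nrmE normrN. Qed.

Lemma nrmB z w : nrm (z - w) = nrm (w - z).
Proof. by rewrite -nrmN opprB. Qed.

Lemma nrmD z w : nrm (z + w) <= nrm z + nrm w.
Proof. by rewrite -lecR rmorphD /= -!nrmE ler_normD. Qed.

Lemma nrmV z : nrm z^-1 = (nrm z)^-1.
Proof. by apply: cplx_inj; rewrite fmorphV /= -!nrmE normfV. Qed.

Lemma nrmX z n : nrm (z ^+ n) = nrm z ^+ n.
Proof. by elim: n => [|n IH]; rewrite ?nrm1 // !exprS nrmM IH. Qed.

Lemma nrm_nat n : nrm n%:R = n%:R.
Proof. by apply: cplx_inj; rewrite -nrmE normr_nat rmorph_nat. Qed.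

Lemma nrm_sum (I : Type) (s : seq I) (P : pred I) (f : I -> C) :
  nrm (\sum_(i <- s | P i) f i) <= \sum_(i <- s | P i) nrm (f i).
Proof.
elim/big_rec2: _ => [|i x y _ IH]; first by rewrite nrm0.
by apply: le_trans (nrmD _ _) _; rewrite lerD2l.
Qed.

Lemma ReB z w : complex.Re (z - w) = complex.Re z - complex.Re w.
Proof. by case: z w => [a b] [c d]. Qed.

Lemma ImB z w : complex.Im (z - w) = complex.Im z - complex.Im w.
Proof. by case: z w => [a b] [c d]. Qed.

Lemma nrm_Re z : `|complex.Re z| <= nrm z.
Proof. by rewrite -lecR -nrmE; exact: normc_ge_Re. Qed.

Lemma nrm_Im z : `|complex.Im z| <= nrm z.
Proof.
have -> : complex.Im z = complex.Re (- ('i%C * z)) by case: z => a b /=; rewrite mul0r sub0r mul1r opprK.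
apply: le_trans (nrm_Re _) _; rewrite nrmN nrmM.
have -> : nrm 'i%C = 1; last by rewrite mul1r.
by apply: cplx_inj; rewrite -nrmE normc_def /= expr0n expr1n add0r sqrtr1.
Qed.

Lemma nrm_le z : nrm z <= `|complex.Re z| + `|complex.Im z|.
Proof.
have {1}-> : z = (complex.Re z)%:C%C + 'i%C * (complex.Im z)%:C%C by case: z => a b; simpc.
apply: le_trans (nrmD _ _) _; rewrite nrmM.
have -> : nrm 'i%C = 1 by apply: cplx_inj; rewrite -nrmE normc_def /= expr0n expr1n add0r sqrtr1.
have nr (r : R) : nrm r%:C%C = `|r|.
  by apply: cplx_inj; rewrite -nrmE normc_def /= expr0n addr0 sqrtr_sqr.
by rewrite mul1r !nr.
Qed.

Lemma nrm_prod_1B (I : Type) (s : seq I) (f : I -> C) : \sum_(i <- s) nrm (f i) <= 2^-1 ->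
  nrm (\prod_(i <- s) (1 - f i) - 1) <= 2 * \sum_(i <- s) nrm (f i).
Proof.
elim: s => [|i s IH]; first by rewrite !big_nil subrr nrm0 mulr0.
rewrite !big_cons; set P := \prod_(j <- s) _; set S := \sum_(j <- s) _ => h.
have n0 := nrm_ge0 (f i).
have S0 : 0 <= S by apply: sumr_ge0 => j _; exact: nrm_ge0.
have {}IH : nrm (P - 1) <= 2 * S by apply: IH; rewrite -/S; clear - h n0; lra.
have -> : (1 - f i) * P - 1 = (P - 1) + - (f i * P) by ring.
apply: le_trans (nrmD _ _) _; rewrite nrmN nrmM.
have nP : nrm P <= 1 + nrm (P - 1).
  by rewrite -{1}(subrK 1 P) addrC; apply: le_trans (nrmD _ _) _; rewrite nrm1.
move: n0 S0 IH nP h; move: (nrm (f i)) (nrm P) (nrm (P - 1)) S => a b c d.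
by clear; nra.
Qed.

Lemma nrm_inv_1 z : nrm (z - 1) <= 2^-1 -> z != 0 /\ nrm (z^-1 - 1) <= 2 * nrm (z - 1).
Proof.
move=> h; have z1 : 1 <= nrm z + nrm (z - 1).
  have e1 : z + (1 - z) = 1 by ring.
  by have := nrmD z (1 - z); rewrite e1 nrm1 (nrmB 1).
have z0 : z != 0.
  by apply/eqP => ze; move: h z1; rewrite ze nrm0 sub0r nrmN nrm1 => {ze} h _; exfalso; lra.
split=> //; have -> : z^-1 - 1 = (1 - z) * z^-1 by rewrite mulrBl mul1r mulfV.
rewrite nrmM nrmV nrmB; have nz : 2^-1 <= nrm z by clear - h z1; lra.
rewrite mulrC ler_wpM2r ?nrm_ge0 //.
by rewrite -[leRHS]invrK lef_pV2 // posrE ?invr_gt0 //; clear - nz; lra.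
Qed.

End ComplexNorm.

(** * Uniqueness of the coefficients of a Dirichlet polynomial *)

Section DirichletPolynomial.
Variable R : realType.
Local Notation C := (complexNumField R).

(** Strong induction on [m]: once the coefficients below [m] vanish, multiplication by [m ^ t]
    leaves the coefficient of [m] plus terms that decay like [(m / (m + 1)) ^ t]. *)
Lemma dirichlet_poly_unique (J : finType) (c : J -> C) (M : J -> nat) (q t0 : nat) (B : R) :
  (forall j, (0 < M j)%N) ->
  (forall t, (t0 <= t)%N -> nrm (\sum_j c j * (M j)%:R^-1 ^+ t) <= B * (q.+1)%:R^-1 ^+ t) ->
  forall m, (0 < m <= q)%N -> \sum_(j | M j == m) c j = 0.
Proof.
move=> M0 bd; elim/ltn_ind => m IH /andP[m0 mq].
have [B0|B0] := ltP B 0.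
  exfalso; have := bd t0 (leqnn _); have := nrm_ge0 (\sum_j c j * (M j)%:R^-1 ^+ t0).
  have : 0 < (q.+1)%:R^-1 ^+ t0 :> R by rewrite exprn_gt0 // invr_gt0 ltr0n.
  by move: (nrm _) (_ ^+ t0) => a b; clear - B0; nra.
set S := \sum_(j | _) c j.
pose X : R := B + \sum_j nrm (c j).
have X0 : 0 <= X by rewrite addr_ge0 // sumr_ge0 // => j _; exact: nrm_ge0.
have mR : 0 < m%:R :> R by rewrite ltr0n.
have key t : (t0 <= t)%N -> nrm S <= X * (m%:R / m.+1%:R) ^+ t.
  move=> tt; have split_sum : m%:R ^+ t * (\sum_j c j * (M j)%:R^-1 ^+ t) =
      S + \sum_(j | (m < M j)%N) c j * (m%:R / (M j)%:R) ^+ t.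
    rewrite mulr_sumr (bigID (fun j => (m < M j)%N)) /= addrC; congr (_ + _); last first.
      by apply: eq_bigr => j _; rewrite exprMn mulrCA.
    rewrite (bigID (fun j => M j == m)) /= -[RHS]addr0; congr (_ + _).
      rewrite (eq_bigl (fun j => M j == m)) => [|j]; last by case: eqP => [->|]; rewrite ?ltnn ?andbF.
      apply: eq_bigr => j /eqP ->.
      by rewrite mulrCA -exprMn mulfV ?expr1n ?mulr1 // pnatr_eq0 -lt0n.
    rewrite (partition_big (fun j => inord (M j) : 'I_m.+1) predT) //= big1 // => u _.
    have [um|um] := leqP m u.
      rewrite big_pred0 // => j; apply/negbTE; apply/negP => /andP[/andP[]].
      rewrite -leqNgt => le /eqP ne /eqP e; apply: ne; apply/eqP; rewrite eqn_leq le.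
      by move: um; rewrite -e inordK // ltnS.
    have [u0|u0] := posnP u.
      rewrite big_pred0 // => j; apply/negbTE; apply/negP => /andP[/andP[]].
      by rewrite -leqNgt => le _ /eqP e; have := M0 j; move: u0; rewrite -e inordK ?ltnS // => ->.
    have := IH u um; rewrite u0 /= (leq_trans (ltnW um) mq) => /(_ isT) e0.
    rewrite (eq_bigr (fun j => c j * (m%:R ^+ t * u%:R^-1 ^+ t))); last first.
      move=> j /andP[/andP[]]; rewrite -leqNgt => le _ /eqP <-.
      by rewrite inordK ?ltnS // mulrCA.
    rewrite -mulr_suml (eq_bigl (fun j => M j == u)) ?e0 ?mul0r // => j.
    apply/idP/idP => [/andP[/andP[]]|/eqP Mu].
      by rewrite -leqNgt => le _ /eqP <-; rewrite inordK // ltnS.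
    by rewrite Mu -leqNgt (ltnW um) ltn_eqF //=; apply/eqP; apply: val_inj; rewrite /= inordK.
  have rho0 : 0 <= m%:R / m.+1%:R :> R by rewrite divr_ge0.
  have -> : S = m%:R ^+ t * (\sum_j c j * (M j)%:R^-1 ^+ t) - \sum_(j | (m < M j)%N) c j * (m%:R / (M j)%:R) ^+ t.
    by rewrite split_sum addrK.
  have mono (n : nat) : (m < n)%N -> (m%:R / n%:R) ^+ t <= (m%:R / m.+1%:R) ^+ t :> R.
    move=> mn; apply: lerXn2r; rewrite ?nnegrE ?divr_ge0 // ler_wpM2l // lef_pV2 ?posrE ?ltr0n ?ler_nat //.
    exact: leq_trans mn.
  apply: le_trans (nrmD _ _) _; rewrite nrmN /X mulrDl lerD //.
    rewrite nrmM nrmX nrm_nat; apply: (@le_trans _ _ (m%:R ^+ t * (B * q.+1%:R^-1 ^+ t))).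
      by rewrite ler_wpM2l ?exprn_ge0 // bd.
    by rewrite mulrCA -exprMn ler_wpM2l // mono.
  apply: le_trans (nrm_sum _ _ _) _; rewrite mulr_suml.
  apply: (@le_trans _ _ (\sum_(j | (m < M j)%N) nrm (c j) * (m%:R / m.+1%:R) ^+ t)).
    apply: ler_sum => j mj; rewrite nrmM nrmX nrmM nrmV !nrm_nat ler_wpM2l ?nrm_ge0 //; exact: mono.
  rewrite [leRHS](bigID (fun j => (m < M j)%N)) /= lerDl sumr_ge0 // => j _.
  by rewrite mulr_ge0 ?nrm_ge0 // exprn_ge0.
apply: nrm_eq0; apply/eqP; rewrite eq_le nrm_ge0 andbT leNgt; apply/negP => S0.
have [t tb] : exists t : nat, X * m%:R / nrm S < t%:R.
  by exists (Num.bound (X * m%:R / nrm S)); apply: archi_boundP; apply: divr_ge0; [apply: mulr_ge0|exact: nrm_ge0].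
have le := key (t0 + t)%N (leq_addr _ _); set n := (t0 + t)%N in le.
(* Decay like 1 / n suffices, and follows by induction from
   [m * (m + n + 1) <= (m + 1) * (m + n)]. *)
have bern : (m%:R / m.+1%:R) ^+ n * (m + n)%:R <= m%:R :> R.
  elim: (n) => [|n' IHn]; first by rewrite expr0 mul1r addn0.
  apply: le_trans IHn; rewrite exprSr -mulrA ler_wpM2l ?exprn_ge0 ?divr_ge0 //.
  rewrite mulrAC ler_pdivrMr ?ltr0n // -!natrM ler_nat; clear; nia.
have mn0 : 0 < (m + n)%:R :> R by rewrite ltr0n addn_gt0 m0.
have : nrm S * (m + n)%:R <= X * m%:R.
  apply: (@le_trans _ _ (X * (m%:R / m.+1%:R) ^+ n * (m + n)%:R)); first by rewrite ler_wpM2r // ltW.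
  by rewrite -mulrA ler_wpM2l.
apply/negP; rewrite -ltNge -ltr_pdivrMl // mulrC; apply: lt_le_trans tb _.
by rewrite ler_nat /n addnA leq_addl.
Qed.

End DirichletPolynomial.

Lemma le_quarter_half (R : realType) (x : R) : x <= 4^-1 -> x <= 2^-1. Proof. lra. Qed.
Lemma le_double_half (R : realType) (v x : R) : v <= 2 * x -> x <= 4^-1 -> v <= 2^-1. Proof. lra. Qed.
Lemma le_double_double (R : realType) (u v x : R) : u <= 2 * v -> v <= 2 * x -> u <= 4 * x. Proof. lra. Qed.
Lemma le_quarter_one (R : realType) (x : R) : x <= 4^-1 -> 4 * x <= 1. Proof. lra. Qed.

#[local] Existing Instance totally_filter.

(** * Convergence and tails of Euler products *)

Section EulerProduct.
Variables (R : realType) (I : choiceType) (N : I -> nat).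
Local Notation C := (complexNumField R).
Variables (z : I -> C) (fib : nat -> {fset I}) (B : nat).
Hypothesis N1 : forall i, (1 < N i)%N.
Hypothesis z1 : forall i, nrm (z i) <= 1.
Hypothesis fibP : forall i m, (i \in fib m) = (N i == m).
Hypothesis fibB : forall m, (#|` fib m| <= B * m)%N.

Definition eterm t i : C := z i * (N i)%:R^-1 ^+ t.

Definition upto q : {fset I} := (\bigcup_(m <- iota 0 q.+1) fib m)%fset.

Lemma uptoP q i : (i \in upto q) = (N i <= q)%N.
Proof.
apply/bigfcupP/idP => [[m]|iq].
  by rewrite andbT mem_iota fibP /= add0n ltnS => mq /eqP ->.
by exists (N i); rewrite ?fibP // andbT mem_iota /= add0n ltnS.
Qed.

Definition euler t (A : {fset I}) : C := \prod_(i <- A) (1 - eterm t i)^-1.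
Definition eulerV t q : C := \prod_(i <- upto q) (1 - eterm t i).
(** Bound for the tail over norms above [q] at exponent [t + 3]: [t] powers come out as
    [(q + 1) ^ -t], one of the other three is consumed by the at most [B * m] factors of norm [m],
    and the sum of [m ^ -2] is at most 2. *)
Definition eps q t : R := (2 * B)%:R * (q.+1)%:R^-1 ^+ t.

Lemma nrm_eterm t i : nrm (eterm t i) <= (N i)%:R^-1 ^+ t.
Proof.
rewrite nrmM nrmX nrmV nrm_nat -[leRHS]mul1r ler_wpM2r // exprn_ge0 // invr_ge0.
Qed.

Lemma tail_sum q t (A : seq I) : uniq A -> (forall i, i \in A -> (q < N i)%N) ->
  \sum_(i <- A) nrm (eterm (t + 3) i) <= eps q t.
Proof.
move=> uA qA; apply: (@le_trans _ _ (\sum_(i <- A) q.+1%:R^-1 ^+ t * (N i)%:R^-1 ^+ 3)).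
  rewrite !big_seq; apply: ler_sum => i iA; apply: le_trans (nrm_eterm _ _) _.
  rewrite exprD ler_wpM2r ?exprn_ge0 ?invr_ge0 // lerXn2r ?nnegrE ?invr_ge0 //.
  by rewrite lef_pV2 ?posrE ?ltr0n ?ler_nat ?qA // ltnW.
rewrite -mulr_sumr /eps mulrC ler_wpM2r ?exprn_ge0 ?invr_ge0 // natrM mulrC.
pose X := \max_(i <- A) N i.
have NX i : i \in A -> (N i <= X)%N by move=> iA; rewrite /X (big_rem i) //= leq_maxl.
apply: (@le_trans _ _ (\sum_(m < X.+1) B%:R * (m%:R^-1 ^+ 2))); last first.
  by rewrite -mulr_sumr ler_wpM2l //; exact: (sum_inv_sq R X predT).
rewrite big_seq (partition_big (fun i => inord (N i) : 'I_X.+1) predT) //=; apply: ler_sum => m _.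
have eqm i : i \in A -> (inord (N i) == m :> 'I_X.+1) = (N i == m :> nat).
  by move=> iA; rewrite -(inj_eq val_inj) /= inordK // ltnS NX.
rewrite (eq_bigl (fun i => (i \in A) && (N i == m))); last first.
  by move=> i; case: (boolP (i \in A)) => //= iA; rewrite eqm.
rewrite -big_seq_cond (eq_bigr (fun=> m%:R^-1 ^+ 3)) => [|i /eqP -> //].
rewrite big_const_seq iter_addr_0 -[leLHS]mulr_natl.
have [m0|m0] := posnP (m : nat).
  rewrite m0 invr0 !expr0n /= !mulr0; exact: lexx.
have le : (count (fun i => N i == m) A <= B * m)%N.
  apply: leq_trans (fibB m); rewrite -size_filter; apply: uniq_leq_size; first exact: filter_uniq.
  by move=> i; rewrite mem_filter fibP => /andP[].
apply: (@le_trans _ _ ((B * m)%:R * m%:R^-1 ^+ 3)).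
  by rewrite ler_wpM2r ?exprn_ge0 ?invr_ge0 // ler_nat.
by rewrite natrM -mulrA ler_wpM2l // exprS mulrA mulfV ?mul1r // pnatr_eq0 -lt0n.
Qed.

Lemma upto_split q t (A : {fset I}) : (upto q `<=` A)%fset -> eps q t <= 4^-1 ->
  exists T : C, [/\ euler (t + 3) A * eulerV (t + 3) q = T, nrm (T - 1) <= 4 * eps q t
    & eulerV (t + 3) q != 0].
Proof.
move=> sub e4; set s := (t + 3)%N.
have n0 i : 1 - eterm s i != 0.
  rewrite subr_eq0; apply/eqP => e1; have := nrm_eterm s i; rewrite -e1 nrm1.
  apply/negP; rewrite -ltNge; apply: (@le_lt_trans _ _ ((N i)%:R^-1)); last first.
    by rewrite invf_lt1 ?ltr1n // ltr0n ltnW.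
  rewrite -[leRHS]expr1 ler_wiXn2l ?invr_ge0 //; last by rewrite /s addn3.
  by rewrite invf_le1 ?ler1n ?ltr0n // ltnW.
pose A' := [seq i <- A | (q < N i)%N].
pose V := \prod_(i <- A') (1 - eterm s i).
have eA : \prod_(i <- A) (1 - eterm s i) = eulerV s q * V.
  rewrite (bigID (fun i => (N i <= q)%N)) /=; congr (_ * _).
    rewrite -big_filter; apply: perm_big; apply: uniq_perm; rewrite ?filter_uniq ?fset_uniq //.
    move=> i; rewrite mem_filter uptoP; case: (boolP (N i <= q)%N) => //= iq.
    by apply: (fsubsetP sub); rewrite uptoP.
  by rewrite -big_filter; apply: congr_big => //; apply: eq_filter => i; rewrite -ltnNge.
have ts : \sum_(i <- A') nrm (eterm s i) <= eps q t.
  apply: tail_sum; first by rewrite filter_uniq // fset_uniq.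
  by move=> i; rewrite mem_filter => /andP[].
have V1 : nrm (V - 1) <= 2 * eps q t.
  apply: le_trans (nrm_prod_1B _) _; last by rewrite ler_wpM2l.
  by apply: le_trans ts _; exact: le_quarter_half.
have [|V0 Vi] := nrm_inv_1 (z := V); first exact: le_double_half V1 e4.
have e0 : eulerV s q != 0 by rewrite prodf_seq_neq0; apply/allP => i _; rewrite n0.
exists V^-1; split=> //; last exact: le_double_double Vi V1.
have -> : euler s A = (eulerV s q * V)^-1 by rewrite -eA /euler prodfV.
by rewrite invfM mulrAC mulVf ?mul1r.
Qed.

Lemma eps_small q (e : R) t : (0 < t)%N -> 0 < e -> exists m, (q <= m)%N /\ eps m t < e.
Proof.
move=> t0 e0; pose m := Num.bound ((2 * B)%:R / e).
have mb : (2 * B)%:R / e < m%:R by apply: archi_boundP; rewrite divr_ge0 // ltW.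
exists (q + m)%N; split; first exact: leq_addr.
apply: (@le_lt_trans _ _ ((2 * B)%:R * (q + m).+1%:R^-1)).
  rewrite ler_wpM2l // -[leRHS]expr1 ler_wiXn2l ?invr_ge0 //.
  by rewrite invf_le1 ?ler1n ?ltr0n.
rewrite ltr_pdivrMr ?ltr0n // mulrC -ltr_pdivrMr //; apply: lt_le_trans mb _.
by rewrite ler_nat; apply: leqW; exact: leq_addl.
Qed.

Lemma euler_cauchy t : (0 < t)%N -> eps 1 t <= 4^-1 -> forall e : R, 0 < e ->
  exists m, forall A : {fset I}, (upto m `<=` A)%fset ->
    nrm (euler (t + 3) (upto m) - euler (t + 3) A) < e.
Proof.
move=> t0 e1 e e0.
(* All norms exceed 1, so for [q = 1] the lemma [upto_split] bounds a whole partial product. *)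
have u1 : upto 1 = fset0.
  apply/fsetP => i; rewrite uptoP inE; apply/negbTE; rewrite -ltnNge; exact: N1.
have [m [m1 em]] := @eps_small 1%N (e / 8) t t0 ltac:(by rewrite divr_gt0).
have em4 : eps m t <= 4^-1.
  apply: le_trans e1; rewrite ler_wpM2l // lerXn2r ?nnegrE ?invr_ge0 //.
  by rewrite lef_pV2 ?posrE ?ltr0n // ler_nat ltnS.
exists m => A mA; set s := (t + 3)%N.
have [T [eT nT V0]] := upto_split mA em4.
have [T1 [eT1 nT1 _]] := @upto_split 1%N t (upto m) (eq_ind_r (fun X => (X `<=` upto m)%fset) (fsub0set _) u1) e1.
have eU : euler s (upto m) = (eulerV s m)^-1 by rewrite /euler /eulerV prodfV.
have n2 : nrm (euler s (upto m)) <= 2.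
  move: eT1; rewrite /eulerV u1 big_seq_fset0 mulr1 => ->.
  rewrite -(subrK 1 T1); apply: le_trans (nrmD _ _) _; rewrite nrm1.
  by rewrite -[2]/(1 + 1) lerD2r; apply: le_trans nT1 _; exact: le_quarter_one.
have -> : euler s (upto m) - euler s A = euler s (upto m) * (1 - T).
  by rewrite mulrBr mulr1 -eT eU mulrCA mulVf ?mulr1.
rewrite nrmM nrmB; apply: (@le_lt_trans _ _ (2 * (4 * eps m t))).
  by apply: ler_pM; rewrite ?nrm_ge0.
by rewrite mulrA -natrM -[(2 * 4)%N]/8%N mulrC -ltr_pdivlMr.
Qed.

Lemma euler_cvg t : (0 < t)%N -> eps 1 t <= 4^-1 ->
  exists L : C, euler (t + 3) @ totally --> L.
Proof.
move=> t0 e1; set s := (t + 3)%N; have cau := euler_cauchy t0 e1.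
have part (f : C -> R) : (forall u v, `|f u - f v| <= nrm (u - v)) ->
    exists a : R, (f \o euler s) @ totally --> a.
  move=> fle; pose Fi := (f \o euler s) @ (@totally I).
  have FF : ProperFilter Fi by apply: fmap_proper_filter.
  have : cauchy Fi.
    apply: cauchy_exP => e e0; have [m mP] := cau e e0; exists (f (euler s (upto m))).
    exists (upto m) => // A mA /=.
    by rewrite /ball /=; apply: le_lt_trans (fle _ _) _; exact: mP.
  by move=> /cauchy_cvg h; exists (lim Fi).
have reB (u v : C) : `|complex.Re u - complex.Re v| <= nrm (u - v).
  by rewrite -ReB; exact: nrm_Re.
have imB (u v : C) : `|complex.Im u - complex.Im v| <= nrm (u - v).
  by rewrite -ImB; exact: nrm_Im.
have [a aP] := part (@complex.Re R) reB.
have [b bP] := part (@complex.Im R) imB.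
exists (Complex a b : C); apply/(@cvgrPdist_lt _ _ _ (@totally I)) => e e0.
have er : e = (complex.Re e)%:C%C by rewrite RRe_real // gtr0_real.
have e0' : 0 < complex.Re e by rewrite -ltcR -er.
have e2 : 0 < complex.Re e / 2 by rewrite divr_gt0.
have /(@cvgrPdist_lt _ _ _ (@totally I))/(_ _ e2) [A1 _ A1P] := aP.
have /(@cvgrPdist_lt _ _ _ (@totally I))/(_ _ e2) [A2 _ A2P] := bP.
exists (A1 `|` A2)%fset => // A; rewrite /= fsubUset => /andP[s1 s2].
rewrite nrmE er ltcR; apply: le_lt_trans (nrm_le _) _; rewrite ReB ImB /=.
have := ltrD (A1P A s1) (A2P A s2); rewrite -splitr /=; exact.
Qed.

Lemma euler_bound q : (0 < q)%N -> exists (t0 : nat) (Bd : R), forall t, (t0 <= t)%N ->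
  exists L : C, euler t @ totally --> L /\ nrm (L * eulerV t q - 1) <= Bd * q.+1%:R^-1 ^+ t.
Proof.
move=> q0; exists (8 * B + 4)%N, ((8 * B + 1)%:R * q.+1%:R ^+ 3) => t tt.
have -> : t = (t - 3 + 3)%N by rewrite subnK //; lia.
have t0 : (0 < t - 3)%N by lia.
have tB : (8 * B <= t - 3)%N by lia.
move: (t - 3)%N t0 tB => {tt t} t t0 tB.
have e1 : eps 1 t <= 4^-1.
  rewrite /eps exprVn ler_pdivrMr ?exprn_gt0 // mulrC ler_pdivlMr // -natrM -natrX ler_nat.
  by apply: leq_trans (ltnW (ltn_expl t (ltnSn 1))); lia.
have e4 : eps q t <= 4^-1.
  apply: le_trans e1; rewrite ler_wpM2l // lerXn2r ?nnegrE ?invr_ge0 //.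
  by rewrite lef_pV2 ?posrE ?ltr0n // ler_nat ltnS.
have [L LP] := euler_cvg t0 e1; exists L; split=> //.
have [_ [_ _ V0]] := upto_split (fsubset_refl _) e4.
set V := eulerV (t + 3) q in V0 *.
have nV : 0 < nrm V by rewrite lt0r nrm_ge0 andbT; apply: contra_neq V0; exact: nrm_eq0.
pose d : R := q.+1%:R^-1 ^+ t; have d0 : 0 < d by rewrite exprn_gt0 // invr_gt0 ltr0n.
have dV : 0 < d / nrm V by rewrite divr_gt0.
have dVC : 0 < (d / nrm V)%:C%C :> C by rewrite -[0]/(0%:C%C) ltcR.
have /(@cvgrPdist_lt _ _ _ (@totally I))/(_ _ dVC) [A1 _ A1P] := LP.
have := A1P (A1 `|` upto q)%fset (fsubsetUl _ _); rewrite /= nrmE ltcR; set A := (A1 `|` _)%fset => LA.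
have [T [eT nT _]] := upto_split (fsubsetUr A1 (upto q)) e4; rewrite -/A -/V in eT.
have -> : L * V - 1 = (L - euler (t + 3) A) * V + (T - 1) by rewrite -eT; ring.
apply: le_trans (nrmD _ _) _.
have -> : (8 * B + 1)%:R * q.+1%:R ^+ 3 * q.+1%:R^-1 ^+ (t + 3) = d + 4 * eps q t.
  rewrite exprD mulrACA [_ ^+ 3 * _]mulrC -mulrA -exprMn mulVf ?pnatr_eq0 // expr1n mulr1.
  rewrite -/d /eps -/d natrD mulrDl mul1r addrC; congr (_ + _).
  by rewrite mulrA -natrM mulnA.
rewrite lerD // nrmM; apply: ltW; rewrite -ltr_pdivlMr //.
Qed.

End EulerProduct.

Section EulerUnique.
Variable R : realType.
Local Notation C := (complexNumField R).

(** Since all norms exceed 1, a product of norms can be prime only if it has a single factor. The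
    left side is the coefficient of [q ^ -t] in the expanded inverse Euler product. *)
Lemma prime_norm_sets (I : choiceType) (N : I -> nat) (z : I -> C) (fib : nat -> {fset I}) q :
  (forall i, (1 < N i)%N) -> (forall i m, (i \in fib m) = (N i == m)) -> prime q ->
  \sum_(S : {set upto fib q} | (\prod_(i in S) N (val i))%N == q) \prod_(i in S) (- z (val i))
  = - \sum_(i <- fib q) z i.
Proof.
move=> N1 fibP q_pr.
transitivity (\sum_(S in [set [set i] | i in [pred i : upto fib q | N (val i) == q]]%SET)
  \prod_(i in S) (- z (val i))).
  apply: eq_bigl => S; apply/eqP/imsetP => [e|[i iq ->]]; last by rewrite big_set1; exact/eqP.
  have [i iS] : exists i, i \in S.
    apply/set0Pn; apply: contraTneq q_pr => S0; by rewrite -e S0 big_set0.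
  exists i.
    rewrite inE; apply/eqP/(prime_nt_dvdP q_pr); first by rewrite gtn_eqF.
    by rewrite -[X in (_ %| X)%N]e (bigD1 i) //= dvdn_mulr.
  have Ni : N (val i) = q.
    apply/(prime_nt_dvdP q_pr); first by rewrite gtn_eqF.
    by rewrite -[X in (_ %| X)%N]e (bigD1 i) //= dvdn_mulr.
  apply/eqP; rewrite finset.eqEsubset finset.sub1set iS andbT; apply/fintype.subsetP => j jS; rewrite inE.
  apply/negPn/negP => ji; have : (q * N (val j) %| q)%N.
    by rewrite -[X in (_ %| X)%N]e (bigD1 i) //= (bigD1 j) ?jS //= Ni mulnA dvdn_mulr.
  move=> /dvdn_leq; rewrite prime_gt0 // => /(_ isT); apply/negP.
  by rewrite -ltnNge ltn_Pmulr // prime_gt0.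
rewrite big_imset /=; last by move=> i j _ _; exact: set1_inj.
under eq_bigr => i _ do rewrite big_set1.
rewrite sumrN; congr (- _).
rewrite -(big_seq_fsetE _ (upto fib q) (fun i => N i == q) z) /=.
rewrite -big_filter; apply: perm_big; apply: uniq_perm; rewrite ?filter_uniq ?fset_uniq // => i.
rewrite mem_filter fibP; case: eqP => //= Ni; rewrite (uptoP fibP) Ni leqnn //.
Qed.

Lemma eulerV_expand (I : choiceType) (N : I -> nat) (z : I -> C) (fib : nat -> {fset I}) t q :
  eulerV N z fib t q = \sum_(S : {set upto fib q})
     (\prod_(i in S) (- z (val i))) * (\prod_(i in S) N (val i))%:R^-1 ^+ t.
Proof.
rewrite /eulerV big_seq_fsetE /=.
rewrite (eq_bigr (fun i : upto fib q => (- z (val i) * (N (val i))%:R^-1 ^+ t) + 1)); last first.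
  by move=> i _; rewrite addrC mulNr.
rewrite bigA_distr; apply: eq_bigr => S _.
rewrite (bigID (fun i => i \in S)) /= [X in _ * X]big1 ?mulr1; last by move=> i /negbTE ->.
rewrite (eq_bigr (fun i => (- z (val i) * (N (val i))%:R^-1 ^+ t))) => [|i -> //].
rewrite big_split /=; congr (_ * _); rewrite natr_prod -prodfV.
by rewrite -prodrXl.
Qed.

Lemma nrm_eulerV (I : choiceType) (N : I -> nat) (z : I -> C) (fib : nat -> {fset I}) t q :
  (forall i, (1 < N i)%N) -> (forall i, nrm (z i) <= 1) -> nrm (eulerV N z fib t q) <= 2 ^+ #|` upto fib q|.
Proof.
move=> N1 z1; rewrite /eulerV; elim: (enum_fset (upto fib q)) => [|i s IH].
  by rewrite big_nil nrm1.
rewrite big_cons exprS nrmM; apply: ler_pM; rewrite ?nrm_ge0 //.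
apply: le_trans (nrmD _ _) _; rewrite nrmN nrm1 -[2]/(1 + 1) lerD2l.
apply: le_trans (nrm_eterm N z1 t i) _; apply: exprn_ile1; rewrite ?invr_ge0 //.
by rewrite invf_le1 ?ler1n ?ltr0n // ltnW.
Qed.

(* The Euler factors of norm > q only contribute O((q + 1) ^ -t), so the finite products over
   the norms <= q agree up to that order; they are Dirichlet polynomials. *)
Lemma euler_unique (I I' : choiceType) (N : I -> nat) (N' : I' -> nat) (z : I -> C) (z' : I' -> C)
    (fib : nat -> {fset I}) (fib' : nat -> {fset I'}) (B B' q t1 : nat) :
  (forall i, (1 < N i)%N) -> (forall i, (1 < N' i)%N) ->
  (forall i, nrm (z i) <= 1) -> (forall i, nrm (z' i) <= 1) ->
  (forall i m, (i \in fib m) = (N i == m)) -> (forall i m, (i \in fib' m) = (N' i == m)) ->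
  (forall m, (#|` fib m| <= B * m)%N) -> (forall m, (#|` fib' m| <= B' * m)%N) ->
  (forall t, (t1 <= t)%N -> lim (euler N z t @ totally) = lim (euler N' z' t @ totally)) ->
  prime q -> \sum_(i <- fib q) z i = \sum_(i <- fib' q) z' i.
Proof.
move=> N1 N1' z1 z1' fibP fibP' fibB fibB' eL q_pr.
have q0 := prime_gt0 q_pr.
have [t2 [D DP]] := euler_bound N1 z1 fibP fibB q0.
have [t3 [D' DP']] := euler_bound N1' z1' fibP' fibB' q0.
pose J := ({set upto fib q} + {set upto fib' q})%type.
pose c (j : J) : C := match j with
  | inl U => \prod_(i in U) (- z (val i)) | inr U => - \prod_(i in U) (- z' (val i)) end.
pose M (j : J) : nat := match j with
  | inl U => \prod_(i in U) N (val i) | inr U => \prod_(i in U) N' (val i) end.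
have M0 j : (0 < M j)%N by case: j => S /=; rewrite prodn_cond_gt0 // => i _; rewrite ltnW.
pose a : R := 2 ^+ #|` upto fib q|; pose a' : R := 2 ^+ #|` upto fib' q|.
have := @dirichlet_poly_unique R J c M q (t1 + t2 + t3) (a * D' + a' * D) M0 _ q.
rewrite q0 leqnn => h; have {}h := h _ isT.
have : \sum_(j | M j == q) c j = 0.
  apply: h => t tt; rewrite big_sumType /=.
  have -> : \sum_(S : {set upto fib q}) c (inl S) * (M (inl S))%:R^-1 ^+ t = eulerV N z fib t q.
    by rewrite eulerV_expand.
  have -> : \sum_(S : {set upto fib' q}) c (inr S) * (M (inr S))%:R^-1 ^+ t = - eulerV N' z' fib' t q.
    by rewrite eulerV_expand -sumrN; apply: eq_bigr => S _; rewrite /= mulNr.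
  have [|L [cL bL]] := DP t; first by lia.
  have [|L' [cL' bL']] := DP' t; first by lia.
  have eLL : L = L'.
    have l1 := cvg_lim (@norm_hausdorff _ C) cL; have l2 := cvg_lim (@norm_hausdorff _ C) cL'.
    by rewrite -l1 -l2 eL //; lia.
  rewrite -eLL {L' cL' eLL} in bL'.
  have nV := nrm_eulerV fib t q N1 z1; have nV' := nrm_eulerV fib' t q N1' z1'.
  move: (eulerV N z fib t q) (eulerV N' z' fib' t q) nV nV' bL bL' => V V' nV nV' bL bL'.
  have -> : V - V' = V' * (L * V - 1) - V * (L * V' - 1) by ring.
  apply: le_trans (nrmD _ _) _; rewrite nrmN !nrmM addrC mulrDl -!mulrA.
  by apply: lerD; apply: ler_pM; rewrite ?nrm_ge0.
rewrite big_sumType /= (prime_norm_sets z N1 fibP q_pr) sumrN (prime_norm_sets z' N1' fibP' q_pr).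
by rewrite opprK addrC => /eqP; rewrite subr_eq0 => /eqP.
Qed.

End EulerUnique.

(** * Kummer characters and the transfer *)

Record kiso (E E' : fieldType) := Kiso {
  kf :> {rmorphism E -> E'};
  ki : {rmorphism E' -> E};
  kfK : cancel kf ki;
  kiK : cancel ki kf }.

Definition kiso_inv (E E' : fieldType) (tau : kiso E E') : kiso E' E :=
  Kiso (kiK tau) (kfK tau).

Definition kiso_comp (E1 E2 E3 : fieldType) (f : kiso E1 E2) (g : kiso E2 E3) : kiso E1 E3 :=
  @Kiso E1 E3 (g \o f) (ki f \o ki g) (can_comp (kfK g) (kfK f)) (can_comp (kiK f) (kiK g)).

Lemma algC_embedding (R : realType) : exists mu : {rmorphism algC -> R[i]}, True.
Proof.
apply: (closed_field_embedding (i := ratr : {rmorphism rat -> algC})) => z.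
have [r [er rm] _] := minCpolyP z; exists r; first exact: monic_neq0.
by rewrite -er root_minCpoly.
Qed.

(** * Transfers of Kummer characters *)

Section Richness.
Variables (R : realType) (K : fieldExtType rat) (Kb : algClosure K) (F : splittingFieldType rat).
Variable T : tower Kb F.
Local Notation G := (gal_of {:F}).
Local Notation C := (complexNumField R).
Local Notation k := (tw_k T).
Local Notation i := (tw_i T).
Local Notation FC := (tw_FC T).
Local Notation H := (stabK T).
Implicit Types (g h : absGal Kb) (x y t : G) (a : F).

Lemma fixed_in_tower (z : Kb) : (forall g, lifts T g 1%g -> g z = z) -> exists a, z = i a.
Proof.
move=> fz; have [|a ea] := @fixed_by_stabilizer F FC (tw_e T z).
  move=> nu nuF.
  pose f : {rmorphism Kb -> Kb} := tw_e' T \o nu \o tw_e T.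
  pose f' : {rmorphism Kb -> Kb} := tw_e' T \o algC_invaut nu \o tw_e T.
  have fi a : f (i a) = i a.
    by apply: (can_inj (tw_eK T)); rewrite /f /= tw_e'K -[nu _]/(nu (FC a)) nuF.
  have [|||g gP] := @absGal_build K Kb f f'.
  - by move=> y; rewrite /f /f' /= tw_e'K algC_autK tw_eK.
  - by move=> y; rewrite /f /f' /= tw_e'K algC_invautK tw_eK.
  - by move=> b; rewrite -(tw_ik T) fi.
  have gz : g z = z by apply: fz => a; rewrite gP fi gal_id.
  by apply: (can_inj (tw_e'K T)); rewrite tw_eK -[RHS]gz gP.
by exists a; apply: (can_inj (tw_eK T)).
Qed.

Lemma kiso_restrict (tau : {rmorphism Kb -> Kb}) : exists x : G, forall a, tau (i a) = i (x a).
Proof.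
pose nu : {rmorphism algC -> algC} := tw_e T \o tau \o tw_e' T.
have [x xP] := gal_restrict FC nu; exists x => a; apply: (can_inj (tw_eK T)).
by have := xP a; rewrite /nu /= tw_eK.
Qed.

Variable l : nat.
Hypothesis l_pr : prime l.
Variable zeta : F.
Hypothesis zetaP : l.-primitive_root zeta.

Lemma unity_in_tower (z : Kb) : z ^+ l = 1 -> exists j, z = i (zeta ^+ j).
Proof.
have zP : l.-primitive_root (i zeta) by rewrite fmorph_primitive_root.
by move=> /(prim_rootP zP)[j ->]; exists j; rewrite rmorphXn.
Qed.

Lemma cyclotomic_exists x : exists m, x zeta = zeta ^+ m.
Proof.
have : (x zeta) ^+ l = 1 by rewrite -rmorphXn (prim_expr_order zetaP) rmorph1.
by move=> /(prim_rootP zetaP)[j ->]; exists j.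
Qed.

(** The cyclotomic character modulo [l]. The chosen exponent matters only modulo [l], hence [cyc1]
    states non-divisibility instead of a value. *)
Definition cyc x : nat := xget 0%N [set m | x zeta = zeta ^+ m].

Lemma cycP x : x zeta = zeta ^+ cyc x.
Proof.
rewrite /cyc; case: xgetP => [m _ //|no].
by have [m em] := cyclotomic_exists x; have := no m em.
Qed.

Lemma cyc1 : ~~ (l %| cyc 1%g)%N.
Proof.
have := cycP 1%g; rewrite gal_id -{1}(expr1 zeta) => /eqP.
rewrite (eq_prim_root_expr zetaP) => /eqP e1; apply/negP; rewrite /dvdn -e1.
by rewrite modn_small // prime_gt1.
Qed.

Lemma cyc_act (f : {rmorphism Kb -> Kb}) x (z : Kb) : (forall a, f (i a) = i (x a)) ->
  z ^+ l = 1 -> f z = z ^+ cyc x.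
Proof.
move=> fx /unity_in_tower[j ->].
rewrite fx; have -> : x (zeta ^+ j) = (x zeta) ^+ j by rewrite rmorphXn.
by rewrite cycP -rmorphXn -!exprM mulnC.
Qed.

Section Transfer.
Variables (u : G -> absGal Kb) (r : absGal Kb -> G) (a : F) (beta : Kb) (mu : {rmorphism Kb -> C}).
Hypothesis uP : forall t, t \in H -> lifts T (u t) t.
Hypothesis rP : forall g, r g \in H /\ lifts T g (r g).
Hypothesis a0 : a != 0.
Hypothesis betaP : beta ^+ l = i a.

Let beta0 : beta != 0.
Proof.
apply: contra_neq a0 => b0; apply: (fmorph_inj i); rewrite -betaP b0 rmorph0 expr0n.
by rewrite gtn_eqF ?prime_gt0.
Qed.

(* The product of the cocycle over H is the transfer to Gal(Kb / K) of the Kummer character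
   of the l-th root beta of a on Gal(Kb / F); u is a section of the restriction map r. *)
Definition cocycle g t : Kb := ((u (t * r g))^-1 * (g * u t))%g beta / beta.

Let absX g z n : g (z ^+ n) = g z ^+ n.
Proof. by have [f fP] := absGal_rmorph g; rewrite -!fP rmorphXn. Qed.
Let absM g z w : g (z * w) = g z * g w.
Proof. by have [f fP] := absGal_rmorph g; rewrite -!fP rmorphM. Qed.
Let absV g z : g z^-1 = (g z)^-1.
Proof. by have [f fP] := absGal_rmorph g; rewrite -!fP fmorphV. Qed.
Lemma kummer_unity g : lifts T g 1%g -> (g beta / beta) ^+ l = 1.
Proof.
by move=> g1; rewrite expr_div_n -absX betaP g1 gal_id divff // -betaP expf_neq0.
Qed.

Lemma cocycle_lifts g t : t \in H -> lifts T ((u (t * r g))^-1 * (g * u t))%g 1%g.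
Proof.
move=> tH; have [rH gr] := rP g.
rewrite -(mulgV (t * r g)%g); apply: liftsM; first by apply: liftsV; apply: uP; exact: groupM.
by apply: liftsM => //; exact: uP.
Qed.

Lemma cocycle_unity g t : t \in H -> cocycle g t ^+ l = 1.
Proof. by move=> tH; apply: kummer_unity; exact: cocycle_lifts. Qed.

Lemma rM g h : r (g * h)%g = (r h * r g)%g.
Proof.
apply: (@lifts_uniq _ _ _ T (g * h)%g); first by case: (rP (g * h)%g).
by apply: liftsM; [case: (rP g)|case: (rP h)].
Qed.

Lemma cocycleM g h t : t \in H -> cocycle (g * h)%g t = cocycle h t * cocycle g (t * r h)%g.
Proof.
move=> tH; have t'H : (t * r h)%g \in H by rewrite groupM //; case: (rP h).
rewrite /cocycle rM (mulgA t (r h) (r g)).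
set w1 := ((u (t * r h * r g))^-1 * (g * u (t * r h)))%g.
have -> : ((u (t * r h * r g))^-1 * (g * h * u t))%g = (w1 * ((u (t * r h))^-1 * (h * u t)))%g.
  by rewrite /w1 !mulgA mulgK.
set w2 := ((u (t * r h))^-1 * (h * u t))%g.
have w1F : lifts T w1 1%g by exact: cocycle_lifts.
have [j ej] := unity_in_tower (cocycle_unity h tH); rewrite -/(cocycle _ _) in ej.
have e2 : w2 beta = cocycle h t * beta by rewrite /cocycle divfK.
have ew : w1 (cocycle h t) = cocycle h t by rewrite ej w1F gal_id.
by rewrite absGalM e2 absM ew mulfK // mulrA.
Qed.

Definition transfer g : C := mu (\prod_(t in H) cocycle g t).

Lemma transferM g h : transfer (g * h)%g = transfer g * transfer h.
Proof.
rewrite /transfer -rmorphM mulrC; congr (mu _).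
rewrite (eq_bigr (fun t => cocycle h t * cocycle g (t * r h)%g)); last by move=> t; exact: cocycleM.
rewrite big_split /=; congr (_ * _).
rewrite [RHS](reindex_inj (mulIg (r h))) /=; apply: eq_bigl => t.
by have [rH _] := rP h; rewrite -[RHS]/((t * r h)%g \in H) groupMr.
Qed.

Lemma transfer_unity g : transfer g ^+ l = 1.
Proof.
rewrite /transfer -rmorphXn -prodrXl big1 ?rmorph1 // => t tH; exact: cocycle_unity.
Qed.

Lemma transfer_level g : lifts T g 1%g -> (forall t, t \in H -> g (u t beta) = u t beta) -> transfer g = 1.
Proof.
move=> g1 gu; have r1 : r g = 1%g by apply: (lifts_uniq (rP g).2 g1).
rewrite /transfer big1 ?rmorph1 // => t tH.
by rewrite /cocycle r1 mulg1 !absGalM gu // absGalVK divff.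
Qed.

(** On Gal(Kb/F) the transfer is the product of the Kummer characters of the conjugates [u t beta].
    Their values are roots of unity, on which the automorphism [(u t)^-1] acts by raising to the
    power [cyc t^-1]. *)
Lemma transfer_fixF g : lifts T g 1%g ->
  transfer g = mu (\prod_(t in H) (g (u t beta) / u t beta) ^+ cyc t^-1%g).
Proof.
move=> g1; have r1 : r g = 1%g by apply: (lifts_uniq (rP g).2 g1).
rewrite /transfer; congr (mu _); apply: eq_bigr => t tH.
have [f fP] := absGal_rmorph (u t)^-1%g.
have bl : (u t beta) ^+ l = i (t a) by rewrite -absX betaP uP.
have ta0 : i (t a) != 0 by rewrite !fmorph_eq0.
have zl : (g (u t beta) / u t beta) ^+ l = 1.
  by rewrite expr_div_n -absX bl g1 gal_id divff.
rewrite -(cyc_act (f := f) _ zl); last by move=> b; rewrite fP; apply: (liftsV (uP tH)).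
by rewrite fP absM absV absGalVK /cocycle r1 mulg1 !absGalM.
Qed.

Lemma transfer_conj (tau : kiso Kb Kb) x g h : (forall b, tau (i b) = i (x b)) ->
  (forall z, h (tau z) = tau (g z)) -> lifts T g 1%g -> lifts T h 1%g ->
  transfer h = mu (\prod_(t in H) (g (ki tau (u t beta)) / ki tau (u t beta)) ^+ cyc (x * t^-1)%g).
Proof.
move=> tx ht g1 h1; have r1 : r h = 1%g by apply: (lifts_uniq (rP h).2 h1).
rewrite /transfer; congr (mu _); apply: eq_bigr => t tH.
have [f fP] := absGal_rmorph (u t)^-1%g.
have bl : (u t beta) ^+ l = i (t a) by rewrite -absX betaP uP.
have bl' : (ki tau (u t beta)) ^+ l = i ((x^-1)%g (t a)).
  by rewrite -rmorphXn bl; apply: (can_inj (kfK tau)); rewrite kiK tx galVf.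
have ta0 : i ((x^-1)%g (t a)) != 0 by rewrite !fmorph_eq0.
have zl : (g (ki tau (u t beta)) / ki tau (u t beta)) ^+ l = 1.
  by rewrite expr_div_n -absX bl' g1 gal_id divff.
rewrite -(cyc_act (f := f \o tau : {rmorphism Kb -> Kb}) _ zl); last first.
  by move=> b; rewrite /= fP tx (liftsV (uP tH)) galMf.
rewrite /= fP fmorph_div kiK -ht kiK absM absV absGalVK /cocycle r1 mulg1 !absGalM.
by [].
Qed.

(** If the transfer agreed with its conjugate by tau on Gal(Kb/F), Kummer theory would make the
    corresponding products [C1] and [C2] of conjugates of [a] differ by an [l]-th power in [F]. The
    valuation of [C1] at [Q] is [cyc 1], prime to [l], since only [t = 1] contributes; that of [C2]
    is 0, since [t * x^-1] is never 1 for [x] outside [H]. *)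
Lemma transfer_nonconj (tau : kiso Kb Kb) x q Q phi : good_prime q Q phi -> prime q ->
  (forall b, tau (i b) = i (x b)) -> x \notin H ->
  alint a -> qval q Q a = 1%N -> (forall y, y != 1%g -> qval q Q (y a) = 0%N) ->
  exists g h, [/\ lifts T g 1%g, forall z, h (tau z) = tau (g z) & transfer g <> transfer h].
Proof.
move=> gQ q_pr tx xH ia qa qya; apply: contrapT => no.
have eqt g : lifts T g 1%g -> exists2 h : absGal Kb, (forall z, h (tau z) = tau (g z)) & transfer g = transfer h /\ lifts T h 1%g.
  move=> g1; have [f fP] := absGal_rmorph g; have [f' fP'] := absGal_rmorph (g^-1)%g.
  pose hf : {rmorphism Kb -> Kb} := tau \o f \o ki tau.
  pose hf' : {rmorphism Kb -> Kb} := tau \o f' \o ki tau.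
  have hfi b : hf (i b) = i b.
    rewrite /hf /=; have -> : ki tau (i b) = i ((x^-1)%g b).
      by apply: (can_inj (kfK tau)); rewrite kiK tx galVf.
    by rewrite fP g1 gal_id tx galVf.
  have [|||h hP] := @absGal_build K Kb hf hf'.
  - by move=> z; rewrite /hf /hf' /= kfK fP fP' absGalVK kiK.
  - by move=> z; rewrite /hf /hf' /= kfK fP fP' absGalKV kiK.
  - by move=> b; rewrite -(tw_ik T) hfi.
  have ht z : h (tau z) = tau (g z) by rewrite hP /hf /= kfK fP.
  exists h => //; split; last by move=> b; rewrite hP hfi gal_id.
  by apply: contrapT => ne; apply: no; exists g, h.
pose g1 := \prod_(t in H) (u t beta) ^+ cyc t^-1%g.
pose g2 := \prod_(t in H) (ki tau (u t beta)) ^+ cyc (x * t^-1)%g.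
have ub0 t : u t beta != 0.
  by have [f fP] := absGal_rmorph (u t); rewrite -fP fmorph_eq0.
have g20 : g2 != 0 by apply/prodf_neq0 => t _; rewrite expf_neq0 // fmorph_eq0.
have g10 : g1 != 0 by apply/prodf_neq0 => t _; rewrite expf_neq0.
(* Equality of the two products of Kummer characters means that Gal(Kb/F) fixes the quotient of the
   radicals [g1] and [g2]. *)
have [c0 ec0] : exists c0, g1 / g2 = i c0.
  apply: fixed_in_tower => g gF; have [h ht [eqgh hF]] := eqt g gF.
  have [f fP] := absGal_rmorph g.
  have ratio (w : G -> Kb) (n : G -> nat) :
      \prod_(t in H) (g (w t) / w t) ^+ n t = g (\prod_(t in H) w t ^+ n t) / \prod_(t in H) w t ^+ n t.
    rewrite -fP rmorph_prod -prodf_div; apply: eq_bigr => t _.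
    by rewrite rmorphXn /= fP expr_div_n.
  move: eqgh; rewrite transfer_fixF // (transfer_conj tx ht gF hF) => /(fmorph_inj mu).
  rewrite !ratio -/g1 -/g2 => e12.
  rewrite absM absV; apply/eqP; rewrite eqr_div ?g20 //; last first.
    by rewrite -fP fmorph_eq0.
  by move/eqP: e12; rewrite eqr_div // => /eqP ->; rewrite mulrC.
(* Valuations are at hand for integers, so [c0] is scaled; the scaling changes both sides by an
   [l]-th power only. *)
have [m m0 im] := alint_scale FC c0.
pose C1 := \prod_(t in H) (t a) ^+ cyc t^-1%g.
pose C2 := \prod_(t in H) ((t * x^-1)%g a) ^+ cyc (x * t^-1)%g.
have e12 : c0 ^+ l * C2 = C1.
  apply: (fmorph_inj i); rewrite rmorphM rmorphXn -ec0 expr_div_n /C1 /C2 !rmorph_prod.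
  have -> : \prod_(t in H) i (t a ^+ cyc t^-1%g) = g1 ^+ l.
    rewrite -prodrXl; apply: eq_bigr => t tH.
    by rewrite rmorphXn exprAC -absX betaP uP.
  have -> : \prod_(t in H) i ((t * x^-1)%g a ^+ cyc (x * t^-1)%g) = g2 ^+ l.
    rewrite -prodrXl; apply: eq_bigr => t tH.
    rewrite rmorphXn [RHS]exprAC; congr (_ ^+ _); rewrite -[RHS]rmorphXn -absX betaP uP //.
    by apply: (can_inj (kfK tau)); rewrite kiK tx galMf galVf.
  by rewrite divfK // expf_neq0.
have mF : (m%:~R : F) != 0 by apply: contra_neq m0 => e0; apply: (intrF_inj FC).
have c00 : c0 != 0 by apply: contra_neq g10 => c00; move: ec0; rewrite c00 rmorph0 => /eqP; rewrite mulf_eq0 invr_eq0 (negbTE g20) orbF => /eqP.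
have iy y : alint (y a) by exact/alint_gal.
have y0 (y : G) : y a != 0 by rewrite fmorph_eq0.
have qvX b n : alint b -> b != 0 -> qval q Q (b ^+ n) = (n * qval q Q b)%N.
  move=> ib b0; elim: n => [|n IH].
    by rewrite expr0 mul0n; have := qval_logn FC q_pr gQ (z := 1) isT; rewrite rmorph1 logn1.
  by rewrite exprS (qvalM FC q_pr gQ) ?IH ?mulSn // ?expf_neq0 //; exact: alintX.
have qP (w : G -> G) (n : G -> nat) : qval q Q (\prod_(t in H) (w t a) ^+ n t) = (\sum_(t in H) n t * qval q Q (w t a))%N.
  have side t : t \in H -> alint ((w t a) ^+ n t) /\ (w t a) ^+ n t != 0.
    by move=> _; split; [exact: alintX|rewrite expf_neq0].
  rewrite (qval_prod FC q_pr gQ side); apply: eq_bigr => t _.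
  by apply: qvX; [exact: iy|exact: y0].
have q1 : qval q Q C1 = cyc 1%g.
  rewrite /C1 (qP id) (bigD1 1%g (group1 H)) /= gal_id qa invg1 muln1 big1 ?addn0 // => t /andP[_ t1].
  by rewrite qya // muln0.
have q2 : qval q Q C2 = 0%N.
  rewrite /C2 (qP (fun t => (t * x^-1)%g)) big1 // => t tH; rewrite qya ?muln0 //.
  apply: contra xH => /eqP e; have -> : x = t by apply/eqP; rewrite eq_sym eq_mulgV1 e.
  by [].
have iC (w : G -> G) (n : G -> nat) : alint (\prod_(t in H) (w t a) ^+ n t) /\ \prod_(t in H) (w t a) ^+ n t != 0.
  split; first by apply: alint_prod => t _; exact: alintX.
  by apply/prodf_neq0 => t _; rewrite expf_neq0.
have [iC1 C10] := iC id (fun t => cyc t^-1%g); have [iC2 C20] := iC (fun t => (t * x^-1)%g) (fun t => cyc (x * t^-1)%g).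
rewrite -/C1 in iC1 C10; rewrite -/C2 in iC2 C20.
have im0 : alint (m%:~R : F) by exact: alint_int.
have mc0 : m%:~R * c0 != 0 by rewrite mulf_neq0.
have e3 : (m%:~R * c0) ^+ l * C2 = m%:~R ^+ l * C1 by rewrite exprMn -mulrA e12.
have := congr1 (qval q Q) e3.
rewrite (qvalM FC q_pr gQ (alintX l im) iC2 (expf_neq0 l mc0) C20) (qvX _ l im mc0) q2 addn0.
rewrite (qvalM FC q_pr gQ (alintX l im0) iC1 (expf_neq0 l mF) C10) (qvX _ l im0 mF) q1 => e.
by have := cyc1; rewrite -(dvdn_addr _ (dvdn_mulr (qval q Q m%:~R) (dvdnn l))) -e dvdn_mulr.
Qed.

End Transfer.
End Richness.

(** * A totally split prime and an element of valuation one *)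

Section SplitPrime.
Variables (R : realType) (F : splittingFieldType rat) (FC : {rmorphism F -> algC}).
Local Notation G := (gal_of {:F}).

(** At a split prime the generator [theta] is congruent to an integer [n], and [a = theta - n]
    works: its other conjugates avoid [Q] because [different] does. The element [x0] ensures that
    [theta] is not an integer, so [a] is not 0. *)
Lemma split_prime_generator (x0 : G) : x0 != 1%g -> exists q Q (phi : G) (a : F),
  [/\ prime q /\ good_prime q Q phi, alint a, a != 0, qval q Q a = 1%N
    & forall y : G, y != 1%g -> qval q Q (y a) = 0%N].
Proof.
move=> x01; have [theta [ith sep]] := primitive_exists FC.
have [D [Q_ [phi_ goodP]]] := good_primes_exist FC.
have [D1 D1P] := prime_not_dividing FC (different_alint ith) (different_neq0 sep).
have goodP' q : prime q -> (maxn D D1 < q)%N -> good_prime q (Q_ q) (phi_ q).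
  by move=> q_pr; rewrite gtn_max => /andP[+ _]; exact: goodP.
(* Were there no large [q] with trivial Frobenius, the trivial group would be covered by the empty
   family, and [frobenius_cover] would give 1 <= 0. *)
have [q [q_pr ltq p1]] : exists q, [/\ prime q, (maxn D D1 < q)%N & phi_ q = 1%g].
  apply: contrapT => no.
  have := @frobenius_cover R F FC (maxn D D1) Q_ phi_ goodP' 1%G void (fun=> 1%G).
  rewrite big1 => [h|[]]; rewrite cards1 in h; suff : (1 <= 0)%N by [].
  apply: h => q x q_pr ltq; rewrite inE => /eqP e; exfalso; apply: no; exists q; split=> //.
  have -> : phi_ q = (x^-1 * (x * phi_ q * x^-1) * x)%g by rewrite !mulgA mulVg mul1g mulgKV.
  by rewrite e mulg1 mulVg.
have gQ := goodP' q q_pr ltq; have [prQ Qq fr _] := gQ; set Q := Q_ q in gQ prQ Qq fr.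
have idQ := prime_isideal prQ; have sO := alint_subring F.
have [r Qr] : exists r : 'I_q, Q (theta - (r : nat)%:R).
  apply: (residue_exists q_pr prQ Qq) => //.
  by apply: (ideal_symB sO idQ); have := fr _ ith; rewrite p1 gal_id.
have nd (y : G) : y != 1%g -> ~ Q (theta - y theta).
  move=> y1 Qy; move: ltq; rewrite gtn_max => /andP[_ ltq1].
  apply: (D1P q Q q_pr ltq1 prQ Qq); rewrite /different (bigD1 y) //=.
  apply: (idealM_r idQ) => //; apply: alint_prod => z _; apply: alintB => //; exact/alint_gal.
have main (n : nat) : Q (theta - n%:R) -> qval q Q (theta - n%:R) = 1%N ->
    exists q Q (phi : G) (a : F), [/\ prime q /\ good_prime q Q phi, alint a, a != 0, qval q Q a = 1%N
      & forall y : G, y != 1%g -> qval q Q (y a) = 0%N].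
  move=> Qn qn; exists q, Q, (phi_ q), (theta - n%:R).
  have ia : alint (theta - n%:R) by apply: alintB => //; exact: alint_nat.
  have a0 : theta - n%:R != 0.
    apply: contra x01; rewrite subr_eq0 => /eqP e; apply/eqP; apply: sep.
    by rewrite e !rmorph_nat.
  split=> // y y1; apply/eqP; rewrite -leqn0 leqNgt; apply/negP => /(qval_gt0 gQ).
  rewrite fmorph_eq0 => h; have := h (iffRL (alint_gal y _) ia) a0.
  rewrite rmorphB rmorph_nat => Qy; apply: (nd y y1).
  by apply: (ideal_transB idQ Qn); exact: (ideal_symB sO idQ).
have ia (n : nat) : alint (theta - n%:R) by apply: alintB => //; exact: alint_nat.
have a0 (n : nat) : theta - n%:R != 0.
  apply: contra x01; rewrite subr_eq0 => /eqP e; apply/eqP; apply: sep.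
  by rewrite e !rmorph_nat.
have [q1|q1] := eqVneq (qval q Q (theta - (r : nat)%:R)) 1%N; first exact: main q1.
have qgt : (1 < qval q Q (theta - (r : nat)%:R))%N.
  by have := (qval_gt0 gQ (ia r) (a0 r)).1 Qr; move: q1; case: (qval _ _ _) => [|[]].
(* Subtracting [q], of valuation one, from an element of valuation at least two gives valuation
   exactly one. *)
have Qrq : Q (theta - (r + q)%:R).
  by rewrite natrD opprD addrA; exact: (idealB sO idQ).
apply: (main _ Qrq); apply: (qval_eq FC q_pr gQ (ia _) (a0 _)).
have [t [w [it iw nt nw e]]] := qvalP gQ (ia r) (a0 r).
set n := qval _ _ _ in e qgt.
have iq : alint (q%:R : F) by exact: alint_nat.
exists t, (q%:R ^+ n.-1 * w - t); split=> //.
- by apply: alintB => //; apply: alintM => //; exact: alintX.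
- move=> Qt; apply: nt; apply: (ideal_subr sO idQ Qt).
  rewrite -(prednK (n := n.-1)) ?ltn_predRL // exprS -mulrA; apply: (idealM_r idQ) => //.
  by apply: alintM => //; exact: alintX.
- by rewrite natrD opprD addrA mulrBr e expr1 mulrBr mulrA -exprS prednK ?(ltnW qgt) // mulrC [q%:R * t]mulrC.
Qed.

End SplitPrime.

(** An automorphism moving [K] is detected by a character on elements arbitrarily close to the
    identity. Taking [F] to contain [s] and the [l]-th roots of unity places [g] in Gal(Kb/F) and
    brings Kummer theory into play; the radicand is the element [a] of [split_prime_generator]. *)
Lemma richness (R : realType) (K : fieldExtType rat) (Kb : algClosure K) (l : nat)
    (tau : kiso Kb Kb) (s : seq Kb) : prime l ->
  ~ (forall b, tau (acl_emb Kb b) = acl_emb Kb b) ->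
  exists chi : charGroup R Kb l, exists g h : absGal Kb,
    [/\ {in s, g =1 id}, forall z, h (tau z) = tau (g z) & val chi g <> val chi h].
Proof.
move=> l_pr nK.
have [e [e' [ee' e'e]]] := closure_iso Kb.
have [z0 z0P] := C_prim_root_exists (prime_gt0 l_pr).
have [F [FC FP]] := galois_field_exists (z0 :: e (acl_emb Kb (kgen K)) :: map e s).
have [|T [TFC Te]] := tower_exists ee' e'e (FC := FC).
  by apply: FP; rewrite !inE eqxx orbT.
have FP' z : z \in z0 :: e (acl_emb Kb (kgen K)) :: map e s -> exists a, tw_i T a = e' z.
  move=> /FP[a ea]; exists a; apply: (can_inj ee'); rewrite e'e -ea -TFC twE Te.
  by [].
have [zeta ez] := FP' z0 (mem_head _ _).
have zetaP : l.-primitive_root zeta.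
  rewrite -(fmorph_primitive_root (tw_i T)) ez fmorph_primitive_root //.
have [x xP] := kiso_restrict T tau.
have xH : x \notin stabK T.
  apply/negP => /stabKP xk; apply: nK => b; by rewrite -(tw_ik T) xP xk.
have x1 : x != 1%g by apply: contra xH => /eqP ->; exact: group1.
have [q [Q [phi [a [[q_pr gQ] ia a0 qa qya]]]]] := split_prime_generator R (tw_FC T) x1.
have /choice[u uP] : forall t, exists g, t \in stabK T -> lifts T g t.
  move=> t; have [tH|tH] := boolP (t \in stabK T); last by exists 1%g.
  by have [g gt] := lifts_exists tH; exists g.
have /choice[r rP] : forall g, exists x, x \in stabK T /\ lifts T g x.
  by move=> g; have [y yH gy] := res_exists T g; exists y.
have [beta betaP] : exists beta : Kb, beta ^+ l = tw_i T a.
  have [b] := @solve_monicpoly Kb l (fun j => if j == 0%N then tw_i T a else 0) (prime_gt0 l_pr).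
  rewrite (bigD1 (Ordinal (prime_gt0 l_pr))) //= expr0 mulr1 big1 ?addr0 => [|j].
    by exists b.
  by rewrite -(inj_eq val_inj) /= => /negbTE ->; rewrite mul0r.
have [mu0 _] := algC_embedding R.
pose mu : {rmorphism Kb -> complexNumField R} := mu0 \o e.
have [theta [ith sep]] := primitive_exists (tw_FC T).
pose f := transfer T u r beta mu.
(* Fixing [theta] places an element in Gal(Kb/F), and fixing all [u t beta] then makes the transfer
   trivial. *)
pose lev := tw_i T theta :: [seq u t beta | t <- enum (stabK T)].
have fM g h : f (g * h)%g = f g * f h by exact: (transferM l_pr zetaP mu uP rP a0 betaP).
have fl g : f g ^+ l = 1 by exact: (transfer_unity l_pr mu uP rP a0 betaP).
have fs (g : absGal Kb) : {in lev, g =1 id} -> f g = 1.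
  move=> gs; apply: (transfer_level l_pr mu rP a0 betaP).
    have [y yH gy] := res_exists T g; suff -> : 1%g = y by [].
    apply: sep; rewrite gal_id; apply: (fmorph_inj (tw_i T)).
    by rewrite -gy gs // mem_head.
  by move=> t tH; apply: gs; rewrite inE; apply/orP; right; apply: map_f; rewrite mem_enum.
have f0 g : f g != 0.
  apply/eqP => fg0; have := fl g; rewrite fg0 expr0n gtn_eqF ?prime_gt0 // => /esym/eqP.
  by rewrite oner_eq0.
pose chi := DirichletChar f0 fM (level_continuous fM fs).
have chiG : chi \in charGen l by apply: charGenP.
have [g [h [gF ht ne]]] := transfer_nonconj l_pr zetaP mu uP rP a0 betaP gQ q_pr xP xH ia qa qya.
exists (exist _ chi chiG), g, h; split=> // z zs.
have [b eb] := FP' (e z) ltac:(by rewrite !inE map_f ?orbT).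
by rewrite -[z]ee' -eb gF gal_id.
Qed.

(** A prime of norm [m] lies over some [q <= m] and is the pullback of one fixed prime over [q]
    along an element of [G]; this leaves at most [(m + 1) * |G|] possibilities. *)
Lemma prime_fibres (K : fieldExtType rat) (Kb : algClosure K) (F : splittingFieldType rat)
    (T : tower Kb F) :
  exists (fib : nat -> {fset primeOf K}) (B : nat),
    (forall p m, (p \in fib m) = (primeNorm p == m)) /\ forall m, (#|` fib m| <= B * m)%N.
Proof.
pose G := gal_of {:F}; pose k := tw_k T.
have /choice[Q QP] : forall q, exists Q : set F, prime q -> is_prime_ideal (@alint F) Q /\ Q q%:R.
  move=> q; have [q_pr|nq] := boolP (prime q); last by exists set0.
  by have [Q QP] := prime_over_exists (tw_FC T) q_pr; exists Q.
pose cond (qx : nat * G) (p : primeOf K) := forall b, val p b <-> alint b /\ Q qx.1 (qx.2 (k b)).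
have /choice[f fP] : forall qx, exists o : option (primeOf K), forall p, cond qx p -> o = Some p.
  move=> qx; have [[p cp]|no] := pselect (exists p, cond qx p); last by exists None => p cp; case: no; exists p.
  exists (Some p) => p' cp'; congr Some; apply: val_inj; apply/seteqP.
  by split=> b /= h; [apply/(cp' b)/(cp b)|apply/(cp b)/(cp' b)].
pose L m := pmap f (map (fun qx : 'I_m.+1 * G => (nat_of_ord qx.1, qx.2)) (enum {: 'I_m.+1 * G})).
pose fib m : {fset primeOf K} := [fset p in L m | primeNorm p == m]%fset.
have N1 (p : primeOf K) : (1 < primeNorm p)%N by exact: (primeK_norm_gt1 T (primeOfP p)).
have fibP p m : (p \in fib m) = (primeNorm p == m).
  rewrite !inE /=; apply: andb_idl => /eqP Np.
  have [q q_pr pq] := primeK_over T (primeOfP p).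
  have qm : (q < m.+1)%N.
    rewrite ltnS -Np; apply: dvdn_leq; first by rewrite ltnW.
    exact: (primeK_dvd_norm T (primeOfP p) q_pr pq).
  have [prQ Qq] := QP q q_pr.
  have [x xP] := primeK_conj T (primeOfP p) q_pr pq prQ Qq.
  rewrite mem_pmap; apply/mapP; exists (q, x).
    by apply/mapP; exists (Ordinal qm, x); rewrite ?mem_enum.
  apply/esym; apply: fP => b /=; split=> [pb|[ib Qb]]; last exact/xP.
  have ib : alint b by rewrite -OKE; exact: (ideal_sub (prime_isideal (is_nonzero_prime_ideal (primeOfP p))) pb).
  by split=> //; exact/xP.
exists fib, (2 * #|{: G}|)%N; split=> // m.
have [->|m0] := posnP m.
  rewrite muln0 leqn0 cardfs_eq0; apply/eqP/fsetP => p; rewrite fibP inE.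
  by apply/negbTE; rewrite -lt0n ltnW.
apply: (@leq_trans (size (L m))).
  apply: uniq_leq_size; first exact: fset_uniq.
  by move=> p; rewrite !inE /= => /andP[].
apply: leq_trans (_ : m.+1 * #|{: G}| <= _)%N; last by clear -m0; nia.
rewrite /L size_pmap; apply: leq_trans (count_size _ _) _.
by rewrite size_map -cardE card_prod card_ord.
Qed.

Section NatPow.
Variable R : realType.
Local Notation C := (complexNumField R).

Lemma natpowC_nat (n t : nat) : (0 < n)%N -> natpowC n (- t%:R : R[i]) = n%:R^-1 ^+ t :> C.
Proof.
move=> n0; have n0R : 0 < n%:R :> R by rewrite ltr0n.
rewrite /natpowC.
have -> : (- t%:R : R[i]) * (ln n%:R)%:C%C = (- (t%:R * ln n%:R))%:C%C.
  by rewrite -(rmorph_nat (real_complex R)) rmorphN rmorphM mulNr.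
rewrite /expC /= cos0 sin0.
have -> : (1 +i* 0)%C = 1 :> R[i] by [].
rewrite mulr1 expRN mulrC expRM_natr lnK ?posrE //.
by rewrite -exprVn rmorphXn fmorphV rmorph_nat.
Qed.

Lemma Lseries_euler (K : fieldType) (Kb : algClosure K) (chi : dirichletChar R Kb) (t : nat) :
  (forall p : primeOf K, (1 < primeNorm p)%N) ->
  Lseries chi t%:R = lim (euler (@primeNorm K) (char_at chi) t @ totally).
Proof.
move=> N1; rewrite /Lseries; congr (lim (_ @ totally)); apply: funext => A.
rewrite /euler; apply: eq_bigr => p _; rewrite /eterm natpowC_nat //.
exact: ltnW.
Qed.

Lemma char_at_nrm (K : fieldType) (Kb : algClosure K) (chi : dirichletChar R Kb) (l : nat)
    (p : primeOf K) : (0 < l)%N -> (forall g, chi g ^+ l = 1) -> nrm (char_at chi p) <= 1.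
Proof.
move=> l0 cl; rewrite /char_at; case: asboolP => _; last by rewrite nrm0.
set g := get _; have := congr1 (@nrm R) (cl g); rewrite nrmX nrm1 => /eqP.
by rewrite pexpr_eq1 ?nrm_ge0 // => /eqP ->.
Qed.

End NatPow.

(** * From equal L-series to matching Frobenius values *)

Section Coefficients.
Variables (R : realType) (K K' : fieldExtType rat) (Kb : algClosure K) (Kb' : algClosure K') (l : nat).
Hypothesis l_pr : prime l.
Variables (F : splittingFieldType rat) (T : tower Kb F) (T' : tower Kb' F).
Local Notation G := (gal_of {:F}).
Local Notation C := (complexNumField R).
Variables (D : nat) (Q_ : nat -> set F) (phi_ : nat -> G).
Hypothesis goodP : forall q, prime q -> (D < q)%N -> good_prime q (Q_ q) (phi_ q).

Lemma frobenius_sums : exists D' : nat, forall (chi : dirichletChar R Kb) (chi' : dirichletChar R Kb'),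
  (forall g, chi g ^+ l = 1) -> (forall g, chi' g ^+ l = 1) ->
  (forall g, lifts T g 1%g -> chi g = 1) -> (forall g, lifts T' g 1%g -> chi' g = 1) ->
  (forall s : R[i], 1 < complex.Re s -> Lseries chi s = Lseries chi' s) ->
  forall q, prime q -> (D' < q)%N ->
  \sum_(x in fixq phi_ (stabK T) q) chiF T chi (x * phi_ q * x^-1)%g =
  \sum_(x in fixq phi_ (stabK T') q) chiF T' chi' (x * phi_ q * x^-1)%g.
Proof.
have [b [ib gb]] := integral_generator T; have [D0 sb] := conjugates_separated T ib.
have [b' [ib' gb']] := integral_generator T'; have [D0' sb'] := conjugates_separated T' ib'.
have [fib [B [fibP fibB]]] := prime_fibres T; have [fib' [B' [fibP' fibB']]] := prime_fibres T'.
exists (D + D0 + D0')%N => chi chi' cl cl' lv lv' eL q q_pr ltq.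
have SP p : p \in fib q <-> primeNorm p = q by rewrite fibP; split=> /eqP.
have SP' p : p \in fib' q <-> primeNorm p = q by rewrite fibP'; split=> /eqP.
rewrite -(local_sum goodP ib gb sb q_pr _ _ lv SP) -?(local_sum goodP ib' gb' sb' q_pr _ _ lv' SP'); try lia.
have N1 (p : primeOf K) : (1 < primeNorm p)%N by exact: (primeK_norm_gt1 T (primeOfP p)).
have N1' (p : primeOf K') : (1 < primeNorm p)%N by exact: (primeK_norm_gt1 T' (primeOfP p)).
apply: (@euler_unique R _ _ (@primeNorm K) (@primeNorm K') (char_at chi) (char_at chi') fib fib' B B' q 2) => //.
- by move=> p; apply: (char_at_nrm _ (prime_gt0 l_pr)).
- by move=> p; apply: (char_at_nrm _ (prime_gt0 l_pr)).
- move=> t t2; rewrite -!Lseries_euler // eL //.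
  by rewrite -(rmorph_nat (real_complex R)) /= ltr1n.
Qed.

Section Orthogonality.
Variable n : nat.
Variables (c : 'I_n -> charGroup R Kb l) (c' : 'I_n -> charGroup R Kb' l).
Variable psi : charGroup R Kb l -> charGroup R Kb' l.
Hypothesis psiM : {morph psi : x y / (x * y)%g}.
Hypothesis cc' : forall j, c' j = psi (c j).
Hypothesis psiL : forall chi (s : R[i]), 1 < complex.Re s -> Lseries (val chi) s = Lseries (val (psi chi)) s.
Hypothesis lc : forall j g, lifts T g 1%g -> val (c j) g = 1.
Hypothesis lc' : forall j g, lifts T' g 1%g -> val (c' j) g = 1.

Definition cprod (K0 : fieldType) (K0b : algClosure K0) (d : 'I_n -> charGroup R K0b l)
  (a : {ffun 'I_n -> 'I_l}) : charGroup R K0b l := (\prod_j d j ^+ a j)%g.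

Lemma val_cprod (K0 : fieldType) (K0b : algClosure K0) (d : 'I_n -> charGroup R K0b l) a g :
  val (cprod d a) g = \prod_j (val (d j) g) ^+ a j.
Proof.
rewrite /cprod; elim/big_rec2: _ => [|j x y _ <-] //.
have vX (u : charGroup R K0b l) m : val (u ^+ m)%g g = val u g ^+ m.
  by elim: m => [|m IH]; rewrite ?expg0 ?expr0 // expgS exprS -IH.
by rewrite -vX.
Qed.

Lemma geom_unity (z : C) : z ^+ l = 1 -> \sum_(a < l) z ^+ a = if z == 1 then l%:R else 0.
Proof.
move=> zl; case: eqP => [->|/eqP z1].
  by under eq_bigr do rewrite expr1n; rewrite sumr_const card_ord.
apply/eqP; have := subrX1 z l; rewrite zl subrr => /esym/eqP.
by rewrite mulf_eq0 subr_eq0 (negbTE z1).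
Qed.

Lemma psi1 : psi 1%g = 1%g.
Proof. by apply: (mulgI (psi 1%g)); rewrite -psiM !mulg1. Qed.

Lemma psi_cprod a : psi (cprod c a) = cprod c' a.
Proof.
rewrite /cprod; elim/big_rec2: _ => [|j x y _ <-]; first exact: psi1.
rewrite psiM cc'; congr (_ * _)%g; move: (nat_of_ord (a j)) => m.
by elim: m => [|m IH]; rewrite ?expg0 ?psi1 // !expgS psiM IH.
Qed.

(** Orthogonality over all products of powers of the chosen characters. The sum [N] counts, with the
    factor [l ^ n], the fixed cosets at which all characters take the prescribed values [z j]. Over
    [K] it is positive because of [x0], and by [frobenius_sums] it is the same over [K']. *)
Lemma frobenius_match : exists D' : nat, forall q x0, prime q -> (D' < q)%N ->
  (x0 * phi_ q * x0^-1)%g \in stabK T -> exists x',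
  (x' * phi_ q * x'^-1)%g \in stabK T' /\
  forall j, chiF T' (val (c' j)) (x' * phi_ q * x'^-1)%g = chiF T (val (c j)) (x0 * phi_ q * x0^-1)%g.
Proof.
have [D' DP] := frobenius_sums; exists D' => q x0 q_pr ltq x0H.
set g0 := (x0 * phi_ q * x0^-1)%g in x0H *.
have clK (u : charGroup R Kb l) g : val u g ^+ l = 1 := charGen_exp (valP u) g.
have clK' (u : charGroup R Kb' l) g : val u g ^+ l = 1 := charGen_exp (valP u) g.
have lcp a g : lifts T g 1%g -> val (cprod c a) g = 1.
  by move=> g1; rewrite val_cprod big1 // => j _; rewrite lc // expr1n.
have lcp' a g : lifts T' g 1%g -> val (cprod c' a) g = 1.
  by move=> g1; rewrite val_cprod big1 // => j _; rewrite lc' // expr1n.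
have sums a : \sum_(x in fixq phi_ (stabK T) q) chiF T (val (cprod c a)) (x * phi_ q * x^-1)%g =
  \sum_(x in fixq phi_ (stabK T') q) chiF T' (val (cprod c' a)) (x * phi_ q * x^-1)%g.
  apply: DP => //; [exact: lcp|exact: lcp'|by move=> s s1; rewrite psiL // psi_cprod].
pose z j : C := chiF T (val (c j)) g0.
have zl j : z j ^+ l = 1 by exact: clK.
have z0 j : z j != 0 by exact: dchar_neq0.
pose N : C := \sum_(a : {ffun 'I_n -> 'I_l}) (\prod_j z j ^- a j) *
  \sum_(x in fixq phi_ (stabK T) q) chiF T (val (cprod c a)) (x * phi_ q * x^-1)%g.
have dist (E : G -> 'I_n -> C) (A : {set G}) : (forall x j, E x j ^+ l = 1) ->
    \sum_(a : {ffun 'I_n -> 'I_l}) (\prod_j z j ^- a j) * (\sum_(x in A) \prod_j E x j ^+ a j) =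
    \sum_(x in A) \prod_j (if E x j == z j then l%:R else 0).
  move=> El; under eq_bigr => a _ do rewrite mulr_sumr.
  rewrite exchange_big /=; apply: eq_bigr => x _.
  transitivity (\sum_(a : {ffun 'I_n -> 'I_l}) \prod_j (E x j / z j) ^+ a j).
    by apply: eq_bigr => a _; rewrite -big_split /=; apply: eq_bigr => j _; rewrite expr_div_n mulrC.
  rewrite -(bigA_distr_bigA (fun j (b : 'I_l) => (E x j / z j) ^+ b)); apply: eq_bigr => j _.
  rewrite geom_unity; first by rewrite -(inj_eq (mulIf (z0 j))) divfK // mul1r.
  by rewrite expr_div_n El zl divr1.
have E1 : N = \sum_(x in fixq phi_ (stabK T) q)
    \prod_j (if chiF T (val (c j)) (x * phi_ q * x^-1)%g == z j then l%:R else 0).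
  rewrite -dist; last by move=> x j; exact: clK.
  by apply: eq_bigr => a _; congr (_ * _); apply: eq_bigr => x _; rewrite /chiF val_cprod.
have E2 : N = \sum_(x in fixq phi_ (stabK T') q)
    \prod_j (if chiF T' (val (c' j)) (x * phi_ q * x^-1)%g == z j then l%:R else 0).
  rewrite -dist; last by move=> x j; exact: clK'.
  apply: eq_bigr => a _; rewrite sums; congr (_ * _).
  by apply: eq_bigr => x _; rewrite /chiF val_cprod.
apply: contrapT => no.
have N0 : N = 0.
  rewrite E2; apply: big1 => x xf.
  have xH' : (x * phi_ q * x^-1)%g \in stabK T' by move: xf; rewrite [_ \in fixq _ _ _]inE => /andP[].
  have [j nj] : exists j, chiF T' (val (c' j)) (x * phi_ q * x^-1)%g <> z j.
    apply: contrapT => all; apply: no; exists x; split=> // j.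
    by apply: contrapT => nj; apply: all; exists j.
  by rewrite (bigD1 j) //=; case: eqP => // _; rewrite mul0r.
have [h hH eh] := repr_cosetP (stabK T) x0; set x1 := repr _ in eh.
have ex1 : (x1 * phi_ q * x1^-1)%g = (h * g0 * h^-1)%g by rewrite eh invMg /g0 !mulgA.
have x1f : x1 \in fixq phi_ (stabK T) q.
  rewrite [_ \in fixq _ _ _]inE transv_repr /= ex1; exact: (groupM (groupM hH x0H) (groupVr hH)).
have lpos : 0 <= l%:R :> C by rewrite ler0n.
have : 0 < N.
  rewrite E1 (bigD1 x1) //=; apply: ltr_pwDl.
    apply: prodr_gt0 => j _; rewrite ex1 chiFJ ?eqxx ?ltr0n ?prime_gt0 //; exact: lc.
  by apply: sumr_ge0 => x _; apply: prodr_ge0 => j _; case: ifP.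
by rewrite N0 ltxx.
Qed.

End Orthogonality.
End Coefficients.

(** * Transport along isomorphisms *)

Lemma alint_image (E E' : fieldType) (sg : kiso E E') : @alint E' = sg @` @alint E.
Proof.
apply/seteqP; split=> [z iz|_ [a ia <-]]; last exact/(alint_rmorph sg a).
by exists (ki sg z); [apply/(alint_rmorph (ki sg) z)|rewrite kiK].
Qed.

Lemma image_kiso_inv (E E' : fieldType) (f : kiso E E') (P : set E') : f @` (ki f @` P) = P.
Proof.
apply/seteqP; split=> [_ [_ [z Pz <-] <-]|z Pz]; first by rewrite kiK.
by exists (ki f z); [exists z|rewrite kiK].
Qed.

Definition cj (K K' : fieldType) (Kb : algClosure K) (Kb' : algClosure K') (tau : kiso Kb Kb')
  (g : absGal Kb) (g' : absGal Kb') := forall z, g' (tau z) = tau (g z).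

Section Conjugation.
Variables (K K' : fieldType) (Kb : algClosure K) (Kb' : algClosure K') (tau : kiso Kb Kb').

Lemma cj_inv (g : absGal Kb) (g' : absGal Kb') : cj tau g g' <-> cj (kiso_inv tau) g' g.
Proof.
split=> gg z /=; first by apply: (can_inj (kfK tau)); rewrite kiK -gg kiK.
by have /= h := gg (tau z); rewrite kfK in h; rewrite h kiK.
Qed.

Lemma cj_uniq (g : absGal Kb) (g1 g2 : absGal Kb') : cj tau g g1 -> cj tau g g2 -> g1 = g2.
Proof. by move=> e1 e2; apply: absGal_ext => z; rewrite -(kiK tau z) e1 e2. Qed.

Lemma cjM (g h : absGal Kb) (g' h' : absGal Kb') : cj tau g g' -> cj tau h h' -> cj tau (g * h)%g (g' * h')%g.
Proof. by move=> e1 e2 z; rewrite !absGalM e2 e1. Qed.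

Lemma cj_exists (g : absGal Kb) : (forall b, g (ki tau (acl_emb Kb' b)) = ki tau (acl_emb Kb' b)) ->
  exists g', cj tau g g'.
Proof.
move=> gK; have [f fP] := absGal_rmorph g; have [f' fP'] := absGal_rmorph (g^-1)%g.
pose h : {rmorphism Kb' -> Kb'} := tau \o f \o ki tau.
pose h' : {rmorphism Kb' -> Kb'} := tau \o f' \o ki tau.
have [|||g' gP'] := @absGal_build K' Kb' h h'.
- by move=> z; rewrite /h /h' /= kfK fP fP' absGalVK kiK.
- by move=> z; rewrite /h /h' /= kfK fP fP' absGalKV kiK.
- by move=> b; rewrite /h /= fP gK kiK.
by exists g' => z; rewrite gP' /h /= kfK fP.
Qed.

End Conjugation.

Section Transport.
Variables (R : realType) (K K' : fieldType) (Kb : algClosure K) (Kb' : algClosure K').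
Variables (sg : kiso K K') (tau : kiso Kb Kb').
Hypothesis ext : forall b, tau (acl_emb Kb b) = acl_emb Kb' (sg b).
Variables (chi : dirichletChar R Kb) (chi' : dirichletChar R Kb').
Hypothesis rel : forall g g', cj tau g g' -> chi' g' = chi g.

Lemma ext_cj g : exists g', cj tau g g'.
Proof.
apply: cj_exists => b; have -> : ki tau (acl_emb Kb' b) = acl_emb Kb (ki sg b).
  by apply: (can_inj (kfK tau)); rewrite kiK ext kiK.
by rewrite gal_fix.
Qed.

Lemma ext_cj_inv g' : exists g, cj tau g g'.
Proof.
have [|g gg] := @cj_exists _ _ _ _ (kiso_inv tau) g'.
  by move=> b /=; rewrite ext gal_fix.
by exists g; apply/cj_inv.
Qed.

Lemma charField_image z : charField chi z -> charField chi' (tau z).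
Proof.
move=> cz g' cg'; have [g gg] := ext_cj_inv g'.
by rewrite gg cz // -(rel gg).
Qed.

Lemma charInt_transport z : charInt chi z -> charInt chi' (tau z).
Proof.
by move=> [cz iz]; split; [exact: charField_image|exact/(alint_rmorph tau z)].
Qed.

End Transport.

Section TransportPrimes.
Variables (R : realType) (K K' : fieldType) (Kb : algClosure K) (Kb' : algClosure K').
Variables (sg : kiso K K') (tau : kiso Kb Kb').
Hypothesis ext : forall b, tau (acl_emb Kb b) = acl_emb Kb' (sg b).
Variables (chi : dirichletChar R Kb) (chi' : dirichletChar R Kb').
Hypothesis rel : forall g g', cj tau g g' -> chi' g' = chi g.
Variables (p : primeOf K) (p' : primeOf K').
Hypothesis pp' : val p' = sg @` val p.

Lemma ext_inv b : kiso_inv tau (acl_emb Kb' b) = acl_emb Kb (kiso_inv sg b).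
Proof. by apply: (can_inj (kfK tau)); rewrite kiK ext kiK. Qed.

Lemma rel_inv g' g : cj (kiso_inv tau) g' g -> chi g = chi' g'.
Proof. by move=> /(cj_inv tau) gg; rewrite (rel gg). Qed.

Lemma charInt_imageE : charInt chi' = tau @` charInt chi.
Proof.
apply/seteqP; split=> [z cz|_ [z cz <-]]; last exact: (charInt_transport ext rel).
exists (ki tau z); last by rewrite kiK.
exact: (charInt_transport (sg := kiso_inv sg) (tau := kiso_inv tau) ext_inv rel_inv).
Qed.

Lemma above_image P : prime_above chi p P -> prime_above chi' p' (tau @` P).
Proof.
move=> [nzP eP]; split; first by rewrite charInt_imageE; exact: nonzero_prime_image.
rewrite pp' -eP; apply/seteqP; split=> [b /= [z Pz ez]|_ [b Pb <-]].
  exists (ki sg b); last by rewrite kiK.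
  by rewrite /= -[acl_emb Kb _]ext_inv /= -ez kfK.
by exists (acl_emb Kb b).
Qed.

Lemma emb_image : acl_emb Kb' @` val p' = tau @` (acl_emb Kb @` val p).
Proof.
rewrite pp'; apply/seteqP; split=> [_ [_ [b pb <-] <-]|_ [_ [b pb <-] <-]].
  by exists (acl_emb Kb b); [exists b|].
by exists (sg b); [exists b|rewrite ext].
Qed.

End TransportPrimes.

Section TransportFrobenius.
Variables (R : realType) (K K' : fieldType) (Kb : algClosure K) (Kb' : algClosure K').
Variables (sg : kiso K K') (tau : kiso Kb Kb').
Hypothesis ext : forall b, tau (acl_emb Kb b) = acl_emb Kb' (sg b).
Variables (chi : dirichletChar R Kb) (chi' : dirichletChar R Kb').
Hypothesis rel : forall g g', cj tau g g' -> chi' g' = chi g.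
Variables (p : primeOf K) (p' : primeOf K').
Hypothesis pp' : val p' = sg @` val p.
Hypothesis NN : primeNorm p' = primeNorm p.

Let pp_inv : val p = kiso_inv sg @` val p'.
Proof. by rewrite pp' -[LHS](image_kiso_inv (kiso_inv sg)). Qed.

Lemma above_preimage P' : prime_above chi' p' P' ->
  exists2 P, prime_above chi p P & P' = tau @` P.
Proof.
move=> aP'; exists (ki tau @` P'); last by rewrite image_kiso_inv.
exact: (above_image (sg := kiso_inv sg) (tau := kiso_inv tau) (ext_inv ext) (rel_inv rel) pp_inv aP').
Qed.

Lemma unramified_image : unramified chi p -> unramified chi' p'.
Proof.
move=> unr P' /above_preimage[P aP ->]; have [s1 s2] := unr P aP.
rewrite /is_ramification_index (emb_image ext pp') (charInt_imageE ext rel) !ideal_exp_image.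
split; first by move=> _ [z pz <-]; exists z => //; exact: s1.
move=> sub; apply: s2 => z pz.
by have := sub (tau z); rewrite !(fmorph_image tau); exact.
Qed.

Lemma frobenius_image g g' : cj tau g g' -> is_frobenius chi p g -> is_frobenius chi' p' g'.
Proof.
move=> gg fr P' /above_preimage[P aP ->] w; rewrite (charInt_imageE ext rel) => -[z cz <-].
by rewrite gg NN -rmorphXn -rmorphB (fmorph_image tau); exact: fr.
Qed.

End TransportFrobenius.

Lemma char_at_transport (R : realType) (K K' : fieldExtType rat) (Kb : algClosure K) (Kb' : algClosure K')
    (F F' : splittingFieldType rat) (T : tower Kb F) (T' : tower Kb' F')
    (sg : kiso K K') (tau : kiso Kb Kb') (chi : dirichletChar R Kb) (chi' : dirichletChar R Kb') p p' :
  (forall b, tau (acl_emb Kb b) = acl_emb Kb' (sg b)) ->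
  (forall g g', cj tau g g' -> chi' g' = chi g) ->
  (forall g, lifts T g 1%g -> chi g = 1) -> (forall g, lifts T' g 1%g -> chi' g = 1) ->
  val p' = sg @` val p -> primeNorm p' = primeNorm p -> char_at chi' p' = char_at chi p.
Proof.
move=> ext rel lv lv' pp NN.
have ppi : val p = kiso_inv sg @` val p'.
  by rewrite pp -[LHS](image_kiso_inv (kiso_inv sg)).
have [unr|nunr] := pselect (unramified chi p); last first.
  have nunr' : ~ unramified chi' p'.
    by move=> u; apply: nunr; exact: (unramified_image (ext_inv ext) (rel_inv rel) ppi u).
  by rewrite /char_at; case: asboolP => // _; case: asboolP.
have unr' : unramified chi' p' := unramified_image ext rel pp unr.
have [[g fg]|no] := pselect (exists g, is_frobenius chi p g).
  have [g' gg] := ext_cj ext g.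
  rewrite (char_at_frobenius lv unr fg) (char_at_frobenius lv' unr' (frobenius_image ext rel pp NN gg fg)).
  exact: rel.
have no' g' : ~ is_frobenius chi' p' g'.
  move=> fg'; have [g gg] := ext_cj_inv ext g'; apply: no; exists g.
  apply: (frobenius_image (ext_inv ext) (rel_inv rel) ppi (esym NN) _ fg').
  exact/cj_inv.
(* In the absence of a Frobenius element [get] returns the base point 1, where both characters have
   the value 1. *)
rewrite /char_at; case: asboolP => // _; case: asboolP => // _.
rewrite !getPN; last by move=> g fg; exact: (no' g).
  exact: etrans (dchar1 chi') (esym (dchar1 chi)).
by move=> g fg; apply: no; exists g.
Qed.

Lemma lim_totally_bij (C : topologicalType) (I I' : choiceType) (f : I -> I') (f' : I' -> I)
    (h : {fset I} -> C) (h' : {fset I'} -> C) : cancel f f' -> cancel f' f ->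
  (forall A : {fset I}, h' (f @` A)%fset = h A) -> h @ totally = h' @ totally.
Proof.
move=> ff' f'f hh; apply/seteqP; split=> U [A0 _ UA].
  exists (f @` A0)%fset => // A' sub; have -> : A' = (f @` (f' @` A'))%fset.
    apply/fsetP => x; apply/idP/imfsetP => [xA|[_ /imfsetP[y yA ->] ->]]; last by rewrite f'f.
    by exists (f' x); rewrite ?f'f //; apply/imfsetP; exists x.
  rewrite /= hh; apply: UA => /=; apply/fsubsetP => x xA; apply/imfsetP; exists (f x); rewrite ?ff' //.
  by apply: (fsubsetP sub); apply/imfsetP; exists x.
exists (f' @` A0)%fset => // A sub /=; rewrite -hh; apply: UA => /=; apply/fsubsetP => x xA.
apply/imfsetP; exists (f' x); rewrite ?f'f //.
by apply: (fsubsetP sub); apply/imfsetP; exists x.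
Qed.

Lemma Lseries_transport (R : realType) (K K' : fieldExtType rat) (Kb : algClosure K) (Kb' : algClosure K')
    (F F' : splittingFieldType rat) (T : tower Kb F) (T' : tower Kb' F')
    (sg : kiso K K') (tau : kiso Kb Kb') (chi : dirichletChar R Kb) (chi' : dirichletChar R Kb') s :
  (forall b, tau (acl_emb Kb b) = acl_emb Kb' (sg b)) ->
  (forall g g', cj tau g g' -> chi' g' = chi g) ->
  (forall g, lifts T g 1%g -> chi g = 1) -> (forall g, lifts T' g 1%g -> chi' g = 1) ->
  Lseries chi s = Lseries chi' s.
Proof.
move=> ext rel lv lv'.
have img (E E' : fieldExtType rat) (f : kiso E E') (p : primeOf E) : (f @` val p) \in @primeSet E'.
  rewrite inE /primeSet /= OKE (alint_image f) -(OKE E); apply: nonzero_prime_image; exact: primeOfP.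
pose f (p : primeOf K) : primeOf K' := exist _ (sg @` val p) (img K K' sg p).
pose f' (p : primeOf K') : primeOf K := exist _ (ki sg @` val p) (img K' K (kiso_inv sg) p).
have ff' : cancel f f'.
  by move=> p; apply: val_inj => /=; exact: (image_kiso_inv (kiso_inv sg)).
have f'f : cancel f' f by move=> p; apply: val_inj => /=; exact: image_kiso_inv.
rewrite /Lseries; congr (lim _); apply: (lim_totally_bij ff' f'f) => A.
rewrite big_imfset /=; last by move=> p q _ _; exact: (can_inj ff').
apply: eq_bigr => p _.
have NN : primeNorm (f p) = primeNorm p.
  rewrite /primeNorm /= OKE (alint_image sg) -(OKE K); apply: ideal_norm_image.
  - exact: OK_subring.
  - exact: (prime_isideal (is_nonzero_prime_ideal (primeOfP p))).
  - exact: (primeK_finite T (primeOfP p)).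
by rewrite NN (char_at_transport (T := T) (T' := T') ext rel lv lv' (erefl : val (f p) = sg @` val p) NN).
Qed.

(** * Rigidity *)

Lemma kgen_fix (K : fieldExtType rat) (E : fieldType) (f g : {rmorphism K -> E}) :
  f (kgen K) = g (kgen K) -> forall b, f b = g b.
Proof. by move=> e b; exact: rmorph_kgen_ext. Qed.

Lemma fixed_absGal (K : fieldExtType rat) (Kb : algClosure K) (z : Kb) :
  (forall g : absGal Kb, g z = z) -> exists b, z = acl_emb Kb b.
Proof.
move=> fz; have [e [e' [ee' e'e]]] := closure_iso Kb.
have [|b eb] := @fixed_by_stabilizer K (e \o acl_emb Kb : {rmorphism K -> algC}) (e z).
  move=> nu nuK.
  pose f : {rmorphism Kb -> Kb} := e' \o nu \o e.
  pose f' : {rmorphism Kb -> Kb} := e' \o algC_invaut nu \o e.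
  have [|||g gP] := @absGal_build K Kb f f'.
  - by move=> y; rewrite /f /f' /= e'e algC_autK ee'.
  - by move=> y; rewrite /f /f' /= e'e algC_invautK ee'.
  - by move=> b; have /= := nuK b; rewrite /f /= => ->; rewrite ee'.
  by apply: (can_inj e'e); rewrite ee' -[RHS](fz g) gP.
by exists b; apply: (can_inj ee').
Qed.

Section Isos.
Variables (K K' : fieldExtType rat) (Kb : algClosure K) (Kb' : algClosure K').
Variables (e : {rmorphism Kb -> algC}) (ei : {rmorphism algC -> Kb}).
Variables (f : {rmorphism Kb' -> algC}) (fi : {rmorphism algC -> Kb'}).
Hypotheses (eK : cancel e ei) (eiK : cancel ei e) (fK : cancel f fi) (fiK : cancel fi f).

Lemma kiso_of_aut (nu : {rmorphism algC -> algC}) :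
  exists tau : kiso Kb Kb', forall z, tau z = fi (nu (e z)).
Proof.
pose t : {rmorphism Kb -> Kb'} := fi \o nu \o e.
pose t' : {rmorphism Kb' -> Kb} := ei \o algC_invaut nu \o f.
have tt' : cancel t t' by move=> z; rewrite /t /t' /= fiK algC_autK eK.
have t't : cancel t' t by move=> z; rewrite /t /t' /= eiK algC_invautK fK.
by exists (Kiso tt' t't).
Qed.

(** Up to Gal(Kb'/K') an isomorphism is determined by the preimage of a generator of [K'], which is
    a root of one fixed rational polynomial. Roots that do not arise in this way are assigned the
    arbitrary [tau0]. *)
Lemma finite_isos : exists (n : nat) (ts : 'I_n -> kiso Kb Kb'), forall tau : kiso Kb Kb',
  exists j, forall b, tau (ki (ts j) (acl_emb Kb' b)) = acl_emb Kb' b.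
Proof.
pose w := acl_emb Kb' (kgen K').
have [r [er rm] _] := minCpolyP (f w).
have [rs ers] := closed_field_poly_normal (map_poly ratr r : {poly algC}).
have [tau0 _] := kiso_of_aut idfun.
have /choice[ts tsP] : forall j : 'I_(size rs), exists tau : kiso Kb Kb',
    (exists tau : kiso Kb Kb', e (ki tau w) = rs`_j) -> e (ki tau w) = rs`_j.
  move=> j; have [[tau et]|no] := pselect (exists tau : kiso Kb Kb', e (ki tau w) = rs`_j).
    by exists tau.
  by exists tau0 => /no.
exists (size rs), ts => tau.
have : e (ki tau w) \in rs.
  rewrite -root_prod_XsubC -(rootZ _ _ (a := lead_coef (map_poly ratr r : {poly algC}))).
    pose nu : {rmorphism algC -> algC} := e \o ki tau \o fi.
    have -> : e (ki tau w) = nu (f w) by rewrite /nu /= fK.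
    have -> : lead_coef (map_poly ratr r) *: \prod_(a <- rs) ('X - a%:P) = map_poly nu (map_poly ratr r).
      rewrite -ers -map_poly_comp; apply: eq_map_poly => a /=.
      by rewrite -[RHS]/(nu (ratr a)) fmorph_rat.
    by rewrite fmorph_root -er root_minCpoly.
  by rewrite lead_coef_eq0 map_poly_eq0 monic_neq0.
move=> /(nthP 0)[j jlt ej]; pose jo := Ordinal jlt; exists jo => b.
have etj : e (ki (ts jo) w) = rs`_jo by apply: tsP; exists tau.
have ew : ki (ts jo) w = ki tau w by apply: (can_inj eK); rewrite etj -ej.
have := @kgen_fix K' Kb (ki (ts jo) \o acl_emb Kb' : {rmorphism K' -> Kb})
  (ki tau \o acl_emb Kb' : {rmorphism K' -> Kb}) ew b.
by move=> /= ->; rewrite kiK.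
Qed.

(** Frobenius elements for [K] and for [K'] are compared inside one group, hence the common [F] with
    a common embedding into [algC]. *)
Lemma towers_exist (S : seq Kb) (S' : seq Kb') : exists (F : splittingFieldType rat)
   (T : tower Kb F) (T' : tower Kb' F),
  [/\ tw_e T = e, tw_e T' = f, tw_FC T =1 tw_FC T',
      (forall g, lifts T g 1%g -> {in S, g =1 id})
    & (forall g, lifts T' g 1%g -> {in S', g =1 id})].
Proof.
have [F [FC FP]] := galois_field_exists
  (e (acl_emb Kb (kgen K)) :: f (acl_emb Kb' (kgen K')) :: map e S ++ map f S').
have [|T [TFC Te]] := tower_exists eK eiK (FC := FC); first by apply: FP; rewrite mem_head.
have [|T' [TFC' Te']] := tower_exists fK fiK (FC := FC); first by apply: FP; rewrite !inE eqxx orbT.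
exists F, T, T'; split=> //.
- by move=> a; rewrite TFC TFC'.
- move=> g g1 z zS; have [a ea] : exists a, FC a = e z by apply: FP; rewrite !inE mem_cat map_f ?orbT.
  have -> : z = tw_i T a by apply: (can_inj eK); rewrite -ea -TFC twE Te.
  by rewrite g1 gal_id.
- move=> g g1 z zS; have [a ea] : exists a, FC a = f z by apply: FP; rewrite !inE mem_cat map_f ?orbT.
  have -> : z = tw_i T' a by apply: (can_inj fK); rewrite -ea -TFC' twE Te'.
  by rewrite g1 gal_id.
Qed.

End Isos.

Section Rigidity.
Variables (R : realType) (K K' : fieldExtType rat) (Kb : algClosure K) (Kb' : algClosure K') (l : nat).
Hypothesis l_pr : prime l.
Variable psi : charGroup R Kb l -> charGroup R Kb' l.
Hypothesis psi_bij : bijective psi.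
Hypothesis psiM : {morph psi : x y / (x * y)%g}.
Hypothesis psiL : forall chi (s : R[i]), 1 < complex.Re s -> Lseries (val chi) s = Lseries (val (psi chi)) s.
Implicit Types (tau : kiso Kb Kb') (c : seq (charGroup R Kb l)) (chi : charGroup R Kb l).

(* This is the subgroup H_tau of the introduction, for the characters in c. *)
Definition matches tau c (g : absGal Kb) := exists2 g', cj tau g g' &
  forall chi, chi \in c -> val (psi chi) g' = val chi g.

Lemma matches1 tau c : matches tau c 1%g.
Proof. by exists 1%g => // chi _; rewrite !dchar1. Qed.

Lemma matchesM tau c g h : matches tau c g -> matches tau c h -> matches tau c (g * h)%g.
Proof.
move=> [g' gg gP] [h' hh hP]; exists (g' * h')%g; first exact: cjM.
by move=> chi cc; rewrite !dcharM gP ?hP.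
Qed.

Lemma matches_sub tau c c' g : {subset c' <= c} -> matches tau c g -> matches tau c' g.
Proof. by move=> sub [g' gg gP]; exists g' => // chi cc; apply: gP; exact: sub. Qed.

Lemma ki_fix tau (g : absGal Kb) : g (ki tau (acl_emb Kb' (kgen K'))) = ki tau (acl_emb Kb' (kgen K')) ->
  forall b, g (ki tau (acl_emb Kb' b)) = ki tau (acl_emb Kb' b).
Proof.
move=> gk b; have [h hP] := absGal_rmorph g; rewrite -hP.
apply: (@kgen_fix K' Kb (h \o ki tau \o acl_emb Kb' : {rmorphism K' -> Kb})
  (ki tau \o acl_emb Kb' : {rmorphism K' -> Kb})) => /=.
by rewrite hP.
Qed.

Lemma matches_level tau c : exists s : seq Kb, forall g : absGal Kb, {in s, g =1 id} -> matches tau c g.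
Proof.
elim: c => [|chi c [s sP]].
  exists [:: ki tau (acl_emb Kb' (kgen K'))] => g gs.
  have [|g' gg] := cj_exists (tau := tau) (g := g); last by exists g'.
  by apply: ki_fix; apply: gs; rewrite mem_head.
have [s1 s1P] := level_exists (prime_gt0 l_pr) (charGen_exp (valP chi)).
have [s2 s2P] := level_exists (prime_gt0 l_pr) (charGen_exp (valP (psi chi))).
exists (s ++ s1 ++ map (ki tau) s2) => g gs.
have [g' gg gP] : matches tau c g by apply: sP => z zs; apply: gs; rewrite mem_cat zs.
exists g' => // chi0; rewrite inE => /orP[/eqP->|]; last exact: gP.
rewrite [val chi g]s1P ?[val (psi chi) g']s2P // => z zs.
  by rewrite -{1}(kiK tau z) gg gs ?kiK // !mem_cat map_f ?orbT.
by apply: gs; rewrite !mem_cat zs orbT.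
Qed.

(** The point is that [s] does not depend on [chi]: tau is compatible with [psi] for all characters
    at once on one open subgroup. *)
Definition agree tau := exists s : seq Kb, forall g : absGal Kb, {in s, g =1 id} -> forall chi, matches tau [:: chi] g.

(** Each character strictly shrinks the group of elements matched by its predecessors, so the index
    at least doubles with each of them. *)
Fixpoint indep tau c : Prop :=
  if c is chi :: c' then indep tau c' /\ exists g, matches tau c' g /\ ~ matches tau (chi :: c') g else True.

(** The elements matched by a finite list contain an open subgroup. If tau does not agree, some
    character fails on that subgroup, and it extends the list. *)
Lemma indep_long tau m : ~ agree tau -> exists c, size c = m /\ indep tau c.
Proof.
move=> na; elim: m => [|m [c [sc ic]]]; first by exists [::].
have [s sP] := matches_level tau c.
have [g [gs [chi nm]]] : exists g : absGal Kb, {in s, g =1 id} /\ exists chi, ~ matches tau [:: chi] g.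
  apply: contrapT => no; apply: na; exists s => g gs chi; apply: contrapT => nm.
  by apply: no; exists g; split=> //; exists chi.
exists (chi :: c); split; first by rewrite /= sc.
split=> //; exists g; split; first exact: sP.
move=> mc; apply: nm; apply: matches_sub mc => x; rewrite mem_seq1 => /eqP ->; exact: mem_head.
Qed.

Lemma kiso_absGal (rho : kiso Kb' Kb') : (forall b, rho (acl_emb Kb' b) = acl_emb Kb' b) ->
  exists h : absGal Kb', h =1 rho.
Proof. exact: absGal_build (kfK rho) (kiK rho). Qed.

(** If [t2] composed with the inverse of [t1] moved [K'], [richness] would give [g1] and [h1],
    conjugates of one and the same [g] near the identity by [t1] and [t2], and a character [chi']
    separating them. But by surjectivity [chi'] is some [psi chi], and both values equal [chi g]. *)
Lemma agree_uniq (t1 t2 : kiso Kb Kb') : agree t1 -> agree t2 -> forall b, t2 (ki t1 (acl_emb Kb' b)) = acl_emb Kb' b.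
Proof.
move=> [s1 a1] [s2 a2]; pose rho := kiso_comp (kiso_inv t1) t2.
apply: contrapT => nK.
pose s' := t1 (acl_emb Kb (kgen K)) :: map t1 (s1 ++ s2).
have [chi' [g1 [h1 [gs hg ne]]]] := richness R s' l_pr (tau := rho) nK.
have [psi' psiK psi'K] := psi_bij.
have [|g gg0] := cj_exists (tau := kiso_inv t1) (g := g1).
  move=> b /=; have [h hP] := absGal_rmorph g1; rewrite -hP.
  apply: (@kgen_fix K Kb' (h \o t1 \o acl_emb Kb : {rmorphism K -> Kb'}) (t1 \o acl_emb Kb : {rmorphism K -> Kb'})) => /=.
  by rewrite hP; apply: gs; rewrite mem_head.
have gg : cj t1 g g1 by apply/cj_inv.
have gfix z : z \in s1 ++ s2 -> g z = z.
  by move=> zs; apply: (can_inj (kfK t1)); rewrite -gg; apply: gs; rewrite inE map_f ?orbT.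
have [|g1' c1 e1] := a1 g _ (psi' chi'); first by move=> z zs; apply: gfix; rewrite mem_cat zs.
have [|g2' c2 e2] := a2 g _ (psi' chi'); first by move=> z zs; apply: gfix; rewrite mem_cat zs orbT.
have h1c : cj t2 g h1.
  move=> z; have := hg (t1 z); rewrite /= kfK => ->.
  by rewrite gg kfK.
apply: ne; have := e1 _ (mem_head _ _); have := e2 _ (mem_head _ _).
by rewrite psi'K (cj_uniq c1 gg) (cj_uniq c2 h1c) => -> ->.
Qed.

(** Changing tau by an element of Gal(Kb'/K') conjugates [g'], which no character notices; so only
    the class of tau matters. *)
Lemma matches_fix (t1 t2 : kiso Kb Kb') c g : (forall b, t2 (ki t1 (acl_emb Kb' b)) = acl_emb Kb' b) ->
  matches t1 c g -> matches t2 c g.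
Proof.
move=> fx [g' gg gP]; have [h hP] := kiso_absGal (rho := kiso_comp (kiso_inv t1) t2) fx.
have ht z : h (t1 z) = t2 z by rewrite hP /= kfK.
exists (h * g' * h^-1)%g; last by move=> chi cc; rewrite dcharJ gP.
by move=> z; rewrite -!ht !absGalM absGalVK gg.
Qed.

Section FiniteLevel.
Variables (F : splittingFieldType rat) (T : tower Kb F).
Local Notation G := (gal_of {:F}).

Definition matchF_set tau c : {set G} :=
  finset (fun x : G => `[< exists2 g, lifts T g x & matches tau c g >]).

Lemma matchF_setP tau c (x : G) : reflect (exists2 g, lifts T g x & matches tau c g) (x \in matchF_set tau c).
Proof. by rewrite [_ \in matchF_set _ _]inE; exact: asboolP. Qed.

Lemma matchF_group_set tau c : group_set (matchF_set tau c).
Proof.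
apply/group_setP; split=> [|x y /matchF_setP[g gx mg] /matchF_setP[h hy mh]].
  by apply/matchF_setP; exists 1%g; [exact: lifts1|exact: matches1].
by apply/matchF_setP; exists (h * g)%g; [exact: liftsM|exact: matchesM].
Qed.

Definition matchF tau c : {group G} := Group (matchF_group_set tau c).

Lemma matchF_sub tau c c' : {subset c' <= c} -> matchF tau c \subset matchF tau c'.
Proof.
move=> sub; apply/fintype.subsetP => x /matchF_setP[g gx mg].
by apply/matchF_setP; exists g => //; exact: matches_sub mg.
Qed.

Lemma matchF_stab tau c : matchF tau c \subset stabK T.
Proof.
apply/fintype.subsetP => x /matchF_setP[g gx mg].
by have [y yH gy] := res_exists T g; rewrite (lifts_uniq gx gy).
Qed.

(** Under this condition the restriction of an element to [F] decides whether it matches, so that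
    [matchF] loses no information. *)
Definition bigenough tau c := forall g, lifts T g 1%g -> matches tau c g.

Lemma matchF_lifts tau c g x : bigenough tau c -> lifts T g x -> x \in matchF tau c -> matches tau c g.
Proof.
move=> big gx /matchF_setP[h hx mh]; have -> : g = (h * (h^-1 * g))%g by rewrite mulKVg.
apply: matchesM => //; apply: big; rewrite -(mulgV x); apply: liftsM => //; exact: liftsV.
Qed.

Lemma proper_group_half (A B : {group G}) : A \proper B -> (2 * #|A| <= #|B|)%N.
Proof.
move=> pr; have /dvdnP[m em] := cardSg (proper_sub pr).
have := proper_card pr; rewrite em; have := cardG_gt0 A; move: #|A| => a.
by case: m {em} => [|[|m]]; clear; nia.
Qed.

Lemma indep_index tau c : bigenough tau c -> indep tau c -> (2 ^ size c * #|matchF tau c| <= #|stabK T|)%N.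
Proof.
elim: c => [|chi c IH] big; first by move=> _; rewrite mul1n subset_leq_card // matchF_stab.
move=> [ic [g [mg nmg]]].
have big' : bigenough tau c.
  by move=> h h1; apply: matches_sub (big h h1) => x xc; rewrite inE xc orbT.
apply: leq_trans (IH big' ic); rewrite /= expnSr -mulnA leq_mul2l; apply/orP; right.
apply: (proper_group_half (A := matchF tau (chi :: c)) (B := matchF tau c)); rewrite properE matchF_sub /=; last by move=> x xc; rewrite inE xc orbT.
have [x _ gx] := res_exists T g.
apply/negP => /fintype.subsetP /(_ x) h; apply: nmg; apply: (matchF_lifts big gx); apply: h.
by apply/matchF_setP; exists g.
Qed.

End FiniteLevel.

Section Cover.
Variables (e : {rmorphism Kb -> algC}) (ei : {rmorphism algC -> Kb}).
Variables (f : {rmorphism Kb' -> algC}) (fi : {rmorphism algC -> Kb'}).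
Hypotheses (eK : cancel e ei) (eiK : cancel ei e) (fK : cancel f fi) (fiK : cancel fi f).
Variables (n : nat) (ts : 'I_n -> kiso Kb Kb').
Hypothesis tsP : forall tau : kiso Kb Kb',
  exists j, forall b, tau (ki (ts j) (acl_emb Kb' b)) = acl_emb Kb' b.

Variables (F : splittingFieldType rat) (T : tower Kb F) (T' : tower Kb' F).
Local Notation G := (gal_of {:F}).
Hypotheses (Te : tw_e T = e) (Te' : tw_e T' = f) (TT' : tw_FC T =1 tw_FC T').
Variable c : seq (charGroup R Kb l).
Hypothesis lc : forall chi, chi \in c -> forall g, lifts T g 1%g -> val chi g = 1.
Hypothesis lc' : forall chi, chi \in c -> forall g, lifts T' g 1%g -> val (psi chi) g = 1.

(** Extended to [algC] and read through the two towers, [y] becomes an isomorphism from [Kb] to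
    [Kb']. It lies in the class of some [ts j], which by [matches_fix] has the same matching
    elements. *)
Lemma conj_matches (g0 y : G) : g0 \in stabK T -> (y^-1 * g0 * y)%g \in stabK T' ->
  (forall chi, chi \in c -> chiF T' (val (psi chi)) (y^-1 * g0 * y)%g = chiF T (val chi) g0) ->
  exists j, g0 \in matchF T (ts j) c.
Proof.
move=> g0H g0H' eqc; have [nu nuP] := gal_lift (tw_FC T) y.
have [tau tauP] := kiso_of_aut eK eiK fK fiK nu.
have ti a : tau (tw_i T a) = tw_i T' (y a).
  apply: (can_inj fK); rewrite tauP fiK -Te -[tw_e T _]/(tw_FC T a) nuP TT' twE Te'.
  by [].
have kti a : ki tau (tw_i T' a) = tw_i T ((y^-1)%g a).
  by apply: (can_inj (kfK tau)); rewrite kiK ti galVf.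
have [g gx] := lifts_exists g0H.
have cl a : tau (g (ki tau (tw_i T' a))) = tw_i T' ((y^-1 * g0 * y)%g a).
  by rewrite kti gx ti !galMf.
have [|g1 gg1] := cj_exists (tau := tau) (g := g).
  move=> b; apply: (can_inj (kfK tau)); rewrite kiK -(tw_ik T') cl.
  by have /stabKP -> := g0H'.
have g1x : lifts T' g1 (y^-1 * g0 * y)%g by move=> a; rewrite -cl -gg1 kiK.
have [j jP] := tsP tau; exists j; apply/matchF_setP; exists g => //.
apply: (@matches_fix tau (ts j)).
  by move=> b; rewrite -{1}(jP b) kfK kiK.
exists g1 => // chi cc.
by rewrite (chiF_lifts (lc' cc) g1x) (chiF_lifts (lc cc) gx) eqc.
Qed.

Lemma match_cover (I : finType) (Hi : I -> {group G}) :
  (forall j, exists i, matchF T (ts j) c \subset Hi i) -> (#|stabK T| <= \sum_i #|Hi i|)%N.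
Proof.
move=> cov; have [D [Q_ [phi_ goodP]]] := good_primes_exist (tw_FC T).
pose d j := tnth (in_tuple c) j.
have dc j : d j \in c by exact: mem_tnth.
have [D' DP] := frobenius_match l_pr (T := T) (T' := T') goodP psiM (fun j => erefl (psi (d j))) psiL
  (fun j => lc (dc j)) (fun j => lc' (dc j)).
have goodP' q : prime q -> (maxn D D' < q)%N -> good_prime q (Q_ q) (phi_ q).
  by move=> q_pr; rewrite gtn_max => /andP[+ _]; exact: goodP.
apply: (frobenius_cover R (tw_FC T) goodP') => q x q_pr; rewrite gtn_max => /andP[_ ltq] xH.
have [x' [xH' eqc]] := DP q x q_pr ltq xH.
have ey : ((x * x'^-1)^-1 * (x * phi_ q * x^-1) * (x * x'^-1))%g = (x' * phi_ q * x'^-1)%g.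
  by rewrite invMg invgK !mulgA mulgKV mulgKV.
have [|||j xj] := @conj_matches (x * phi_ q * x^-1)%g (x * x'^-1)%g.
- by [].
- by rewrite ey.
- by move=> chi /(tnthP (in_tuple c))[j ->]; rewrite ey; exact: eqc.
by have [i /fintype.subsetP sub] := cov j; exists i; exact: sub.
Qed.

End Cover.

Lemma psi_rigid : exists tau, forall g chi, matches tau [:: chi] g.
Proof.
have [e [ei [eK eiK]]] := closure_iso Kb; have [f [fi [fK fiK]]] := closure_iso Kb'.
have [n [ts tsP]] := finite_isos eK eiK fK fiK.
(* Chosen so that [2 ^ m > 2 * n]: at most [n] subgroups of index at least [2 ^ m] together have
   fewer than half the elements of [H]. *)
pose m := (2 * n).+1.
have /choice[cs csP] : forall j, exists c, ~ agree (ts j) -> size c = m /\ indep (ts j) c.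
  move=> j; have [aj|naj] := pselect (agree (ts j)); first by exists [::].
  by have [c cP] := indep_long m naj; exists c.
pose J := {j : 'I_n | ~~ `[< agree (ts j) >]}.
have JP (j : J) : ~ agree (ts (val j)) by have := valP j => /asboolPn.
have setup (c0 : seq (charGroup R Kb l)) : exists (F : splittingFieldType rat) (T : tower Kb F),
   let c := c0 ++ flatten [seq cs j | j <- enum 'I_n] in
   [/\ forall j, bigenough T (ts j) c,
       (2 ^ m * (\sum_(j : J) #|matchF T (ts (val j)) c|) <= n * #|stabK T|)%N
     & forall (I : finType) (Hi : I -> {group gal_of {:F}}),
       (forall j, exists i, matchF T (ts j) c \subset Hi i) -> (#|stabK T| <= \sum_i #|Hi i|)%N].
  set c := c0 ++ _.
  have /choice[S1 S1P] : forall j, exists s : seq Kb, forall g : absGal Kb, {in s, g =1 id} -> matches (ts j) c g.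
    by move=> j; exact: matches_level.
  have /choice[S2 S2P] : forall chi, exists s, level (val chi) s.
    by move=> chi; exact: (level_exists (prime_gt0 l_pr) (charGen_exp (valP chi))).
  have /choice[S3 S3P] : forall chi, exists s, level (val (psi chi)) s.
    by move=> chi; exact: (level_exists (prime_gt0 l_pr) (charGen_exp (valP (psi chi)))).
  pose S := flatten [seq S1 j | j <- enum 'I_n] ++ flatten (map S2 c).
  have [F [T [T' [Te Te' TT' SP SP']]]] := towers_exist eK eiK fK fiK S (flatten (map S3 c)).
  have big j : bigenough T (ts j) c.
    move=> g g1; apply: S1P => z zs; apply: (SP g g1); rewrite mem_cat; apply/orP; left.
    by apply/flattenP; exists (S1 j) => //; apply: map_f; rewrite mem_enum.
  have lc chi : chi \in c -> forall g, lifts T g 1%g -> val chi g = 1.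
    move=> cc g g1; apply: S2P => z zs; apply: (SP g g1); rewrite mem_cat; apply/orP; right.
    by apply/flattenP; exists (S2 chi) => //; exact: map_f.
  have lc' chi : chi \in c -> forall g, lifts T' g 1%g -> val (psi chi) g = 1.
    move=> cc g g1; apply: S3P => z zs; apply: (SP' g g1).
    by apply/flattenP; exists (S3 chi) => //; exact: map_f.
  have subc j : {subset cs j <= c}.
    move=> x xc; rewrite mem_cat; apply/orP; right; apply/flattenP; exists (cs j) => //.
    by apply: map_f; rewrite mem_enum.
  exists F, T; split=> //.
    rewrite big_distrr /=; apply: leq_trans (_ : \sum_(j : J) #|stabK T| <= _)%N; last first.
      by rewrite sum_nat_const leq_mul2r card_sig; apply/orP; right; rewrite -[X in (_ <= X)%N](card_ord n) max_card.
    apply: leq_sum => j _; have [sz ind] := csP _ (JP j).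
    have bigj : bigenough T (ts (val j)) (cs (val j)).
      by move=> g g1; apply: matches_sub (big (val j) g g1); exact: subc.
    apply: leq_trans (indep_index bigj ind); rewrite sz leq_mul2l; apply/orP; right.
    by apply: subset_leq_card; apply: matchF_sub; exact: subc.
  by move=> I Hi; exact: (match_cover eK eiK fK fiK tsP Te Te' TT' lc lc').
have m2 : (2 * n < 2 ^ m)%N by apply: leq_trans (ltn_expl m (ltnSn 1)); rewrite /m; lia.
(* Otherwise all classes are bad, and their subgroups are too small to cover [H]. *)
have [j0 aj0] : exists j, agree (ts j).
  apply: contrapT => no; have [F [T [big sumJ cov]]] := setup [::].
  set c := [::] ++ _ in big sumJ cov.
  have naj j : ~~ `[< agree (ts j) >] by apply/asboolPn => aj; apply: no; exists j.
  have := cov _ (fun j : J => matchF T (ts (val j)) c) (fun j => ex_intro _ (Sub j (naj j) : J) (subxx _)).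
  move: sumJ (cardG_gt0 (stabK T)); move: (\sum_(j : J) _)%N (#|stabK T|) (2 ^ m)%N m2 => a b d.
  by clear; nia.
(* The index [j0] is fixed before [chi0] and the field [F] that accommodates it. By [agree_uniq] and
   [matches_fix] all agreeing classes have the same matching elements, so a single subgroup stands
   for them. *)
exists (ts j0) => g0 chi0; apply: contrapT => nm.
have [F [T [big sumJ cov]]] := setup [:: chi0]; set c := [:: chi0] ++ _ in big sumJ cov.
pose Hi (o : J + unit) := match o with inl j => matchF T (ts (val j)) c | inr _ => matchF T (ts j0) c end.
have covH j : exists o, matchF T (ts j) c \subset Hi o.
  have [naj|/negPn/asboolP aj] := boolP (~~ `[< agree (ts j) >]).
    by exists (inl (Sub j naj : J)).
  exists (inr tt); apply/fintype.subsetP => x /matchF_setP[g gx mg]; apply/matchF_setP; exists g => //.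
  by apply: matches_fix mg; exact: agree_uniq.
have half : (2 * #|matchF T (ts j0) c| <= #|stabK T|)%N.
  apply: proper_group_half; rewrite properE matchF_stab /=; apply/negP => /fintype.subsetP sub.
  have [x xH gx] := res_exists T g0.
  have := matchF_lifts (big j0) gx (sub x xH); move=> mc; apply: nm; apply: matches_sub mc => y.
  by rewrite mem_seq1 => /eqP ->; exact: mem_head.
have := cov _ Hi covH.
have -> : (\sum_o #|Hi o| = #|matchF T (ts j0) c| + \sum_(j : J) #|matchF T (ts (val j)) c|)%N.
  by rewrite big_sumType /= addnC (big_pred1 tt) // => -[].
move: half sumJ (cardG_gt0 (stabK T)).
move: (\sum_(j : J) _)%N (#|matchF T (ts j0) c|) (#|stabK T|) (2 ^ m)%N m2 => a h b d.
by clear; nia.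
Qed.

End Rigidity.

Section CharTransport.
Variables (R : realType) (K K' : fieldExtType rat) (Kb : algClosure K) (Kb' : algClosure K') (l : nat).
Hypothesis l_pr : prime l.

Lemma char_transport_exists (sg : kiso K K') (tau : kiso Kb Kb') :
  (forall b, tau (acl_emb Kb b) = acl_emb Kb' (sg b)) ->
  exists psi : charGroup R Kb l -> charGroup R Kb' l,
    forall chi g g', cj tau g g' -> val (psi chi) g' = val chi g.
Proof.
move=> ext; have /choice[d dP] : forall g', exists g, cj tau g g' by exact: ext_cj_inv ext.
have dM g' h' : d (g' * h')%g = (d g' * d h')%g.
  apply: (cj_uniq (tau := kiso_inv tau) (g := (g' * h')%g)); apply/(cj_inv tau).
    exact: dP.
  by apply: cjM; exact: dP.
suff /choice[psi psiP] : forall chi : charGroup R Kb l, exists psichi : charGroup R Kb' l,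
    forall g g', cj tau g g' -> val psichi g' = val chi g by exists psi.
move=> chi.
pose f g' := val chi (d g').
have fM g' h' : f (g' * h')%g = f g' * f h' by rewrite /f dM dcharM.
have f0 g' : f g' != 0 by exact: dchar_neq0.
have [s sP] := level_exists (prime_gt0 l_pr) (charGen_exp (valP chi)).
have fs (g' : absGal Kb') : {in map tau s, g' =1 id} -> f g' = 1.
  move=> gs; apply: sP => z zs; apply: (can_inj (kfK tau)).
  by rewrite -(dP g') gs // map_f.
pose chi' := DirichletChar f0 fM (level_continuous fM fs).
have chiG : chi' \in charGen l.
  by apply: charGenP => // g'; exact: (charGen_exp (valP chi)).
exists (exist _ chi' chiG) => g g' gg /=; rewrite /f; congr (val chi _).
by apply: (cj_uniq (tau := kiso_inv tau) (g := g')); apply/(cj_inv tau).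
Qed.

End CharTransport.

(** * The correspondence between the two sets of isomorphisms *)

Section Correspondence.
Variables (R : realType) (K K' : fieldExtType rat) (Kb : algClosure K) (Kb' : algClosure K') (l : nat).
Hypothesis l_pr : prime l.
Implicit Types (psi : isoLseries R Kb Kb' l) (sigma : isoField K K').

(** [tau] is hidden behind an existential because it is determined only up to Gal(Kb'/K'), a change
    that affects neither [sigma] nor [psi]. *)
Definition corresponds psi sigma := exists tau : kiso Kb Kb',
  (forall b, tau (acl_emb Kb b) = acl_emb Kb' (sval sigma b)) /\
  forall (chi : charGroup R Kb l) g g', cj tau g g' -> val (sval psi chi) g' = val chi g.

Lemma isoField_kiso sigma : exists sg : kiso K K', sg =1 sval sigma.
Proof.
case: sigma => f [[f' ff' f'f] fa fm] /=.
have f'a : zmod_morphism f' by move=> x y; apply: (can_inj ff'); rewrite fa !f'f.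
have f'm : GRing.monoid_morphism f'.
  by split=> [|x y]; apply: (can_inj ff'); rewrite ?fm.1 ?fm.2 !f'f.
pose F1 : {rmorphism K -> K'} := HB.pack f (GRing.isZmodMorphism.Build K K' f fa)
  (GRing.isMonoidMorphism.Build K K' f fm).
pose F2 : {rmorphism K' -> K} := HB.pack f' (GRing.isZmodMorphism.Build K' K f' f'a)
  (GRing.isMonoidMorphism.Build K' K f' f'm).
by exists (@Kiso K K' F1 F2 ff' f'f).
Qed.

Lemma kiso_extend (sg : kiso K K') :
  exists tau : kiso Kb Kb', forall b, tau (acl_emb Kb b) = acl_emb Kb' (sg b).
Proof.
have [e [ei [eK eiK]]] := closure_iso Kb; have [f [fi [fK fiK]]] := closure_iso Kb'.
have [nu nuP] := embeddings_conjugate (e \o acl_emb Kb : {rmorphism K -> algC})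
  (f \o acl_emb Kb' \o sg : {rmorphism K -> algC}).
have [tau tauP] := kiso_of_aut eK eiK fK fiK nu; exists tau => b.
by rewrite tauP; have /= -> := nuP b; rewrite fK.
Qed.

Lemma corresponds_agree psi sigma (tau : kiso Kb Kb') :
  (forall b, tau (acl_emb Kb b) = acl_emb Kb' (sval sigma b)) ->
  (forall (chi : charGroup R Kb l) g g', cj tau g g' -> val (sval psi chi) g' = val chi g) ->
  agree (sval psi) tau.
Proof.
move=> ext rel; have [sg sgP] := isoField_kiso sigma.
exists [::] => g _ chi.
have ext' b : tau (acl_emb Kb b) = acl_emb Kb' (sg b) by rewrite sgP.
have [g' gg] := ext_cj ext' g; exists g' => // chi0 _; exact: rel.
Qed.

Lemma corresponds_sigma_uniq psi sigma sigma' :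
  corresponds psi sigma -> corresponds psi sigma' -> sigma = sigma'.
Proof.
move=> [t1 [e1 r1]] [t2 [e2 r2]].
have [psi_bij _ _] := svalP psi.
have fx := agree_uniq l_pr psi_bij (corresponds_agree e1 r1) (corresponds_agree e2 r2).
have es : sval sigma = sval sigma'.
  apply: funext => b; apply: (fmorph_inj (acl_emb Kb')).
  by rewrite -e2 -[RHS]/(t2 _) -(kfK t1 (acl_emb Kb b)) e1 fx.
by case: sigma sigma' es {e1 e2} => f pf [f' pf'] /= es; subst f'; congr exist; exact: Prop_irrelevance.
Qed.

Lemma corresponds_psi_uniq psi psi' sigma :
  corresponds psi sigma -> corresponds psi' sigma -> psi = psi'.
Proof.
move=> [t1 [e1 r1]] [t2 [e2 r2]].
have [sg sgP] := isoField_kiso sigma.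
have e1' b : t1 (acl_emb Kb b) = acl_emb Kb' (sg b) by rewrite sgP.
have e2' b : t2 (acl_emb Kb b) = acl_emb Kb' (sg b) by rewrite sgP.
have es : sval psi = sval psi'.
  apply: funext => chi; apply: val_inj; apply: dchar_ext => g'.
  have [g gg] := ext_cj_inv e1' g'.
  have fx b : kiso_comp (kiso_inv t1) t2 (acl_emb Kb' b) = acl_emb Kb' b.
    have -> : acl_emb Kb' b = t1 (acl_emb Kb (ki sg b)) by rewrite e1' kiK.
    by rewrite /= kfK e2' e1'.
  have [h hP] := kiso_absGal fx.
  have ht z : h (t1 z) = t2 z by rewrite hP /= kfK.
  have c2 : cj t2 g (h * g' * h^-1)%g by move=> z; rewrite -!ht !absGalM absGalVK gg.
  by rewrite (r1 chi g g' gg) -(r2 chi g _ c2) dcharJ.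
by case: psi psi' es {r1 r2} => f pf [f' pf'] /= es; subst f'; congr exist; exact: Prop_irrelevance.
Qed.

(** By [psi_rigid] every [g] has a conjugate fixing [K'], so the preimage of [K'] under tau is fixed
    by all [g] and lies in [K]. The opposite inclusion requires [richness] once more. *)
Lemma corresponds_sigma_exists psi : exists sigma, corresponds psi sigma.
Proof.
have [psi_bij psiM psiL] := svalP psi.
have [tau mt] := psi_rigid l_pr psi_bij psiM psiL.
have cjx g : exists g', cj tau g g' by have [g' gg _] := mt g 1%g; exists g'.
have rel (chi : charGroup R Kb l) g g' : cj tau g g' -> val (sval psi chi) g' = val chi g.
  move=> gg; have [g1 gg1 h] := mt g chi.
  by rewrite (cj_uniq gg gg1) h // mem_head.
have /choice[s' s'P] : forall b', exists b, ki tau (acl_emb Kb' b') = acl_emb Kb b.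
  move=> b'; have [b eb] : exists b, ki tau (acl_emb Kb' b') = acl_emb Kb b; last by exists b.
  apply: fixed_absGal => g; have [g' gg] := cjx g.
  by apply: (can_inj (kfK tau)); rewrite -gg kiK gal_fix.
(* For [g'] over [K'] let [rho] be its conjugate by the inverse of tau. If [rho] moved [K], some
   [chi] would separate [g] from its conjugate [h] by [rho]; but their images under tau are
   conjugate by [g'], so [psi chi] takes the same value on them. *)
have /choice[s sP] : forall b, exists b', tau (acl_emb Kb b) = acl_emb Kb' b'.
  move=> b; apply: fixed_absGal => g'.
  have [f fP] := absGal_rmorph g'; have [fi fiP] := absGal_rmorph (g'^-1)%g.
  have c1 : cancel (ki tau \o f \o tau) (ki tau \o fi \o tau).
    by move=> z; rewrite /= kiK fP fiP absGalVK kfK.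
  have c2 : cancel (ki tau \o fi \o tau) (ki tau \o f \o tau).
    by move=> z; rewrite /= kiK fP fiP absGalKV kfK.
  pose rho : kiso Kb Kb := @Kiso Kb Kb (ki tau \o f \o tau) (ki tau \o fi \o tau) c1 c2.
  suff fx : forall b, rho (acl_emb Kb b) = acl_emb Kb b.
    by have := fx b; rewrite /rho /= fP => /(congr1 tau); rewrite kiK.
  apply: contrapT => nfx; have [chi [g [h [_ hg ne]]]] := richness R [::] l_pr (tau := rho) nfx.
  have [g1 gg1] := cjx g; have [h1 hh1] := cjx h; apply: ne.
  rewrite -(rel chi g g1 gg1) -(rel chi h h1 hh1).
  have -> : h1 = (g' * g1 * g'^-1)%g; last by rewrite dcharJ.
  apply: absGal_ext => z; rewrite !absGalM.
  have := hg (ki tau ((g'^-1)%g z)); rewrite /rho /= kiK fP absGalKV => e.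
  rewrite -[in LHS](kiK tau z) hh1 e kiK fP -gg1 kiK.
  by [].
have ss' : cancel s s'.
  by move=> b; apply: (fmorph_inj (acl_emb Kb)); rewrite -s'P -sP kfK.
have s's : cancel s' s.
  by move=> b; apply: (fmorph_inj (acl_emb Kb')); rewrite -sP -s'P kiK.
have sa : zmod_morphism s.
  by move=> x y; apply: (fmorph_inj (acl_emb Kb')); rewrite rmorphB -!sP !rmorphB.
have sm : GRing.monoid_morphism s.
  split=> [|x y]; apply: (fmorph_inj (acl_emb Kb')); first by rewrite -sP !rmorph1.
  by rewrite rmorphM -!sP !rmorphM.
pose sigma : isoField K K' := exist _ s (And3 (Bijective ss' s's) sa sm).
by exists sigma, tau.
Qed.

Lemma corresponds_psi_exists sigma : exists psi, corresponds psi sigma.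
Proof.
have [sg sgP] := isoField_kiso sigma; have [tau ext] := kiso_extend sg.
have [psi psiP] := char_transport_exists R l_pr ext.
have exti : forall b, kiso_inv tau (acl_emb Kb' b) = acl_emb Kb (kiso_inv sg b) := ext_inv ext.
have [e [ei [eK eiK]]] := closure_iso Kb; have [f [fi [fK fiK]]] := closure_iso Kb'.
have psiL chi (s : R[i]) : 1 < complex.Re s -> Lseries (val chi) s = Lseries (val (psi chi)) s.
  move=> _.
  have [s1 s1P] := level_exists (prime_gt0 l_pr) (charGen_exp (valP chi)).
  have [s2 s2P] := level_exists (prime_gt0 l_pr) (charGen_exp (valP (psi chi))).
  have [F [T [T' [_ _ _ SP SP']]]] := towers_exist eK eiK fK fiK s1 s2.
  apply: (Lseries_transport (T := T) (T' := T') s ext).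
  - by move=> g g' gg; exact: psiP.
  - by move=> g g1; apply: s1P; exact: SP.
  - by move=> g g1; apply: s2P; exact: SP'.
have psiM : {morph psi : x y / (x * y)%g}.
  move=> x y; apply: val_inj; apply: dchar_ext => g'; have [g gg] := ext_cj_inv ext g'.
  by rewrite (psiP _ _ _ gg) /= (psiP _ _ _ gg) (psiP _ _ _ gg).
have psi_inj : injective psi.
  move=> x y exy; apply: val_inj; apply: dchar_ext => g; have [g' gg] := ext_cj ext g.
  by rewrite -(psiP x _ _ gg) exy (psiP y _ _ gg).
have [psi' psiP'] := char_transport_exists R l_pr exti.
have psi'K : cancel psi' psi.
  move=> x; apply: val_inj; apply: dchar_ext => g'; have [g gg] := ext_cj_inv ext g'.
  by rewrite (psiP _ _ _ gg); apply: psiP'; exact/cj_inv.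
have psiK : cancel psi psi' by move=> x; apply: psi_inj; rewrite psi'K.
pose Psi : isoLseries R Kb Kb' l := exist _ psi (And3 (Bijective psiK psi'K) psiM psiL).
exists Psi, tau; split=> //= b.
by rewrite ext sgP.
Qed.

End Correspondence.

Theorem theoremA (R : realType) (K K' : fieldExtType rat)
    (Kb : algClosure K) (Kb' : algClosure K') (l : nat) (l_prime : prime l) :
  exists Theta : isoLseries R Kb Kb' l -> isoField K K', bijective Theta.
Proof.
have /choice[th thP] := @corresponds_sigma_exists R K K' Kb Kb' l l_prime.
have /choice[xi xiP] := @corresponds_psi_exists R K K' Kb Kb' l l_prime.
exists th; exists xi => x.
  exact: (corresponds_psi_uniq (xiP _) (thP x)).
exact: (corresponds_sigma_uniq l_prime (thP _) (xiP x)).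
Qed.
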